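(* There are constants $0<\lambda,\Lambda,K^*<\infty$ (independent of $K$, $M$, $y$) such that for all integers $K\ge K^*$, all integers $M\ge 1$ and all $y\in Y_M$, with $N=KM$, $$2\lambda\,\mathrm{Id}_{Y_M}\;\le\;\mathrm{Hess}_{Y_M}\bar H(y)\;\le\;2\Lambda\,\mathrm{Id}_{Y_M}$$ in the sense of quadratic forms, where the Hessian is taken with respect to the $L^2(\mathbb T)$ inner product on $Y_M$.
   Context: Fix an integer $L\ge 0$. Let $\psi:\mathbb R\to\mathbb R$, $\psi(z)=\tfrac12 z^2+az+\delta\psi(z)$, where $\delta\psi\in C^2(\mathbb R)$ with $\sup|\delta\psi|<\infty$ and $\sup|\delta\psi''|<\infty$, and $a\in\mathbb R$ is chosen such that $\int_{\mathbb R} z e^{-\psi(z)}dz=0$. Constants may depend on $L$ and $\psi$. Let $\mathbb T=\mathbb R/\mathbb Z$ and $N=KM$. Let $X_N=\mathbb R^N$, identified with the space of step functions on $\mathbb T$ that are constant on each $[\frac{j-1}{N},\frac jN)$, via $x(\theta)=x_j$ for $\theta\in[\frac{j-1}N,\frac jN)$. Let $H(x)=H_N(x)=\sum_{n=1}^N\psi(x_n)$. Spline space: for $L\ge1$, $Y_M$ is the set of $y\in C^{L-1}(\mathbb T)$ whose restriction to each $(\frac{m-1}M,\frac mM)$, $m=1,\dots,M$, is a polynomial of degree $\le L$; for $L=0$, $Y_M$ is the set of $y\in L^2(\mathbb T)$ constant on each $(\frac{m-1}M,\frac mM)$. $Y_M$ carries the $L^2(\mathbb T)$ inner product, and $P:L^2(\mathbb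 T)\to Y_M$ is the $L^2$-orthogonal projection. It is assumed that $K$ is large enough for $P|_{X_N}:X_N\to Y_M$ to be surjective. The coarse-grained Hamiltonian $\bar H:Y_M\to\mathbb R$ is $\bar H(y)=-\frac1N\ln\int_{\{x\in X_N:\,Px=y\}}e^{-H(x)}dx$, where $dx$ is the Hausdorff measure on the affine space $\{x\in X_N: Px=y\}$. *)

(* Defs.v *)
From HB Require Import structures.
From mathcomp Require Import all_boot all_order all_algebra.
From mathcomp Require Import all_classical all_reals all_analysis.

Set Implicit Arguments.
Unset Strict Implicit.
Unset Printing Implicit Defensive.

Import Order.TTheory GRing.Theory Num.Theory.
Import numFieldNormedType.Exports.

Local Open Scope classical_set_scope.
Local Open Scope ring_scope.

(* Functions on the torus R/Z are 1-periodic functions R -> R. *)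

Definition continuously_differentiable (R : realType) (k : nat) (f : R -> R) :=
  (forall i, (i < k)%N -> forall t, derivable (f^`(i))%classic t 1) /\
  continuous (f^`(k))%classic.

Definition l2ip (R : realType) (f g : R -> R) : R :=
  \int[@lebesgue_measure R]_(t in `[0, 1]) (f t * g t).

Definition l2norm (R : realType) (f : R -> R) : R := Num.sqrt (l2ip f f).

(* Coordinates and cells are numbered from 0: x 0 j is the value on
   [j/N, (j+1)/N[ modulo 1. *)
Definition step_function (R : realType) (N : nat) (x : 'rV[R]_N) (t : R) : R :=
  \sum_(j < N) x 0 j *
    \1_(`[j%:R / N%:R, j.+1%:R / N%:R[ : set R) (t - (Num.floor t)%:~R).

(* For L = 0 an element of L^2 that is constant on each open cell is represented
   by its right-continuous version, which makes the representative unique. *)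
Definition spline (R : realType) (L M : nat) : set (R -> R) :=
  [set y | periodic y 1 /\
    match L with
    | 0 => forall m, (m < M)%N -> exists c : R, forall t : R,
             m%:R / M%:R <= t < m.+1%:R / M%:R -> y t = c
    | L'.+1 => continuously_differentiable L' y /\
           forall m, (m < M)%N -> exists2 p : {poly R}, (size p <= L.+1)%N &
             forall t : R, m%:R / M%:R < t < m.+1%:R / M%:R -> y t = p.[t]
    end].

Definition orth_proj (R : realType) (Y : set (R -> R)) (u : R -> R) : R -> R :=
  xget (cst 0) [set y | Y y /\ forall z, Y z -> l2ip (u \- y) z = 0].

(* Every subset is declared measurable, so that the library's outer extension
   [mu_ext] ranges over coverings by arbitrary sets. *)
Definition all_sets (R : realType) (N : nat) : Type := 'rV[R]_N.

Section all_sets.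
Variables (R : realType) (N : nat).

HB.instance Definition _ := Pointed.on (all_sets R N).
HB.instance Definition _ := @isMeasurable.Build default_measure_display
  (all_sets R N) (fun _ => True) I (fun _ _ => I) (fun _ _ => I).

End all_sets.

Definition euclidean_dist (R : realType) (N : nat) (x y : 'rV[R]_N) : R :=
  Num.sqrt (\sum_(i < N) (x 0 i - y 0 i) ^+ 2).

Definition euclidean_diam (R : realType) (N : nat) (U : set 'rV[R]_N) : \bar R :=
  ereal_sup [set e | exists x y, [/\ U x, U y & e = (euclidean_dist x y)%:E]].

(* Lebesgue measure of the Euclidean unit ball of R^d. *)
Fixpoint unit_ball_volume (R : realType) (d : nat) : R :=
  match d with
  | 0 => 1
  | 1 => 2
  | d'.+2 => 2 * pi / d'.+2%:R * unit_ball_volume R d'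
  end.

Section hausdorff.
Variables (R : realType) (N d : nat).
Local Open Scope ereal_scope.

Definition hausdorff_cost (delta : R) (U : set (all_sets R N)) : \bar R :=
  if U == set0 then 0
  else if euclidean_diam U <= delta%:E
       then (unit_ball_volume R d / 2 ^+ d)%R%:E * euclidean_diam U ^+ d
       else +oo.

(* The factor in the cost makes this the d-dimensional Lebesgue measure on
   d-dimensional affine subspaces. *)
Definition hausdorff (A : set 'rV[R]_N) : \bar R :=
  ereal_sup [set mu_ext (hausdorff_cost delta) A
            | delta in [set delta : R | (0 < delta)%R]].

Let unit_ball_volume_ge0 n : (0 <= unit_ball_volume R n)%R.
Proof.
suff: (0 <= unit_ball_volume R n)%R /\ (0 <= unit_ball_volume R n.+1)%R by case.
elim: n => [|n [IH0 IH1]]; first by [].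
by split=> //=; rewrite mulr_ge0// divr_ge0// mulr_ge0// pi_ge0.
Qed.

Let hausdorff_cost0 delta : hausdorff_cost delta set0 = 0.
Proof. by rewrite /hausdorff_cost eqxx. Qed.

Let hausdorff_cost_ge0 delta U : 0 <= hausdorff_cost delta U.
Proof.
rewrite /hausdorff_cost; case: eqP => // /eqP/set0P[x Ux].
case: ifP => _; last exact: leey.
rewrite mule_ge0 ?lee_fin ?divr_ge0 ?exprn_ge0//.
rewrite expe_ge0//; apply: ereal_sup_ubound; exists x, x; split=> //.
rewrite /euclidean_dist big1 ?sqrtr0// => i _.
by rewrite subrr expr0n.
Qed.

Let hausdorff0 : hausdorff set0 = 0.
Proof.
rewrite /hausdorff (_ : [set _ | _ in _] = [set 0]) ?ereal_sup1//.
apply/seteqP; split=> [_ [e _ <-]|_ ->] /=.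
  by rewrite mu_ext0.
by exists 1%R => //=; rewrite mu_ext0.
Qed.

Let hausdorff_ge0 A : 0 <= hausdorff A.
Proof.
have h : 0 <= mu_ext (hausdorff_cost 1%R) A by exact: mu_ext_ge0.
apply: (le_trans h).
by apply: ereal_sup_ubound; exists 1%R => /=.
Qed.

Let le_hausdorff : {homo hausdorff : A B / A `<=` B >-> A <= B}.
Proof.
move=> A B AB; apply: ge_ereal_sup => _ [e e0 <-].
apply: le_trans (le_mu_ext (hausdorff_cost e) AB) _.
by apply: ereal_sup_ubound; exists e.
Qed.

Let hausdorff_sigma_subadditive : sigma_subadditive hausdorff.
Proof.
move=> F; apply: ge_ereal_sup => _ [e e0 <-].
apply: (le_trans (mu_ext_sigma_subadditive (hausdorff_cost_ge0 e) F)).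
apply: lee_nneseries => [i _ _|i _]; first exact: mu_ext_ge0.
by apply: ereal_sup_ubound; exists e.
Qed.

HB.instance Definition _ := isOuterMeasure.Build R 'rV[R]_N hausdorff
  hausdorff0 hausdorff_ge0 le_hausdorff hausdorff_sigma_subadditive.

End hausdorff.

(* Dimension of an affine subspace of R^N. *)
Definition affine_dim (R : realType) (N : nat) (A : set 'rV[R]_N) : nat :=
  \max_(k < N.+1 | `[< exists (x : 'rV[R]_N) (B : 'M[R]_(k, N)),
    [/\ A x, row_free B & forall i, A (x + row i B)] >]) k.

Definition hausdorff_outer_measure (R : realType) (N d : nat) :
  {outer_measure set 'rV[R]_N -> \bar R} := @hausdorff R N d.

(* The sigma-algebra is that of the Caratheodory measurable sets. *)
Definition hausdorff_integral (R : realType) (N d : nat) (A : set 'rV[R]_N)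
    (f : 'rV[R]_N -> R) : R :=
  let nu := hausdorff_outer_measure R N d in
  \int[(nu : set (caratheodory_type nu) -> \bar R)]_(x in A) f x.

Definition hamiltonian (R : realType) (psi : R -> R) (N : nat) (x : 'rV[R]_N) : R :=
  \sum_(n < N) psi (x 0 n).

Definition coarse_hamiltonian (R : realType) (psi : R -> R) (L K M : nat)
    (y : R -> R) : R :=
  let N := (K * M)%N in
  let fiber := [set x : 'rV[R]_N |
                 orth_proj (@spline R L M) (step_function x) = y] in
  - (N%:R^-1 * ln (hausdorff_integral (affine_dim fiber) fiber
                     (fun x => expR (- hamiltonian psi x)))).

(* Gradient and Hessian, in the Frechet sense and for the L^2 inner product, of
   the restriction of F to a finite-dimensional linear space Y of functions. *)
Definition is_gradient (R : realType) (Y : set (R -> R)) (F : (R -> R) -> R)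
    (y g : R -> R) : Prop :=
  Y g /\
  forall e : R, 0 < e -> exists2 r : R, 0 < r &
    forall h, Y h -> l2norm h < r ->
      `|F (y \+ h) - F y - l2ip g h| <= e * l2norm h.

Definition is_hessian (R : realType) (Y : set (R -> R)) (F : (R -> R) -> R)
    (y : R -> R) (A : (R -> R) -> (R -> R)) : Prop :=
  [/\ forall h, Y h -> Y (A h),
      forall (c : R) h k, Y h -> Y k ->
        A (fun t => c * h t + k t) = (fun t => c * A h t + A k t)
    & exists (G : (R -> R) -> (R -> R)) (r0 : R),
      [/\ 0 < r0,
          forall z, Y z -> l2norm (z \- y) < r0 -> is_gradient Y F z (G z)
        & forall e : R, 0 < e -> exists2 r : R, 0 < r &
            forall h, Y h -> l2norm h < r ->
              l2norm (fun t => G (y \+ h) t - G y t - A h t) <= e * l2norm h]].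

(* Main.v *)
(* The restriction of a spline to one of the M cells is a polynomial of degree at
   most L, so P x = y depends on x only through the L + 1 lowest moments of x on
   each cell. Let g z be the integral of exp (- H) over the K sites of one cell with
   prescribed moments z (scaled by K^(-1/2)).

   For K large, g (z + k) g (z - k) exp (c |k|^2) <= g(z)^2 with c independent of K:
   tilting the one-site measures moves their means onto the fiber, and integrating
   by parts along the fiber shows that the Hessian of ln g differs from minus a Gram
   matrix of one-site variances by O(K^(-1/2)). Normalisation of the error terms
   needs a lower bound of g, obtained from Chebyshev's inequality, and an upper bound,
   obtained by differentiating in as many disjoint blocks of sites as there are
   moments. The midpoint form of the Prekopa-Leindler inequality carries the estimate
   over from the product of the cells to the fiber {P x = y}. This bounds second
   differences of the coarse-grained Hamiltonian from below.

   For the upper bound lift h to some x with P x = h and |x|^2 <= C N |h|^2; since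
   psi'' is bounded, exp (- H) at a midpoint is controlled by the geometric mean of
   its values at the two endpoints, and Cauchy-Schwarz applies to the integrals.

   Differentiation under the integral sign turns bounds on second differences into
   bounds on the Hessian. The Hausdorff integral over an affine subspace is compared
   with an iterated Lebesgue integral through the uniqueness of translation-invariant
   integrals, which avoids any area formula. *)

From HB Require Import structures.
Require Import Defs.
From mathcomp Require Import all_boot all_order all_algebra.
From mathcomp Require Import all_classical all_reals all_analysis.
From mathcomp Require Import measurable_realfun zify ring lra.

Set Implicit Arguments.
Unset Strict Implicit.
Unset Printing Implicit Defensive.

Import Order.TTheory GRing.Theory Num.Theory.
Import numFieldNormedType.Exports.

Local Open Scope classical_set_scope.
Local Open Scope ring_scope.

(** * Gaussian-bounded functions *)

Section gaussian_class.
Context {R : realType}.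

(** The Hessian of the logarithm of a fiber integral depends on a direction only through its
    moments, so the lift of a moment vector to the sites is free. The lift used is
    [a k = v k * xe xi k], with [v k] the variance of the tilted site [k]. The score along it is a
    sum of one-site functions, and since combinations of moments are constant on the fiber,
    multiples of [x k - m k] may be added to make each of them orthogonal to all affine functions.
    With mean zero alone, integration by parts would gain only [kap ^+ 2] per pair of sites, where
    [kap] is of order K^(-1/2), and after summation over the pairs the error would stay of order
    one. Orthogonality to affine functions gains [kap ^+ 4] per pair, which sums to an error of
    order 1/K. What is left on the diagonal is the family of one-site variances.

    Fiber integrals are only bounded in absolute value and compared with the central one, up to
    factors independent of K. No asymptotics of the fiber density, hence no local limit theorem or
    Fourier transform, enters. *)

Definition sqn n (x : 'rV[R]_n) : R := \sum_i x 0 i ^+ 2.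

Definition frob m n (A : 'M[R]_(m, n)) : R := \sum_i \sum_j A i j ^+ 2.

Definition vcvg n (u : nat -> 'rV[R]_n) (x : 'rV[R]_n) :=
  forall i, (fun k => u k 0 i) @ \oo --> x 0 i.

(* Sequential continuity is all that dominated convergence needs. *)
Definition scont n (f : 'rV[R]_n -> R) :=
  forall u x, vcvg u x -> (fun k => f (u k)) @ \oo --> f x.

Definition gbd n (f : 'rV[R]_n -> R) (C c : R) :=
  forall x, `|f x| <= C * expR (- (c * sqn x)).

(* [gb] requires a Gaussian bound, [sg] growth slower than every inverse
   Gaussian, so that a product of an [sg] and a [gb] function is [gb]. *)
Definition gb n (f : 'rV[R]_n -> R) :=
  scont f /\ exists C c : R, [/\ 0 < c, 0 <= C & gbd f C c].

Definition sg n (h : 'rV[R]_n -> R) := scont h /\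
  forall e : R, 0 < e -> exists2 C : R, 0 <= C & forall x, `|h x| <= C * expR (e * sqn x).

Lemma seq_lim_le (u : nat -> R) (l M : R) : u @ \oo --> l -> (forall k, u k <= M) -> l <= M.
Proof.
move=> ul uM; rewrite -(cvg_lim _ ul)//; apply: limr_le.
  by apply/cvg_ex; exists l.
exact: nearW.
Qed.

Lemma seq_lim_ge (u : nat -> R) (l M : R) : u @ \oo --> l -> (forall k, M <= u k) -> M <= l.
Proof.
move=> ul uM; rewrite -(cvg_lim _ ul)//; apply: limr_ge.
  by apply/cvg_ex; exists l.
exact: nearW.
Qed.

Lemma sqn_ge0 n (x : 'rV[R]_n) : 0 <= sqn x.
Proof. by apply: sumr_ge0 => i _; exact: sqr_ge0. Qed.

Lemma sqn0 n : sqn (0 : 'rV[R]_n) = 0.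
Proof. by apply: big1 => i _; rewrite mxE expr0n. Qed.

Lemma sqnN n (x : 'rV[R]_n) : sqn (- x) = sqn x.
Proof. by apply: eq_bigr => i _; rewrite mxE sqrrN. Qed.

Lemma sqnZ n (a : R) (x : 'rV[R]_n) : sqn (a *: x) = a ^+ 2 * sqn x.
Proof. by rewrite mulr_sumr; apply: eq_bigr => i _; rewrite mxE exprMn. Qed.

Lemma sqn_row_mx p q (u : 'rV[R]_p) (v : 'rV[R]_q) :
  sqn (row_mx u v) = sqn u + sqn v.
Proof.
by rewrite /sqn big_split_ord; congr (_ + _); apply: eq_bigr => i _;
  rewrite ?row_mxEl ?row_mxEr.
Qed.

Lemma coord_sqn n (x : 'rV[R]_n) i : x 0 i ^+ 2 <= sqn x.
Proof.
rewrite /sqn (bigD1 i)//= lerDl; apply: sumr_ge0 => j _; exact: sqr_ge0.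
Qed.

Lemma coord_sqrt_sqn n (x : 'rV[R]_n) i : `|x 0 i| <= Num.sqrt (sqn x).
Proof. by rewrite -sqrtr_sqr ler_sqrt ?sqn_ge0//; exact: coord_sqn. Qed.

Lemma sqnD n (x y : 'rV[R]_n) : sqn x / 2 - sqn y <= sqn (x + y).
Proof.
rewrite /sqn mulr_suml -sumrB; apply: ler_sum => i _; rewrite mxE.
have := sqr_ge0 (x 0 i / 2 + y 0 i) ; have := sqr_ge0 (x 0 i + 2 * y 0 i); nra.
Qed.

Lemma sqnD_le n (x y : 'rV[R]_n) : sqn (x + y) <= 2 * sqn x + 2 * sqn y.
Proof.
rewrite /sqn !mulr_sumr -big_split; apply: ler_sum => i _; rewrite mxE /=.
by have := sqr_ge0 (x 0 i - y 0 i); nra.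
Qed.

Lemma sum_CauchySchwarz n (a b : 'I_n -> R) :
  (\sum_i a i * b i) ^+ 2 <= (\sum_i a i ^+ 2) * (\sum_i b i ^+ 2).
Proof.
rewrite -subr_ge0; set A := \sum_i a i ^+ 2; set B := \sum_i b i ^+ 2.
set S := \sum_i _.
have [A0|A0] := eqVneq A 0.
  suff -> : S = 0 by rewrite A0 mul0r expr0n subr0.
  apply: big1 => i _; suff -> : a i = 0 by rewrite mul0r.
  apply/eqP; rewrite -sqrf_eq0; move/eqP: A0.
  by rewrite psumr_eq0 => [/allP/(_ i (mem_index_enum _)) //|j _]; exact: sqr_ge0.
have Ap : 0 < A by rewrite lt_def A0 sumr_ge0// => i _; exact: sqr_ge0.
have : 0 <= \sum_i (A * b i - S * a i) ^+ 2 by apply: sumr_ge0 => i _; exact: sqr_ge0.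
have -> : \sum_i (A * b i - S * a i) ^+ 2 = A * (A * B - S ^+ 2).
  transitivity (A ^+ 2 * B - 2 * A * S * S + S ^+ 2 * A); last by ring.
  rewrite (eq_bigr (fun i => A ^+ 2 * (b i ^+ 2) +
    (- (2 * A * S)) * (a i * b i) + S ^+ 2 * (a i ^+ 2))) => [|i _]; last by ring.
  by rewrite !big_split -!mulr_sumr /= mulNr.
by rewrite pmulr_rge0.
Qed.

Lemma frob_ge0 m n (A : 'M[R]_(m, n)) : 0 <= frob A.
Proof. by apply: sumr_ge0 => i _; apply: sumr_ge0 => j _; exact: sqr_ge0. Qed.

Lemma sqn_mulmx m n (x : 'rV[R]_m) (A : 'M[R]_(m, n)) :
  sqn (x *m A) <= frob A * sqn x.
Proof.
rewrite /frob exchange_big /= mulr_suml; apply: ler_sum => j _.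
rewrite mxE mulrC; exact: sum_CauchySchwarz.
Qed.

(** Since [x = x *m A *m A'], a right inverse certifies injectivity with a bound. The [+ 1] keeps
    the constant invertible when [A'] vanishes, which happens for [m = 0]. *)
Lemma sqn_row_free m n (A : 'M[R]_(m, n)) (A' : 'M[R]_(n, m)) :
  A *m A' = 1%:M -> exists2 k : R, 0 < k & forall x, k * sqn x <= sqn (x *m A).
Proof.
move=> AA'; have f1 : 0 < frob A' + 1 by rewrite ltr_wpDl// frob_ge0.
exists (frob A' + 1)^-1; first by rewrite invr_gt0.
move=> x; rewrite mulrC ler_pdivrMr//; apply: (@le_trans _ _ (sqn (x *m A *m A'))).
  by rewrite -mulmxA AA' mulmx1.
apply: le_trans (sqn_mulmx _ _) _; rewrite mulrC ler_wpM2l ?sqn_ge0//.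
by rewrite lerDl.
Qed.

Lemma vcvg_cst n (x : 'rV[R]_n) : vcvg (fun=> x) x.
Proof. by move=> i; exact: cvg_cst. Qed.

Lemma vcvgD n u v (x y : 'rV[R]_n) :
  vcvg u x -> vcvg v y -> vcvg (fun k => u k + v k) (x + y).
Proof. by move=> ux vy i; rewrite mxE; under eq_fun do rewrite mxE; exact: cvgD. Qed.

Lemma cvg_rsum I (r : seq I) (P : pred I) (f : I -> nat -> R) (l : I -> R) :
  (forall i, P i -> f i @ \oo --> l i) ->
  (fun k => \sum_(i <- r | P i) f i k) @ \oo --> \sum_(i <- r | P i) l i.
Proof.
move=> fl; elim: r => [|i r IH].
  by rewrite big_nil; under eq_fun do rewrite big_nil; exact: cvg_cst.
rewrite big_cons; under eq_fun do rewrite big_cons.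
by case: (boolP (P i)) => // Pi; apply: cvgD => //; exact: fl.
Qed.

Lemma vcvg_mulmx m n u (x : 'rV[R]_m) (A : 'M[R]_(m, n)) :
  vcvg u x -> vcvg (fun k => u k *m A) (x *m A).
Proof.
move=> ux i; rewrite mxE; under eq_fun do rewrite mxE.
by apply: cvg_rsum => j _; apply: cvgMl; exact: ux.
Qed.

Lemma vcvgZ n (a : nat -> R) (b : R) u (x : 'rV[R]_n) :
  a @ \oo --> b -> vcvg u x -> vcvg (fun k => a k *: u k) (b *: x).
Proof.
by move=> ab ux i; rewrite mxE; under eq_fun do rewrite mxE; apply: cvgM => //; exact: ux.
Qed.

Lemma vcvg_row_mx p q u v (x : 'rV[R]_p) (y : 'rV[R]_q) :
  vcvg u x -> vcvg v y -> vcvg (fun k => row_mx (u k) (v k)) (row_mx x y).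
Proof.
move=> ux vy i; rewrite mxE; under eq_fun do rewrite mxE.
by case: fintype.splitP => j _; [exact: ux|exact: vy].
Qed.

Lemma vcvg_scalar (a : nat -> R) (b : R) : a @ \oo --> b ->
  vcvg (fun k => (a k)%:M : 'rV_1) b%:M.
Proof. by move=> ab i; rewrite mxE; under eq_fun do rewrite mxE; rewrite !ord1. Qed.

Lemma scont_cst n (a : R) : scont (fun _ : 'rV[R]_n => a).
Proof. by move=> u x _; exact: cvg_cst. Qed.

Lemma scont_coord n i : scont (fun x : 'rV[R]_n => x 0 i).
Proof. by move=> u x; apply. Qed.

Lemma scontD n (f g : 'rV[R]_n -> R) : scont f -> scont g ->
  scont (fun x => f x + g x).
Proof. by move=> cf cg u x ux; apply: cvgD; [exact: cf|exact: cg]. Qed.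

Lemma scontM n (f g : 'rV[R]_n -> R) : scont f -> scont g ->
  scont (fun x => f x * g x).
Proof. by move=> cf cg u x ux; apply: cvgM; [exact: cf|exact: cg]. Qed.

Lemma scont_sum n I (r : seq I) (P : pred I) (f : I -> 'rV[R]_n -> R) :
  (forall i, P i -> scont (f i)) -> scont (fun x => \sum_(i <- r | P i) f i x).
Proof. by move=> cf u x ux; apply: cvg_rsum => i Pi; exact: cf. Qed.

Lemma scont_prod n I (r : seq I) (P : pred I) (f : I -> 'rV[R]_n -> R) :
  (forall i, P i -> scont (f i)) -> scont (fun x => \prod_(i <- r | P i) f i x).
Proof.
move=> cf; elim: r => [|i r IH].
  by under eq_fun do rewrite big_nil; exact: scont_cst.
under eq_fun do rewrite big_cons.
by case: (boolP (P i)) => // Pi; apply: scontM => //; exact: cf.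
Qed.

Lemma scont_comp n (f : 'rV[R]_n -> R) (h : R -> R) : continuous h -> scont f ->
  scont (fun x => h (f x)).
Proof.
move=> ch cf u x ux; have := cf _ _ ux => /(@continuous_cvg _ _ _ _ _ _ h); apply.
exact: ch.
Qed.

Lemma scontN n (f : 'rV[R]_n -> R) : scont f -> scont (fun x => - f x).
Proof. by move=> cf u x ux; apply: cvgN; exact: cf. Qed.

Lemma scont_sqn n : scont (@sqn n).
Proof. by apply: scont_sum => i _ u x ux; apply: cvgM; exact: ux. Qed.

Lemma scont_norm n (f : 'rV[R]_n -> R) : scont f -> scont (fun x => `|f x|).
Proof. by move=> cf u x ux; apply: cvg_norm; exact: cf. Qed.

Lemma scont_affine p n (f : 'rV[R]_n -> R) x0 (A : 'M[R]_(p, n)) :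
  scont f -> scont (fun t => f (x0 + t *m A)).
Proof.
move=> cf u x ux; apply: cf; apply: vcvgD; first exact: vcvg_cst.
exact: vcvg_mulmx.
Qed.

Lemma scont_shift n (f : 'rV[R]_n -> R) x0 : scont f -> scont (fun t => f (t + x0)).
Proof. by move=> cf u x ux; apply: cf; apply: vcvgD => //; exact: vcvg_cst. Qed.

Lemma expRle1 (x : R) : 0 <= x -> expR (- x) <= 1.
Proof. by move=> x0; rewrite -expR0 ler_expR lerNl oppr0. Qed.

Lemma gbd_le n (f : 'rV[R]_n -> R) (C c C' c' : R) : 0 <= C ->
  gbd f C c -> C <= C' -> c' <= c -> gbd f C' c'.
Proof.
move=> C0 fC CC' cc' x; apply: le_trans (fC x) _.
apply: ler_pM; rewrite ?expR_ge0//.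
by rewrite ler_expR lerN2 ler_wpM2r ?sqn_ge0.
Qed.

Lemma gb_lin n (f g : 'rV[R]_n -> R) (a : R) : gb f -> gb g ->
  gb (fun x => a * f x + g x).
Proof.
move=> [cf [C [c [c0 C0 fC]]]] [cg [D [d [d0 D0 gD]]]]; split.
  by apply: scontD => //; apply: scontM => //; exact: scont_cst.
exists (`|a| * C + D), (Num.min c d); split; first by rewrite lt_min c0 d0.
  by rewrite addr_ge0// mulr_ge0.
move=> x; rewrite mulrDl -mulrA; apply: le_trans (ler_normD _ _) _.
rewrite normrM; apply: lerD.
  rewrite ler_wpM2l//.
  by apply: gbd_le fC _ _ _ => //; rewrite ge_min lexx.
by apply: gbd_le gD _ _ _ => //; rewrite ge_min lexx orbT.
Qed.

Lemma gb0 n : gb (fun _ : 'rV[R]_n => 0).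
Proof.
split; first exact: scont_cst.
by exists 0, 1; split => // x; rewrite normr0 mul0r.
Qed.

Lemma gbD n (f g : 'rV[R]_n -> R) : gb f -> gb g -> gb (fun x => f x + g x).
Proof.
by move=> gf gg; have := gb_lin 1 gf gg; under eq_fun do rewrite mul1r.
Qed.

Lemma gbZ n (a : R) (f : 'rV[R]_n -> R) : gb f -> gb (fun x => a * f x).
Proof.
by move=> gf; have := gb_lin a gf (@gb0 n); under eq_fun do rewrite addr0.
Qed.

Lemma gbN n (f : 'rV[R]_n -> R) : gb f -> gb (fun x => - f x).
Proof. by move=> gf; have := gbZ (-1) gf; under eq_fun do rewrite mulN1r. Qed.

Lemma gb_norm n (f : 'rV[R]_n -> R) : gb f -> gb (fun x => `|f x|).
Proof.
move=> [cf [C [c [c0 C0 fC]]]]; split; first exact: scont_norm.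
by exists C, c; split => // x; rewrite normr_id.
Qed.

Lemma gb_sum n I (r : seq I) (P : pred I) (f : I -> 'rV[R]_n -> R) :
  (forall i, P i -> gb (f i)) -> gb (fun x => \sum_(i <- r | P i) f i x).
Proof.
move=> cf; elim: r => [|i r IH].
  by under eq_fun do rewrite big_nil; exact: gb0.
under eq_fun do rewrite big_cons.
by case: (boolP (P i)) => // Pi; apply: gbD => //; exact: cf.
Qed.

Lemma gb_mul_sg n (f h : 'rV[R]_n -> R) : gb f -> sg h -> gb (fun x => h x * f x).
Proof.
move=> [cf [C [c [c0 C0 fC]]]] [ch hB]; split; first exact: scontM.
have [D D0 hD] := hB (c / 2) (divr_gt0 c0 (ltr0n _ 2)).
exists (D * C), (c / 2); split; [exact: divr_gt0|exact: mulr_ge0|] => x.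
rewrite normrM; apply: le_trans (ler_pM _ _ (hD x) (fC x)) _ => //.
rewrite mulrACA -expRD; apply: ler_wpM2l; first exact: mulr_ge0.
by rewrite ler_expR; lra.
Qed.

Lemma sg_cst n (a : R) : sg (fun _ : 'rV[R]_n => a).
Proof.
split; first exact: scont_cst.
move=> e e0; exists `|a| => // x; rewrite ler_peMr// -expR0 ler_expR mulr_ge0//.
  exact: ltW.
exact: sqn_ge0.
Qed.

Lemma sgD n (f g : 'rV[R]_n -> R) : sg f -> sg g -> sg (fun x => f x + g x).
Proof.
move=> [cf fB] [cg gB]; split; first exact: scontD.
move=> e e0; have [C C0 fC] := fB e e0; have [D D0 gD] := gB e e0.
exists (C + D); first exact: addr_ge0.
by move=> x; rewrite mulrDl; apply: le_trans (ler_normD _ _) (lerD _ _).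
Qed.

Lemma sgM n (f g : 'rV[R]_n -> R) : sg f -> sg g -> sg (fun x => f x * g x).
Proof.
move=> [cf fB] [cg gB]; split; first exact: scontM.
move=> e e0; have e20 : 0 < e / 2 by exact: divr_gt0.
have [C C0 fC] := fB _ e20; have [D D0 gD] := gB _ e20.
exists (C * D); first exact: mulr_ge0.
move=> x; rewrite normrM; apply: le_trans (ler_pM _ _ (fC x) (gD x)) _ => //.
by rewrite mulrACA -expRD -mulrDl -splitr.
Qed.

Lemma sg_sum n I (r : seq I) (P : pred I) (f : I -> 'rV[R]_n -> R) :
  (forall i, P i -> sg (f i)) -> sg (fun x => \sum_(i <- r | P i) f i x).
Proof.
move=> cf; elim: r => [|i r IH].
  by under eq_fun do rewrite big_nil; exact: sg_cst.
under eq_fun do rewrite big_cons.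
by case: (boolP (P i)) => // Pi; apply: sgD => //; exact: cf.
Qed.

Lemma sg_prod n I (r : seq I) (P : pred I) (f : I -> 'rV[R]_n -> R) :
  (forall i, P i -> sg (f i)) -> sg (fun x => \prod_(i <- r | P i) f i x).
Proof.
move=> cf; elim: r => [|i r IH].
  by under eq_fun do rewrite big_nil; exact: sg_cst.
under eq_fun do rewrite big_cons.
by case: (boolP (P i)) => // Pi; apply: sgM => //; exact: cf.
Qed.

Lemma sg_le n (f g : 'rV[R]_n -> R) : scont f -> (forall x, `|f x| <= `|g x|) ->
  sg g -> sg f.
Proof.
move=> cf fg [cg gB]; split=> // e /gB[C C0 gC]; exists C => // x.
exact: le_trans (fg x) (gC x).
Qed.

Lemma sg_sqn n : sg (@sqn n).
Proof.
split; first exact: scont_sqn.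
move=> e e0; exists e^-1; first by rewrite invr_ge0 ltW.
move=> x; rewrite ger0_norm ?sqn_ge0// mulrC ler_pdivlMr// mulrC.
by apply: le_trans (expR_ge1Dx _); rewrite lerDr.
Qed.

Lemma sg_coord n i : sg (fun x : 'rV[R]_n => x 0 i).
Proof.
apply: (@sg_le _ _ (fun x => 1 + sqn x)); first exact: scont_coord.
  move=> x; rewrite [leRHS]ger0_norm ?addr_ge0 ?sqn_ge0//.
  have := coord_sqn x i; rewrite -real_normK ?num_real//.
  by have := sqr_ge0 (`|x 0 i| - 1); nra.
by apply: sgD; [exact: sg_cst|exact: sg_sqn].
Qed.

Definition gauss n (c : R) (x : 'rV[R]_n) : R := expR (- (c * sqn x)).

Lemma gauss_gb n (c : R) : 0 < c -> gb (@gauss n c).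
Proof.
move=> c0; split.
  apply: (@scont_comp _ (fun x => - (c * sqn x)) expR).
    exact: continuous_expR.
  by apply: scontN; apply: scontM; [exact: scont_cst|exact: scont_sqn].
by exists 1, c; split => // x; rewrite mul1r ger0_norm// expR_ge0.
Qed.

Lemma gauss_gt0 n (c : R) (x : 'rV[R]_n) : 0 < gauss c x.
Proof. exact: expR_gt0. Qed.

(** [k] depends on [A] only, and the other constant on [x0] explicitly: dominated convergence needs
    one bound for a whole sequence of functions or of base points, which [gb_affine] does not
    provide. *)
Lemma gbd_affine p n (A : 'M[R]_(p, n)) (A' : 'M[R]_(n, p)) : A *m A' = 1%:M ->
  exists2 k : R, 0 < k & forall (f : 'rV[R]_n -> R) (C c : R) (x0 : 'rV[R]_n), 0 <= C -> 0 < c ->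
    gbd f C c -> gbd (fun t => f (x0 + t *m A)) (C * expR (c * sqn x0)) (c * k).
Proof.
move=> AA'; have [k k0 kA] := sqn_row_free AA'; exists (k / 2); first exact: divr_gt0.
move=> f C c x0 C0 c0 fC t; apply: le_trans (fC _) _.
rewrite -mulrA; apply: ler_wpM2l => //; rewrite -expRD ler_expR.
rewrite [x0 + _]addrC.
have := sqnD (t *m A) x0; have := kA t => h1 h2.
have : c * (k / 2 * sqn t - sqn x0) <= c * sqn (t *m A + x0).
  rewrite ler_wpM2l ?(ltW c0)//; apply: le_trans h2.
  by rewrite lerD2r; lra.
rewrite mulrBr; lra.
Qed.

Lemma gb_affine p n (f : 'rV[R]_n -> R) x0 (A : 'M[R]_(p, n)) (A' : 'M[R]_(n, p)) :
  A *m A' = 1%:M -> gb f -> gb (fun t => f (x0 + t *m A)).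
Proof.
move=> AA' [cf [C [c [c0 C0 fC]]]]; split; first exact: scont_affine.
have [k k0 H] := gbd_affine AA'.
exists (C * expR (c * sqn x0)), (c * k); split; [exact: mulr_gt0| |exact: H].
by rewrite mulr_ge0// expR_ge0.
Qed.

Lemma gbd_shift n (f : 'rV[R]_n -> R) (C c : R) a : 0 <= C -> 0 < c -> gbd f C c ->
  gbd (fun x => f (x + a)) (C * expR (c * sqn a)) (c / 2).
Proof.
move=> C0 c0 fC x; apply: le_trans (fC _) _; rewrite -mulrA ler_wpM2l//.
rewrite -expRD ler_expR; have := sqnD x a => h.
have : c * (sqn x / 2 - sqn a) <= c * sqn (x + a) by rewrite ler_wpM2l// ltW.
lra.
Qed.

Lemma gb_shift n (f : 'rV[R]_n -> R) a : gb f -> gb (fun x => f (x + a)).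
Proof.
move=> [cf [C [c [c0 C0 fC]]]]; split; first exact: scont_shift.
exists (C * expR (c * sqn a)), (c / 2); split; [exact: divr_gt0| |exact: gbd_shift].
by rewrite mulr_ge0// expR_ge0.
Qed.

Lemma gbd_slice p q (f : 'rV[R]_(p + q) -> R) (C c : R) u : gbd f C c ->
  gbd (fun v => f (row_mx u v)) (C * expR (- (c * sqn u))) c.
Proof.
by move=> fC v; rewrite -mulrA -expRD -opprD -mulrDr -sqn_row_mx; exact: fC.
Qed.

Lemma scont_slice p q (f : 'rV[R]_(p + q) -> R) u : scont f ->
  scont (fun v => f (row_mx u v)).
Proof.
by move=> cf w x wx; apply: cf; apply: vcvg_row_mx => //; exact: vcvg_cst.
Qed.

Lemma gb_slice p q (f : 'rV[R]_(p + q) -> R) u : gb f -> gb (fun v => f (row_mx u v)).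
Proof.
move=> [cf [C [c [c0 C0 fC]]]]; split; first exact: scont_slice.
exists (C * expR (- (c * sqn u))), c; split => //; last exact: gbd_slice.
by rewrite mulr_ge0// expR_ge0.
Qed.

End gaussian_class.

(** * Derivatives and translation-invariant integrals *)

Section derivatives.
Context {R : realType}.

Definition dv (f : R -> R) (x l : R) := is_derive (x : R) (1 : R) f l.

(** Bridge to [int_dc], where convergence is along sequences. *)
Lemma dv_seqP f x l : dv f x l <->
  forall u : nat -> R, (forall k, u k != 0) -> u @ \oo --> (0 : R) ->
    (fun k => (f (x + u k) - f x) / u k) @ \oo --> l.
Proof.
have E u : (fun k => (f (x + u k) - f x) / u k) =
  ((fun h : R => h^-1 *: (f (h *: 1 + x) - f x)) \o (u : nat -> R)).
  by apply/funext => k /=; rewrite [RHS]mulrC [_ *: 1]mulr1 [_ + x]addrC.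
split=> [[fx <-] u u0 ul|H].
  rewrite E; have /cvgr_dnbhsP := fx; apply; split => //.
have cvgl : (fun h : R => h^-1 *: (f (h *: 1 + x) - f x)) @ 0^' --> l.
  by apply/cvgr_dnbhsP => u [u0 ul]; have := H _ u0 ul; rewrite E.
apply: DeriveDef; first by apply/cvg_ex; exists l.
exact: cvg_lim cvgl.
Qed.

Lemma dv_cst a x : dv (fun=> a) x 0.
Proof. exact: is_derive_cst. Qed.

Lemma dv_id x : dv (fun t => t) x 1.
Proof. exact: is_derive_id. Qed.

Lemma dvD f g x a b : dv f x a -> dv g x b -> dv (fun t => f t + g t) x (a + b).
Proof. exact: is_deriveD. Qed.

Lemma dvN f x a : dv f x a -> dv (fun t => - f t) x (- a).
Proof. exact: is_deriveN. Qed.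

Lemma dvM f g x a b : dv f x a -> dv g x b ->
  dv (fun t => f t * g t) x (a * g x + f x * b).
Proof.
by move=> fa gb; have := is_deriveM fa gb; rewrite /GRing.scale /= addrC (mulrC a).
Qed.

Lemma dv_comp f g x a b : dv f (g x) a -> dv g x b -> dv (fun t => f (g t)) x (a * b).
Proof. by move=> fa gb; have := is_derive1_comp fa gb. Qed.

Lemma dvZ (k : R) f x a : dv f x a -> dv (fun t => k * f t) x (k * a).
Proof.
by move=> fa; have := dvM (dv_cst k x) fa; rewrite mul0r add0r.
Qed.

Lemma dv_sum I (r : seq I) (P : pred I) (f : I -> R -> R) (df : I -> R) x :
  (forall i, P i -> dv (f i) x (df i)) ->
  dv (fun t => \sum_(i <- r | P i) f i t) x (\sum_(i <- r | P i) df i).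
Proof.
move=> fd; elim: r => [|i r IH].
  by rewrite big_nil; under eq_fun do rewrite big_nil; exact: dv_cst.
rewrite big_cons; under eq_fun do rewrite big_cons.
by case: (boolP (P i)) => // Pi; apply: dvD => //; exact: fd.
Qed.

Lemma dv_expR f x a : dv f x a -> dv (fun t => expR (f t)) x (a * expR (f x)).
Proof. by move=> fa; rewrite mulrC; apply: dv_comp fa; exact: is_derive_expR. Qed.

Lemma dv_ln f x a : 0 < f x -> dv f x a -> dv (fun t => ln (f t)) x (a / f x).
Proof. by move=> fx fa; rewrite mulrC; apply: dv_comp fa; exact: is_derive1_ln. Qed.

Lemma dv_eq f x a b : dv f x a -> a = b -> dv f x b.
Proof. by move=> + <-. Qed.

Lemma dv_uniq f x a b : dv f x a -> dv f x b -> a = b.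
Proof. by move=> [_ <-] [_ <-]. Qed.

Lemma dv_continuous f x a : dv f x a -> {for x, continuous f}.
Proof.
by move=> [fx _]; exact/differentiable_continuous/derivable1_diffP.
Qed.

Lemma dvV f x a : f x != 0 -> dv f x a -> dv (fun t => (f t)^-1) x (- (a / f x ^+ 2)).
Proof.
move=> fx [fa <-]; apply: DeriveDef; first exact: derivableV.
by rewrite deriveV //= /GRing.scale /= mulNr mulrC.
Qed.

Lemma dv_MVT f f' (a b : R) : a < b -> (forall t, a <= t <= b -> dv f t (f' t)) ->
  exists2 c, a < c < b & f b - f a = f' c * (b - a).
Proof.
move=> ab fd; have [||c] := @MVT R f f' a b ab.
- by move=> x /itvP xab; apply: fd; rewrite !xab.
- apply: continuous_in_subspaceT => x; rewrite inE => /itvP xab.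
  by apply: dv_continuous (fd x _); rewrite !xab.
- by move=> /itvP cab e; exists c; rewrite ?cab.
Qed.

Lemma dv_le f f' (a b M : R) : a <= b -> (forall t, a <= t <= b -> dv f t (f' t)) ->
  (forall t, a <= t <= b -> f' t <= M) -> f b - f a <= M * (b - a).
Proof.
rewrite le_eqVlt => /predU1P[->|ab] fd fM; first by rewrite !subrr mulr0.
have [c /andP[/ltW ac /ltW cb] ->] := dv_MVT ab fd.
by apply: ler_wpM2r; [rewrite subr_ge0 ltW|apply: fM; rewrite ac].
Qed.

Lemma dv_norm_le f f' (a b M : R) :
  (forall t, Num.min a b <= t <= Num.max a b -> dv f t (f' t)) ->
  (forall t, Num.min a b <= t <= Num.max a b -> `|f' t| <= M) -> `|f b - f a| <= M * `|b - a|.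
Proof.
wlog ab : a b / a < b => [H|] fd fM.
  have [ab|ba|->] := ltgtP a b; first exact: H.
    rewrite distrC [X in _ * X]distrC; apply: H => //.
      by move=> t; rewrite minC maxC; exact: fd.
    by move=> t; rewrite minC maxC; exact: fM.
  by rewrite !subrr !normr0 mulr0.
move: fd fM; rewrite (min_idPl (ltW ab)) (max_idPr (ltW ab)) => fd fM.
have [c /andP[/ltW ac /ltW cb] ->] := dv_MVT ab fd.
by rewrite normrM ler_wpM2r// fM// ac.
Qed.

End derivatives.

Section integrals.
Context {R : realType}.
(* By [isInt_uniq] these properties determine a functional up to a factor; this
   replaces all changes of variables. *)
Record isInt n (I : ('rV[R]_n -> R) -> R) : Prop := {
  int_lin : forall a f g, gb f -> gb g -> I (fun x => a * f x + g x) = a * I f + I g;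
  int_mono : forall f g, gb f -> gb g -> (forall x, f x <= g x) -> I f <= I g;
  int_dc : forall (f_ : nat -> 'rV[R]_n -> R) f (C c : R), 0 < c -> 0 <= C ->
    (forall k, scont (f_ k)) -> scont f -> (forall k, gbd (f_ k) C c) ->
    (forall x, (fun k => f_ k x) @ \oo --> f x) -> (fun k => I (f_ k)) @ \oo --> I f;
  int_tr : forall f a, gb f -> I (fun x => f (x + a)) = I f;
  int_gauss : forall c, 0 < c -> 0 < I (gauss c) }.

Section isInt_theory.
Variables (n : nat) (I : ('rV[R]_n -> R) -> R) (II : isInt I).

Lemma int0 : I (fun=> 0) = 0.
Proof.
have := int_lin II 1 (@gb0 R n) (@gb0 R n).
under eq_fun do rewrite mulr0 addr0.
by move=> /eqP; rewrite mul1r -subr_eq subrr => /eqP/esym.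
Qed.

Lemma intD f g : gb f -> gb g -> I (fun x => f x + g x) = I f + I g.
Proof.
by move=> gf gg; rewrite -[I f]mul1r -(int_lin II)//; under [in RHS]eq_fun do rewrite mul1r.
Qed.

Lemma intZ a f : gb f -> I (fun x => a * f x) = a * I f.
Proof.
move=> gf; rewrite -[RHS]addr0 -int0 -(int_lin II)//; last exact: gb0.
by under [in RHS]eq_fun do rewrite addr0.
Qed.

Lemma intN f : gb f -> I (fun x => - f x) = - I f.
Proof. by move=> gf; rewrite -mulN1r -intZ//; under [in RHS]eq_fun do rewrite mulN1r. Qed.

Lemma intB f g : gb f -> gb g -> I (fun x => f x - g x) = I f - I g.
Proof. by move=> gf gg; rewrite -intN// -intD//; exact: gbN. Qed.

Lemma int_sum J (r : seq J) (P : pred J) (f : J -> 'rV[R]_n -> R) :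
  (forall i, P i -> gb (f i)) ->
  I (fun x => \sum_(i <- r | P i) f i x) = \sum_(i <- r | P i) I (f i).
Proof.
move=> fg; elim: r => [|i r IH].
  by rewrite big_nil; under eq_fun do rewrite big_nil; exact: int0.
rewrite big_cons; under eq_fun do rewrite big_cons.
case: (boolP (P i)) => // Pi; rewrite intD ?IH//; first exact: fg.
exact: gb_sum.
Qed.

Lemma int_ge0 f : gb f -> (forall x, 0 <= f x) -> 0 <= I f.
Proof. by move=> gf f0; rewrite -int0; apply: (int_mono II) => //; exact: gb0. Qed.

Lemma int_norm f : gb f -> `|I f| <= I (fun x => `|f x|).
Proof.
move=> gf; rewrite ler_norml -intN; last exact: gb_norm.
apply/andP; split; apply: (int_mono II) => //; try exact: gb_norm.
- by apply: gbN; exact: gb_norm.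
- by move=> x; rewrite lerNl; exact: ler_normr_id || rewrite -normrN ler_norm.
- by move=> x; exact: ler_norm.
Qed.

Lemma int_bound f C c : 0 < c -> 0 <= C -> scont f -> gbd f C c ->
  `|I f| <= C * I (gauss c).
Proof.
move=> c0 C0 cf fC; have gf : gb f by split => //; exists C, c.
apply: le_trans (int_norm gf) _; rewrite -intZ; last exact: gauss_gb.
by apply: (int_mono II) => //; [exact: gb_norm|apply: gbZ; exact: gauss_gb].
Qed.

Lemma int_dv (F F' : R -> 'rV[R]_n -> R) (t0 C c : R) : 0 < c -> 0 <= C ->
  (forall t, `|t - t0| <= 1 -> scont (F t)) ->
  (forall t, `|t - t0| <= 1 -> gbd (F t) C c) ->
  scont (F' t0) ->
  (forall t x, `|t - t0| <= 1 -> dv (F ^~ x) t (F' t x)) ->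
  (forall t, `|t - t0| <= 1 -> gbd (F' t) C c) ->
  dv (fun t => I (F t)) t0 (I (F' t0)).
Proof.
move=> c0 C0 cF bF cF' dF bF'; apply/dv_seqP => u u0 ul.
(* The bounds hold for [|t - t0| <= 1] only; larger increments, finitely many, are replaced by the
   nonzero value 1. *)
pose w k := if `|u k| <= 1 then u k else 1.
have w1 k : `|w k| <= 1 by rewrite /w; case: ifP => //; rewrite normr1.
have w0 k : w k != 0 by rewrite /w; case: ifP => // _; exact: oner_neq0.
have uw : \forall k \near \oo, w k = u k.
  move/cvgr0Pnorm_le : ul => /(_ 1 ltr01); apply: filterS => k uk.
  by rewrite /w uk.
have wl : w @ \oo --> (0 : R).
  by apply: cvg_trans ul; apply: near_eq_cvg; apply: filterS uw => k ->.
have t01 : `|t0 - t0| <= 1 by rewrite subrr normr0 ler01.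
have gF t : `|t - t0| <= 1 -> gb (F t).
  by move=> tt; split; [exact: cF|exists C, c; split => //; exact: bF].
have tw k : `|t0 + w k - t0| <= 1 by rewrite addrC addrA addNr add0r.
pose q k x := (w k)^-1 * (F (t0 + w k) x + - F t0 x).
have Eq k : (I (F (t0 + w k)) - I (F t0)) / w k = I (q k).
  rewrite /q intZ; last by apply: gbD; [exact: gF|apply: gbN; exact: gF].
  by rewrite mulrC intB//; exact: gF.
have cq : (fun k => I (q k)) @ \oo --> I (F' t0).
  apply: (int_dc II c0 C0) => //.
  - move=> k; apply: scontM; first exact: scont_cst.
    by apply: scontD; [exact: cF|apply: scontN; exact: cF].
  - move=> k x; rewrite /q normrM normfV mulrC ler_pdivrMr ?normr_gt0//.
    have wE : w k = (t0 + w k) - t0 by rewrite addrC addrA addNr add0r.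
    suff H2 : `|F (t0 + w k) x - F t0 x| <= C * expR (- (c * sqn x)) * `|(t0 + w k) - t0|.
      by rewrite -wE in H2.
    apply: (@dv_norm_le R (F ^~ x) (F' ^~ x) t0 (t0 + w k)) => t tI.
      apply: dF; apply: le_trans (w1 k).
      move: tI; case: (ltrP t0 (t0 + w k)) => h /andP[h1 h2].
        rewrite ger0_norm ?subr_ge0// ger0_norm; lra.
      by rewrite ler0_norm ?subr_le0// ler0_norm; lra.
    apply: bF'; apply: le_trans (w1 k).
    move: tI; case: (ltrP t0 (t0 + w k)) => h /andP[h1 h2].
      rewrite ger0_norm ?subr_ge0// ger0_norm; lra.
    by rewrite ler0_norm ?subr_le0// ler0_norm; lra.
  - move=> x; have /dv_seqP/(_ w w0 wl) := dF t0 x t01.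
    by under eq_fun do rewrite mulrC.
apply: cvg_trans cq; apply: near_eq_cvg; near=> k.
by rewrite -Eq; have -> : w k = u k by near: k.
Unshelve. all: by end_near. Qed.

(** By translation invariance [t |-> I (fun x => f (x + t *: v))] is constant; its derivative at 0
    is [I f']. *)
Lemma int_IBP f f' v (C c : R) : 0 < c -> 0 <= C -> scont f -> scont f' ->
  gbd f C c -> gbd f' C c ->
  (forall x t, dv (fun s => f (x + s *: v)) t (f' (x + t *: v))) ->
  I f' = 0.
Proof.
move=> c0 C0 cf cf' bf bf' df.
pose C1 := C * expR (c * sqn v).
have C10 : 0 <= C1 by rewrite mulr_ge0// expR_ge0.
have b1 g : scont g -> gbd g C c -> forall t, `|t| <= 1 ->
    gbd (fun x => g (x + t *: v)) C1 (c / 2).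
  move=> cg bg t t1; apply: gbd_le (gbd_shift _ _ _ bg) _ _ => //.
    by rewrite mulr_ge0// expR_ge0.
  rewrite ler_wpM2l// ler_expR ler_wpM2l ?(ltW c0)// sqnZ ler_piMl ?sqn_ge0//.
  by rewrite -real_normK ?num_real// expr_le1.
have H : dv (fun t => I (fun x => f (x + t *: v))) 0 (I (fun x => f' (x + 0 *: v))).
  apply: (@int_dv (fun t x => f (x + t *: v)) (fun t x => f' (x + t *: v)) 0 C1 (c / 2)).
  - exact: divr_gt0.
  - by [].
  - by move=> t _; exact: scont_shift.
  - by move=> t; rewrite subr0 => t1; apply: b1.
  - exact: scont_shift.
  - by move=> t x _; exact: df.
  - by move=> t; rewrite subr0 => t1; apply: b1.
have gf : gb f by split=> //; exists C, c.
have := H; under eq_fun do rewrite (int_tr II _ gf).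
move=> /dv_uniq/(_ (dv_cst _ _)).
by under eq_fun do rewrite scale0r addr0.
Qed.

End isInt_theory.

End integrals.

(** * Integrals on the line and iterated integrals *)

Lemma Rintegral_dct d (T : measurableType d) (R : realType) (mu : {measure set T -> \bar R})
    (D : set T) (f_ : nat -> T -> R) (f g : T -> R) : measurable D ->
  (forall k, measurable_fun D (f_ k)) -> (forall x, D x -> (fun k => f_ k x) @ \oo --> f x) ->
  mu.-integrable D (EFin \o g) -> (forall k x, D x -> `|f_ k x| <= g x) ->
  (fun k => \int[mu]_(x in D) f_ k x) @ \oo --> \int[mu]_(x in D) f x.
Proof.
move=> mD mf ff ig bd.
have mf' k : measurable_fun D (EFin \o f_ k) by exact/measurable_EFinP.
have ff' x : D x -> (fun k => (EFin \o f_ k) x) @ \oo --> (EFin \o f) x.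
  by move=> Dx; apply: cvg_EFin; [exact: nearW|exact: ff].
have mf0 : measurable_fun D (EFin \o f) by exact: emeasurable_fun_cvg mf' ff'.
have [i1 _ i2] := @dominated_convergence _ _ _ mu D mD (fun k => EFin \o f_ k)
  (EFin \o f) (EFin \o g) mf' mf0 (aeW _ ff') ig
  (aeW _ (fun x n Dx => bd n x Dx)).
apply: fine_cvg; rewrite fineK; first exact: i2.
exact: integrable_fin_num.
Qed.

Section one_dimension.
Context {R : realType}.
Let mu := @lebesgue_measure R.

Definition gauss1 (c t : R) : R := expR (- (c * t ^+ 2)).

Definition gbd1 (f : R -> R) (C c : R) := forall t, `|f t| <= C * gauss1 c t.

Definition Int (f : R -> R) : R := \int[mu]_(t in setT) f t.

Definition prim (f : R -> R) (x : R) : R := \int[mu]_(t in `]-oo, x]) f t.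

Lemma continuous_gauss1 c : continuous (gauss1 c).
Proof.
move=> x; apply: continuous_comp; last exact: continuous_expR.
apply: cvgN; apply: cvgM; first exact: cvg_cst.
by apply: cvgM; exact: cvg_id.
Qed.

Lemma integrable_gauss1 c : 0 < c -> mu.-integrable setT (EFin \o gauss1 c).
Proof.
(* Standard deviation of the normal law whose density is proportional to [gauss1 c]. *)
move=> c0; pose s : R := Num.sqrt (c^-1 / 2).
have s0 : s != 0 by rewrite gt_eqF// sqrtr_gt0 divr_gt0// invr_gt0.
have s2 : s ^+ 2 = c^-1 / 2 by rewrite sqr_sqrtr// divr_ge0// invr_ge0 ltW.
have -> : EFin \o gauss1 c =
  (fun x => (normal_peak s)^-1%:E * (normal_pdf 0 s x)%:E)%E.
  apply/funext => x /=; rewrite normal_pdfE// -EFinM; congr EFin.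
  rewrite mulKf ?gt_eqF ?normal_peak_gt0// /normal_fun /gauss1 subr0 s2.
  congr (expR _); rewrite -mulr_natr -mulrA mulVf ?pnatr_eq0// mulr1.
  by rewrite mulNr invrK mulrC.
apply: integrableZl => //; exact: integrable_normal_pdf.
Qed.

Lemma integrable_gbd1 f C c : 0 < c -> continuous f -> gbd1 f C c ->
  mu.-integrable setT (EFin \o f).
Proof.
move=> c0 cf fC; apply: (@le_integrable _ _ _ mu setT _ _ (fun x => (C%:E * (gauss1 c x)%:E)%E)) => //.
- by apply/measurable_EFinP; apply: continuous_measurable_fun.
- move=> x _; rewrite -EFinM lee_fin; apply: le_trans (fC x) _.
  exact: ler_norm.
- apply: integrableZl => //; exact: integrable_gauss1.
Qed.

Lemma integrable_Cgauss1 C c : 0 < c -> mu.-integrable setT (EFin \o (fun x => C * gauss1 c x)).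
Proof.
move=> c0; rewrite (_ : EFin \o _ = (fun x => C%:E * (gauss1 c x)%:E)%E)//.
by apply: integrableZl => //; exact: integrable_gauss1.
Qed.

Lemma Int_dc (f_ : nat -> R -> R) f C c : 0 < c ->
  (forall k, continuous (f_ k)) -> (forall k, gbd1 (f_ k) C c) ->
  (forall x, (fun k => f_ k x) @ \oo --> f x) -> (fun k => Int (f_ k)) @ \oo --> Int f.
Proof.
move=> c0 cf fC ff.
apply: (@Rintegral_dct _ _ _ mu setT f_ f (fun x => C * gauss1 c x)) => //.
- by move=> k; exact: continuous_measurable_fun.
- exact: integrable_Cgauss1.
- by move=> k x _; exact: fC.
Qed.

Lemma primE f x : prim f x = \int[mu]_(t in setT) ((f \_ `]-oo, x]) t).
Proof. by rewrite /prim Rintegral_mkcond. Qed.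

Lemma prim_dc (x_ : nat -> R) (f_ : nat -> R -> R) g C c : 0 < c ->
  (forall k, continuous (f_ k)) -> (forall k, gbd1 (f_ k) C c) ->
  (forall t, (fun k => (f_ k \_ `]-oo, x_ k]) t) @ \oo --> g t) ->
  (fun k => prim (f_ k) (x_ k)) @ \oo --> Int g.
Proof.
move=> c0 cf fC fg; under eq_fun do rewrite primE.
apply: (@Rintegral_dct _ _ _ mu setT (fun k => f_ k \_ `]-oo, x_ k]) g (fun x => C * gauss1 c x)) => //.
- move=> k; apply/(measurable_restrictT _ _).1 => //.
  by apply: measurable_funTS; exact: continuous_measurable_fun.
- exact: integrable_Cgauss1.
- move=> k x _; rewrite patchE; case: ifP => _; first exact: fC.
  by rewrite normr0; apply: le_trans (fC k x).
Qed.

Lemma prim_fixed_dc (f_ : nat -> R -> R) f x C c : 0 < c ->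
  (forall k, continuous (f_ k)) -> (forall k, gbd1 (f_ k) C c) ->
  (forall t, (fun k => f_ k t) @ \oo --> f t) ->
  (fun k => prim (f_ k) x) @ \oo --> prim f x.
Proof.
move=> c0 cf fC ff; rewrite primE; apply: (prim_dc (x_ := fun=> x) c0 cf fC) => t.
under eq_fun do rewrite patchE; rewrite patchE.
by case: ifP => _; [exact: ff|exact: cvg_cst].
Qed.

Lemma prim_ninfty f (b C c : R) : 0 < c -> continuous f -> gbd1 f C c ->
  (fun k : nat => prim f (- k%:R + b)) @ \oo --> (0 : R).
Proof.
move=> c0 cf fC; have -> : 0 = Int (fun=> 0) :> R by rewrite /Int Rintegral_cst// mul0r.
apply: (@prim_dc _ (fun=> f) _ C c) => //= t.
apply: cvg_near_cst; exists (Num.truncn `|b - t|).+1 => // k /= tk.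
rewrite patchE; case: ifPn => //; rewrite inE /= in_itv /= => tk'.
have : `|b - t| < k%:R by apply: lt_le_trans (truncnS_gt _) _; rewrite ler_nat.
by rewrite ltr_norml => /andP[_]; lra.
Qed.

Lemma prim_pinfty f (b C c : R) : 0 < c -> continuous f -> gbd1 f C c ->
  (fun k : nat => prim f (k%:R + b)) @ \oo --> Int f.
Proof.
move=> c0 cf fC; apply: (@prim_dc _ (fun=> f) _ C c) => //= t.
apply: cvg_near_cst; exists (Num.truncn `|b - t|).+1 => // k /= tk.
rewrite patchE; case: ifPn => //; rewrite notin_setE /= in_itv /= => /negP.
have : `|b - t| < k%:R by apply: lt_le_trans (truncnS_gt _) _; rewrite ler_nat.
by rewrite -ltNge ltr_norml => /andP[+ _]; lra.
Qed.

Lemma prim_dv f C c x : 0 < c -> continuous f -> gbd1 f C c -> dv (prim f) x (f x).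
Proof.
move=> c0 cf fC; have [|||d1 d2] := @continuous_FTC1 R f -oo%O x (x + 1) _ _ _ (cf x).
- by rewrite ltrDl.
- apply: (integrableS _ _ (subsetT _)) => //; exact: integrable_gbd1 fC.
- by rewrite ltNyr.
- by apply: DeriveDef; [exact: d1|rewrite -derive1E; exact: d2].
Qed.

Lemma Int_lin a f g C c D d : 0 < c -> continuous f -> gbd1 f C c ->
  0 < d -> continuous g -> gbd1 g D d ->
  Int (fun x => a * f x + g x) = a * Int f + Int g.
Proof.
move=> c0 cf fC d0 cg gD; rewrite /Int RintegralD//.
- by rewrite RintegralZl//; exact: integrable_gbd1 fC.
- have -> : EFin \o (fun x => a * f x) = (fun x => a%:E * (f x)%:E)%E by [].
  by apply: integrableZl => //; exact: integrable_gbd1 fC.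
- exact: integrable_gbd1 gD.
Qed.

Lemma Int_mono f g C c D d : 0 < c -> continuous f -> gbd1 f C c ->
  0 < d -> continuous g -> gbd1 g D d -> (forall x, f x <= g x) -> Int f <= Int g.
Proof.
move=> c0 cf fC d0 cg gD fg; apply: le_Rintegral => //.
- exact: integrable_gbd1 fC.
- exact: integrable_gbd1 gD.
Qed.

Lemma prim_le f x y C c : 0 < c -> continuous f -> gbd1 f C c ->
  (forall t, 0 <= f t) -> x <= y -> prim f x <= prim f y.
Proof.
move=> c0 cf fC f0; rewrite le_eqVlt => /predU1P[->//|xy].
have [|z _ e] := @dv_MVT _ (prim f) f x y xy; first by move=> t _; exact: prim_dv fC.
by rewrite -subr_ge0 e mulr_ge0// subr_ge0 ltW.
Qed.

Lemma dv_shift f (b x l : R) : dv f (x + b) l -> dv (fun t => f (t + b)) x l.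
Proof.
move=> fl; rewrite -[l]mulr1; apply: (@dv_comp _ f (fun t => t + b)) => //.
by rewrite -[1]addr0; apply: dvD; [exact: dv_id|exact: dv_cst].
Qed.

Lemma Int_shift f (b C c D d : R) : 0 < c -> continuous f -> gbd1 f C c ->
  0 < d -> gbd1 (fun t => f (t + b)) D d -> Int (fun t => f (t + b)) = Int f.
Proof.
move=> c0 cf fC d0 fD.
have cfb : continuous (fun t => f (t + b)).
  move=> t; apply: continuous_comp; last exact: cf.
  by apply: cvgD; [exact: cvg_id|exact: cvg_cst].
pose A x := prim (fun t => f (t + b)) x - prim f (x + b).
have A0 x : A x = A 0.
  apply: is_derive_0_is_cst => y; rewrite -[0](subrr (f (y + b))).
  apply: dvD; first exact: prim_dv cfb fD.
  by apply: dvN; apply: dv_shift; exact: prim_dv cf fC.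
have h1 : (fun k : nat => A (- k%:R)) @ \oo --> (0 - 0 : R).
  apply: cvgB; last exact: prim_ninfty cf fC.
  by have := prim_ninfty 0 d0 cfb fD; under eq_fun do rewrite addr0.
have h2 : (fun k : nat => A k%:R) @ \oo --> Int (fun t => f (t + b)) - Int f.
  apply: cvgB; last exact: prim_pinfty cf fC.
  by have := prim_pinfty 0 d0 cfb fD; under eq_fun do rewrite addr0.
have e1 : A 0 = 0.
  transitivity (0 - 0 : R); last by rewrite subr0.
  rewrite -(cvg_lim _ h1)//; under eq_fun do rewrite A0.
  by rewrite lim_cst.
have e2 : Int (fun t => f (t + b)) - Int f = 0.
  rewrite -(cvg_lim _ h2)//; under eq_fun do rewrite A0 e1.
  by rewrite lim_cst.
by apply/eqP; rewrite -subr_eq0 e2.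
Qed.

End one_dimension.

Section iterated_integrals.
Context {R : realType}.

Lemma seq_continuous (f : R -> R) :
  (forall (u : nat -> R) (a : R), u @ \oo --> a -> (fun k => f (u k)) @ \oo --> f a) ->
  continuous f.
Proof. by move=> H a; apply/(@cvg_nbhsP _ R^o) => u ua; exact: H. Qed.

Lemma sqn_scalar (t : R) : sqn (t%:M : 'rV_1) = t ^+ 2.
Proof. by rewrite /sqn big_ord1 mxE. Qed.

Lemma scont_scalar (f : 'rV[R]_1 -> R) : scont f -> continuous (fun t => f t%:M).
Proof. by move=> cf; apply: seq_continuous => u a ua; apply: cf; exact: vcvg_scalar. Qed.

Lemma gbd_scalar (f : 'rV[R]_1 -> R) (C c : R) : gbd f C c -> gbd1 (fun t => f t%:M) C c.
Proof. by move=> fC t; rewrite /gauss1 -sqn_scalar; exact: fC. Qed.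

Lemma gb_scalar (f : 'rV[R]_1 -> R) : gb f ->
  [/\ continuous (fun t => f t%:M) & exists C c : R, [/\ 0 < c, 0 <= C & gbd1 (fun t => f t%:M) C c]].
Proof.
move=> [cf [C [c [c0 C0 fC]]]]; split; first exact: scont_scalar.
by exists C, c; split => //; exact: gbd_scalar.
Qed.

Lemma Int_gt0 (f : R -> R) (C c : R) : 0 < c -> continuous f -> gbd1 f C c ->
  (forall t, 0 < f t) -> 0 < Int f.
Proof.
move=> c0 cf fC f0; have f0' t := ltW (f0 t).
have pm x y : x <= y -> prim f x <= prim f y by apply: prim_le fC f0'.
have p0 x : 0 <= prim f x by apply: Rintegral_ge0.
have [|z _ e] := @dv_MVT _ (prim f) f 0 1 ltr01; first by move=> t _; exact: prim_dv fC.
have p1 : 0 < prim f 1.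
  have : 0 < prim f 1 - prim f 0 by rewrite e subr0 mulr1.
  by rewrite subr_gt0; apply: le_lt_trans.
apply: lt_le_trans p1 _; apply: (seq_lim_ge (prim_pinfty 1 c0 cf fC)) => k.
by apply: pm; rewrite lerDr.
Qed.

Lemma isInt_Int : isInt (fun f : 'rV[R]_1 -> R => Int (fun t => f t%:M)).
Proof.
split.
- move=> a f g /gb_scalar[cf [C [c [c0 C0 fC]]]] /gb_scalar[cg [D [d [d0 D0 gD]]]].
  exact: Int_lin fC d0 cg gD.
- move=> f g /gb_scalar[cf [C [c [c0 C0 fC]]]] /gb_scalar[cg [D [d [d0 D0 gD]]]] fg.
  by apply: Int_mono fC d0 cg gD _.
- move=> f_ f C c c0 C0 cf_ cf fC ff; apply: (@Int_dc _ _ _ C c) => // k.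
    exact: scont_scalar.
  exact: gbd_scalar.
- move=> f a gf; have [cf [C [c [c0 C0 fC]]]] := gb_scalar gf.
  pose b := a 0 0; have -> : a = b%:M by apply/rowP => i; rewrite !ord1 mxE mulr1n.
  under eq_fun do rewrite -raddfD /=.
  apply: (@Int_shift _ (fun t => f t%:M) b C c (C * expR (c * sqn (b%:M : 'rV_1))) (c / 2)) => //.
    exact: divr_gt0.
  have fC' : gbd f C c.
    move=> x; have -> : x = (x 0 0)%:M by apply/rowP => i; rewrite !ord1 mxE mulr1n.
    by rewrite sqn_scalar; exact: fC.
  by have := gbd_scalar (gbd_shift b%:M C0 c0 fC'); under eq_fun do rewrite -raddfD /=.
- move=> c c0; apply: (@Int_gt0 _ 1 c) => //.
  + by apply: scont_scalar; case: (@gauss_gb R 1 c c0).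
  + by move=> t; rewrite mul1r ger0_norm ?expR_ge0// /gauss sqn_scalar.
  + by move=> t; exact: gauss_gt0.
Qed.

Definition scont2 p q (F : 'rV[R]_p -> 'rV[R]_q -> R) :=
  forall u x v y, vcvg u x -> vcvg v y -> (fun k => F (u k) (v k)) @ \oo --> F x y.

Definition gbd2 p q (F : 'rV[R]_p -> 'rV[R]_q -> R) (C c : R) :=
  forall x y, `|F x y| <= C * (gauss c x * gauss c y).

Definition gb2 p q (F : 'rV[R]_p -> 'rV[R]_q -> R) :=
  scont2 F /\ exists C c : R, [/\ 0 < c, 0 <= C & gbd2 F C c].

Lemma gauss_row_mx p q c (u : 'rV[R]_p) (v : 'rV[R]_q) :
  gauss c (row_mx u v) = gauss c u * gauss c v.
Proof. by rewrite /gauss sqn_row_mx mulrDr opprD expRD. Qed.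

Lemma gauss_le1 n c (u : 'rV[R]_n) : 0 < c -> gauss c u <= 1.
Proof. by move=> c0; apply: expRle1; rewrite mulr_ge0 ?sqn_ge0// ltW. Qed.

Lemma gauss_ge0 n c (u : 'rV[R]_n) : 0 <= gauss c u.
Proof. exact: ltW (gauss_gt0 _ _). Qed.

Lemma gb_gb2 p q (f : 'rV[R]_(p + q) -> R) : gb f -> gb2 (fun u v => f (row_mx u v)).
Proof.
move=> [cf [C [c [c0 C0 fC]]]]; split.
  by move=> u x v y ux vy; apply: cf; exact: vcvg_row_mx.
by exists C, c; split => // x y; rewrite -gauss_row_mx; exact: fC.
Qed.

Lemma gb2_slice p q (F : 'rV[R]_p -> 'rV[R]_q -> R) x : gb2 F -> gb (F x).
Proof.
move=> [cF [C [c [c0 C0 FC]]]]; split.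
  by move=> u y uy; apply: cF => //; exact: vcvg_cst.
exists (C * gauss c x), c; split => //; first by rewrite mulr_ge0// gauss_ge0.
by move=> y; rewrite -mulrA; exact: FC.
Qed.

Lemma gbd_int2 p q (F : 'rV[R]_p -> 'rV[R]_q -> R) I (C c : R) : isInt I ->
  scont2 F -> 0 < c -> 0 <= C -> gbd2 F C c ->
  gbd (fun x => I (F x)) (C * I (gauss c)) c.
Proof.
move=> II cF c0 C0 FC x; rewrite mulrAC.
apply: (int_bound II c0) => //; first by rewrite mulr_ge0// gauss_ge0.
  by move=> u y uy; apply: cF => //; exact: vcvg_cst.
by move=> y; rewrite -mulrA; exact: FC.
Qed.

Lemma gb_int2 p q (F : 'rV[R]_p -> 'rV[R]_q -> R) I : isInt I -> gb2 F ->
  gb (fun x => I (F x)).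
Proof.
move=> II [cF [C [c [c0 C0 FC]]]]; split; last first.
  exists (C * I (gauss c)), c; split => //; last exact: gbd_int2.
  by rewrite mulr_ge0// ltW// (int_gauss II).
move=> u x ux; apply: (int_dc II c0 C0).
- by move=> k v y vy; apply: cF => //; exact: vcvg_cst.
- by move=> v y vy; apply: cF => //; exact: vcvg_cst.
- move=> k y; apply: le_trans (FC _ _) _; rewrite ler_wpM2l// ler_piMl ?gauss_ge0//.
  exact: gauss_le1.
- by move=> y; apply: cF => //; exact: vcvg_cst.
Qed.

Lemma isInt_comp p q (I : ('rV[R]_p -> R) -> R) (I' : ('rV[R]_q -> R) -> R) :
  isInt I -> isInt I' -> isInt (fun f => I (fun u => I' (fun v => f (row_mx u v)))).
Proof.
move=> II II'; split.
- move=> a f g gf gg.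
  under eq_fun => u do rewrite (int_lin II' a (gb_slice u gf) (gb_slice u gg)).
  by rewrite (int_lin II)//; apply: gb_int2 => //; exact: gb_gb2.
- move=> f g gf gg fg; apply: (int_mono II); try by apply: gb_int2 => //; exact: gb_gb2.
  by move=> u; apply: (int_mono II') => //; exact: gb_slice.
- move=> f_ f C c c0 C0 cf_ cf fC ff.
  have g_ k : gb (f_ k) by split => //; exists C, c.
  apply: (@int_dc _ _ _ II _ _ (C * I' (gauss c)) c) => //.
  + by rewrite mulr_ge0// ltW// (int_gauss II').
  + by move=> k; case: (gb_int2 II' (gb_gb2 (g_ k))).
  + suff /(gb_int2 II')[] : gb2 (fun u v => f (row_mx u v)) by [].
    apply: gb_gb2; split=> //; exists C, c; split => // x.
    by apply: (seq_lim_le (cvg_norm (ff x))) => k; exact: fC.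
  + move=> k; apply: gbd_int2 => //; first by case: (gb_gb2 (g_ k)).
    by move=> x y; rewrite -gauss_row_mx; exact: fC.
  + move=> u; apply: (@int_dc _ _ _ II' _ _ (C * gauss c u) c) => //.
    * by rewrite mulr_ge0// gauss_ge0.
    * by move=> k; exact: scont_slice.
    * exact: scont_slice.
    * by move=> k; exact: gbd_slice.
- move=> f a gf; rewrite -[a]hsubmxK.
  under eq_fun do under eq_fun do rewrite add_row_mx.
  under eq_fun => u do rewrite (int_tr II' _ (gb_slice (u + lsubmx a) gf)).
  by rewrite (int_tr II (f := fun u => I' (fun v => f (row_mx u v))))//;
    apply: gb_int2 => //; exact: gb_gb2.
- move=> c c0; under eq_fun do under eq_fun do rewrite gauss_row_mx.
  under eq_fun do rewrite (intZ II' _ (@gauss_gb R q c c0)) mulrC.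
  by rewrite (intZ II _ (@gauss_gb R p c c0)) mulr_gt0// (int_gauss II, int_gauss II').
Qed.

Lemma isInt_eval0 : isInt (fun f : 'rV[R]_0 -> R => f 0).
Proof.
split=> //.
- by move=> f a _; congr f; apply/rowP => -[].
- by move=> c _; exact: gauss_gt0.
Qed.

Fixpoint J n : ('rV[R]_n -> R) -> R :=
  match n with
  | 0 => fun f => f 0
  | m.+1 => fun f => Int (fun t => J (fun x : 'rV[R]_m => f (row_mx (t%:M : 'rV_1) x)))
  end.

Lemma isInt_J n : isInt (@J n).
Proof. by elim: n => [|n IH]; [exact: isInt_eval0|exact: isInt_comp isInt_Int IH]. Qed.

Lemma int_gt0 n I (f : 'rV[R]_n -> R) (e c : R) : isInt I -> gb f -> 0 < e -> 0 < c ->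
  (forall x, e * gauss c x <= f x) -> 0 < I f.
Proof.
move=> II gf e0 c0 ef; apply: (@lt_le_trans _ _ (I (fun x => e * gauss c x))).
  by rewrite (intZ II)//; [rewrite mulr_gt0// (int_gauss II)|exact: gauss_gb].
by apply: (int_mono II) => //; apply: gbZ; exact: gauss_gb.
Qed.

Lemma J_gt0 n (f : 'rV[R]_n -> R) : gb f -> (forall x, 0 < f x) -> 0 < J f.
Proof.
elim: n f => [|n IH] f gf f0 /=; first exact: f0.
have [cJ [C [c [c0 C0 H]]]] := gb_scalar (gb_int2 (isInt_J n) (@gb_gb2 1 n f gf)).
apply: (Int_gt0 c0 cJ H) => t; apply: IH => [|x]; last exact: f0.
exact: (@gb_slice R 1 n).
Qed.

Lemma gb_mulmx p n (f : 'rV[R]_n -> R) (A : 'M[R]_(p, n)) (A' : 'M[R]_(n, p)) :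
  A *m A' = 1%:M -> gb f -> gb (fun t => f (t *m A)).
Proof.
by move=> AA' /(gb_affine 0 AA'); under eq_fun do rewrite add0r.
Qed.

(** With [isInt_uniq], this yields linear changes of variables without determinants. *)
Lemma isInt_mulmx p n I (A : 'M[R]_(p, n)) (A' : 'M[R]_(n, p)) :
  A *m A' = 1%:M -> A' *m A = 1%:M -> isInt I ->
  isInt (fun f => I (fun t => f (t *m A))).
Proof.
move=> AA' A'A II; split.
- by move=> a f g gf gg; rewrite (int_lin II)//; exact: gb_mulmx AA' _.
- move=> f g gf gg fg; apply: (int_mono II) => //; exact: gb_mulmx AA' _.
- move=> f_ f C c c0 C0 cf_ cf fC ff; have [k k0 kA] := gbd_affine AA'.
  apply: (@int_dc _ _ _ II _ _ (C * expR (c * sqn (0 : 'rV[R]_n))) (c * k)) => //.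
  + exact: mulr_gt0.
  + by rewrite mulr_ge0// expR_ge0.
  + by move=> j; have := @scont_affine R _ _ (f_ j) 0 A (cf_ j); under eq_fun do rewrite add0r.
  + by have := @scont_affine R _ _ f 0 A cf; under eq_fun do rewrite add0r.
  + by move=> j; have := kA _ _ _ 0 C0 c0 (fC j); under [X in gbd X]eq_fun do rewrite add0r.
- move=> f a gf; rewrite -[a]mulmx1 -A'A mulmxA.
  under eq_fun do rewrite -mulmxDl.
  by rewrite (int_tr II (f := fun t => f (t *m A)))//; exact: gb_mulmx AA' _.
- move=> c c0; apply: (@int_gt0 _ _ _ 1 (c * (frob A + 1))) => //.
  + by apply: gb_mulmx AA' _; exact: gauss_gb.
  + by rewrite mulr_gt0// ltr_wpDl// frob_ge0.
  + move=> x; rewrite mul1r ler_expR lerN2 -mulrA ler_wpM2l ?(ltW c0)//.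
    apply: le_trans (sqn_mulmx _ _) _; rewrite ler_wpM2r ?sqn_ge0// lerDl.
    exact: ler01.
Qed.

Lemma prim_gauss_bound (f : R -> R) (C c T : R) : 0 < c -> continuous f ->
  gbd1 f C c -> `|prim f T| <= C * Int (gauss1 c).
Proof.
move=> c0 cf fC.
have gc : continuous (gauss1 c : R -> R) by exact: continuous_gauss1.
have C0 : 0 <= C.
  have := fC 0; rewrite /gauss1 expr0n mulr0 oppr0 expR0 mulr1.
  exact: le_trans.
apply: (@le_trans _ _ (prim (fun t => `|f t|) T)).
  by apply: le_normr_Rintegral => //; apply: integrableS (integrable_gbd1 c0 cf fC).
have cn : continuous (fun t => `|f t|).
  by move=> t; apply: continuous_comp; [exact: cf|exact: norm_continuous].
have bn : gbd1 (fun t => `|f t|) C c by move=> t; rewrite normr_id.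
apply: (@le_trans _ _ (Int (fun t => `|f t|))).
  apply: (seq_lim_ge (prim_pinfty T c0 cn bn)) => k.
  by apply: prim_le cn bn _ _; last by rewrite lerDr.
rewrite /Int -RintegralZl//; last exact: integrable_gauss1.
apply: le_Rintegral => //; first exact: integrable_gbd1 bn.
exact: integrable_Cgauss1.
Qed.

(** Fubini for a functional not known to be the integral of a measure. With the inner or outer
    integral cut at an upper limit [T], both sides have the same derivative in [T], by [int_dv], and
    both vanish at minus infinity. *)
Lemma int_swap1 n I (F : R -> 'rV[R]_n -> R) : isInt I ->
  gb2 (fun (t : 'rV_1) x => F (t 0 0) x) ->
  I (fun x => Int (F ^~ x)) = Int (fun t => I (F t)).
Proof.
move=> II gF; have [cF [C [c [c0 C0 FC]]]] := gF.
have E (t : R) : (t%:M : 'rV_1) 0 0 = t by rewrite mxE.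
have bF t x : `|F t x| <= C * (gauss1 c t * gauss c x).
  by have := FC t%:M x; rewrite [gauss c t%:M]/gauss sqn_scalar E.
have c2 u (x : R) v y : u @ \oo --> x -> vcvg v y -> (fun k => F (u k) (v k)) @ \oo --> F x y.
  by move=> ux vy; have := cF _ _ _ _ (vcvg_scalar ux) vy; under eq_fun do rewrite E; rewrite E.
have cx x : continuous (F ^~ x).
  by apply: seq_continuous => u a ua; apply: c2 => //; exact: vcvg_cst.
have ct t : scont (F t) by move=> v y vy; apply: c2 => //; exact: cvg_cst.
have bx x : gbd1 (F ^~ x) (C * gauss c x) c.
  by move=> t; rewrite -mulrA [gauss _ _ * _]mulrC; exact: bF.
have g1 (t : R) : gauss1 c t <= 1 by apply: expRle1; rewrite mulr_ge0 ?sqr_ge0// ltW.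
have bt t : gbd (F t) C c.
  by move=> x; apply: le_trans (bF _ _) _; rewrite ler_wpM2l// ler_piMl// gauss_ge0.
have bu x : gbd1 (F ^~ x) C c.
  move=> t; apply: le_trans (bF _ _) _; rewrite ler_wpM2l// ler_piMr ?gauss_le1//.
  exact: expR_ge0.
have cI : continuous (fun t => I (F t)).
  apply: seq_continuous => u a ua; apply: (int_dc II c0 C0) => // x.
  by apply: c2 => //; exact: vcvg_cst.
have bI : gbd1 (fun t => I (F t)) (C * I (gauss c)) c.
  move=> t; rewrite mulrAC; apply: (int_bound II c0) => //.
    by rewrite mulr_ge0// expR_ge0.
  by move=> x; rewrite -mulrA; exact: bF.
pose G : R := Int (gauss1 c).
have G0 : 0 <= G by apply: Rintegral_ge0 => t _; exact: expR_ge0.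
have bP T : gbd (fun x => prim (F ^~ x) T) (C * G) c.
  by move=> x; rewrite mulrAC; apply: prim_gauss_bound c0 (cx x) (bx x).
have cP T : scont (fun x => prim (F ^~ x) T).
  move=> u x ux; apply: (@prim_fixed_dc _ _ _ _ C c) => //.
  by move=> t; apply: c2 => //; exact: cvg_cst.
pose A T := I (fun x => prim (F ^~ x) T) - prim (fun t => I (F t)) T.
have A0 T : A T = A 0.
  apply: is_derive_0_is_cst => y; rewrite -[0](subrr (I (F y))).
  apply: dvD; last by apply: dvN; exact: prim_dv cI bI.
  apply: (@int_dv _ _ _ II (fun T x => prim (F ^~ x) T) F y (C * G + C) c) => //.
  - by rewrite addr_ge0// mulr_ge0.
  - by move=> t _; apply: gbd_le (bP t) _ _ => //; rewrite ?mulr_ge0// lerDl.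
  - by move=> t x _; exact: prim_dv (cx x) (bx x).
  - by move=> t _; apply: gbd_le (bt t) _ _ => //; rewrite lerDr mulr_ge0.
have h1 : (fun k : nat => A (- k%:R + 0)) @ \oo --> (I (fun=> 0) - 0 : R).
  apply: cvgB; last exact: prim_ninfty cI bI.
  apply: (@int_dc _ _ _ II _ _ (C * G) c) => //; first exact: mulr_ge0.
    exact: scont_cst.
  by move=> x; exact: prim_ninfty (cx x) (bx x).
have h2 : (fun k : nat => A (k%:R + 0)) @ \oo --> I (fun x => Int (F ^~ x)) - Int (fun t => I (F t)).
  apply: cvgB; last exact: prim_pinfty cI bI.
  apply: (@int_dc _ _ _ II _ _ (C * G) c) => //; first exact: mulr_ge0.
    move=> u x ux; apply: (@Int_dc _ _ _ C c) => //.
    by move=> t; apply: c2 => //; exact: cvg_cst.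
  by move=> x; exact: prim_pinfty (cx x) (bx x).
have e1 : A 0 = 0.
  transitivity (I (fun=> 0) - 0); last by rewrite (int0 II) subr0.
  rewrite -(cvg_lim _ h1)//; under eq_fun do rewrite A0.
  by rewrite lim_cst.
apply/eqP; rewrite -subr_eq0; apply/eqP.
rewrite -(cvg_lim _ h2)//; under eq_fun do rewrite A0 e1.
by rewrite lim_cst.
Qed.

Lemma int_swapJ p n I (F : 'rV[R]_p -> 'rV[R]_n -> R) : isInt I -> gb2 F ->
  I (fun x => J (F ^~ x)) = J (fun u => I (F u)).
Proof.
move=> II; elim: p F => [//|p IH] F gF /=.
have [cF [C [c [c0 C0 FC]]]] := gF.
have gFt (t : R) : gb2 (fun u x => F (row_mx (t%:M : 'rV_1) u) x).
  split.
    move=> u x v y ux vy; apply: cF => //; apply: (@vcvg_row_mx _ 1) => //.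
    exact: vcvg_cst.
  exists C, c; split => // x y; apply: le_trans (FC _ _) _.
  rewrite (@gauss_row_mx 1) ler_wpM2l// ler_wpM2r ?gauss_ge0//.
  by rewrite ler_piMl ?gauss_ge0// gauss_le1.
under [in RHS]eq_fun do rewrite -(IH _ (gFt _)).
rewrite (int_swap1 (F := fun t x => J (fun u => F (row_mx (t%:M : 'rV_1) u) x)) II)//.
have E (t : 'rV[R]_1) : (t 0 0)%:M = t by apply/rowP => i; rewrite !ord1 mxE mulr1n.
split.
  move=> u x v y ux vy; apply: (@int_dc _ _ _ (isInt_J p) _ _ C c) => //.
  - move=> k w z wz; apply: cF; last exact: vcvg_cst.
    by apply: (@vcvg_row_mx _ 1) => //; exact: vcvg_cst.
  - move=> w z wz; apply: cF; last exact: vcvg_cst.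
    by apply: (@vcvg_row_mx _ 1) => //; exact: vcvg_cst.
  - move=> k w; apply: le_trans (FC _ _) _; rewrite (@gauss_row_mx 1) ler_wpM2l//.
    rewrite mulrAC ler_piMl ?gauss_ge0//.
    by rewrite mulr_ile1 ?gauss_ge0// gauss_le1.
  - move=> w; apply: cF => //; apply: (@vcvg_row_mx _ 1); last exact: vcvg_cst.
    by under [X in vcvg X]eq_fun do rewrite E; rewrite E.
exists (C * J (gauss c : 'rV[R]_p -> R)), c; split => //.
  by rewrite mulr_ge0// ltW// (int_gauss (isInt_J _)).
move=> x y; rewrite mulrAC; apply: (int_bound (isInt_J p) c0).
- by rewrite mulr_ge0// mulr_ge0// gauss_ge0.
- by move=> w z wz; apply: (gFt _).1 => //; exact: vcvg_cst.
- move=> w; apply: le_trans (FC _ _) _; rewrite (@gauss_row_mx 1) E.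
  by rewrite -!mulrA ler_wpM2l// ler_wpM2l ?gauss_ge0// mulrC.
Qed.

(* Both sides of [I f * J g = I g * J f], [g] an even Gaussian, are the double
   integral of [f x * g (y - x)], i.e. of [f (x + y) * g x]. *)
Lemma isInt_uniq n I (f : 'rV[R]_n -> R) : isInt I -> gb f ->
  I f = I (gauss 1) / J (gauss 1 : 'rV[R]_n -> R) * J f.
Proof.
move=> II gf; have JJ := isInt_J n; set g : 'rV[R]_n -> R := gauss 1.
have gg : gb g by exact: gauss_gb.
have gN x : g (- x) = g x by rewrite /g /gauss sqnN.
have Jg : J g != 0 by rewrite gt_eqF// (int_gauss JJ).
rewrite mulrAC; apply: (mulIf Jg); rewrite divfK//.
have [cf [C [c [c0 C0 fC]]]] := gf.
have cg := gg.1.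
have g1 : gb2 (fun y x => f x * g (y - x)).
  split.
    move=> u x v y ux vy; apply: cvgM; first exact: cf.
    apply: cg; apply: vcvgD => // i; rewrite mxE; under eq_fun do rewrite mxE.
    by apply: cvgN; exact: vy.
  pose m := Num.min 1 (c / 2); have m0 : 0 < m by rewrite lt_min ltr01 divr_gt0.
  exists C, (m / 2); split => //; first exact: divr_gt0.
  move=> y x; rewrite normrM [`|g _|]ger0_norm ?gauss_ge0// -expRD.
  apply: le_trans (ler_wpM2r (gauss_ge0 _ _) (fC x)) _.
  rewrite -mulrA -expRD ler_wpM2l// ler_expR.
  have := sqnD y (- x); rewrite sqnN.
  have m1 : m <= 1 by rewrite ge_min lexx.
  have m2 : m <= c / 2 by rewrite ge_min lexx orbT.
  have := sqn_ge0 x; have := sqn_ge0 (y - x); have := sqn_ge0 y; nra.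
have g2 : gb2 (fun y x => f (x + y) * g x).
  split.
    move=> u x v y ux vy; apply: cvgM; last exact: cg.
    by apply: cf; exact: vcvgD.
  pose m := Num.min c (2^-1); have m0 : 0 < m by rewrite lt_min c0 invr_gt0 ltr0n.
  exists C, (m / 2); split => //; first exact: divr_gt0.
  move=> y x; rewrite normrM [`|g _|]ger0_norm ?gauss_ge0// -expRD.
  apply: le_trans (ler_wpM2r (gauss_ge0 _ _) (fC _)) _.
  rewrite -mulrA -expRD ler_wpM2l// ler_expR.
  have := sqnD y x; rewrite [y + x]addrC.
  have m1 : m <= c by rewrite ge_min lexx.
  have m2 : m <= 2^-1 by rewrite ge_min lexx orbT.
  have := sqn_ge0 x; have := sqn_ge0 (x + y); have := sqn_ge0 y; nra.
transitivity (I (fun x => J (fun y => f x * g (y - x)))).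
  under [in RHS]eq_fun => x do rewrite (intZ JJ _ (gb_shift (- x) gg)) (int_tr JJ _ gg) mulrC.
  by rewrite (intZ II)// mulrC.
rewrite (int_swapJ II g1).
transitivity (J (fun y => I (fun x => f (x + y) * g x))).
  congr J; apply/funext => y; rewrite -(int_tr II y (gb2_slice y g1)).
  by congr I; apply/funext => x; rewrite opprD addrCA subrr addr0 gN.
rewrite -(int_swapJ II g2).
under eq_fun => x do under eq_fun => y do rewrite mulrC addrC.
under eq_fun => x do rewrite (intZ JJ _ (gb_shift x gf)) (int_tr JJ _ gf) mulrC.
by rewrite (intZ II)// mulrC.
Qed.

End iterated_integrals.

(** * Scores and integrals over fibers *)

Section fiber_integrals.
Context {R : realType}.

Lemma prim_dv_eq (u u' : R -> R) (C c T : R) : 0 < c -> continuous u' ->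
  gbd1 u C c -> gbd1 u' C c -> (forall t, dv u t (u' t)) -> u T = prim u' T.
Proof.
move=> c0 cu' bu bu' du.
pose A x := u x - prim u' x.
have A0 x : A x = A T.
  apply: is_derive_0_is_cst => y; rewrite -[0](subrr (u' y)).
  by apply: dvD => //; apply: dvN; exact: prim_dv bu'.
(* [u] decays at least geometrically along the negative integers, because [k ^ 2 >= k]. *)
have g0 : (fun k : nat => expR (- c) ^+ k) @ \oo --> (0 : R).
  by apply: cvg_expr; rewrite ger0_norm ?expR_ge0// -expR0 ltr_expR oppr_lt0.
have uk (k : nat) : `|u (- k%:R)| <= C * expR (- c) ^+ k.
  have C0 : 0 <= C.
    have := bu 0; rewrite /gauss1 expr0n mulr0 oppr0 expR0 mulr1.
    exact: le_trans.
  apply: le_trans (bu _) _; rewrite ler_wpM2l// -expRM_natl ler_expR mulrN lerN2.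
  have -> : (- k%:R : R) ^+ 2 = (k ^ 2)%:R by rewrite sqrrN natrX.
  rewrite mulrC ler_wpM2l ?(ltW c0)// ler_nat.
  by case: (k) => // j; rewrite -mulnn leq_pmulr.
have h : (fun k : nat => A (- k%:R + 0)) @ \oo --> (0 - 0 : R).
  apply: cvgB; last exact: prim_ninfty bu'.
  apply/norm_cvg0P; apply: (@squeeze_cvgr _ _ _ _ (fun=> 0) (fun k : nat => C * expR (- c) ^+ k)).
  - by apply: nearW => k; rewrite normr_ge0 addr0 uk.
  - exact: cvg_cst.
  - by rewrite -[X in _ --> X](mulr0 C); apply: cvgM; [exact: cvg_cst|exact: g0].
apply/eqP; rewrite -subr_eq0 -[X in _ == X](subrr 0) -(cvg_lim _ h)//.
by under [in X in lim X]eq_fun do rewrite A0; rewrite lim_cst.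
Qed.

(** The one-variable case of [norm_le_J]: a decaying function is the integral of its derivative from
    minus infinity. *)
Lemma norm_le_Int (u u' : R -> R) (C c T : R) : 0 < c -> continuous u' ->
  gbd1 u C c -> gbd1 u' C c -> (forall t, dv u t (u' t)) ->
  `|u T| <= Int (fun t => `|u' t|).
Proof.
move=> c0 cu' bu bu' du; rewrite (prim_dv_eq T c0 cu' bu bu' du).
apply: (@le_trans _ _ (prim (fun t => `|u' t|) T)).
  by apply: le_normr_Rintegral => //; apply: integrableS (integrable_gbd1 c0 cu' bu').
have cn : continuous (fun t => `|u' t|).
  by move=> t; apply: continuous_comp; [exact: cu'|exact: norm_continuous].
have bn : gbd1 (fun t => `|u' t|) C c by move=> t; rewrite normr_id.
apply: (seq_lim_ge (prim_pinfty T c0 cn bn)) => k.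
by apply: prim_le cn bn _ _; last by rewrite lerDr.
Qed.

Lemma dv_line n (f : 'rV[R]_n -> R) (f' : 'rV[R]_n -> R) v :
  (forall x, dv (fun s => f (x + s *: v)) 0 (f' x)) ->
  forall x t, dv (fun s => f (x + s *: v)) t (f' (x + t *: v)).
Proof.
move=> H x t; have := H (x + t *: v).
rewrite -[X in dv _ X](subrr t) => /dv_shift.
under eq_fun => s do rewrite -addrA -scalerDl [t + _]addrC subrK.
by [].
Qed.

Lemma fib_dv n q I (f f' : 'rV[R]_n -> R) (v y : 'rV[R]_n) (B : 'M[R]_(q, n)) B' t :
  isInt I -> B *m B' = 1%:M -> gb f -> gb f' ->
  (forall x, dv (fun s => f (x + s *: v)) 0 (f' x)) ->
  dv (fun s => I (fun w => f (y + s *: v + w *m B))) t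
     (I (fun w => f' (y + t *: v + w *m B))).
Proof.
move=> II BB' [cf [C1 [c1 [c10 C10 fC]]]] [cf' [C2 [c2 [c20 C20 fC']]]] df.
pose C := C1 + C2; pose c := Num.min c1 c2.
have c0 : 0 < c by rewrite lt_min c10.
have C0 : 0 <= C by rewrite addr_ge0.
have b1 : gbd f C c by apply: gbd_le fC _ _ => //; rewrite ?lerDl// ge_min lexx.
have b2 : gbd f' C c by apply: gbd_le fC' _ _ => //; rewrite ?lerDr// ge_min lexx orbT.
have [k k0 kA] := gbd_affine BB'.
pose M := 2 * sqn y + 2 * ((`|t| + 1) ^+ 2 * sqn v).
have bg g s : gbd g C c -> `|s - t| <= 1 ->
    gbd (fun w => g (y + s *: v + w *m B)) (C * expR (c * M)) (c * k).
  move=> bg st; apply: gbd_le (kA g C c _ C0 c0 bg) _ _ => //.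
    by rewrite mulr_ge0// expR_ge0.
  rewrite ler_wpM2l// ler_expR ler_wpM2l ?(ltW c0)//.
  apply: le_trans (sqnD_le _ _) _; rewrite lerD2l ler_wpM2l// sqnZ.
  rewrite ler_wpM2r ?sqn_ge0// -real_normK ?num_real// lerXn2r ?nnegrE ?addr_ge0//.
  by rewrite -lerBlDl; apply: le_trans (lerB_dist _ _) _.
apply: (@int_dv _ _ _ II (fun s w => f (y + s *: v + w *m B))
  (fun s w => f' (y + s *: v + w *m B)) t (C * expR (c * M)) (c * k)) => //.
- exact: mulr_gt0.
- by rewrite mulr_ge0// expR_ge0.
- by move=> s _; exact: scont_affine.
- by move=> s; exact: bg.
- exact: scont_affine.
- move=> s x _; have := dv_line df (y + x *m B) s.
  by rewrite addrAC; under eq_fun do rewrite addrAC.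
- by move=> s; exact: bg.
Qed.

Lemma int_IBP_gb n I (f f' : 'rV[R]_n -> R) v : isInt I -> gb f -> gb f' ->
  (forall x, dv (fun s => f (x + s *: v)) 0 (f' x)) -> I f' = 0.
Proof.
move=> II [cf [C [c [c0 C0 H]]]] [cf' [C' [c' [c0' C0' H']]]] df.
have cc0 : 0 < Num.min c c' by rewrite lt_min c0.
apply: (@int_IBP _ _ _ II f f' v (C + C') (Num.min c c')) => //.
- by rewrite addr_ge0.
- by apply: gbd_le H _ _ => //; rewrite ?lerDl// ge_min lexx.
- by apply: gbd_le H' _ _ => //; rewrite ?lerDr// ge_min lexx orbT.
- exact: dv_line.
Qed.

(** [G s] is the mixed derivative of [G 0] in the first [s] coordinates. Integrating back one
    coordinate at a time bounds a point value by the L1 norm of the full mixed derivative. Applied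
    to the fiber integral as a function of the moments, this replaces a Fourier bound on a
    density. *)
Lemma norm_le_J D (G : nat -> 'rV[R]_D -> R) :
  (forall s, gb (G s)) ->
  (forall (s : 'I_D) x, dv (fun t => G s (x + t *: delta_mx 0 s)) 0 (G s.+1 x)) ->
  `|G 0%N 0| <= J (fun x => `|G D x|).
Proof.
elim: D G => [|D IH] G gG dG; first by [].
have z0 : 0 = row_mx (0%:M : 'rV[R]_1) (0 : 'rV[R]_D) :> 'rV_(1 + D).
  by rewrite raddf0 row_mx0.
have gs (s : nat) (t : R) : gb (fun x => G s (row_mx (t%:M : 'rV_1) x)) by exact: gb_slice.
have g0 (s : nat) : gb (fun t : 'rV_1 => G s (row_mx t (0 : 'rV_D))).
  have [cG [C [c [c0 C0 GC]]]] := gG s; split.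
    by move=> u x ux; apply: cG; apply: (@vcvg_row_mx _ 1) => //; exact: vcvg_cst.
  exists C, c; split => // x; have := GC (row_mx x 0).
  by rewrite (@sqn_row_mx _ 1) sqn0 addr0.
have e0 (t s : R) : row_mx (t%:M : 'rV_1) (0 : 'rV_D) + s *: delta_mx 0 ord0 = row_mx ((t + s)%:M : 'rV_1) 0.
  rewrite [delta_mx 0 ord0](_ : _ = row_mx (1%:M : 'rV_1) 0); last first.
    apply/rowP => i; rewrite !mxE; case: fintype.splitP => j ij; rewrite !mxE.
      rewrite (_ : i = ord0) ?eqxx; last by apply: val_inj; rewrite /= ij ord1.
      by rewrite !ord1.
    by rewrite (_ : i == ord0 = false) ?andbF//; apply/eqP => i0; move: ij; rewrite i0.
  by rewrite (@scale_row_mx _ _ 1 D) (@add_row_mx _ 1 1 D) scaler0 addr0 scale_scalar_mx mulr1 -raddfD.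
have [c1 [C [c [c0 C0 bG]]]] := g0 0%N; have [c1' [C' [c' [c0' C0' bG']]]] := g0 1%N.
pose cc := Num.min c c'; pose CC := C + C'.
have cc0 : 0 < cc by rewrite lt_min c0.
have /= h1 := @norm_le_Int (fun t => G 0%N (row_mx (t%:M : 'rV_1) 0))
  (fun t => G 1%N (row_mx (t%:M : 'rV_1) 0)) CC cc 0 cc0.
rewrite z0; apply: le_trans (h1 _ _ _ _) _.
- exact: scont_scalar c1'.
- have := gbd_scalar (gbd_le C0 bG (C' := CC) (c' := cc) _ _); apply.
    by rewrite lerDl.
  by rewrite ge_min lexx.
- have := gbd_scalar (gbd_le C0' bG' (C' := CC) (c' := cc) _ _); apply.
    by rewrite lerDr.
  by rewrite ge_min lexx orbT.
- move=> t; have := dG ord0 (row_mx (t%:M : 'rV_1) 0).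
  under eq_fun do rewrite e0 addrC.
  by rewrite -[X in dv _ X](subrr t) => /dv_shift; under eq_fun do rewrite subrK.
have [|c2 [C2 [c2' [c20 C20 b2]]]] := @gb_scalar R (fun t : 'rV_1 => `|G 1%N (row_mx t 0)|).
  exact: gb_norm.
have [|c3 [C3 [c3' [c30 C30 b3]]]] := @gb_scalar R
    (fun t : 'rV_1 => J (fun x : 'rV[R]_D => `|G D.+1 (row_mx t x)|)).
  have gn : @gb R (1 + D) (fun z => `|G D.+1 z|) by apply: gb_norm; exact: gG.
  exact: (gb_int2 (isInt_J D) (gb_gb2 gn)).
apply: Int_mono c20 c2 b2 c30 c3 b3 _ => t.
apply: (IH (fun s x => G s.+1 (row_mx (t%:M : 'rV_1) x))).
  by move=> s; exact: gs.
move=> s x; have := dG (lift ord0 s) (row_mx (t%:M : 'rV_1) x).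
rewrite (_ : delta_mx 0 (lift ord0 s) = row_mx (0 : 'rV_1) (delta_mx 0 s) :> 'rV_(1 + D)).
  have e1 u : row_mx (t%:M : 'rV_1) x + u *: row_mx (0 : 'rV_1) (delta_mx 0 s) =
      row_mx (t%:M : 'rV_1) (x + u *: delta_mx 0 s).
    by rewrite (@scale_row_mx _ _ 1 D) (@add_row_mx _ 1 1 D) scaler0 addr0.
  by under eq_fun do rewrite e1.
apply/rowP => i; rewrite !mxE; case: fintype.splitP => j ij; rewrite !mxE.
  rewrite (_ : i = ord0) ?andbF//; apply: val_inj; by rewrite /= ij ord1.
by rewrite -!val_eqE /= ij.
Qed.

Lemma rcons_mx0 n (t : R) (x : 'rV[R]_n) : (row_mx (t%:M : 'rV_1) x : 'rV_(1 + n)) 0 ord0 = t.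
Proof. by rewrite mxE; case: fintype.splitP => // j _; rewrite !ord1 mxE mulr1n. Qed.

Lemma rcons_mxS n (t : R) (x : 'rV[R]_n) k :
  (row_mx (t%:M : 'rV_1) x : 'rV_(1 + n)) 0 (lift ord0 k) = x 0 k.
Proof.
rewrite mxE; case: fintype.splitP => j; rewrite ?ord1//=.
by rewrite /bump /= => /eq_add_S/val_inj ->.
Qed.

Definition gb1 (f : R -> R) :=
  continuous f /\ exists C c : R, [/\ 0 < c, 0 <= C & gbd1 f C c].

Definition Pi n (phi : 'I_n -> R -> R) (x : 'rV[R]_n) : R := \prod_k phi k (x 0 k).

Lemma scont_site n (f : R -> R) (k : 'I_n) : continuous f -> scont (fun x : 'rV[R]_n => f (x 0 k)).
Proof. by move=> cf; apply: (scont_comp cf); exact: scont_coord. Qed.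

Lemma gb_Pi n (phi : 'I_n -> R -> R) : (forall k, gb1 (phi k)) -> gb (Pi phi).
Proof.
move=> gphi; split.
  by apply: scont_prod => k _; apply: scont_site; case: (gphi k).
have /choice[C /choice[c H]] : forall k, exists C c : R, [/\ 0 < c, 0 <= C & gbd1 (phi k) C c].
  by move=> k; case: (gphi k).
have c0 k : 0 < c k by case: (H k).
have C0 k : 0 <= C k by case: (H k).
have S0 : 0 < 1 + \sum_k (c k)^-1.
  by rewrite ltr_pwDl// sumr_ge0// => k _; rewrite invr_ge0 ltW.
exists (\prod_k C k), (1 + \sum_k (c k)^-1)^-1; split; first by rewrite invr_gt0.
  by apply: prodr_ge0 => k _.
move=> x; rewrite normr_prod; apply: (@le_trans _ _ (\prod_k (C k * gauss1 (c k) (x 0 k)))).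
  by apply: ler_prod => k _; rewrite normr_ge0 /=; case: (H k).
rewrite big_split ler_wpM2l ?prodr_ge0// -expR_sum ler_expR sumrN lerN2 mulr_sumr.
apply: ler_sum => k _; rewrite ler_wpM2r ?sqr_ge0// -[leRHS]invrK lef_pV2 ?posrE ?invr_gt0//.
rewrite (bigD1 k)//= addrCA lerDl addr_ge0// sumr_ge0// => j _.
by rewrite invr_ge0 ltW.
Qed.

Lemma J_prod n (phi : 'I_n -> R -> R) : (forall k, gb1 (phi k)) ->
  J (Pi phi) = \prod_k Int (phi k).
Proof.
rewrite /Pi; elim: n phi => [|n IH] phi gphi; first by rewrite /= !big_ord0.
rewrite big_ord_recl /=.
have E t : J (fun x : 'rV[R]_n => \prod_(k < n.+1) phi k ((row_mx (t%:M : 'rV_1) x : 'rV_(1 + n)) 0 k)) =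
    phi ord0 t * \prod_(k < n) Int (phi (lift ord0 k)).
  rewrite -IH => [|k]; last exact: gphi.
  rewrite -(intZ (isInt_J n)); last exact: (gb_Pi (fun k => gphi (lift ord0 k))).
  congr J; apply/funext => x; rewrite big_ord_recl rcons_mx0; congr (_ * _).
  by apply: eq_bigr => k _; rewrite rcons_mxS.
under eq_fun do rewrite E mulrC.
have [c0 [C [c [c1 C1 H]]]] := gphi ord0.
rewrite /Int RintegralZl//; last exact: integrable_gbd1 H.
by rewrite mulrC.
Qed.

Lemma dv_prod_log J (r : seq J) (P : pred J) (f : J -> R -> R) (l : J -> R) t :
  (forall i, P i -> dv (f i) t (l i * f i t)) ->
  dv (fun s => \prod_(i <- r | P i) f i s) t
     ((\sum_(i <- r | P i) l i) * \prod_(i <- r | P i) f i t).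
Proof.
move=> df; elim: r => [|i r IH].
  rewrite !big_nil mul0r; under eq_fun do rewrite big_nil; exact: dv_cst.
rewrite !big_cons; under eq_fun do rewrite big_cons.
case: (boolP (P i)) => // Pi; apply: (dv_eq (dvM (df i Pi) IH)); ring.
Qed.

End fiber_integrals.

(** * Products of scores and their norms *)

Section score_products.
Context {R : realType} (n : nat).
Variables (p th h : 'I_n -> R -> R) (Ch : R).
Hypothesis p_dv : forall k t, dv (p k) t (- (th k t * p k t)).
Hypothesis th_dv : forall k t, dv (th k) t (h k t).
Hypothesis h_cont : forall k, continuous (h k).
Hypothesis h_bound : forall k t, `|h k t| <= Ch.

(* The score: the derivative of [ln (Pi p)] in the direction [a]. *)
Definition rho (a x : 'rV[R]_n) : R := - \sum_k a 0 k * th k (x 0 k).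

(** The iterated derivative of [Pi phi] along the directions of [l], provided that these have
    disjoint supports inside the sites where [phi k = p k] ([dv_Phi]). *)
Definition Phi (phi : 'I_n -> R -> R) (l : seq 'rV[R]_n) (x : 'rV[R]_n) : R :=
  Pi phi x * \prod_(a <- l) rho a x.

Definition disj (a b : 'rV[R]_n) := forall k, a 0 k * b 0 k = 0.

Definition upd (phi : 'I_n -> R -> R) k (f : R -> R) :=
  fun j => if j == k then f else phi j.

Lemma th_cont k : continuous (th k).
Proof. by move=> t; exact: dv_continuous (th_dv k t). Qed.

Lemma sg_site (f : R -> R) (k : 'I_n) : continuous f ->
  (exists C : R, forall t, `|f t| <= C * (1 + t ^+ 2)) -> sg (fun x : 'rV[R]_n => f (x 0 k)).
Proof.
move=> cf [C fC]; apply: (@sg_le _ _ _ (fun x => `|C| * (1 + sqn x))).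
- exact: scont_site.
- move=> x; apply: le_trans (fC _) _; rewrite [leRHS]ger0_norm; last first.
    by rewrite mulr_ge0// addr_ge0// sqn_ge0.
  apply: (@le_trans _ _ (`|C| * (1 + x 0 k ^+ 2))).
    by rewrite ler_wpM2r ?addr_ge0 ?sqr_ge0// ler_norm.
  by rewrite ler_wpM2l// lerD2l coord_sqn.
- by apply: sgM; [exact: sg_cst|apply: sgD; [exact: sg_cst|exact: sg_sqn]].
Qed.

Lemma sg_th k : sg (fun x : 'rV[R]_n => th k (x 0 k)).
Proof.
apply: sg_site; first exact: th_cont.
exists (`|th k 0| + Ch) => t.
have Ch0 : 0 <= Ch by apply: le_trans (h_bound k 0).
have -> : th k t = th k 0 + (th k t - th k 0) by rewrite addrC subrK.
apply: le_trans (ler_normD _ _) _; rewrite mulrDl; apply: lerD.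
  by rewrite ler_peMr// lerDl sqr_ge0.
apply: (@le_trans _ _ (Ch * `|t - 0|)).
  by apply: (@dv_norm_le _ _ (h k)) => s _; [exact: th_dv|exact: h_bound].
rewrite ler_wpM2l// subr0 -real_normK ?num_real//.
by have := sqr_ge0 (`|t| - 1); nra.
Qed.

Lemma sg_rho a : sg (rho a).
Proof.
rewrite /rho; under eq_fun do rewrite -mulN1r.
apply: sgM; first exact: sg_cst.
by apply: sg_sum => k _; apply: sgM; [exact: sg_cst|exact: sg_th].
Qed.

Lemma sg_h k : sg (fun x : 'rV[R]_n => h k (x 0 k)).
Proof.
apply: sg_site => //; exists Ch => t; apply: le_trans (h_bound k t) _.
rewrite ler_peMr ?lerDl ?sqr_ge0//; exact: le_trans (h_bound k 0).
Qed.

Lemma gb_Phi phi l : (forall k, gb1 (phi k)) -> gb (Phi phi l).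
Proof.
move=> gphi; rewrite /Phi; under eq_fun do rewrite mulrC.
apply: gb_mul_sg; first exact: gb_Pi.
by apply: sg_prod => a _; exact: sg_rho.
Qed.

Lemma rhoZ c a x : rho (c *: a) x = c * rho a x.
Proof.
rewrite /rho mulrN mulr_sumr; congr (- _); apply: eq_bigr => k _.
by rewrite mxE mulrA.
Qed.

Lemma rho_disj a b x t : disj a b -> rho a (x + t *: b) = rho a x.
Proof.
move=> ab; congr (- _); apply: eq_bigr => k _.
have /eqP := ab k; rewrite mulf_eq0 => /orP[/eqP ->|/eqP bk]; first by rewrite !mul0r.
by rewrite !mxE bk mulr0 addr0.
Qed.

Lemma dv_coord (x b : 'rV[R]_n) k (t : R) : dv (fun s => (x + s *: b) 0 k) t (b 0 k).
Proof.
under eq_fun do rewrite !mxE; apply: (dv_eq (dvD (dv_cst _ _) (dvM (dv_id _) (dv_cst _ _)))).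
by rewrite mul1r mulr0 addr0 add0r.
Qed.

Lemma dv_Pi phi (b x : 'rV[R]_n) : (forall k, b 0 k != 0 -> phi k = p k) ->
  dv (fun s => Pi phi (x + s *: b)) 0 (Pi phi x * rho b x).
Proof.
move=> bphi.
have H : dv (fun s => Pi phi (x + s *: b)) 0
    ((\sum_k (- (b 0 k * th k ((x + 0 *: b) 0 k)))) * Pi phi (x + 0 *: b)).
  apply: (@dv_prod_log _ _ _ _ (fun k s => phi k ((x + s *: b) 0 k))) => k _.
  have [bk|/bphi ->] := eqVneq (b 0 k) 0.
    rewrite bk !mul0r oppr0 mul0r; under eq_fun do rewrite !mxE bk mulr0 addr0.
    exact: dv_cst.
  apply: (dv_eq (dv_comp (p_dv k _) (dv_coord _ _ _ _))); ring.
by apply: (dv_eq H); rewrite scale0r addr0 sumrN mulrC.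
Qed.

Lemma prod_rho_disj (l : seq 'rV[R]_n) b x t : (forall a, a \in l -> disj a b) ->
  \prod_(a <- l) rho a (x + t *: b) = \prod_(a <- l) rho a x.
Proof. by move=> lb; apply: eq_big_seq => a al; rewrite rho_disj//; exact: lb. Qed.

Lemma dv_Phi phi (l : seq 'rV[R]_n) (b x : 'rV[R]_n) : (forall k, b 0 k != 0 -> phi k = p k) ->
  (forall a, a \in l -> disj a b) ->
  dv (fun s => Phi phi l (x + s *: b)) 0 (Phi phi (b :: l) x).
Proof.
move=> bphi lb; rewrite /Phi big_cons mulrA.
under eq_fun do rewrite (prod_rho_disj _ _ lb).
apply: (dv_eq (dvM (dv_Pi x bphi) (dv_cst _ _))).
by rewrite mulr0 addr0.
Qed.

Lemma dv_rho b x : dv (fun s => rho b (x + s *: b)) 0 (- \sum_k b 0 k ^+ 2 * h k (x 0 k)).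
Proof.
apply: dvN; apply: dv_sum => k _.
have := dvZ (b 0 k) (dv_comp (th_dv k _) (dv_coord x b k 0)).
by rewrite scale0r addr0 => H; apply: (dv_eq H); ring.
Qed.

Fixpoint pdisj (l : seq 'rV[R]_n) : Prop :=
  if l is a :: l' then (forall b, b \in l' -> disj b a) /\ pdisj l' else True.

(* Integration by parts in the direction [b] trades [rho b ^+ 2] for the second derivative of the potential. *)
Lemma J_rho_sqr phi l C1 : (forall k t, 0 <= phi k t) -> (forall k, gb1 (phi k)) ->
  0 <= C1 -> pdisj l ->
  (forall a, a \in l -> Ch * sqn a <= C1 /\ forall k, a 0 k != 0 -> phi k = p k) ->
  J (fun x => Pi phi x * (\prod_(a <- l) rho a x) ^+ 2) <= C1 ^+ size l * J (Pi phi).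
Proof.
move=> phi0 gphi C10; have JJ := isInt_J (R := R) n.
have gP := gb_Pi gphi.
have sgl l' : sg (fun x => (\prod_(a <- l') rho a x) ^+ 2).
  by under eq_fun do rewrite expr2; apply: sgM; apply: sg_prod => a _; exact: sg_rho.
elim: l => [_ _|b l IH /= [bl dl] Hl].
  under eq_fun do rewrite big_nil expr1n mulr1; by rewrite expr0 mul1r.
have [Cb bphi] := Hl b (mem_head _ _).
have {}IH := IH dl (fun a al => Hl a (@mem_behead _ (b :: l) a al)).
pose f x := Pi phi x * (\prod_(a <- l) rho a x) ^+ 2.
have f0 x : 0 <= f x by rewrite mulr_ge0 ?sqr_ge0// prodr_ge0.
have gf : gb f by rewrite /f; under eq_fun do rewrite mulrC; exact: gb_mul_sg.
pose hb (x : 'rV[R]_n) : R := \sum_k b 0 k ^+ 2 * h k (x 0 k).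
have sghb : sg hb by apply: sg_sum => k _; apply: sgM; [exact: sg_cst|exact: sg_h].
have gfr : gb (fun x => rho b x * f x) by apply: gb_mul_sg => //; exact: sg_rho.
have gfrr : gb (fun x => (rho b x) ^+ 2 * f x).
  by apply: gb_mul_sg => //; under eq_fun do rewrite expr2; apply: sgM; exact: sg_rho.
have gfh : gb (fun x => hb x * f x) by exact: gb_mul_sg.
have gd : gb (fun x => (rho b x) ^+ 2 * f x - hb x * f x) by apply: gbD => //; exact: gbN.
have Hd x : dv (fun s => rho b (x + s *: b) * f (x + s *: b)) 0
     ((rho b x) ^+ 2 * f x - hb x * f x).
  rewrite /f; under eq_fun do rewrite (prod_rho_disj _ _ bl).
  apply: (dv_eq (dvM (dv_rho b x) (dvM (dv_Pi x bphi) (dv_cst _ _)))).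
  rewrite scale0r addr0 /hb; ring.
have E0 : J (fun x => (rho b x) ^+ 2 * f x - hb x * f x) = 0.
  exact: (int_IBP_gb JJ gfr gd Hd).
move: E0; rewrite (intB JJ)// => /eqP; rewrite subr_eq0 => /eqP E0.
under eq_fun => x do rewrite big_cons exprMn mulrCA -/(f x).
rewrite E0 exprS -mulrA; apply: le_trans (ler_wpM2l C10 IH).
rewrite -(intZ JJ)//; apply: (int_mono JJ) => //; first exact: gbZ.
move=> x; rewrite ler_wpM2r//; apply: le_trans Cb; rewrite /hb /sqn mulr_sumr.
apply: ler_sum => k _; rewrite mulrC ler_wpM2r ?sqr_ge0//.
exact: le_trans (ler_norm _) (h_bound k _).
Qed.

(** The L1 norm is reduced to the L2 norm, where integration by parts applies, by
    [|r| <= 1 + r ^+ 2]. *)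
Lemma J_Phi_norm phi l C1 : (forall k t, 0 <= phi k t) -> (forall k, gb1 (phi k)) ->
  0 <= C1 -> pdisj l ->
  (forall a, a \in l -> Ch * sqn a <= C1 /\ forall k, a 0 k != 0 -> phi k = p k) ->
  J (fun x => `|Phi phi l x|) <= (1 + C1 ^+ size l) * J (Pi phi).
Proof.
move=> phi0 gphi C10 dl Hl; have JJ := isInt_J (R := R) n.
have gP := gb_Pi gphi.
have gPr : gb (fun x => Pi phi x * (\prod_(a <- l) rho a x) ^+ 2).
  under eq_fun do rewrite mulrC; apply: gb_mul_sg => //; under eq_fun do rewrite expr2.
  by apply: sgM; apply: sg_prod => a _; exact: sg_rho.
rewrite mulrDl mul1r; apply: le_trans (lerD (lexx _) (J_rho_sqr phi0 gphi C10 dl Hl)).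
rewrite -(intD JJ)//; apply: (int_mono JJ); [apply: gb_norm; exact: gb_Phi|exact: gbD|].
move=> x; rewrite /Phi normrM ger0_norm ?prodr_ge0//; rewrite -[X in X + _]mulr1 -mulrDr.
rewrite ler_wpM2l ?prodr_ge0//; set r := \prod_(a <- l) _.
by rewrite -[r ^+ 2]real_normK ?num_real//; have := sqr_ge0 (`|r| - 1); nra.
Qed.

End score_products.

(** * Midpoint inequalities *)

Section midpoint.
Context {R : realType}.

(** The second derivative of [ln p] is at least [- Ch], so [phi s = expR (Ch * s ^+ 2) * (p (t + s)
    * p (t - s))] is nondecreasing for [s >= 0]. *)
Lemma score_midpoint (p th h : R -> R) (Ch : R) : (forall t, 0 < p t) ->
  (forall t, dv p t (- (th t * p t))) -> (forall t, dv th t (h t)) ->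
  (forall t, `|h t| <= Ch) ->
  forall t v, p t ^+ 2 <= expR (Ch * v ^+ 2) * (p (t + v) * p (t - v)).
Proof.
move=> p0 dp dth hC t v.
wlog v0 : v / 0 <= v => [H|].
  have [v0|v0] := leP 0 v; first exact: H.
  have := H (- v); rewrite oppr_ge0 sqrrN opprK [p (t - v) * _]mulrC; apply; exact: ltW.
pose phi s := expR (Ch * s ^+ 2) * (p (t + s) * p (t - s)).
have dl s : dv (fun s => t + s) s 1.
  by apply: (dv_eq (dvD (dv_cst _ _) (dv_id _))); rewrite add0r.
have dr s : dv (fun s => t - s) s (- 1).
  by apply: (dv_eq (dvD (dv_cst _ _) (dvN (dv_id _)))); rewrite add0r.
have dphi s : dv phi s (phi s * (2 * Ch * s - (th (t + s) - th (t - s)))).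
  have de : dv (fun s => expR (Ch * s ^+ 2)) s (2 * Ch * s * expR (Ch * s ^+ 2)).
    apply: dv_expR; apply: (dv_eq (dvZ Ch (dvM (dv_id s) (dv_id s)))); ring.
  apply: (dv_eq (dvM de (dvM (dv_comp (dp _) (dl s)) (dv_comp (dp _) (dr s))))).
  rewrite /phi; ring.
have -> : p t ^+ 2 = phi 0 by rewrite /phi expr0n mulr0 expR0 mul1r addr0 subr0 expr2.
move: v0; rewrite le_eqVlt => /predU1P[<-//|v0].
have [c /andP[c0 cv] e] := @dv_MVT _ phi
  (fun s => phi s * (2 * Ch * s - (th (t + s) - th (t - s)))) 0 v v0 (fun s _ => dphi s).
rewrite -subr_ge0 e mulr_ge0 ?subr_ge0 ?(ltW v0)// mulr_ge0//.
  by rewrite mulr_ge0 ?expR_ge0// mulr_ge0// ltW.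
rewrite subr_ge0.
have : th (t + c) - th (t - c) <= Ch * (t + c - (t - c)).
  apply: (@dv_le _ th h) => [|s _|s _]; [lra|exact: dth|].
  exact: le_trans (ler_norm _) (hC s).
by move/le_trans; apply; lra.
Qed.

(** Cauchy-Schwarz without square roots of functions: integrate [2 * l * f <= l ^+ 2 * k * f1 + f2]
    and take the optimal [l]. *)
Lemma int_midpoint n I (f f1 f2 : 'rV[R]_n -> R) (k : R) : isInt I ->
  gb f -> gb f1 -> gb f2 -> 0 < k -> (forall x, 0 <= f x) ->
  (forall x, 0 <= f1 x) -> (forall x, 0 <= f2 x) -> 0 < I f1 ->
  (forall x, f x ^+ 2 <= k * (f1 x * f2 x)) -> I f ^+ 2 <= k * (I f1 * I f2).
Proof.
move=> II gf gf1 gf2 k0 f0 f10 f20 I1 fk.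
have I0 : 0 <= I f by exact: int_ge0.
have [l l0 lE] : exists2 l : R, 0 <= l & l = I f / (k * I f1).
  by exists (I f / (k * I f1)) => //; rewrite divr_ge0// mulr_ge0// ltW.
have : I (fun x => 2 * l * f x) <= I (fun x => l ^+ 2 * k * f1 x + f2 x).
  apply: (int_mono II); [exact: gbZ|by apply: gb_lin|] => x.
  have a0 := f10 x; have b0 := f20 x; have c0 := f0 x; have := fk x.
  move: (f x) (f1 x) (f2 x) a0 b0 c0 => c a b a0 b0 c0 H.
  have H1 : (2 * l * c) ^+ 2 <= (l ^+ 2 * k * a + b) ^+ 2.
    have -> : (l ^+ 2 * k * a + b) ^+ 2 = (l ^+ 2 * k * a - b) ^+ 2 + 4 * l ^+ 2 * (k * (a * b)) by ring.
    have -> : (2 * l * c) ^+ 2 = 0 + 4 * l ^+ 2 * c ^+ 2 by ring.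
    by apply: lerD; [exact: sqr_ge0|rewrite ler_wpM2l// mulr_ge0 ?sqr_ge0].
  rewrite -(@ler_pXn2r _ 2)// ?nnegrE//; first by rewrite !mulr_ge0.
  by rewrite addr_ge0// mulr_ge0// mulr_ge0 ?sqr_ge0// ltW.
rewrite (int_lin II)// (intZ II)//.
have kI : 0 < k * I f1 by exact: mulr_gt0.
have -> : 2 * l * I f = 2 * (I f ^+ 2 / (k * I f1)) by rewrite lE; ring.
have -> : l ^+ 2 * k * I f1 = I f ^+ 2 / (k * I f1).
  by rewrite lE; field; rewrite !gt_eqF.
move=> H; have : I f ^+ 2 / (k * I f1) <= I f2 by lra.
by rewrite ler_pdivrMr// [I f2 * _]mulrC -mulrA.
Qed.

End midpoint.

Lemma frobE {R : realType} m n (A : 'M[R]_(m, n)) : frob A = \sum_i sqn (row i A).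
Proof. by apply: eq_bigr => i _; apply: eq_bigr => j _; rewrite mxE. Qed.

Lemma sqn_row {R : realType} m n (A : 'M[R]_(m, n)) i : sqn (row i A) <= frob A.
Proof.
rewrite frobE (bigD1 i)//= lerDl; apply: sumr_ge0 => j _; exact: sqn_ge0.
Qed.

(** * Bounds on fiber integrals *)

Section fiber_bounds.
Context {R : realType} (n D q : nat).
Variables (p th h : 'I_n -> R -> R) (Ch : R).
Hypothesis p_gt0 : forall k t, 0 < p k t.
Hypothesis p_gb : forall k, gb1 (p k).
Hypothesis p_dv : forall k t, dv (p k) t (- (th k t * p k t)).
Hypothesis th_dv : forall k t, dv (th k) t (h k t).
Hypothesis h_cont : forall k, continuous (h k).
Hypothesis h_bound : forall k t, `|h k t| <= Ch.
Variables (E : 'M[R]_(n, D)) (B : 'M[R]_(q, n)) (B' : 'M[R]_(n, q)).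
Hypothesis BE : B *m E = 0.
Hypothesis BB' : B *m B' = 1%:M.
Hypothesis kerE : forall u : 'rV[R]_n, u *m E = 0 -> u *m B' *m B = u.
Variables (cls : 'I_n -> nat) (A : nat -> 'M[R]_(D, n)) (nc : nat) (C1 : R).
(* The sites are divided into classes, each of which alone realises all moments:
   [A r] is a right inverse of [E] supported on the class [r]. *)
Hypothesis AE : forall r, (r < nc)%N -> A r *m E = 1%:M.
Hypothesis A_cls : forall r i k, A r i k != 0 -> cls k = r.
Hypothesis A_frob : forall r, (r < nc)%N -> frob (A r) <= C1.
Hypothesis C1_ge0 : 0 <= C1.
Hypothesis Ch_ge0 : 0 <= Ch.

Let JD := isInt_J (R := R) D.
Let Jq := isInt_J (R := R) q.
Let Jn := isInt_J (R := R) n.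
Local Notation Phi := (Phi th).
Local Notation rho := (rho th).

(* The integral over the fiber [{x | x *m E = y *m E}], up to a constant factor. *)
Definition fib (y : 'rV[R]_n) (f : 'rV[R]_n -> R) : R := J (fun w : 'rV_q => f (y + w *m B)).

Definition supp (a : 'rV[R]_n) r := forall k, a 0 k != 0 -> cls k = r.

Fixpoint csup (l : seq 'rV[R]_n) (rs : seq nat) : Prop :=
  match l, rs with
  | [::], [::] => True
  | a :: l', r :: rs' => supp a r /\ csup l' rs'
  | _, _ => False
  end.

Lemma supp_mulA u r : supp (u *m A r) r.
Proof.
move=> k; rewrite mxE; apply: contraNeq => ck; rewrite big1// => i _.
by rewrite (_ : A r i k = 0) ?mulr0//; apply/eqP; apply: contraNT ck => /A_cls ->.
Qed.

Lemma disj_supp a b r r' : supp a r -> supp b r' -> r != r' -> disj a b.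
Proof.
move=> ar br rr' k; have [->|/ar ak] := eqVneq (a 0 k) 0; first by rewrite mul0r.
have [->|/br bk] := eqVneq (b 0 k) 0; first by rewrite mulr0.
by rewrite -ak -bk eqxx in rr'.
Qed.

Lemma csup_mem l rs a : csup l rs -> a \in l -> exists2 r, r \in rs & supp a r.
Proof.
elim: l rs => // b l IH [//|r rs] /= [br lrs].
rewrite inE => /predU1P[->|/(IH _ lrs)[r' r'rs ar']].
  by exists r; rewrite ?mem_head.
by exists r'; rewrite // inE r'rs orbT.
Qed.

Lemma csup_pdisj l rs : csup l rs -> uniq rs -> pdisj l.
Proof.
elim: l rs => // a l IH [//|r rs] /= [ar lrs] /andP[rrs urs]; split; last exact: IH lrs urs.
move=> b bl; have [r' r'rs br'] := csup_mem lrs bl.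
by apply: disj_supp br' ar _; apply: contraNneq rrs => <-.
Qed.

Section reference_lift.
Variable c : nat -> nat.
Hypothesis c_lt : forall i, (i < D)%N -> (c i < nc)%N.

(** The lift of the [i]-th moment into the class [c i]: a separate class per moment makes the [D]
    directions disjoint. It is zero for [i >= D], so lists of directions can be built by recursion
    over [nat]. *)
Definition bvec (i : nat) : 'rV[R]_n := (\row_(j < D) ((j : nat) == i)%:R) *m A (c i).

Definition Bm : 'M[R]_(D, n) := \matrix_(i < D) bvec i.

Fixpoint blist l s := if s is s'.+1 then bvec s' :: blist l s' else l.

Definition crefs s := rev [seq c i | i <- iota 0 s].

Lemma crefsS s : crefs s.+1 = c s :: crefs s.
Proof. by rewrite /crefs -addn1 iotaD map_cat rev_cat. Qed.

Lemma crefs_cat s m : (s <= m)%N -> exists l, crefs m = l ++ crefs s.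
Proof.
elim: m => [|m IH]; first by rewrite leqn0 => /eqP ->; exists [::].
rewrite leq_eqVlt => /predU1P[->|/IH[l ml]]; first by exists [::].
by exists (c m :: l); rewrite crefsS ml.
Qed.

Lemma bvec_delta (i : 'I_D) : bvec i = row i (A (c i)).
Proof.
rewrite rowE /bvec; congr (_ *m _); apply/rowP => j; rewrite !mxE eqxx /=.
by rewrite -val_eqE.
Qed.

Lemma BmE : Bm *m E = 1%:M.
Proof.
apply/row_matrixP => i; rewrite row_mul rowK bvec_delta -row_mul AE//; exact: c_lt.
Qed.

Lemma Bm_row (i : 'I_D) : row i Bm = bvec i.
Proof. by rewrite rowK. Qed.

Lemma bvec_sqn i : (i < D)%N -> sqn (bvec i) <= C1.
Proof.
move=> iD; rewrite (_ : i = Ordinal iD)// bvec_delta.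
by apply: le_trans (A_frob (c_lt iD)); exact: sqn_row.
Qed.

Lemma Bm_frob : frob Bm <= D%:R * C1.
Proof.
rewrite frobE mulr_natl -[X in C1 *+ X]card_ord -sumr_const; apply: ler_sum => i _.
by rewrite Bm_row bvec_sqn.
Qed.

Lemma csup_blist l rs s : csup l rs -> csup (blist l s) (crefs s ++ rs).
Proof.
move=> lrs; elim: s => // s IH; rewrite crefsS /=; split=> //.
exact: supp_mulA.
Qed.

Lemma size_blist l s : size (blist l s) = (s + size l)%N.
Proof. by elim: s => //= s ->. Qed.

Lemma blist_sqn l s : (s <= D)%N -> (forall a, a \in l -> sqn a <= C1) ->
  forall a, a \in blist l s -> sqn a <= C1.
Proof.
move=> sD lC; elim: s sD => // s IH sD a; rewrite inE => /predU1P[->|].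
  exact: bvec_sqn.
exact: IH (ltnW sD) _.
Qed.

(** Coordinates on the sites: moments through the lift [Bm], then the fiber through [B]. The second
    block of [stk'] removes the lifted moments of a vector before reading off its fiber
    coordinates. *)
Let stk : 'M[R]_(D + q, n) := col_mx Bm B.
Let stk' : 'M[R]_(n, D + q) := row_mx E (B' - E *m Bm *m B').

Let stkK : stk *m stk' = 1%:M.
Proof.
rewrite mul_col_row BmE BE !mulmxBr -!mulmxA !(mulmxA _ E) BmE BE mul1mx mul0mx.
by rewrite subrr BB' subr0 -scalar_mx_block.
Qed.

Let stk'K : stk' *m stk = 1%:M.
Proof.
rewrite mul_row_col; apply/row_matrixP => i.
rewrite rowE [RHS]rowE mulmx1; set e := delta_mx _ _.
have ek : (e - e *m E *m Bm) *m E = 0 by rewrite mulmxBl -!mulmxA BmE mulmx1 subrr.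
rewrite mulmxDr (_ : e *m ((B' - E *m Bm *m B') *m B) = (e - e *m E *m Bm) *m B' *m B).
  by rewrite (kerE ek) mulmxA addrC subrK.
by rewrite !(mulmxBl, mulmxBr) !mulmxA.
Qed.

(** The Jacobian between the coordinates [stk] and those of the sites, read off from the unit
    Gaussian as in [isInt_uniq]. Its value is never computed; [cb_le] eliminates it. *)
Definition cb : R := J (fun t : 'rV_D => fib (t *m Bm) (gauss 1)) / J (gauss 1 : 'rV[R]_n -> R).

Let I0 := fun f : 'rV[R]_n -> R =>
  J (fun t : 'rV[R]_D => J (fun w : 'rV[R]_q => f (row_mx t w *m stk))).

Let isInt_I0 : isInt I0.
Proof. exact: isInt_mulmx stkK stk'K (isInt_comp JD Jq). Qed.

Lemma cb_gt0 : 0 < cb.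
Proof.
rewrite divr_gt0 ?(int_gauss Jn)//; have := int_gauss isInt_I0 ltr01.
by rewrite /I0 /fib; under eq_fun do under eq_fun do rewrite mul_row_col.
Qed.

Lemma fib_total f y : gb f -> J (fun t : 'rV_D => fib (y + t *m Bm) f) = cb * J f.
Proof.
move=> gf; rewrite -(int_tr Jn y gf).
have := isInt_uniq isInt_I0 (gb_shift y gf); rewrite /I0 /cb /fib.
under eq_fun do under eq_fun do rewrite mul_row_col addrC addrA.
under [in X in _ = X / _ * _ -> _]eq_fun do under eq_fun do rewrite mul_row_col.
by move=> ->.
Qed.

Lemma fib_gb2 f y : gb f -> gb2 (fun t w => f (y + t *m Bm + w *m B)).
Proof.
move=> gf; have := gb_gb2 (gb_affine y stkK gf).
by under eq_fun do under eq_fun do rewrite mul_row_col addrA.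
Qed.

Lemma fib_gb f y : gb f -> gb (fun t => fib (y + t *m Bm) f).
Proof. by move=> gf; exact: (gb_int2 Jq (fib_gb2 y gf)). Qed.

(** [norm_le_J] applied to the fiber integral as a function of the moments: a derivative along
    [bvec s] puts the score of [bvec s] into the integrand, [fib_total] collects the fibers, and
    [J_Phi_norm] bounds the result. Outside the classes in use the factors [phi k] may be any
    functions in [gb1], also of changing sign, as the antiderivatives in [fib_site1] and [fib_site2]
    are. *)
Lemma fib_sup phi l rs y : (forall k, gb1 (phi k)) -> csup l rs ->
  uniq (crefs D ++ rs) -> (forall k, cls k \in crefs D ++ rs -> phi k = p k) ->
  (forall a, a \in l -> sqn a <= C1) ->
  `|fib y (Phi phi l)| <=
    cb * ((1 + (Ch * C1) ^+ (D + size l)) * J (Pi (fun k t => `|phi k t|))).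
Proof.
move=> gphi lrs urs hphi lC.
have gP l' : gb (Phi phi l') by exact: (gb_Phi th_dv h_bound).
pose G s (t : 'rV[R]_D) := fib (y + t *m Bm) (Phi phi (blist l s)).
have := @norm_le_J R D G (fun s => fib_gb y (gP _)).
have -> : G 0%N 0 = fib y (Phi phi l) by rewrite /G mul0mx addr0.
move=> H; apply: le_trans (H _) _; last first.
  have gn : gb (fun x => `|Phi phi (blist l D) x|) by apply: gb_norm; exact: gP.
  apply: (@le_trans _ _ (J (fun t => fib (y + t *m Bm) (fun x => `|Phi phi (blist l D) x|)))).
    apply: (int_mono JD) => [||t]; [by apply: gb_norm; exact: fib_gb|exact: fib_gb|].
    by apply: (int_norm Jq); exact: gb2_slice (fib_gb2 y (gP _)).
  rewrite fib_total// ler_wpM2l ?(ltW cb_gt0)//.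
  rewrite -(size_blist l D).
  have absE x : `|Phi phi (blist l D) x| = `|Phi (fun k t => `|phi k t|) (blist l D) x|.
    rewrite /Phi !normrM; congr (_ * _); rewrite /Pi !normr_prod.
    by apply: eq_bigr => k _; rewrite normr_id.
  under eq_fun do rewrite absE.
  have cs := csup_blist D lrs.
  apply: (J_Phi_norm p_dv th_dv h_cont h_bound) => //.
  - move=> k; have [ck [C [c1 [c10 C0 H']]]] := gphi k; split.
      by move=> t; apply: continuous_comp; [exact: ck|exact: norm_continuous].
    by exists C, c1; split => // t; rewrite normr_id.
  - exact: mulr_ge0.
  - exact: csup_pdisj cs urs.
  - move=> a ab; split; first by rewrite ler_wpM2l// (blist_sqn _ lC ab).
    move=> k ak; have [r rr ar] := csup_mem cs ab.
    rewrite hphi ?(ar _ ak)//; apply/funext => t; rewrite ger0_norm//.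
    exact: ltW.
move=> s x; rewrite /G.
under eq_fun do rewrite mulmxDl -scalemxAl -rowE Bm_row addrA.
have [l1 l1E] := crefs_cat (ltn_ord s).
have urs' : uniq (c s :: crefs s ++ rs).
  by move: urs; rewrite l1E -catA cat_uniq crefsS => /and3P[].
have := @fib_dv R n q _ (Phi phi (blist l s)) (Phi phi (bvec s :: blist l s)) (bvec s)
  (y + x *m Bm) B B' 0 Jq BB' (gP _) (gP _).
rewrite scale0r addr0; apply => z; apply: (dv_Phi p_dv).
  move=> k bk; apply: hphi; rewrite (supp_mulA bk) l1E crefsS !mem_cat mem_head.
  by rewrite orbT.
move=> a ab; have cs := csup_blist s.+1 lrs; rewrite crefsS /= in cs.
by have [H1 _] := @csup_pdisj (bvec s :: blist l s) (c s :: (crefs s ++ rs)) cs urs'; exact: H1.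
Qed.

(** This is [eps ^+ 2 / (Kc * U)] in the notation of [fib_lower]: [eps * cb] is the density found by
    Chebyshev, [Kc] the loss of the midpoint inequality over the distance to that fiber, and
    [cb * U] the upper bound of [fib_sup]. *)
Definition low_const (CS : R) : R :=
  (4 * expR 1 * J (gauss (2 * CS + 1)^-1 : 'rV[R]_D -> R))^-1 ^+ 2 /
  (expR (Ch * (D%:R * C1 * (2 * CS + 1))) * (1 + (Ch * C1) ^+ D)).

Lemma Phi_nil phi : Phi phi [::] = Pi phi.
Proof. by apply/funext => x; rewrite /Phi big_nil mulr1. Qed.

Lemma Pi_midpoint x v :
  Pi p x ^+ 2 <= expR (Ch * sqn v) * (Pi p (x + v) * Pi p (x - v)).
Proof.
rewrite /Pi /sqn mulr_sumr expR_sum -!big_split /= -prodrXl; apply: ler_prod => k _.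
rewrite sqr_ge0 !mxE /=; exact: (score_midpoint (p_gt0 k) (p_dv k) (th_dv k) (h_bound k)).
Qed.

Lemma Pi_gt0 x : 0 < Pi p x.
Proof. by apply: prodr_gt0. Qed.

(* By Chebyshev some fiber at bounded distance carries mass of order [cb]; the
   midpoint inequality and the upper bound [fib_sup] transport this to the
   central fiber. *)
Lemma fib_lower m (CS : R) : uniq (crefs D) -> 0 <= CS -> J (Pi p) = 1 ->
  J (fun x => sqn ((x - m) *m E) * Pi p x) <= CS ->
  low_const CS * cb <= fib m (Pi p).
Proof.
move=> uc CS0 J1 JS; pose r := 2 * CS + 1; have r0 : 0 < r by rewrite ltr_wpDl// mulr_ge0.
have gP : gb (Pi p) by exact: gb_Pi.
have cb0 := cb_gt0.
pose g t := fib (m + t *m Bm) (Pi p); have gg : gb g by exact: fib_gb.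
have g0 t : 0 <= g t.
  apply: (int_ge0 Jq); first exact: gb2_slice (fib_gb2 m gP).
  by move=> w; exact: ltW (Pi_gt0 _).
pose U := 1 + (Ch * C1) ^+ D.
have gU t : g t <= cb * U.
  have := @fib_sup p [::] [::] (m + t *m Bm) p_gb I _ (fun _ _ => erefl) _.
  rewrite cats0 Phi_nil addn0 => /(_ uc) H; apply: le_trans (ler_norm _) _.
  apply: le_trans (H _) _ => //.
  rewrite (_ : Pi (fun k t => `|p k t|) = Pi p) ?J1 ?mulr1//.
  by apply/funext => x; apply: eq_bigr => k _; rewrite ger0_norm// ltW.
have Jg : J g = cb by rewrite /g fib_total// J1 mulr1.
have gS : gb (fun x => sqn ((x - m) *m E) * Pi p x).
  apply: gb_mul_sg => //; split.
    move=> u x ux; apply: scont_sqn; apply: vcvg_mulmx; apply: vcvgD => //.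
    exact: vcvg_cst.
  move=> e e0; pose e1 := e / (2 * (frob E + 1)).
  have f1 : 0 < frob E + 1 by rewrite ltr_wpDl// frob_ge0.
  have e10 : 0 < e1 by rewrite divr_gt0// mulr_gt0.
  exists (e1^-1 * expR (e * sqn m)).
    by rewrite mulr_ge0 ?expR_ge0// invr_ge0 ltW.
  move=> x; rewrite ger0_norm ?sqn_ge0// -mulrA -expRD mulrC ler_pdivlMr// mulrC.
  apply: (@le_trans _ _ (expR (e1 * sqn ((x - m) *m E)))).
    by apply: le_trans (expR_ge1Dx _); rewrite lerDr.
  rewrite ler_expR; apply: (@le_trans _ _ (e1 * ((frob E + 1) * (2 * sqn x + 2 * sqn m)))).
    rewrite ler_wpM2l ?(ltW e10)//; apply: le_trans (sqn_mulmx _ _) _.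
    apply: ler_pM; rewrite ?frob_ge0 ?sqn_ge0// ?lerDl//.
    by apply: le_trans (sqnD_le _ _) _; rewrite sqnN.
  rewrite /e1 -mulrDr le_eqVlt; apply/orP; left; apply/eqP.
  by field; rewrite gt_eqF.
have JSg : J (fun t => sqn t * g t) <= cb * CS.
  apply: le_trans (ler_wpM2l (ltW cb0) JS); rewrite -(fib_total m gS).
  rewrite le_eqVlt; apply/orP; left; apply/eqP; congr J; apply/funext => t.
  rewrite /g /fib -(intZ Jq); last exact: gb2_slice (fib_gb2 m gP).
  congr J; apply/funext => w; congr (sqn _ * _).
  rewrite [m + _ + _ - m]addrC !addrA addNr add0r.
  by rewrite mulmxDl -!mulmxA BE mulmx0 addr0 BmE mulmx1.
have gSg : gb (fun t => sqn t * g t) by apply: gb_mul_sg => //; exact: sg_sqn.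
pose Jr := J (gauss r^-1 : 'rV[R]_D -> R).
have Jr0 : 0 < Jr by rewrite (int_gauss JD)// invr_gt0.
pose eps := (4 * expR 1 * Jr)^-1.
have eps0 : 0 < eps by rewrite invr_gt0 !mulr_gt0// expR_gt0.
(* If every fiber with [sqn t <= r] were below [eps * cb], the mass near the center would be at most
   [cb / 4], while Chebyshev leaves at least [cb / 2]. The continuous weight [1 - r^-1 * sqn t]
   replaces the indicator of the ball, and a multiple of [gauss r^-1] bounds the weighted function
   from above. *)
have [t1 t1r g1] : exists2 t1, sqn t1 <= r & eps * cb <= g t1.
  apply: contrapT => H.
  have Hlt t : sqn t <= r -> g t < eps * cb.
    by move=> tr; rewrite ltNge; apply/negP => gt; apply: H; exists t.
  pose f t := - r^-1 * (sqn t * g t) + g t.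
  have gf : gb f by apply: gb_lin.
  have h1 : cb / 2 <= J f.
    rewrite /f (int_lin JD)// Jg mulNr.
    have : r^-1 * J (fun t => sqn t * g t) <= r^-1 * (cb * CS).
      by rewrite ler_wpM2l// invr_ge0 ltW.
    suff : r^-1 * (cb * CS) <= cb / 2 by lra.
    by rewrite mulrC -mulrA ler_wpM2l ?(ltW cb0)// ler_pdivrMr// /r; lra.
  have h2 : J f <= J (fun t : 'rV_D => eps * cb * expR 1 * gauss r^-1 t).
    apply: (int_mono JD) => //; first by apply: gbZ; apply: gauss_gb; rewrite invr_gt0.
    move=> t; rewrite /f.
    have -> : - r^-1 * (sqn t * g t) + g t = (1 - r^-1 * sqn t) * g t by ring.
    have [tr|tr] := leP (sqn t) r.
      apply: (@le_trans _ _ (1 * (eps * cb))).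
        apply: ler_pM => //.
        - by rewrite subr_ge0 mulrC ler_pdivrMr ?mul1r.
        - by rewrite lerBlDr lerDl mulr_ge0 ?sqn_ge0// invr_ge0 ltW.
        - exact: ltW (Hlt t tr).
      have ec0 : 0 <= eps * cb := ltW (mulr_gt0 eps0 cb0).
      have h2 : 1 <= expR 1 * gauss r^-1 t.
        by rewrite -expRD -[leLHS]expR0 ler_expR subr_ge0 mulrC ler_pdivrMr ?mul1r.
      by rewrite mul1r -mulrA; exact: ler_peMr.
    apply: (@le_trans _ _ 0).
      by rewrite mulr_le0_ge0// subr_le0 mulrC ler_pdivlMr ?mul1r// ltW.
    by rewrite mulr_ge0 ?gauss_ge0// mulr_ge0 ?expR_ge0// ltW// mulr_gt0.
  rewrite (intZ JD) in h2; last by apply: gauss_gb; rewrite invr_gt0.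
  have : eps * cb * expR 1 * Jr = cb / 4.
    by rewrite /eps; field; rewrite !gt_eqF// expR_gt0.
  rewrite -/Jr in h2 => e4; rewrite e4 in h2; have := le_trans h1 h2; lra.
have fm : fib m (Pi p) = g 0 by rewrite /g mul0mx addr0.
pose Kc := expR (Ch * (D%:R * C1 * r)).
(* The fiber at [t1] lies midway between the one at [t1 + t1], which [fib_sup] bounds from above,
   and the central one. *)
have mid : g t1 ^+ 2 <= Kc * (g (t1 + t1) * g 0).
  pose v := t1 *m Bm.
  apply: (@le_trans _ _ (expR (Ch * sqn v) * (g (t1 + t1) * g 0))); last first.
    rewrite ler_wpM2r ?mulr_ge0// ler_expR ler_wpM2l//.
    apply: le_trans (sqn_mulmx _ _) _; apply: ler_pM; rewrite ?frob_ge0 ?sqn_ge0//.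
    exact: Bm_frob.
  have gs t := gb2_slice t (fib_gb2 m gP).
  apply: (int_midpoint Jq) => //; try exact: gs.
  - exact: expR_gt0.
  - by move=> w; exact: ltW (Pi_gt0 _).
  - by move=> w; exact: ltW (Pi_gt0 _).
  - by move=> w; exact: ltW (Pi_gt0 _).
  - by apply: J_gt0 => [|w]; [exact: gs|exact: Pi_gt0].
  - move=> w; have := Pi_midpoint (m + t1 *m Bm + w *m B) v.
    congr (_ <= _ * (Pi p _ * Pi p _)).
      by rewrite mulmxDl /v; rewrite [LHS]addrAC !addrA.
    by rewrite mul0mx addr0 /v addrAC addrK.
have U0 : 0 < U by rewrite ltr_pwDl// exprn_ge0// mulr_ge0.
rewrite fm /low_const -/r -/Jr -/eps -/Kc -/U.
have : (eps * cb) ^+ 2 <= Kc * (cb * U * g 0).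
  apply: (@le_trans _ _ (g t1 ^+ 2)).
    by rewrite lerXn2r ?nnegrE// mulr_ge0 ?ltW.
  by apply: le_trans mid _; rewrite ler_wpM2l ?expR_ge0// ler_wpM2r.
rewrite exprMn => H; rewrite mulrAC ler_pdivrMr ?mulr_gt0 ?expR_gt0//.
rewrite -(ler_pM2r cb0); move: H; rewrite expr2; congr (_ <= _); ring.
Qed.

End reference_lift.

Lemma Pi_upd (phi : 'I_n -> R -> R) (j : 'I_n) f (x : 'rV[R]_n) :
  Pi (upd phi j f) x = f (x 0 j) * \prod_(k | k != j) phi k (x 0 k).
Proof.
rewrite /Pi (bigD1 j)//= /upd eqxx; congr (_ * _); apply: eq_bigr => k kj.
by rewrite (negbTE kj).
Qed.

Lemma PhiZ phi (k : R) a l x : Phi phi (k *: a :: l) x = k * Phi phi (a :: l) x.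
Proof. by rewrite /Phi !big_cons rhoZ; ring. Qed.

Lemma fib_gbw f y : gb f -> gb (fun w : 'rV_q => f (y + w *m B)).
Proof. by move=> gf; exact: gb_affine BB' gf. Qed.

(* Moving the site [j] and compensating in a disjoint class of sites stays in the fiber. *)
Lemma fib_IBP y phi l j r (b b' : R -> R) : (forall k, gb1 (phi k)) ->
  gb1 b -> gb1 b' -> (forall t, dv b t (b' t)) -> (r < nc)%N -> cls j != r ->
  (forall k, cls k = r -> phi k = p k) ->
  (forall a, a \in l -> disj a (row j E *m A r)) -> (forall a, a \in l -> a 0 j = 0) ->
  fib y (Phi (upd phi j b') l) = fib y (Phi (upd phi j b) (row j E *m A r :: l)).
Proof.
move=> gphi gb_ gb_' db rn jr hphi ld lj; set e := row j E *m A r.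
have ej : e 0 j = 0.
  by apply/eqP; apply: contraNT jr => /supp_mulA ->.
have gu f : gb1 f -> forall k, gb1 (upd phi j f k).
  by move=> gf k; rewrite /upd; case: eqP.
have g1 : gb (Phi (upd phi j b) l) by apply: (gb_Phi th_dv h_bound); exact: gu.
have g2 : gb (Phi (upd phi j b') l) by apply: (gb_Phi th_dv h_bound); exact: gu.
have g3 : gb (Phi (upd phi j b) (e :: l)) by apply: (gb_Phi th_dv h_bound); exact: gu.
pose tau : 'rV[R]_n := delta_mx 0 j - e.
have tauk k : tau 0 k = (k == j)%:R - e 0 k.
  by rewrite /tau mxE [delta_mx _ _ _ _]mxE [(- e) _ _]mxE eqxx.
have tauE : tau *m E = 0 by rewrite mulmxBl -rowE -mulmxA AE// mulmx1 subrr.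
pose eta := tau *m B'; have tauB : eta *m B = tau by exact: kerE.
have Hd x : dv (fun s => Phi (upd phi j b) l (x + s *: tau)) 0
    (Phi (upd phi j b') l x - Phi (upd phi j b) (e :: l) x).
  have rl s : \prod_(a <- l) rho a (x + s *: tau) = \prod_(a <- l) rho a x.
    apply: prod_rho_disj => a al k; rewrite tauk mulrBr.
    rewrite (ld a al k) subr0; have [->|_] := eqVneq k j; last by rewrite mulr0.
    by rewrite (lj a al) mul0r.
  rewrite /Phi; under eq_fun do rewrite rl Pi_upd.
  have d1 : dv (fun s => b ((x + s *: tau) 0 j)) 0 (b' (x 0 j)).
    have := dv_comp (db _) (dv_coord x tau j 0).
    by rewrite scale0r addr0 tauk eqxx ej subr0 mulr1.
  have d2 : dv (fun s => \prod_(k | k != j) phi k ((x + s *: tau) 0 k)) 0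
      ((\sum_(k | k != j) e 0 k * th k (x 0 k)) * \prod_(k | k != j) phi k (x 0 k)).
    have := @dv_prod_log R _ (index_enum _) (fun k => k != j)
      (fun k s => phi k ((x + s *: tau) 0 k)) (fun k => e 0 k * th k (x 0 k)) 0.
    rewrite scale0r addr0; apply => k kj.
    have tk : tau 0 k = - e 0 k by rewrite tauk (negbTE kj) sub0r.
    have [ek|ek] := eqVneq (e 0 k) 0.
      rewrite ek !mul0r; under eq_fun do rewrite mxE [(_ *: tau) _ _]mxE tk ek oppr0 mulr0 addr0.
      exact: dv_cst.
    rewrite hphi; last exact: supp_mulA ek.
    have := dv_comp (p_dv k _) (dv_coord x tau k 0); rewrite scale0r addr0 tk.
    by move=> H; apply: (dv_eq H); ring.
  apply: (dv_eq (dvM (dvM d1 d2) (dv_cst _ _))).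
  have eE : rho e x = - \sum_(k | k != j) e 0 k * th k (x 0 k).
    by rewrite /rho (bigD1 j)//= ej mul0r add0r.
  rewrite !Pi_upd big_cons eE scale0r addr0; ring.
have := @int_IBP_gb R q _ (fun w => Phi (upd phi j b) l (y + w *m B))
  (fun w => Phi (upd phi j b') l (y + w *m B) - Phi (upd phi j b) (e :: l) (y + w *m B)) eta Jq
  (fib_gbw y g1).
rewrite (intB Jq); [|exact: fib_gbw|exact: fib_gbw] => H.
apply/eqP; rewrite -subr_eq0; apply/eqP; apply: H.
  by apply: gbD; [exact: fib_gbw|apply: gbN; exact: fib_gbw].
move=> w; have := Hd (y + w *m B).
by under [X in _ -> dv X _ _]eq_fun do rewrite mulmxDl -scalemxAl tauB addrA.
Qed.

Variables (kap : R).
Hypothesis kap_gt0 : 0 < kap.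
Hypothesis E_row : forall j, sqn (row j E) <= kap ^+ 2.

(** Normalised by [kap], so that its squared norm obeys the same bound [C1] as the reference lifts.
    The factor [kap] taken out is the gain of one integration by parts ([fib_IBP1]). *)
Definition evec j r : 'rV[R]_n := (kap^-1 *: row j E) *m A r.

Lemma evec_sqn j r : (r < nc)%N -> sqn (evec j r) <= C1.
Proof.
move=> rn; apply: le_trans (sqn_mulmx _ _) _; rewrite -[leRHS]mulr1.
apply: ler_pM; rewrite ?frob_ge0 ?sqn_ge0//; first exact: A_frob.
by rewrite sqnZ exprVn mulrC ler_pdivrMr ?exprn_gt0// mul1r.
Qed.

Lemma evecE j r : row j E *m A r = kap *: evec j r.
Proof. by rewrite /evec scalemxAl scalerA divff ?scale1r// gt_eqF. Qed.

Lemma fib_IBP1 y phi l rs j r (b b' : R -> R) : (forall k, gb1 (phi k)) ->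
  gb1 b -> gb1 b' -> (forall t, dv b t (b' t)) -> (r < nc)%N ->
  csup l rs -> r \notin cls j :: rs -> cls j \notin rs ->
  (forall k, cls k = r -> phi k = p k) ->
  fib y (Phi (upd phi j b') l) = kap * fib y (Phi (upd phi j b) (evec j r :: l)).
Proof.
move=> gphi gb_ gb_' db rn lrs; rewrite inE negb_or => /andP[rj rrs] jrs hphi.
rewrite (fib_IBP y gphi gb_ gb_' db rn _ hphi) 1?eq_sym//.
- rewrite -(intZ Jq); last first.
    apply: fib_gbw; apply: (gb_Phi th_dv h_bound) => k.
    by rewrite /upd; case: eqP.
  by congr J; apply/funext => w; rewrite evecE PhiZ.
- move=> a al; have [r' r'rs ar'] := csup_mem lrs al.
  by apply: disj_supp ar' (@supp_mulA _ _) _; apply: contraNneq rrs => <-.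
- move=> a al; have [r' r'rs ar'] := csup_mem lrs al.
  by apply/eqP; apply: contraNT jrs => /ar' ->.
Qed.

(** The number [D + 6] of classes: [D] for the reference lift, four for the integrations by parts of
    [fib_site2], and the two classes [r1], [r2] of the sites being moved, which must be avoided. *)
Lemma choose_classes r1 r2 : nc = (D + 6)%N ->
  exists c : nat -> nat, (forall i, (i < D + 4)%N -> [/\ (c i < nc)%N, c i != r1 & c i != r2]) /\
    uniq (crefs c D ++ [:: c D.+3; c D.+2; c D.+1; c D]).
Proof.
move=> ncE; pose s := [seq r <- iota 0 nc | (r != r1) && (r != r2)].
have us : uniq s by rewrite filter_uniq ?iota_uniq.
have szs : (D + 4 <= size s)%N.
  rewrite size_filter -(leq_add2r (count (predC (fun r => (r != r1) && (r != r2))) (iota 0 nc))).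
  rewrite count_predC size_iota ncE -[6%N]/(4 + 2)%N addnA leq_add2l.
  rewrite (@eq_count _ _ (predU (pred1 r1) (pred1 r2))); last first.
    by move=> x /=; rewrite negb_and !negbK.
  apply: (@leq_trans (count (pred1 r1) (iota 0 (D + 4 + 2)) + count (pred1 r2) (iota 0 (D + 4 + 2)))).
    by rewrite -count_predUI leq_addr.
  by rewrite !count_uniq_mem ?iota_uniq//; case: (_ \in _); case: (_ \in _).
exists (nth 0%N s); split.
  move=> i iD; have : nth 0%N s i \in s by apply: mem_nth; exact: leq_trans szs.
  by rewrite mem_filter mem_iota add0n => /andP[/andP[-> ->]].
have e : [seq nth 0%N s i | i <- iota 0 (D + 4)] = take (D + 4) s.
  by rewrite map_nth_iota0.
rewrite -(@perm_uniq _ (take (D + 4) s)) ?take_uniq// -e iotaD map_cat.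
by apply: perm_cat; [rewrite perm_sym perm_rev|rewrite add0n perm_sym -perm_rev].
Qed.

Lemma ltn_addl4 k : (k < k + 4)%N. Proof. by rewrite -[X in (X < _)%N]addn0 ltn_add2l. Qed.

Hypothesis ncE : nc = (D + 6)%N.
Hypothesis p_int : forall k, Int (p k) = 1.

Lemma upd_gb1 (phi : 'I_n -> R -> R) (j : 'I_n) (f : R -> R) : (forall k, gb1 (phi k)) -> gb1 f -> forall k, gb1 (upd phi j f k).
Proof. by move=> gphi gf k; rewrite /upd; case: eqP. Qed.

Lemma gb1_norm (f : R -> R) : gb1 f -> gb1 (fun t => `|f t|).
Proof.
move=> [cf [C [c [c0 C0 H]]]]; split.
  by move=> t; apply: continuous_comp; [exact: cf|exact: norm_continuous].
by exists C, c; split => // t; rewrite normr_id.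
Qed.

Lemma Int_norm_ge0 (f : R -> R) : 0 <= Int (fun t => `|f t|).
Proof. by apply: Rintegral_ge0 => t _; exact: normr_ge0. Qed.

Lemma Int_norm_p k : Int (fun t => `|p k t|) = 1.
Proof.
by rewrite -(p_int k); congr Int; apply/funext => t; rewrite ger0_norm// ltW.
Qed.

Lemma J_upd1 (j : 'I_n) (f : R -> R) : gb1 f ->
  J (Pi (fun k t => `|upd p j f k t|)) = Int (fun t => `|f t|).
Proof.
move=> gf; rewrite J_prod => [|k]; last by apply: gb1_norm; exact: upd_gb1.
rewrite (bigD1 j)//= /upd eqxx big1 ?mulr1// => k kj.
by rewrite (negbTE kj) Int_norm_p.
Qed.

Lemma J_upd2 (i j : 'I_n) (f g : R -> R) : i != j -> gb1 f -> gb1 g ->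
  J (Pi (fun k t => `|upd (upd p i f) j g k t|)) = Int (fun t => `|f t|) * Int (fun t => `|g t|).
Proof.
move=> ij gf gg; rewrite J_prod => [|k]; last by apply: gb1_norm; do 2 apply: upd_gb1 => //.
rewrite (bigD1 j)//= (bigD1 i)//= /upd !eqxx (negbTE ij) big1 ?mulr1 1?mulrC// => k /andP[kj ki].
by rewrite (negbTE kj) (negbTE ki) Int_norm_p.
Qed.

Variables (m : 'rV[R]_n) (CS : R).
Hypothesis CS_ge0 : 0 <= CS.
Hypothesis m_var : J (fun x => sqn ((x - m) *m E) * Pi p x) <= CS.

(** The factor of [fib_sup] for a list of [s] further directions. *)
Definition Ufac (s : nat) : R := 1 + (Ch * C1) ^+ (D + s).

Lemma Ufac_gt0 s : 0 < Ufac s.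
Proof. by rewrite ltr_pwDl// exprn_ge0// mulr_ge0. Qed.

Lemma low_const_gt0 : 0 < low_const CS.
Proof.
have r0 : 0 < 2 * CS + 1 by rewrite ltr_wpDl// mulr_ge0.
rewrite divr_gt0 ?exprn_gt0 ?invr_gt0 ?mulr_gt0 ?expR_gt0 ?(int_gauss JD) ?invr_gt0//.
by have := Ufac_gt0 0; rewrite /Ufac addn0.
Qed.

(** Every bound of [fib_sup] carries the factor [cb]; this makes it relative to the central fiber,
    with a constant free of [n]. *)
Lemma cb_le c : (forall i, (i < D)%N -> (c i < nc)%N) -> uniq (crefs c D) ->
  cb c <= fib m (Pi p) / low_const CS.
Proof.
move=> cl uc; rewrite ler_pdivlMr ?low_const_gt0// mulrC.
apply: fib_lower => //; rewrite J_prod//.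
by rewrite big1.
Qed.

Lemma cb_mul c (U X : R) : (forall i, (i < D)%N -> (c i < nc)%N) -> uniq (crefs c D) ->
  0 <= U -> 0 <= X -> cb c * (U * X) <= U / low_const CS * X * fib m (Pi p).
Proof.
move=> cl uc U0 X0; rewrite mulrC (_ : U / _ * _ * _ = U * X * (fib m (Pi p) / low_const CS)); last ring.
by rewrite ler_wpM2l ?mulr_ge0//; exact: cb_le.
Qed.

Lemma fib_site1 j (b b' : R -> R) : gb1 b -> gb1 b' -> (forall t, dv b t (b' t)) ->
  `|fib m (Pi (upd p j b'))| <=
    kap * (Ufac 1 / low_const CS * Int (fun t => `|b t|)) * fib m (Pi p).
Proof.
move=> gb_ gb_' db; have [c [Hc uc]] := choose_classes (cls j) (cls j) ncE.
have cl i : (i < D)%N -> (c i < nc)%N by move=> iD; have [] := Hc i (ltn_addr _ iD).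
have [rn rj _] := Hc D (ltn_addl4 D).
rewrite -Phi_nil (@fib_IBP1 m p [::] [::] j (c D) b b')//; last by rewrite inE.
have [uc0 uc1] : uniq (crefs c D) /\ uniq (crefs c D ++ [:: c D]).
  by move: uc; rewrite !cat_uniq /= !orbF !negb_or => /and3P[-> /and4P[_ _ _ ->] _].
have H := @fib_sup c cl (upd p j b) [:: evec j (c D)] [:: c D] m (upd_gb1 j p_gb gb_).
rewrite normrM gtr0_norm// -[leRHS]mulrA ler_wpM2l ?(ltW kap_gt0)//.
apply: le_trans (H _ _ _ _) _.
- by split=> //; exact: supp_mulA.
- by [].
- move=> k; rewrite /upd; case: eqP => // ->; rewrite mem_cat inE => /orP[|/eqP jD].
    by rewrite mem_rev => /mapP[i]; rewrite mem_iota => iD jc; have [_] := Hc i (ltn_addr _ iD); rewrite jc eqxx.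
  by rewrite jD eqxx in rj.
- by move=> a; rewrite inE => /eqP ->; exact: evec_sqn.
rewrite J_upd1//=; apply: cb_mul => //; [exact: ltW (Ufac_gt0 1)|exact: Int_norm_ge0].
Qed.

Lemma updC (phi : 'I_n -> R -> R) (i j : 'I_n) (f g : R -> R) : i != j ->
  upd (upd phi i f) j g = upd (upd phi j g) i f.
Proof.
move=> ij; apply/funext => k; rewrite /upd.
by have [->|//] := eqVneq k j; rewrite eq_sym (negbTE ij).
Qed.

(** Two integrations by parts at each of the two sites, compensated in four further classes so that
    no score is ever differentiated; each of them contributes a factor [kap]. *)
Lemma fib_site2 i j (b b1 b2 f f1 f2 : R -> R) : i != j ->
  gb1 b -> gb1 b1 -> gb1 b2 -> gb1 f -> gb1 f1 -> gb1 f2 ->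
  (forall t, dv b t (b1 t)) -> (forall t, dv b1 t (b2 t)) ->
  (forall t, dv f t (f1 t)) -> (forall t, dv f1 t (f2 t)) ->
  `|fib m (Pi (upd (upd p i b2) j f2))| <=
    kap ^+ 4 * (Ufac 4 / low_const CS * (Int (fun t => `|b t|) * Int (fun t => `|f t|)))
    * fib m (Pi p).
Proof.
move=> ij gb0 gb1_ gb2_ gf0 gf1 gf2 db db1 df df1.
have [c [Hc uc]] := choose_classes (cls i) (cls j) ncE.
have cl k : (k < D)%N -> (c k < nc)%N by move=> kD; have [] := Hc k (ltn_addr _ kD).
have Hr k : (k < 4)%N -> [/\ (c (D + k) < nc)%N, c (D + k)%N != cls i & c (D + k)%N != cls j].
  by move=> k4; apply: Hc; rewrite ltn_add2l.
have := (Hr 0%N isT, Hr 1%N isT, Hr 2%N isT, Hr 3%N isT).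
rewrite addn0 addn1 addn2 addn3.
move=> [[[[r0 i0 j0] [r1 i1 j1]] [r2 i2 j2]] [r3 i3 j3]].
move: (uc); rewrite cat_uniq => /and3P[uc0 _ /=]; rewrite andbT => /and3P[].
rewrite !inE !negb_or => /and3P[n32 n31 n30] /andP[n21 n20] n10.
pose l2 := [:: evec j (c D.+1); evec j (c D)].
pose l4 := [:: evec i (c D.+3), evec i (c D.+2) & l2].
have hp k (g : R -> R) r k' : r != cls k -> cls k' = r -> upd p k g k' = p k'.
  by move=> rk kr; rewrite /upd; case: eqP => // kk; rewrite -kr kk eqxx in rk.
have e4 : fib m (Pi (upd (upd p i b2) j f2)) =
    kap ^+ 4 * fib m (Phi (upd (upd p i b) j f) l4).
  rewrite -Phi_nil.
  rewrite (@fib_IBP1 m (upd p i b2) [::] [::] j (c D) f1 f2) ?inE//; last first.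
  - by move=> k; exact: hp.
  - exact: upd_gb1.
  rewrite (@fib_IBP1 m (upd p i b2) [:: evec j (c D)] [:: c D] j (c D.+1) f f1) ?inE ?negb_or ?j1 ?n10//; last first.
  - by move=> k; exact: hp.
  - by rewrite eq_sym.
  - by split=> //; exact: supp_mulA.
  - exact: upd_gb1.
  rewrite updC//.
  rewrite (@fib_IBP1 m (upd p j f) l2 [:: c D.+1; c D] i (c D.+2) b1 b2) ?inE ?negb_or ?i2 ?n21 ?n20//; last first.
  - by move=> k; exact: hp.
  - by rewrite ![cls i == _]eq_sym i1 i0.
  - by split; [|split=> //]; exact: supp_mulA.
  - exact: upd_gb1.
  rewrite (@fib_IBP1 m (upd p j f) (evec i (c D.+2) :: l2) [:: c D.+2; c D.+1; c D] i (c D.+3) b b1) ?inE ?negb_or ?i3 ?n32 ?n31 ?n30//; last first.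
  - by move=> k; exact: hp.
  - by rewrite ![cls i == _]eq_sym i2 i1 i0.
  - by split; [|split; [|split=> //]]; exact: supp_mulA.
  - exact: upd_gb1.
  by rewrite [upd (upd p j f) i b]updC 1?eq_sym// /l4; ring.
rewrite e4 normrM ger0_norm ?exprn_ge0 ?(ltW kap_gt0)// -[leRHS]mulrA ler_wpM2l ?exprn_ge0 ?(ltW kap_gt0)//.
have gu k : gb1 (upd (upd p i b) j f k) by do 2 apply: upd_gb1 => //.
apply: le_trans (@fib_sup c cl _ l4 [:: c D.+3; c D.+2; c D.+1; c D] m gu _ uc _ _) _.
- by do 4 (split; [exact: supp_mulA|]).
- move=> k; rewrite mem_cat => kc; have [ki kj] : cls k != cls i /\ cls k != cls j.
    move: kc => /orP[|].
      rewrite mem_rev => /mapP[s]; rewrite mem_iota add0n => /andP[_ sD] ->.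
      by have [] := Hc s (ltn_addr _ sD).
    by rewrite !inE => /or4P[] /eqP ->.
  by rewrite /upd; case: eqP => [kk|_]; [rewrite kk eqxx in kj|case: eqP => // kk; rewrite kk eqxx in ki].
- by move=> a; rewrite !inE => /or4P[] /eqP ->; exact: evec_sqn.
rewrite J_upd2//=; apply: cb_mul => //; [exact: ltW (Ufac_gt0 4)|by rewrite mulr_ge0 ?Int_norm_ge0].
Qed.

Lemma Pi_updM (phi : 'I_n -> R -> R) (j : 'I_n) (f g : R -> R) (x : 'rV[R]_n) :
  (forall t, g t * phi j t = f t) -> Pi (upd phi j f) x = g (x 0 j) * Pi phi x.
Proof. by move=> fg; rewrite Pi_upd /Pi [in RHS](bigD1 j)//= mulrA fg. Qed.

(** [v k] stands for a one-site variance and [F k] for the corrected score. That [F k * p k] is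
    orthogonal to affine functions enters through the decay of its second antiderivative [ga k], and
    a mean-zero property through that of [be k]. *)
Variables (v : 'I_n -> R) (F be be1 ga ga1 ga2 : 'I_n -> R -> R) (cv Cb CE : R).
Hypothesis v_ge : forall k, cv <= v k.
Hypothesis FE : forall k t, F k t = v k * th k t - (t - m 0 k).
Hypothesis be_gb : forall k, gb1 (be k).
Hypothesis be1_gb : forall k, gb1 (be1 k).
Hypothesis ga_gb : forall k, gb1 (ga k).
Hypothesis ga1_gb : forall k, gb1 (ga1 k).
Hypothesis ga2_gb : forall k, gb1 (ga2 k).
Hypothesis be_dv : forall k t, dv (be k) t (be1 k t).
Hypothesis ga_dv : forall k t, dv (ga k) t (ga1 k t).
Hypothesis ga1_dv : forall k t, dv (ga1 k) t (ga2 k t).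
Hypothesis ga2E : forall k t, F k t * p k t = ga2 k t.
Hypothesis be1E : forall k t, (v k ^+ 2 * h k t - F k t ^+ 2 - v k) * p k t = be1 k t.
Hypothesis be_Int : forall k, Int (fun t => `|be k t|) <= Cb.
Hypothesis ga_Int : forall k, Int (fun t => `|ga k t|) <= Cb.
Hypothesis kapE : n%:R * kap ^+ 2 <= CE.

Definition xe (xi : 'rV[R]_D) k : R := \sum_d E k d * xi 0 d.

Lemma fiber_sum0 xi (w : 'rV[R]_q) : \sum_k xe xi k * (w *m B) 0 k = 0.
Proof.
have Z : (w *m B *m E *m xi^T) 0 0 = 0 by rewrite -(mulmxA w) BE mulmx0 mul0mx mxE.
rewrite -[RHS]Z mxE; under [RHS]eq_bigr => d _ do rewrite mxE [xi^T _ _]mxE mulr_suml.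
rewrite [RHS]exchange_big; apply: eq_bigr => k _; rewrite /xe mulr_suml.
by apply: eq_bigr => d _; ring.
Qed.

Lemma fib_sum (r : seq 'I_n) (P : pred 'I_n) (f : 'I_n -> 'rV[R]_n -> R) (c : 'I_n -> R) :
  (forall k, P k -> gb (f k)) ->
  fib m (fun x => \sum_(k <- r | P k) c k * f k x) = \sum_(k <- r | P k) c k * fib m (f k).
Proof.
move=> gf; rewrite /fib (int_sum Jq); last first.
  by move=> k Pk; apply: (@fib_gbw (fun x => c k * f k x)); apply: gbZ; exact: gf.
by apply: eq_bigr => k Pk; rewrite (intZ Jq)//; apply: fib_gbw; exact: gf.
Qed.

(** With the weights [v k], the score along [a] equals [- \sum_k xe xi k * F k] on the fiber, its
    linear part dropping out by [fiber_sum0]. The square is then split into diagonal terms, absorbed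
    in [be1], and pairs of distinct sites, each carrying the second derivative [ga2]. *)
Lemma hess_pointwise xi (w : 'rV[R]_q) (a := \row_k (v k * xe xi k)) (x := m + w *m B) :
  ((\sum_k a 0 k ^+ 2 * h k (x 0 k)) - rho a x ^+ 2) * Pi p x =
  \sum_k xe xi k ^+ 2 * (v k * Pi p x + Pi (upd p k (be1 k)) x)
  - \sum_i xe xi i * \sum_(j | j != i) xe xi j * Pi (upd (upd p i (ga2 i)) j (ga2 j)) x.
Proof.
have rE : rho a x = - \sum_k xe xi k * F k (x 0 k).
  rewrite /rho; congr (- _); rewrite -[RHS]addr0 -[X in _ = _ + X](fiber_sum0 xi w) -big_split /=.
  by apply: eq_bigr => k _; rewrite FE !mxE; ring.
have e1 : \sum_k xe xi k ^+ 2 * (v k * Pi p x + Pi (upd p k (be1 k)) x) =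
    (\sum_k (a 0 k ^+ 2 * h k (x 0 k) - xe xi k ^+ 2 * F k (x 0 k) ^+ 2)) * Pi p x.
  rewrite mulr_suml; apply: eq_bigr => k _.
  have -> : a 0 k = v k * xe xi k by rewrite mxE.
  rewrite (Pi_updM _ (be1E k)); ring.
have e2 : \sum_i xe xi i * \sum_(j | j != i) xe xi j * Pi (upd (upd p i (ga2 i)) j (ga2 j)) x =
   ((\sum_i xe xi i * F i (x 0 i)) ^+ 2 - \sum_i xe xi i ^+ 2 * F i (x 0 i) ^+ 2) * Pi p x.
  rewrite expr2 mulr_suml -sumrB mulr_suml; apply: eq_bigr => i _.
  rewrite [\sum_i _ * F i _](bigD1 i)//= mulrDr -expr2 exprMn addrAC subrr add0r.
  rewrite -!mulrA; congr (_ * _); rewrite mulrA [_ * Pi _ _]mulrC mulr_sumr mulr_sumr.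
  apply: eq_bigr => j ji.
  rewrite (@Pi_updM _ _ _ (F j)); last by move=> t; rewrite /upd (negbTE ji).
  rewrite (Pi_updM _ (ga2E i)); ring.
by rewrite e1 e2 rE sumrB; ring.
Qed.

(** The diagonal is [v k] up to one integration by parts, of order [kap]. A pair of sites
    contributes [kap ^+ 4]; Cauchy-Schwarz over the pairs costs [n], and [n * kap ^+ 2 <= CE] leaves
    [kap ^+ 2]. *)
Lemma fib_hess xi (a := \row_k (v k * xe xi k)) :
  (cv - kap * (Ufac 1 / low_const CS * Cb)
      - kap ^+ 2 * CE * (Ufac 4 / low_const CS * (Cb * Cb))) *
   (\sum_k xe xi k ^+ 2) * fib m (Pi p) <=
  fib m (fun x => ((\sum_k a 0 k ^+ 2 * h k (x 0 k)) - rho a x ^+ 2) * Pi p x).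
Proof.
set S := \sum_k _; set G := fib m (Pi p).
have gP : gb (Pi p) by exact: gb_Pi.
have gU k : gb (Pi (upd p k (be1 k))) by apply: gb_Pi; exact: upd_gb1.
have gUU i j : gb (Pi (upd (upd p i (ga2 i)) j (ga2 j))).
  by apply: gb_Pi; do 2 apply: upd_gb1 => //.
have -> : fib m (fun x => ((\sum_k a 0 k ^+ 2 * h k (x 0 k)) - rho a x ^+ 2) * Pi p x) =
   \sum_k xe xi k ^+ 2 * (v k * G + fib m (Pi (upd p k (be1 k))))
   - \sum_i xe xi i * \sum_(j | j != i) xe xi j * fib m (Pi (upd (upd p i (ga2 i)) j (ga2 j))).
  transitivity (fib m (fun x =>
      \sum_k xe xi k ^+ 2 * (v k * Pi p x + Pi (upd p k (be1 k)) x)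
    - \sum_i xe xi i * \sum_(j | j != i) xe xi j * Pi (upd (upd p i (ga2 i)) j (ga2 j)) x)).
    by rewrite /fib; congr J; apply/funext => w; rewrite hess_pointwise.
  have gb_1 k : gb (fun x => v k * Pi p x + Pi (upd p k (be1 k)) x) by exact: gb_lin.
  have gb_2 i : gb (fun x => \sum_(j | j != i) xe xi j * Pi (upd (upd p i (ga2 i)) j (ga2 j)) x).
    by apply: gb_sum => j _; exact: gbZ.
  rewrite /fib (intB Jq); first last.
  - apply: (@fib_gbw (fun x => \sum_i xe xi i * \sum_(j | j != i)
      xe xi j * Pi (upd (upd p i (ga2 i)) j (ga2 j)) x)).
    by apply: gb_sum => i _; exact: gbZ.
  - apply: (@fib_gbw (fun x => \sum_k xe xi k ^+ 2 * (v k * Pi p x + Pi (upd p k (be1 k)) x))).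
    by apply: gb_sum => i _; exact: gbZ.
  congr (_ - _).
    etransitivity; first exact: (fib_sum _ _ (fun k _ => gb_1 k)).
    apply: eq_bigr => k _; congr (_ * _); by rewrite /fib (int_lin Jq)//; exact: fib_gbw.
  etransitivity; first exact: (fib_sum _ _ (fun k _ => gb_2 k)).
  by apply: eq_bigr => k _; congr (_ * _); rewrite fib_sum.
have G0 : 0 <= G.
  by apply: (int_ge0 Jq) => [|w]; [exact: fib_gbw|exact: ltW (Pi_gt0 _)].
have Cb0 (k : 'I_n) : 0 <= Cb by apply: le_trans (be_Int k); exact: Int_norm_ge0.
set c1 := Ufac 1 / _ * Cb; set c2 := Ufac 4 / _ * _.
have c10 : 0 <= Ufac 1 / low_const CS.
  by rewrite divr_ge0 ?ltW ?Ufac_gt0 ?low_const_gt0.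
have c20 : 0 <= Ufac 4 / low_const CS.
  by rewrite divr_ge0 ?ltW ?Ufac_gt0 ?low_const_gt0.
have c2_ge0 : 0 <= c2 by rewrite mulr_ge0// -expr2 sqr_ge0.
have H1 k : (cv - kap * c1) * G <= v k * G + fib m (Pi (upd p k (be1 k))).
  rewrite mulrBl; apply: lerD; first by rewrite ler_wpM2r.
  rewrite lerNl; apply: le_trans (ler_norm _) _; rewrite normrN.
  apply: le_trans (@fib_site1 k (be k) (be1 k) _ _ _) _ => //.
  by rewrite ler_wpM2r// ler_wpM2l ?(ltW kap_gt0)// ler_wpM2l.
have H2 i j : j != i -> xe xi i * (xe xi j * fib m (Pi (upd (upd p i (ga2 i)) j (ga2 j)))) <=
    `|xe xi i| * (`|xe xi j| * (kap ^+ 4 * c2 * G)).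
  move=> ji; apply: le_trans (ler_norm _) _; rewrite !normrM ler_wpM2l// ler_wpM2l//.
  apply: le_trans (@fib_site2 i j (ga i) (ga1 i) (ga2 i) (ga j) (ga1 j) (ga2 j) _ _ _ _ _ _ _ _ _ _ _) _ => //.
    by rewrite eq_sym.
  rewrite ler_wpM2r// ler_wpM2l ?exprn_ge0 ?(ltW kap_gt0)// ler_wpM2l//.
  by apply: ler_pM; rewrite ?Int_norm_ge0.
have k40 : 0 <= kap ^+ 4 * c2 * G.
  by apply: mulr_ge0 => //; apply: mulr_ge0 => //; rewrite exprn_ge0// ltW.
have H3 : \sum_i xe xi i * \sum_(j | j != i) xe xi j * fib m (Pi (upd (upd p i (ga2 i)) j (ga2 j)))
    <= n%:R * S * (kap ^+ 4 * c2 * G).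
  apply: (@le_trans _ _ ((\sum_i `|xe xi i|) * (\sum_j `|xe xi j|) * (kap ^+ 4 * c2 * G))).
    rewrite !mulr_suml; apply: ler_sum => i _; rewrite -mulrA mulr_sumr mulr_suml mulr_sumr.
    rewrite [leRHS](bigID (fun j => j != i))/= -[leLHS]addr0; apply: lerD.
      by apply: ler_sum => j ji; exact: H2.
    by apply: sumr_ge0 => j ji; apply: mulr_ge0 => //; exact: mulr_ge0.
  apply: ler_wpM2r => //.
  rewrite -expr2; have := sum_CauchySchwarz (fun _ => 1) (fun i => `|xe xi i|).
  rewrite sumr_const card_ord expr1n; under eq_bigr do rewrite mul1r.
  by under [in leRHS]eq_bigr do rewrite real_normK ?num_real//.
have S0 : 0 <= S by apply: sumr_ge0 => k _; exact: sqr_ge0.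
have H4 : (cv - kap * c1) * S * G <= \sum_k xe xi k ^+ 2 * (v k * G + fib m (Pi (upd p k (be1 k)))).
  rewrite mulrAC mulrC mulr_suml; apply: ler_sum => k _; rewrite ler_wpM2l ?sqr_ge0//; exact: H1.
have H5 : n%:R * S * (kap ^+ 4 * c2 * G) <= kap ^+ 2 * CE * c2 * S * G.
  have -> : n%:R * S * (kap ^+ 4 * c2 * G) = n%:R * kap ^+ 2 * (kap ^+ 2 * c2 * S * G) by ring.
  have -> : kap ^+ 2 * CE * c2 * S * G = CE * (kap ^+ 2 * c2 * S * G) by ring.
  apply: ler_wpM2r => //; do 3 (apply: mulr_ge0 => //); exact: sqr_ge0.
apply: le_trans (lerB H4 (le_trans H3 H5)); rewrite le_eqVlt; apply/orP; left; apply/eqP; ring.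
Qed.

End fiber_bounds.

(** * One site *)

Section one_dim.
Context {R : realType}.

Lemma Int_J1 (f : R -> R) : Int f = J (fun x : 'rV[R]_1 => f (x 0 0)).
Proof.
rewrite /=; congr Int; apply/funext => t.
by rewrite mxE; case: split_ordP => [i _|[]//]; rewrite ord1 mxE eqxx.
Qed.

Lemma gb1_gb (f : R -> R) : gb1 f -> gb (fun x : 'rV[R]_1 => f (x 0 0)).
Proof.
move=> [cf [C [c [c0 C0 H]]]]; split; first exact: scont_site.
exists C, c; split=> // x; apply: le_trans (H _) _.
by rewrite /gauss1 /sqn big_ord1.
Qed.

Lemma gb_gb1 (f : R -> R) : gb (fun x : 'rV[R]_1 => f (x 0 0)) -> gb1 f.
Proof.
have e : (fun t => f ((t%:M : 'rV[R]_1) 0 0)) = f by apply/funext => t; rewrite mxE eqxx.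
by move=> /gb_scalar; rewrite e.
Qed.

Lemma gb1_mk (f : R -> R) (C c : R) : 0 < c -> 0 <= C -> continuous f -> gbd1 f C c -> gb1 f.
Proof. by move=> c0 C0 cf H; split=> //; exists C, c. Qed.

Lemma Int_linG (a : R) f g : gb1 f -> gb1 g -> Int (fun x => a * f x + g x) = a * Int f + Int g.
Proof.
by move=> [cf [C [c [c0 _ H]]]] [cg [D [d [d0 _ H']]]]; exact: Int_lin H d0 cg H'.
Qed.

Lemma Int_le (f g : R -> R) : gb1 f -> gb1 g -> (forall x, f x <= g x) -> Int f <= Int g.
Proof.
by move=> [cf [C [c [c0 _ H]]]] [cg [D [d [d0 _ H']]]]; exact: Int_mono H _ _ H'.
Qed.

Lemma gb1_lin (a : R) (f g : R -> R) : gb1 f -> gb1 g -> gb1 (fun x => a * f x + g x).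
Proof. by move=> /gb1_gb gf /gb1_gb gg; apply: gb_gb1; exact: gb_lin. Qed.

Lemma gb1Z (a : R) (f : R -> R) : gb1 f -> gb1 (fun x => a * f x).
Proof. by move=> /gb1_gb gf; apply: gb_gb1; exact: gbZ. Qed.

Lemma Int_Z (a : R) (f : R -> R) : gb1 f -> Int (fun x => a * f x) = a * Int f.
Proof.
by move=> gf; rewrite !Int_J1; exact: (intZ (isInt_J 1) a (gb1_gb gf)).
Qed.

Lemma Int_pos (f : R -> R) : gb1 f -> (forall t, 0 < f t) -> 0 < Int f.
Proof. by move=> [cf [C [c [c0 _ H]]]]; exact: Int_gt0 H. Qed.

Lemma Int_nneg (f : R -> R) : gb1 f -> (forall t, 0 <= f t) -> 0 <= Int f.
Proof. by move=> gf f0; have := int_ge0 (isInt_J 1) (gb1_gb gf); rewrite -Int_J1; apply. Qed.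

Lemma Int_normr (f : R -> R) : gb1 f -> `|Int f| <= Int (fun t => `|f t|).
Proof. by move=> gf; rewrite !Int_J1; exact: (int_norm (isInt_J 1) (gb1_gb gf)). Qed.

Lemma Int_dv0 (f f' : R -> R) : gb1 f -> gb1 f' -> (forall t, dv f t (f' t)) -> Int f' = 0.
Proof.
move=> gf gf' df; rewrite Int_J1.
have [cf [C [c [c0 C0 H]]]] := gb1_gb gf; have [cf' [C' [c' [c0' C0' H']]]] := gb1_gb gf'.
apply: (@int_IBP_gb _ _ _ (fun x : 'rV[R]_1 => f (x 0 0)) _ (const_mx 1) (isInt_J 1)) => //; try exact: gb1_gb.
move=> x; have := dv_comp (df _) (dv_coord x (const_mx 1) 0 0); rewrite scale0r addr0 [const_mx _ _ _]mxE.
by move=> E; apply: (dv_eq E); rewrite mulr1.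
Qed.

Lemma gauss1_gb1 (c : R) : 0 < c -> gb1 (gauss1 c).
Proof.
move=> c0; apply: (@gb1_mk _ 1 c) => //; first exact: continuous_gauss1.
by move=> t; rewrite mul1r ger0_norm ?expR_ge0.
Qed.

Lemma gb1_shift (f : R -> R) b : gb1 f -> gb1 (fun t => f (t + b)).
Proof.
move=> /gb1_gb/(gb_shift (b%:M : 'rV_1)) H; apply: gb_gb1.
by move: H; under eq_fun do rewrite mxE [b%:M _ _]mxE eqxx.
Qed.

Lemma Int_shiftG (f : R -> R) b : gb1 f -> Int (fun t => f (t + b)) = Int f.
Proof.
move=> /gb1_gb gf; have := int_tr (isInt_J 1) (b%:M : 'rV_1) gf.
by rewrite !Int_J1; under eq_fun do rewrite mxE [b%:M _ _]mxE eqxx.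
Qed.

Lemma gauss1_le (c x t : R) : 0 < c -> x ^+ 2 <= t ^+ 2 ->
  gauss1 c t <= gauss1 (c / 2) x * gauss1 (c / 2) t.
Proof.
move=> c0 xt; rewrite /gauss1 -expRD ler_expR.
suff : c / 2 * x ^+ 2 <= c / 2 * t ^+ 2 by lra.
by rewrite ler_wpM2l// divr_ge0// ltW.
Qed.

(** Since [Int f = 0], the value at [x >= 0] is minus the integral over the right tail; at [x < 0]
    it is the integral over the left tail. On the tail [t ^+ 2 >= x ^+ 2], so half of the exponent
    can be frozen at [x] and the other half integrated. *)
Lemma prim_decay (f : R -> R) (C c : R) : 0 < c -> 0 <= C -> continuous f -> gbd1 f C c ->
  Int f = 0 -> gbd1 (prim f) (C * Int (gauss1 (c / 2))) (c / 2).
Proof.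
move=> c0 C0 cf fC f0 x; have c20 : 0 < c / 2 by rewrite divr_gt0.
pose g := gauss1 (c / 2); have gg : gb1 g by exact: gauss1_gb1.
have cg : continuous g by exact: continuous_gauss1.
have bg : gbd1 g 1 (c / 2) by move=> t; rewrite mul1r ger0_norm ?expR_ge0.
pose K := C * gauss1 (c / 2) x; have K0 : 0 <= K by rewrite mulr_ge0 ?expR_ge0.
have inc (y z : R) : y <= z -> (forall t, y <= t <= z -> x ^+ 2 <= t ^+ 2) ->
    `|prim f z - prim f y| <= K * Int g.
  move=> yz xt.
  have gle s : prim g s <= Int g.
    apply: (@seq_lim_ge _ _ _ _ (@prim_pinfty _ g s 1 (c / 2) c20 cg bg)) => k.
    by apply: (prim_le c20 cg bg) => [t|]; [exact: expR_ge0|rewrite lerDr].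
  have gge s : 0 <= prim g s.
    apply: (@seq_lim_le _ _ _ _ (@prim_ninfty _ g s 1 (c / 2) c20 cg bg)) => k.
    by apply: (prim_le c20 cg bg) => [t|]; [exact: expR_ge0|rewrite gerDr oppr_le0].
  have dg t : dv (prim g) t (g t) by exact: prim_dv bg.
  have df t : dv (prim f) t (f t) by exact: prim_dv fC.
  have ft t : y <= t <= z -> `|f t| <= K * g t.
    move=> /xt xt'; apply: le_trans (fC t) _; rewrite /K -mulrA ler_wpM2l//; exact: gauss1_le.
  have A1 : prim f z - prim f y <= K * (prim g z - prim g y).
    have := @dv_le _ (fun t => prim f t + (- K) * prim g t) (fun t => f t + (- K) * g t) y z 0 yz.
    have H t : y <= t <= z -> f t + - K * g t <= 0.
      by move=> /ft; rewrite ler_norml => /andP[_]; lra.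
    move=> /(_ (fun t _ => dvD (df t) (dvZ _ (dg t))) H); lra.
  have A2 : - (prim f z - prim f y) <= K * (prim g z - prim g y).
    have := @dv_le _ (fun t => - prim f t + (- K) * prim g t) (fun t => - f t + (- K) * g t) y z 0 yz.
    have H t : y <= t <= z -> - f t + - K * g t <= 0.
      by move=> /ft; rewrite ler_norml => /andP[]; lra.
    move=> /(_ (fun t _ => dvD (dvN (df t)) (dvZ _ (dg t))) H); lra.
  have : K * (prim g z - prim g y) <= K * Int g.
    by rewrite ler_wpM2l//; have := gle z; have := gge y; lra.
  by rewrite ler_norml; lra.
have -> : C * Int (gauss1 (c / 2)) * gauss1 (c / 2) x = K * Int g by rewrite /K; ring.
have [x0|x0] := leP 0 x.
  have h : (fun k : nat => `|prim f (k%:R + x) - prim f x|) @ \oo --> `|Int f - prim f x|.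
    apply: cvg_norm; apply: cvgB; last exact: cvg_cst.
    exact: prim_pinfty fC.
  rewrite f0 sub0r normrN in h.
  apply: (@seq_lim_le _ _ _ _ h) => k; apply: inc; first by rewrite lerDr.
  by move=> t /andP[xt _]; rewrite lerXn2r ?nnegrE//; exact: le_trans xt.
have h : (fun k : nat => `|prim f x - prim f (- k%:R + x)|) @ \oo --> `|prim f x - 0|.
  apply: cvg_norm; apply: cvgB; first exact: cvg_cst.
  exact: prim_ninfty fC.
rewrite subr0 in h.
apply: (@seq_lim_le _ _ _ _ h) => k; apply: inc; first by rewrite gerDr oppr_le0.
move=> t /andP[_ tx]; rewrite -(sqrrN x) -(sqrrN t) lerXn2r ?nnegrE ?lerN2//.
  by rewrite oppr_ge0 ltW.
by rewrite oppr_ge0 (le_trans tx)// ltW.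
Qed.

(** * Moments and antiderivatives for the one-site density *)

Section one_site.
Variables (de de1 de2 : R -> R) (b0 b1 b2 : R).
Hypothesis de_dv : forall t, dv de t (de1 t).
Hypothesis de1_dv : forall t, dv de1 t (de2 t).
Hypothesis de2_cont : continuous de2.
Hypothesis de_le : forall t, `|de t| <= b0.
Hypothesis de1_le : forall t, `|de1 t| <= b1.
Hypothesis de2_le : forall t, `|de2 t| <= b2.

Let g := @gauss1 R 2^-1.
Let G0 := Int g.

Lemma gauss_int_gt0 (c : R) : 0 < c -> 0 < Int (gauss1 c).
Proof. by move=> c0; apply: Int_pos => [|t]; [exact: gauss1_gb1|exact: expR_gt0]. Qed.

Let G0_gt0 : 0 < G0. Proof. exact: gauss_int_gt0. Qed.

Definition weight t := expR (- de t) * g t.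

Definition site_Z := Int weight.

Definition site_r t := weight t / site_Z.

Let de_cont : continuous de. Proof. by move=> t; exact: dv_continuous (de_dv t). Qed.

Let weight_cont : continuous weight.
Proof.
move=> t; apply: cvgM; last exact: continuous_gauss1.
by apply: (@continuous_comp _ _ _ (fun t => - de t) expR); [apply: cvgN; exact: de_cont|exact: continuous_expR].
Qed.

Let weight_bounds t : expR (- b0) * g t <= weight t <= expR b0 * g t.
Proof.
have g0 : 0 <= g t by exact: expR_ge0.
have := de_le t; rewrite ler_norml => /andP[d1 d2].
by rewrite !ler_wpM2r// ler_expR; lra.
Qed.

Lemma weight_gb1 : gb1 weight.
Proof.
apply: (@gb1_mk _ (expR b0) 2^-1) => //.
move=> t; have /andP[l u] := weight_bounds t; rewrite ger0_norm//.
by apply: le_trans l; rewrite mulr_ge0 ?expR_ge0.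
Qed.

Let weight_gt0 t : 0 < weight t. Proof. by rewrite mulr_gt0 ?expR_gt0. Qed.

Let gG : gb1 g. Proof. exact: gauss1_gb1. Qed.

Lemma site_Z_bounds : expR (- b0) * G0 <= site_Z <= expR b0 * G0.
Proof.
rewrite -!Int_Z//; apply/andP; split; apply: Int_le => [||t]; try exact: weight_gb1; try exact: gb1Z.
  by have /andP[] := weight_bounds t.
by have /andP[] := weight_bounds t.
Qed.

Let Z_gt0 : 0 < site_Z. Proof. exact: Int_pos weight_gb1 _. Qed.

Let A0 := expR (2 * b0) / G0.

Let A0_gt0 : 0 < A0. Proof. by rewrite divr_gt0 ?expR_gt0. Qed.

Let r_upper t : site_r t <= A0 * g t.
Proof.
have g0 : 0 <= g t by exact: expR_ge0.
have /andP[_ u] := weight_bounds t; have /andP[l _] := site_Z_bounds.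
rewrite /site_r ler_pdivrMr//; apply: le_trans u _.
rewrite (_ : A0 * g t * _ = A0 * site_Z * g t); last ring.
rewrite ler_wpM2r//; apply: (@le_trans _ _ (A0 * (expR (- b0) * G0))).
  rewrite /A0 (_ : _ / _ * _ = expR (2 * b0) * expR (- b0)); last by field; rewrite gt_eqF.
  by rewrite -expRD ler_expR; lra.
by rewrite ler_wpM2l// ltW.
Qed.

Let r_lower t : expR (- (2 * b0)) / G0 * g t <= site_r t.
Proof.
have g0 : 0 <= g t by exact: expR_ge0.
have /andP[l _] := weight_bounds t; have /andP[_ u] := site_Z_bounds.
rewrite /site_r ler_pdivlMr//; apply: le_trans l.
rewrite (_ : _ * g t * _ = expR (- (2 * b0)) / G0 * site_Z * g t); last ring.
rewrite ler_wpM2r//; apply: (@le_trans _ _ (expR (- (2 * b0)) / G0 * (expR b0 * G0))).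
  by rewrite ler_wpM2l// divr_ge0 ?expR_ge0// ltW.
rewrite (_ : _ / _ * _ = expR (- (2 * b0)) * expR b0); last by field; rewrite gt_eqF.
by rewrite -expRD ler_expR; lra.
Qed.

Lemma site_r_gt0 t : 0 < site_r t. Proof. by rewrite divr_gt0. Qed.

Lemma quad_gauss (t : R) : (1 + t ^+ 2) * g t <= 4 * gauss1 4^-1 t.
Proof.
have -> : g t = gauss1 4^-1 t * gauss1 4^-1 t by rewrite /g /gauss1 -expRD; congr expR; field.
rewrite mulrA ler_wpM2r ?expR_ge0// /gauss1 expRN ler_pdivrMr ?expR_gt0//.
by have := expR_ge1Dx (4^-1 * t ^+ 2); have := sqr_ge0 t; lra.
Qed.

Let b1_ge0 : 0 <= b1. Proof. exact: le_trans (de1_le 0). Qed.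
Let b2_ge0 : 0 <= b2. Proof. exact: le_trans (de2_le 0). Qed.

Let r_cont : continuous site_r.
Proof. by move=> t; apply: cvgM; [exact: weight_cont|exact: cvg_cst]. Qed.

Lemma quad_gbd (f : R -> R) (C : R) : 0 <= C -> (forall t, `|f t| <= C * (1 + t ^+ 2)) ->
  gbd1 (fun t => f t * site_r t) (C * (A0 * 4)) 4^-1.
Proof.
move=> C0 fC t; rewrite normrM (gtr0_norm (site_r_gt0 t)).
apply: (@le_trans _ _ (C * (1 + t ^+ 2) * (A0 * g t))).
  by apply: ler_pM => //; exact: ltW (site_r_gt0 t).
rewrite (_ : C * _ * _ = C * (A0 * ((1 + t ^+ 2) * g t))); last ring.
rewrite (_ : C * _ * _ = C * (A0 * (4 * gauss1 4^-1 t))); last ring.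
by rewrite ler_wpM2l// ler_wpM2l ?(ltW A0_gt0)// quad_gauss.
Qed.

Lemma quad_gb1 (f : R -> R) (C : R) : continuous f -> 0 <= C ->
  (forall t, `|f t| <= C * (1 + t ^+ 2)) -> gb1 (fun t => f t * site_r t).
Proof.
move=> cf C0 fC; apply: gb1_mk (quad_gbd C0 fC) => //.
  by rewrite mulr_ge0// mulr_ge0// ltW.
by move=> t; apply: cvgM; [exact: cf|exact: r_cont].
Qed.

Lemma site_r_gb1 : gb1 site_r.
Proof.
have -> : site_r = (fun t => 1 * site_r t) by apply/funext => t; rewrite mul1r.
apply: (@quad_gb1 (fun=> 1) 1) => // t; first exact: cvg_cst.
by rewrite mul1r normr1 lerDl sqr_ge0.
Qed.

Lemma site_r_int : Int site_r = 1.
Proof.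
rewrite /site_r; under eq_fun do rewrite mulrC.
by rewrite Int_Z; [rewrite mulVf// gt_eqF|exact: weight_gb1].
Qed.

Definition site_th t := t + de1 t.

Lemma g_dv t : dv g t (- t * g t).
Proof.
have := dv_expR (dvN (dvZ 2^-1 (dvM (dv_id t) (dv_id t)))) => H; apply: (dv_eq H).
by rewrite /g /gauss1; field.
Qed.

Lemma site_r_dv t : dv site_r t (- (site_th t * site_r t)).
Proof.
have := dvM (dvM (dv_expR (dvN (de_dv t))) (g_dv t)) (dv_cst site_Z^-1 t) => H.
by apply: (dv_eq H); rewrite /site_r /site_th /weight; ring.
Qed.

Lemma site_th_dv t : dv site_th t (1 + de2 t).
Proof. exact: dvD (dv_id t) (de1_dv t). Qed.

Let id_cont : continuous (fun t : R => t). Proof. by move=> t; exact: cvg_id. Qed.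

Let th_cont : continuous site_th.
Proof. by move=> t; exact: dv_continuous (site_th_dv t). Qed.

Lemma norm_quad (t : R) : `|t| <= 1 + t ^+ 2.
Proof.
have [t0|t0] := leP 0 t; [rewrite ger0_norm//|rewrite ltr0_norm//];
by have := sqr_ge0 (t - 1); have := sqr_ge0 (t + 1); lra.
Qed.

Definition site_mean := Int (fun t => t * site_r t).

Definition site_var := Int (fun t => (t - site_mean) ^+ 2 * site_r t).

Let M1 := A0 * 4 * Int (@gauss1 R 4^-1).

Let M1_ge0 : 0 <= M1.
Proof.
apply: mulr_ge0; first by rewrite mulr_ge0// ltW.
by apply: ltW; apply: gauss_int_gt0; rewrite invr_gt0.
Qed.

Let Int_quad (f : R -> R) : continuous f -> (forall t, `|f t| <= 1 + t ^+ 2) ->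
  `|Int (fun t => f t * site_r t)| <= M1.
Proof.
move=> cf fC; have fC' t : `|f t| <= 1 * (1 + t ^+ 2) by rewrite mul1r.
have gf := quad_gb1 cf ler01 fC'; have := quad_gbd ler01 fC'; rewrite mul1r => H.
apply: le_trans (Int_normr gf) _; rewrite /M1 -Int_Z; last exact: gauss1_gb1.
by apply: Int_le => //; [exact: gb1_norm|apply: gb1Z; exact: gauss1_gb1].
Qed.

Let idr : gb1 (fun t => t * site_r t).
Proof. by apply: (@quad_gb1 _ 1) => // t; rewrite mul1r norm_quad. Qed.

Let sqr_cont (m : R) : continuous (fun t : R => (t - m) ^+ 2).
Proof.
by move=> t; apply: (@continuous_comp _ _ _ (fun t => t - m) (fun x => x ^+ 2));
  [apply: cvgB; [exact: cvg_id|exact: cvg_cst]|exact: exprn_continuous].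
Qed.

Let sqrB (m t : R) : `|(t - m) ^+ 2| <= 2 * (1 + m ^+ 2) * (1 + t ^+ 2).
Proof.
rewrite ger0_norm ?sqr_ge0//; have := sqr_ge0 (t + m); have := mulr_ge0 (sqr_ge0 t) (sqr_ge0 m).
nra.
Qed.

Let sqrr m : gb1 (fun t => (t - m) ^+ 2 * site_r t).
Proof.
apply: (@quad_gb1 (fun t => (t - m) ^+ 2) (2 * (1 + m ^+ 2))) => //.
by rewrite mulr_ge0// addr_ge0// sqr_ge0.
Qed.

Lemma site_mean_le : `|site_mean| <= M1.
Proof. by apply: Int_quad => // t; exact: norm_quad. Qed.

Lemma site_var_le : site_var <= M1.
Proof.
have e : site_var = Int (fun t => t ^+ 2 * site_r t) - site_mean ^+ 2.
  have -> : site_var = Int (fun t => (- 2 * site_mean) * (t * site_r t) +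
      (site_mean ^+ 2 * site_r t + (t - 0) ^+ 2 * site_r t)).
    by congr Int; apply/funext => t; ring.
  rewrite Int_linG//; last by apply: gb1_lin => //; exact: site_r_gb1.
  rewrite Int_linG//; last exact: site_r_gb1.
  rewrite site_r_int -/site_mean; under [in LHS]eq_fun do rewrite subr0; ring.
have : Int (fun t => t ^+ 2 * site_r t) <= M1.
  apply: le_trans (ler_norm _) _; apply: Int_quad; first exact: exprn_continuous.
  by move=> t; rewrite ger0_norm ?sqr_ge0// lerDr.
by rewrite e; have := sqr_ge0 site_mean; lra.
Qed.

(** [site_r] is at least [expR (- (2 * b0))] times the standard Gaussian density, whose second
    moment about any point is at least 1. *)
Lemma site_var_ge : expR (- (2 * b0)) <= site_var.
Proof.
set m := site_mean; set k := expR (- (2 * b0)) / G0.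
have gq (f : R -> R) : continuous f -> (forall t, `|f t| <= 1 + t ^+ 2) -> gb1 (fun t => f t * g t).
  move=> cf fC; apply: (@gb1_mk _ 4 4^-1) => //.
    by move=> t; apply: cvgM; [exact: cf|exact: continuous_gauss1].
  move=> t; apply: le_trans (quad_gauss t); rewrite normrM (ger0_norm (expR_ge0 _)).
  by rewrite ler_wpM2r ?expR_ge0.
have g1 : gb1 (fun t => t * g t) by apply: gq => // t; exact: norm_quad.
have g2 : gb1 (fun t => t ^+ 2 * g t).
  by apply: gq => [|t]; [exact: exprn_continuous|rewrite ger0_norm ?sqr_ge0// lerDr].
have i1 : Int (fun t => t * g t) = 0.
  have := @Int_dv0 (fun t => -1 * g t) (fun t => -1 * (- t * g t)).
  have -> : (fun t => -1 * (- t * g t)) = (fun t => t * g t) by apply/funext => t; ring.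
  apply => //; first exact: gb1Z.
  by move=> t; have := dvZ (-1) (g_dv t) => H; apply: (dv_eq H); ring.
have i2 : Int (fun t => t ^+ 2 * g t) = G0.
  have := @Int_dv0 (fun t => t * g t) (fun t => -1 * (t ^+ 2 * g t) + g t).
  rewrite Int_linG// -/G0 mulN1r => /(_ g1 (gb1_lin _ g2 gG)) H.
  apply/eqP; rewrite -subr_eq0 -oppr_eq0 opprB addrC; apply/eqP; apply: H => t.
  by have := dvM (dv_id t) (g_dv t) => H; apply: (dv_eq H); ring.
have e : Int (fun t => k * ((t - m) ^+ 2 * g t)) = k * (G0 + m ^+ 2 * G0).
  have -> : (fun t => k * ((t - m) ^+ 2 * g t)) =
      (fun t => k * (t ^+ 2 * g t) + ((k * m ^+ 2) * g t + (- 2 * k * m) * (t * g t))).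
    by apply/funext => t; ring.
  rewrite Int_linG//; last by apply: gb1_lin => //; exact: gb1Z.
  rewrite Int_linG//; last exact: gb1Z.
  by rewrite Int_Z// i1 i2 -/G0; ring.
have k0 : 0 < k by rewrite divr_gt0 ?expR_gt0.
apply: (@le_trans _ _ (k * (G0 + m ^+ 2 * G0))).
  rewrite mulrDr (_ : k * G0 = expR (- (2 * b0))); last by rewrite /k mulrAC mulfK// gt_eqF.
  by rewrite lerDl; apply: mulr_ge0; [exact: ltW|apply: mulr_ge0; [exact: sqr_ge0|exact: ltW]].
have gm : gb1 (fun t => (t - m) ^+ 2 * g t).
  have -> : (fun t => (t - m) ^+ 2 * g t) =
      (fun t => 1 * (t ^+ 2 * g t) + ((m ^+ 2) * g t + (- 2 * m) * (t * g t))).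
    by apply/funext => t; ring.
  by do 2 apply: gb1_lin => //; exact: gb1Z.
rewrite -e; apply: Int_le => [||t]; [exact: gb1Z|exact: sqrr|].
rewrite (_ : k * _ = (t - m) ^+ 2 * (k * g t)); last ring.
by rewrite ler_wpM2l ?sqr_ge0//; exact: r_lower.
Qed.

(* Under the density [site_r], [site_F] is orthogonal to the affine functions and
   [site_W] has mean zero. Hence [site_F * site_r] is a second derivative and
   [site_W * site_r] a first derivative, and integrating by parts over a fiber
   gains a factor [K^(-1/2)] per derivative. *)
Definition site_F t := site_var * site_th t - (t - site_mean).

Definition site_W t := site_var ^+ 2 * (1 + de2 t) - site_F t ^+ 2 - site_var.

Let var_gt0 : 0 < site_var. Proof. exact: lt_le_trans (expR_gt0 _) site_var_ge. Qed.

Let A1 := M1 + 1 + (M1 * b1 + M1).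

Let A1_ge0 : 0 <= A1.
Proof. by rewrite /A1 !addr_ge0// mulr_ge0. Qed.

Let F_cont : continuous site_F.
Proof.
move=> t; apply: cvgB; first by apply: cvgM; [exact: cvg_cst|exact: th_cont].
by apply: cvgB; [exact: cvg_id|exact: cvg_cst].
Qed.

Let F_lin t : `|site_F t| <= A1 * (1 + `|t|).
Proof.
apply: (@le_trans _ _ (M1 * (`|t| + b1) + (`|t| + M1))).
  apply: le_trans (ler_normB _ _) _; apply: lerD.
    rewrite normrM (gtr0_norm var_gt0); apply: ler_pM => //; [exact: ltW|exact: site_var_le|].
    by apply: le_trans (ler_normD _ _) _; rewrite lerD2l.
  by apply: le_trans (ler_normB _ _) _; rewrite lerD2l; exact: site_mean_le.
have h1 : 0 <= M1 * b1 by exact: mulr_ge0.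
have h2 : 0 <= (M1 * b1 + M1) * `|t| by rewrite mulr_ge0// addr_ge0.
by rewrite /A1 -subr_ge0 (_ : _ - _ = 1 + (M1 * b1 + M1) * `|t| + M1); [rewrite !addr_ge0|ring].
Qed.

Let F_quad t : `|site_F t| <= 2 * A1 * (1 + t ^+ 2).
Proof.
apply: le_trans (F_lin t) _; rewrite [2 * _]mulrC -mulrA ler_wpM2l//.
by have := norm_quad t; have := sqr_ge0 t; lra.
Qed.

Let F_sqr t : site_F t ^+ 2 <= 2 * A1 ^+ 2 * (1 + t ^+ 2).
Proof.
rewrite -real_normK ?num_real//; apply: (@le_trans _ _ ((A1 * (1 + `|t|)) ^+ 2)).
  by rewrite lerXn2r ?nnegrE// mulr_ge0// addr_ge0.
rewrite exprMn (_ : 2 * _ * _ = A1 ^+ 2 * (2 * (1 + t ^+ 2))); last ring.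
rewrite ler_wpM2l ?sqr_ge0//.
by rewrite -(@real_normK _ t) ?num_real//; have := sqr_ge0 (`|t| - 1); lra.
Qed.

Let A2 := M1 ^+ 2 * (1 + b2) + 2 * A1 ^+ 2 + M1.

Let A2_ge0 : 0 <= A2.
Proof. by rewrite /A2 !addr_ge0// mulr_ge0 ?sqr_ge0// addr_ge0. Qed.

Let W_quad t : `|site_W t| <= A2 * (1 + t ^+ 2).
Proof.
have T1 : 1 <= 1 + t ^+ 2 by rewrite lerDl sqr_ge0.
have v2 : site_var ^+ 2 <= M1 ^+ 2.
  by rewrite lerXn2r ?nnegrE//; [exact: ltW|exact: site_var_le].
rewrite /A2 [leRHS]mulrDl [X in _ <= X + _]mulrDl; apply: le_trans (ler_normB _ _) _; apply: lerD; last first.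
  rewrite gtr0_norm//; apply: le_trans site_var_le _; exact: ler_peMr.
apply: le_trans (ler_normB _ _) _; apply: lerD; last by rewrite ger0_norm ?sqr_ge0.
rewrite normrM (ger0_norm (sqr_ge0 _)).
apply: (@le_trans _ _ (M1 ^+ 2 * (1 + b2))); last first.
  by rewrite ler_peMr// mulr_ge0 ?sqr_ge0// addr_ge0.
apply: ler_pM => //; first exact: sqr_ge0.
by apply: le_trans (ler_normD _ _) _; rewrite normr1 lerD2l.
Qed.

Let F_gb1 : gb1 (fun t => site_F t * site_r t).
Proof. by apply: (quad_gb1 F_cont _ F_quad); rewrite mulr_ge0. Qed.

Let W_cont : continuous site_W.
Proof.
have sc (f : R -> R) : continuous f -> continuous (fun t => f t ^+ 2).
  by move=> cf t; apply: (@continuous_comp _ _ _ f (fun x => x ^+ 2));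
    [exact: cf|exact: exprn_continuous].
move=> t; apply: cvgB; last exact: cvg_cst.
apply: cvgB; last exact: sc.
by apply: cvgM; [exact: cvg_cst|apply: cvgD; [exact: cvg_cst|exact: de2_cont]].
Qed.

Let W_gb1 : gb1 (fun t => site_W t * site_r t).
Proof. exact: (quad_gb1 W_cont _ W_quad). Qed.

Let th_quad (f : R -> R) (C : R) : continuous f -> 0 <= C -> (forall t, `|f t| <= C * (1 + `|t|)) ->
  gb1 (fun t => site_th t * f t * site_r t).
Proof.
move=> cf C0 fC; apply: (@quad_gb1 (fun t => site_th t * f t) (2 * C * (1 + b1))).
- by move=> t; apply: cvgM; [exact: th_cont|exact: cf].
- by rewrite mulr_ge0 ?mulr_ge0// addr_ge0.
move=> t; rewrite normrM; apply: (@le_trans _ _ ((`|t| + b1) * (C * (1 + `|t|)))).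
  by apply: ler_pM => //; apply: le_trans (ler_normD _ _) _; rewrite lerD2l.
rewrite -(@real_normK _ t) ?num_real//.
have t0 := normr_ge0 t; rewrite (_ : _ * (C * _) = C * ((`|t| + b1) * (1 + `|t|))); last ring.
rewrite (_ : 2 * C * _ * _ = C * (2 * (1 + b1) * (1 + `|t| ^+ 2))); last ring.
rewrite ler_wpM2l//; set x := `|t| in t0 *.
have q : 0 <= 1 - x + 2 * x ^+ 2 by have := sqr_ge0 (x - 1); have := sqr_ge0 x; lra.
by have := mulr_ge0 b1_ge0 q; have := sqr_ge0 (x - 1); have := sqr_ge0 x; lra.
Qed.

Let th_r : gb1 (fun t => site_th t * site_r t).
Proof.
have := @th_quad (fun=> 1) 1 (fun=> cvg_cst _) ler01.
have -> : (fun t => site_th t * 1 * site_r t) = (fun t => site_th t * site_r t).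
  by apply/funext => t; rewrite mulr1.
by apply => t; rewrite normr1 mul1r lerDl.
Qed.

Let I1 : Int (fun t => site_th t * site_r t) = 0.
Proof.
have := @Int_dv0 (fun t => -1 * site_r t) (fun t => site_th t * site_r t).
apply; [apply: gb1Z; exact: site_r_gb1|exact: th_r|].
by move=> t; have := dvZ (-1) (site_r_dv t) => H; apply: (dv_eq H); ring.
Qed.

Let tm_lin (t : R) : `|t - site_mean| <= (1 + M1) * (1 + `|t|).
Proof.
apply: le_trans (ler_normB _ _) _; have := site_mean_le; have := mulr_ge0 M1_ge0 (normr_ge0 t).
by have := normr_ge0 t; lra.
Qed.

Let tm_cont : continuous (fun t : R => t - site_mean).
Proof. by move=> t; apply: cvgB; [exact: cvg_id|exact: cvg_cst]. Qed.

Let tm_r : gb1 (fun t => (t - site_mean) * site_r t).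
Proof.
apply: (@quad_gb1 _ (2 * (1 + M1))) => //; first by rewrite mulr_ge0 ?addr_ge0.
move=> t; apply: le_trans (tm_lin t) _; rewrite [2 * _]mulrC -mulrA ler_wpM2l ?addr_ge0//.
by have := norm_quad t; have := sqr_ge0 t; lra.
Qed.

Let I2 : Int (fun t => (t - site_mean) * site_r t) = 0.
Proof.
have -> : (fun t => (t - site_mean) * site_r t) =
    (fun t => (- site_mean) * site_r t + t * site_r t) by apply/funext => t; ring.
rewrite Int_linG//; last exact: site_r_gb1.
by rewrite site_r_int -/site_mean mulr1 addNr.
Qed.

Let th_tm : gb1 (fun t => site_th t * (t - site_mean) * site_r t).
Proof. by apply: th_quad tm_cont _ tm_lin; rewrite addr_ge0. Qed.

Let I3 : Int (fun t => site_th t * (t - site_mean) * site_r t) = 1.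
Proof.
have := @Int_dv0 (fun t => (t - site_mean) * site_r t)
  (fun t => -1 * (site_th t * (t - site_mean) * site_r t) + site_r t) tm_r.
rewrite Int_linG// ?site_r_int; last exact: site_r_gb1.
move=> H; suff : -1 * Int (fun t => site_th t * (t - site_mean) * site_r t) + 1 = 0 by lra.
apply: H; first by apply: gb1_lin => //; exact: site_r_gb1.
move=> t; have := dvM (dvD (dv_id t) (dv_cst (- site_mean) t)) (site_r_dv t) => H; apply: (dv_eq H).
ring.
Qed.

Let th_th : gb1 (fun t => site_th t * site_th t * site_r t).
Proof.
apply: (@th_quad site_th (1 + b1)) => //; first by rewrite addr_ge0.
move=> t; apply: le_trans (ler_normD _ _) _; have := de1_le t; have := mulr_ge0 b1_ge0 (normr_ge0 t).
by have := normr_ge0 t; lra.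
Qed.

Let h_r : gb1 (fun t => (1 + de2 t) * site_r t).
Proof.
apply: (@quad_gb1 _ (1 + b2)); first by move=> t; apply: cvgD; [exact: cvg_cst|exact: de2_cont].
  by rewrite addr_ge0.
move=> t; apply: (@le_trans _ _ (1 + b2)).
  by apply: le_trans (ler_normD _ _) _; rewrite normr1 lerD2l.
by rewrite ler_peMr ?addr_ge0// lerDl sqr_ge0.
Qed.

Let I4 : Int (fun t => (1 + de2 t) * site_r t) = Int (fun t => site_th t * site_th t * site_r t).
Proof.
have := @Int_dv0 (fun t => site_th t * site_r t)
  (fun t => -1 * (site_th t * site_th t * site_r t) + (1 + de2 t) * site_r t) th_r.
rewrite Int_linG// => H.
suff : -1 * Int (fun t => site_th t * site_th t * site_r t) + Int (fun t => (1 + de2 t) * site_r t) = 0.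
  by lra.
apply: H; first exact: gb1_lin.
move=> t; have := dvM (site_th_dv t) (site_r_dv t) => H; apply: (dv_eq H); ring.
Qed.

Let F_int0 : Int (fun t => site_F t * site_r t) = 0.
Proof.
have -> : (fun t => site_F t * site_r t) =
   (fun t => site_var * (site_th t * site_r t) + (-1) * ((t - site_mean) * site_r t)).
  by apply/funext => t; rewrite /site_F; ring.
by rewrite Int_linG//; [rewrite Int_Z// I1 I2; ring|exact: gb1Z].
Qed.

Let F_tm : gb1 (fun t => (t - site_mean) * (site_F t * site_r t)).
Proof.
have -> : (fun t => (t - site_mean) * (site_F t * site_r t)) =
   (fun t => site_var * (site_th t * (t - site_mean) * site_r t) +
       (-1) * ((t - site_mean) ^+ 2 * site_r t)).
  by apply/funext => t; rewrite /site_F; ring.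
by apply: gb1_lin => //; apply: gb1Z; exact: sqrr.
Qed.

(** This fixes the coefficient of the score in [site_F]: by [I3] the score has covariance 1 with
    [t], so [site_var] times it matches the variance. *)
Let F_tm_int0 : Int (fun t => (t - site_mean) * (site_F t * site_r t)) = 0.
Proof.
have -> : (fun t => (t - site_mean) * (site_F t * site_r t)) =
   (fun t => site_var * (site_th t * (t - site_mean) * site_r t) +
       (-1) * ((t - site_mean) ^+ 2 * site_r t)).
  by apply/funext => t; rewrite /site_F; ring.
have sq := sqrr site_mean.
by rewrite Int_linG//; [rewrite Int_Z// I3 -/site_var; ring|exact: gb1Z].
Qed.

(** By [I3] and [I4], the mean of [site_F ^+ 2] is [site_var ^+ 2] times that of [1 + de2], minus
    [site_var]. *)
Let W_int0 : Int (fun t => site_W t * site_r t) = 0.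
Proof.
have sq := sqrr site_mean.
have -> : (fun t => site_W t * site_r t) =
   (fun t => site_var ^+ 2 * ((1 + de2 t) * site_r t) +
     ((- site_var ^+ 2) * (site_th t * site_th t * site_r t) +
      ((2 * site_var) * (site_th t * (t - site_mean) * site_r t) +
       ((-1) * ((t - site_mean) ^+ 2 * site_r t) + (- site_var) * site_r t)))).
  by apply/funext => t; rewrite /site_W /site_F; ring.
have gr := site_r_gb1.
have e1 : gb1 (fun t => (-1) * ((t - site_mean) ^+ 2 * site_r t) + (- site_var) * site_r t).
  by apply: gb1_lin => //; exact: gb1Z.
have e2 := gb1_lin (2 * site_var) th_tm e1; have e3 := gb1_lin (- site_var ^+ 2) th_th e2.
rewrite Int_linG// Int_linG// Int_linG// Int_linG//; last exact: gb1Z.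
by rewrite Int_Z// I4 I3 site_r_int -/site_var; ring.
Qed.

Definition site_be := prim (fun t => site_W t * site_r t).
Definition site_ga1 := prim (fun t => site_F t * site_r t).
Definition site_ga := prim site_ga1.

Let K1 := A2 * (A0 * 4) * Int (@gauss1 R (4^-1 / 2)).
Let K2 := 2 * A1 * (A0 * 4) * Int (@gauss1 R (4^-1 / 2)).
Let K3 := K2 * Int (@gauss1 R (4^-1 / 2 / 2)).

Definition site_const := K1 * Int (@gauss1 R (4^-1 / 2)) + K3 * Int (@gauss1 R (4^-1 / 2 / 2)).

Let c4 : (0 : R) < 4^-1. Proof. by rewrite invr_gt0. Qed.
Let c8 : (0 : R) < 4^-1 / 2. Proof. by rewrite divr_gt0 ?invr_gt0. Qed.
Let c16 : (0 : R) < 4^-1 / 2 / 2. Proof. by rewrite divr_gt0. Qed.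
Let A04 : 0 <= A0 * 4. Proof. exact: mulr_ge0 (ltW A0_gt0) (ler0n _ 4). Qed.
Let A12 : 0 <= 2 * A1. Proof. exact: mulr_ge0 (ler0n _ 2) A1_ge0. Qed.
Let g8 := ltW (gauss_int_gt0 c8).
Let g16 := ltW (gauss_int_gt0 c16).
Let A24 : 0 <= A2 * (A0 * 4). Proof. exact: mulr_ge0 A2_ge0 A04. Qed.
Let A14 : 0 <= 2 * A1 * (A0 * 4). Proof. exact: mulr_ge0 A12 A04. Qed.
Let K1_ge0 : 0 <= K1. Proof. exact: mulr_ge0 A24 g8. Qed.
Let K2_ge0 : 0 <= K2. Proof. exact: mulr_ge0 A14 g8. Qed.
Let K3_ge0 : 0 <= K3. Proof. exact: mulr_ge0 K2_ge0 g16. Qed.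

Let Int_gbd (f : R -> R) (C c : R) : 0 < c -> gb1 f -> gbd1 f C c ->
  Int (fun t => `|f t|) <= C * Int (gauss1 c).
Proof.
move=> c0 gf fC; rewrite -Int_Z; last exact: gauss1_gb1.
by apply: Int_le => //; [exact: gb1_norm|apply: gb1Z; exact: gauss1_gb1].
Qed.

Let prim_cont (f : R -> R) (C c : R) : 0 < c -> continuous f -> gbd1 f C c -> continuous (prim f).
Proof. by move=> c0 cf fC t; exact: dv_continuous (prim_dv t c0 cf fC). Qed.

Let W_gbd : gbd1 (fun t => site_W t * site_r t) (A2 * (A0 * 4)) 4^-1.
Proof. exact: quad_gbd A2_ge0 W_quad. Qed.

Let F_gbd : gbd1 (fun t => site_F t * site_r t) (2 * A1 * (A0 * 4)) 4^-1.
Proof. by apply: quad_gbd F_quad; rewrite mulr_ge0. Qed.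

Lemma site_be_dv t : dv site_be t (site_W t * site_r t).
Proof. exact: (prim_dv t c4 (proj1 W_gb1) W_gbd). Qed.

Lemma site_W_gb1 : gb1 (fun t => site_W t * site_r t).
Proof. exact: W_gb1. Qed.

Let be_gbd : gbd1 site_be K1 (4^-1 / 2).
Proof.
exact: (prim_decay c4 A24 (proj1 W_gb1) W_gbd W_int0).
Qed.

Lemma site_be_gb1 : gb1 site_be.
Proof. exact: (gb1_mk c8 K1_ge0 (prim_cont c4 (proj1 W_gb1) W_gbd) be_gbd). Qed.

Let rest_ge0 : 0 <= K1 * Int (@gauss1 R (4^-1 / 2)) /\ 0 <= K3 * Int (@gauss1 R (4^-1 / 2 / 2)).
Proof. by split; [exact: mulr_ge0 K1_ge0 g8|exact: mulr_ge0 K3_ge0 g16]. Qed.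

Lemma site_be_Int : Int (fun t => `|site_be t|) <= site_const.
Proof.
have [h1 h2] := rest_ge0.
by apply: le_trans (Int_gbd c8 site_be_gb1 be_gbd) _; rewrite lerDl.
Qed.

Lemma site_ga1_dv t : dv site_ga1 t (site_F t * site_r t).
Proof. exact: (prim_dv t c4 (proj1 F_gb1) F_gbd). Qed.

Lemma site_F_gb1 : gb1 (fun t => site_F t * site_r t).
Proof. exact: F_gb1. Qed.

Let ga1_gbd : gbd1 site_ga1 K2 (4^-1 / 2).
Proof.
exact: (prim_decay c4 A14 (proj1 F_gb1) F_gbd F_int0).
Qed.

Lemma site_ga1_gb1 : gb1 site_ga1.
Proof. exact: (gb1_mk c8 K2_ge0 (prim_cont c4 (proj1 F_gb1) F_gbd) ga1_gbd). Qed.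

(** Integration by parts against [t - site_mean] turns the first moment of [site_F * site_r] into
    minus the mean of its primitive; hence [prim_decay] applies a second time. *)
Let ga1_int0 : Int site_ga1 = 0.
Proof.
have gi : gb1 (fun t => (t - site_mean) * site_ga1 t).
  have -> : (fun t => (t - site_mean) * site_ga1 t) =
    (fun t => 1 * (t * site_ga1 t) + (- site_mean) * site_ga1 t) by apply/funext => t; ring.
  apply: gb1_lin; last by apply: gb1Z; exact: site_ga1_gb1.
  apply: gb_gb1; apply: gb_mul_sg; first exact: gb1_gb site_ga1_gb1.
  exact: sg_coord.
have gg := site_ga1_gb1.
have := @Int_dv0 (fun t => (t - site_mean) * site_ga1 t)
  (fun t => 1 * site_ga1 t + (t - site_mean) * (site_F t * site_r t)) gi.
rewrite Int_linG// F_tm_int0 addr0 mul1r; apply; first exact: gb1_lin.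
move=> t; have := dvM (dvD (dv_id t) (dv_cst (- site_mean) t)) (site_ga1_dv t) => H; apply: (dv_eq H).
by rewrite addr0.
Qed.

Lemma site_ga_dv t : dv site_ga t (site_ga1 t).
Proof. exact: (prim_dv t c8 (proj1 site_ga1_gb1) ga1_gbd). Qed.

Let ga_gbd : gbd1 site_ga K3 (4^-1 / 2 / 2).
Proof. exact: (prim_decay c8 K2_ge0 (proj1 site_ga1_gb1) ga1_gbd ga1_int0). Qed.

Lemma site_ga_gb1 : gb1 site_ga.
Proof. exact: (gb1_mk c16 K3_ge0 (prim_cont c8 (proj1 site_ga1_gb1) ga1_gbd) ga_gbd). Qed.

Lemma site_ga_Int : Int (fun t => `|site_ga t|) <= site_const.
Proof.
have [h1 h2] := rest_ge0.
by apply: le_trans (Int_gbd c16 site_ga_gb1 ga_gbd) _; rewrite lerDr.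
Qed.

Lemma site_sqr_gb1 m : gb1 (fun t => (t - m) ^+ 2 * site_r t).
Proof. exact: sqrr. Qed.

Lemma site_id_gb1 : gb1 (fun t => t * site_r t).
Proof. exact: idr. Qed.

End one_site.

(** The section-local bound [M1] on the variance, in a form available outside the section. *)
Definition var_max (b0 : R) : R := expR (2 * b0) / Int (gauss1 2^-1) * 4 * Int (gauss1 4^-1).

End one_dim.

(** * Tilted one-site measures *)

Section minimum.
Context {R : realType}.

Lemma incr_cvg (f : nat -> nat) : increasing_seq f -> f @ \oo --> \oo.
Proof.
move=> fi; have h k : (k <= f k)%N.
  elim: k => // k IH; apply: leq_ltn_trans IH _.
  by rewrite ltnNge -leEnat fi -ltnNge.
move=> A [N _ NA]; exists N => // k Nk; apply: NA; exact: leq_trans Nk (h k).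
Qed.

Lemma bounded_subseq n (u : nat -> 'rV[R]_n) (M : R) : (forall k i, `|u k 0 i| <= M) ->
  exists2 f : nat -> nat, increasing_seq f & exists x, vcvg (u \o f) x.
Proof.
move=> uM.
have H s : exists2 f : nat -> nat, increasing_seq f &
    forall i : 'I_n, (i < s)%N -> cvgn (fun k => u (f k) 0 i).
  elim: s => [|s [f fi Hf]]; first by exists id.
  have [sn|ns] := ltnP s n; last first.
    exists f => // i _; apply: Hf; exact: leq_trans (ltn_ord i) ns.
  have bu : bounded_fun (fun k => u (f k) 0 (Ordinal sn)).
    by exists M; split; [exact: num_real|move=> e Me x _; exact: le_trans (uM _ _) (ltW Me)].
  have [g gi Hg] := bolzano_weierstrass bu.
  exists (f \o g) => [x y|i]; first by rewrite /= fi -leEnat gi.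
  rewrite ltnS leq_eqVlt => /predU1P[is_|/Hf fc].
    by rewrite (_ : i = Ordinal sn)//; exact/val_inj.
  apply/cvg_ex; exists (limn (fun k => u (f k) 0 i)).
  exact: (cvg_comp _ _ (incr_cvg gi) fc).
have [f fi Hf] := H n; exists f => //; exists (\row_i limn (fun k => u (f k) 0 i)) => i.
by rewrite mxE; apply: Hf.
Qed.

(** Direct method: coercivity bounds a minimising sequence, and a subsequence converges in every
    coordinate. *)
Lemma scont_min n (f : 'rV[R]_n -> R) (k C : R) : scont f -> 0 < k ->
  (forall x, k * sqn x - C <= f x) -> exists x0, forall x, f x0 <= f x.
Proof.
move=> cf k0 fC; pose S := range f.
have S0 : S !=set0 by exists (f 0), 0.
have lS : has_lbound S.
  exists (- C) => _ [x _ <-]; apply: le_trans (fC x).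
  by rewrite lerBrDr addNr mulr_ge0 ?sqn_ge0// ltW.
have hS : has_inf S by split.
have /choice[u Hu] : forall j : nat, exists x, f x < inf S + j.+1%:R^-1.
  move=> j; have j0 : (0 : R) < j.+1%:R^-1 by rewrite invr_gt0.
  by have [_ [x _ <-] fx] := inf_adherent j0 hS; exists x.
pose Mb := (inf S + 1 + C) / k.
have uM j i : `|u j 0 i| <= 1 + Mb.
  have h : sqn (u j) <= Mb.
    rewrite ler_pdivlMr// mulrC -lerBlDr; apply: le_trans (fC _) (le_trans (ltW (Hu j)) _).
    by rewrite lerD2l invf_le1// ler1n.
  have := le_trans (coord_sqn (u j) i) h; have := norm_quad (u j 0 i); lra.
have [g gi [x0 gx]] := bounded_subseq uM.
exists x0 => x; have h1 := cf _ _ gx.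
have h2 : f x0 <= inf S.
  have h3 : (fun j => inf S + (g j).+1%:R^-1) @ \oo --> inf S.
    rewrite -[X in _ --> X]addr0; apply: cvgD; first exact: cvg_cst.
    have hh : (fun j : nat => (j.+1%:R^-1 : R)) @ \oo --> (0 : R) by exact: cvg_harmonic.
    exact: (cvg_comp _ _ (incr_cvg gi) hh).
  apply: (ler_cvg_to h1 h3); near=> j; exact: ltW (Hu _).
by apply: le_trans h2 _; apply: ge_inf => //; exists x.
Unshelve. all: by end_near.
Qed.

Lemma min_dv (f : R -> R) (l : R) : dv f 0 l -> (forall t, f 0 <= f t) -> l = 0.
Proof.
move=> /dv_seqP df fm; apply/eqP; rewrite eq_le; apply/andP; split.
  have h : (fun k : nat => - (k.+1%:R^-1 : R)) @ \oo --> (0 : R).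
    by rewrite -[0]oppr0; apply: cvgN; exact: cvg_harmonic.
  have nz (k : nat) : - (k.+1%:R^-1 : R) != 0 by rewrite oppr_eq0 invr_eq0.
  apply: (@seq_lim_le _ _ _ _ (df _ nz h)) => k.
  by rewrite add0r invrN mulrN -mulNr invrK mulr_le0_ge0// oppr_le0 subr_ge0.
have h : (fun k : nat => (k.+1%:R^-1 : R)) @ \oo --> (0 : R) by exact: cvg_harmonic.
have nz (k : nat) : (k.+1%:R^-1 : R) != 0 by rewrite invr_eq0.
apply: (@seq_lim_ge _ _ _ _ (df _ nz h)) => k.
by rewrite add0r invrK mulr_ge0// subr_ge0.
Qed.

End minimum.

(** * Log-Laplace transforms and tilted means *)

Section tilt.
Context {R : realType}.
Variables (de de1 : R -> R) (b0 : R).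
Hypothesis de_dv : forall t, dv de t (de1 t).
Hypothesis de_le : forall t, `|de t| <= b0.

Definition sh (f : R -> R) c t := f (t + c).

Lemma sh_dv f f' c t : (forall t, dv f t (f' t)) -> dv (sh f c) t (sh f' c t).
Proof. by move=> df; apply: dv_shift; exact: df. Qed.

Definition tilt_Z c := Int (fun x => expR (c * x) * weight de x).

Lemma tilt_weight c x : expR (c * x) * weight de x = expR (c ^+ 2 / 2) * weight (sh de c) (x - c).
Proof.
rewrite /weight /sh subrK /gauss1 mulrCA [RHS]mulrCA; congr (_ * _).
by rewrite -!expRD; congr expR; field.
Qed.

Lemma tilt_gb1 c : gb1 (fun x => expR (c * x) * weight de x).
Proof.
under eq_fun do rewrite tilt_weight; apply: gb1Z; apply: gb1_shift.
by apply: (@weight_gb1 _ _ (sh de1 c) b0) => t; [exact: sh_dv|exact: de_le].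
Qed.

Lemma tilt_ZE c : tilt_Z c = expR (c ^+ 2 / 2) * site_Z (sh de c).
Proof.
have gw : gb1 (weight (sh de c)).
  by apply: (@weight_gb1 _ _ (sh de1 c) b0) => t; [exact: sh_dv|exact: de_le].
rewrite /tilt_Z; under eq_fun do rewrite tilt_weight.
rewrite Int_Z; last exact: gb1_shift.
by rewrite (Int_shiftG (- c) gw).
Qed.

Lemma tilt_Z_gt0 c : 0 < tilt_Z c.
Proof. by apply: Int_pos (tilt_gb1 c) _ => t; rewrite mulr_gt0 ?expR_gt0// mulr_gt0 ?expR_gt0. Qed.

Lemma tilt_Z_ge c : c ^+ 2 / 2 - b0 + ln (Int (@gauss1 R 2^-1)) <= ln (tilt_Z c).
Proof.
have G0 : 0 < Int (@gauss1 R 2^-1) by apply: gauss_int_gt0.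
rewrite -[c ^+ 2 / 2 - b0]expRK -lnM ?posrE ?expR_gt0//.
rewrite ler_ln ?posrE ?mulr_gt0 ?expR_gt0 ?tilt_Z_gt0// tilt_ZE expRD -mulrA ler_wpM2l ?expR_ge0//.
have := @site_Z_bounds _ (sh de c) (sh de1 c) b0.
by move=> /(_ (fun t => sh_dv c t de_dv) (fun t => de_le _)) /andP[].
Qed.

(* Completing the square, tilting by [exp (c x)] amounts to shifting [de] by [c]. *)
Definition tilt_p c x := site_r (sh de c) (x - c).

Lemma tilt_pE c x : tilt_p c x = expR (c * x) * weight de x / tilt_Z c.
Proof.
rewrite tilt_weight tilt_ZE /tilt_p /site_r -mulf_div divff ?mul1r//.
by rewrite gt_eqF// expR_gt0.
Qed.

Lemma tilt_Z_dv c : dv tilt_Z c (Int (fun x => x * (expR (c * x) * weight de x))).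
Proof.
pose k := `|c| + 1; have k0 : 0 <= k by rewrite addr_ge0.
(* The coefficient 1/2 of the Gaussian exponent is split: 1/8 absorbs the tilt, 1/8 absorbs the
   factor [x] of the derivative, and 1/4 remains as the dominating Gaussian. *)
have Hb (t x : R) : `|t - c| <= 1 -> expR (t * x) * weight de x <=
    expR b0 * expR (4 * k ^+ 2) * (expR (- (4^-1 * x ^+ 2)) * expR (- (8^-1 * x ^+ 2))).
  move=> tc; have tk : `|t| <= k.
    rewrite -[t](subrK c) addrC; apply: le_trans (ler_normD _ _) _; by rewrite lerD2l.
  have := de_le x; rewrite ler_norml => /andP[d1 _].
  rewrite /weight /gauss1 -!expRD ler_expR.
  have h : t * x <= k * `|x|.
    by apply: le_trans (ler_norm _) _; rewrite normrM ler_wpM2r.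
  rewrite -(@real_normK _ x) ?num_real//; have := sqr_ge0 (`|x| - 4 * k); have := sqr_ge0 k; lra.
have xb (x : R) : (1 + x ^+ 2) * expR (- (8^-1 * x ^+ 2)) <= 8.
  rewrite expRN ler_pdivrMr ?expR_gt0//.
  by have := expR_ge1Dx (8^-1 * x ^+ 2); have := sqr_ge0 x; lra.
pose C := expR b0 * expR (4 * k ^+ 2) * 8.
have C0 : 0 <= C by rewrite !mulr_ge0 ?expR_ge0.
have Hb2 (t x f : R) : `|t - c| <= 1 -> `|f| <= 1 + x ^+ 2 ->
    `|f * (expR (t * x) * weight de x)| <= C * expR (- (4^-1 * x ^+ 2)).
  move=> tc fx; have w0 : 0 <= expR (t * x) * weight de x.
    by rewrite mulr_ge0 ?expR_ge0// mulr_ge0 ?expR_ge0.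
  rewrite normrM (ger0_norm w0).
  apply: le_trans (ler_pM (normr_ge0 _) w0 fx (Hb t x tc)) _.
  rewrite /C [leLHS](_ : _ = expR b0 * expR (4 * k ^+ 2) * ((1 + x ^+ 2) * expR (- (8^-1 * x ^+ 2))) * expR (- (4^-1 * x ^+ 2))); last ring.
  by rewrite ler_wpM2r ?expR_ge0// ler_wpM2l// mulr_ge0 ?expR_ge0.
have q0 : (0 : R) < 4^-1 by rewrite invr_gt0.
have := @int_dv _ 1 _ (isInt_J 1) (fun t (x : 'rV[R]_1) => expR (t * x 0 0) * weight de (x 0 0))
  (fun t (x : 'rV[R]_1) => x 0 0 * (expR (t * x 0 0) * weight de (x 0 0))) c C 4^-1 q0 C0.
rewrite -(Int_J1 (fun x => x * (expR (c * x) * weight de x))).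
have -> : (fun t => J (fun x : 'rV[R]_1 => expR (t * x 0 0) * weight de (x 0 0))) = tilt_Z.
  by apply/funext => t; rewrite /tilt_Z Int_J1.
apply.
- by move=> t _; have [] := gb1_gb (tilt_gb1 t).
- move=> t tc x; rewrite /sqn big_ord1 -[expR _ * _]mul1r; apply: Hb2 => //.
  by rewrite normr1 lerDl sqr_ge0.
- by apply: scontM; [exact: scont_coord|have [] := gb1_gb (tilt_gb1 c)].
- move=> t x _; have := dvM (dv_expR (dvM (dv_id t) (dv_cst (x 0 0) t))) (dv_cst (weight de (x 0 0)) t).
  by move=> H; apply: (dv_eq H); ring.
- by move=> t tc x; rewrite /sqn big_ord1; apply: Hb2 => //; exact: norm_quad.
Qed.

Definition tilt_mean c := c + site_mean (sh de c).

Lemma tilt_mean_eq c : Int (fun x => x * tilt_p c x) = tilt_mean c.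
Proof.
have h1 : gb1 (site_r (sh de c)).
  by apply: (@site_r_gb1 _ _ (sh de1 c) b0) => t; [exact: sh_dv|exact: de_le].
have h2 : gb1 (fun t => t * site_r (sh de c) t).
  by apply: (@site_id_gb1 _ _ (sh de1 c) b0) => t; [exact: sh_dv|exact: de_le].
have -> : (fun x => x * tilt_p c x) =
  (fun x => (fun t => c * site_r (sh de c) t + t * site_r (sh de c) t) (x - c)).
  by apply/funext => x; rewrite /tilt_p; ring.
rewrite (Int_shiftG (- c) (gb1_lin c h1 h2)) Int_linG// (_ : Int _ = 1) ?mulr1//.
by apply: (@site_r_int _ _ (sh de1 c) b0) => t; [exact: sh_dv|exact: de_le].
Qed.

Lemma ln_tilt_dv c : dv (fun c => ln (tilt_Z c)) c (tilt_mean c).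
Proof.
apply: (dv_eq (dv_ln (tilt_Z_gt0 c) (tilt_Z_dv c))).
rewrite -tilt_mean_eq; under [in RHS]eq_fun do rewrite tilt_pE mulrA mulrC.
rewrite Int_Z 1?mulrC//.
have h2 : gb1 (fun t => t * site_r (sh de c) t).
  by apply: (@site_id_gb1 _ _ (sh de1 c) b0) => t; [exact: sh_dv|exact: de_le].
apply: gb_gb1; apply: gb_mul_sg (gb1_gb (tilt_gb1 c)) _; exact: sg_coord.
Qed.

(** Tilted means with prescribed moments come from convex duality: [s] minimises [f], the sum of the
    log-Laplace transforms minus the linear functional given by [y], and the vanishing of its
    gradient is the equation. Coercivity holds because [ln (tilt_Z c)] grows like [c ^+ 2 / 2] and
    the Gram bound makes the weights [xe E s k] grow with [s]. *)
Lemma tilt_exists n D (E : 'M[R]_(n, D)) (cG aa : R) (y : 'rV[R]_n) : 0 < cG ->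
  (forall xi, cG * sqn xi <= \sum_k xe E xi k ^+ 2) ->
  exists s : 'rV[R]_D, \row_k tilt_mean (xe E s k - aa) *m E = y *m E.
Proof.
move=> cG0 HG.
pose f (s : 'rV[R]_D) := \sum_k (ln (tilt_Z (xe E s k - aa)) - (xe E s k - aa) * y 0 k).
pose g0 := ln (Int (@gauss1 R 2^-1)) - b0.
have fge s : cG / 8 * sqn s - \sum_k (aa ^+ 2 / 4 + y 0 k ^+ 2 - g0) <= f s.
  apply: (@le_trans _ _ (\sum_k (xe E s k ^+ 2 / 8 - (aa ^+ 2 / 4 + y 0 k ^+ 2 - g0)))).
    rewrite [leRHS]sumrB lerD2r -mulr_suml mulrAC ler_pM2r ?invr_gt0//; exact: HG.
  apply: ler_sum => k _; have := tilt_Z_ge (xe E s k - aa); rewrite /g0.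
  set e := xe _ _ _; set Y := y 0 k.
  have := sqr_ge0 ((e - aa) / 2 - Y); have := sqr_ge0 (e - 2 * aa); lra.
have xe_cont k : scont (fun s => xe E s k).
  by apply: scont_sum => d _; apply: scontM; [exact: scont_cst|exact: scont_coord].
have cf : scont f.
  apply: scont_sum => k _.
  have ck : continuous (fun c => ln (tilt_Z c) - c * y 0 k).
    move=> c; apply: (@dv_continuous _ _ _ (tilt_mean c - (1 * y 0 k + c * 0))).
    apply: dvD; first exact: ln_tilt_dv.
    by apply: dvN; apply: dvM; [exact: dv_id|exact: dv_cst].
  apply: (@scont_comp _ _ (fun s => xe E s k - aa) (fun c => ln (tilt_Z c) - c * y 0 k) ck).
  by apply: scontD; [exact: xe_cont|exact: scont_cst].
have [s0 fmin] := scont_min cf (divr_gt0 cG0 (ltr0n _ 8)) fge.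
exists s0; apply/rowP => d.
pose e : 'rV[R]_D := delta_mx 0 d.
have xeD k t : xe E (s0 + t *: e) k = xe E s0 k + t * E k d.
  rewrite /xe [X in _ = _ + t * X](_ : _ = \sum_d' E k d' * e 0 d'); last first.
    rewrite (bigD1 d)//= big1 => [|d' dd]; first by rewrite /e mxE !eqxx mulr1 addr0.
    by rewrite /e mxE (negbTE dd) andbF mulr0.
  rewrite mulr_sumr -big_split; apply: eq_bigr => d' _ /=.
  by rewrite mxE [(t *: e) _ _]mxE; ring.
have df : dv (fun t => f (s0 + t *: e)) 0 (\sum_k (tilt_mean (xe E s0 k - aa) - y 0 k) * E k d).
  apply: dv_sum => k _; under eq_fun do rewrite xeD.
  have d1 : dv (fun t => xe E s0 k + t * E k d - aa) 0 (E k d).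
    have := dvD (dvD (dv_cst (xe E s0 k) 0) (dvM (dv_id 0) (dv_cst (E k d) 0))) (dv_cst (- aa) 0).
    by move=> H; apply: (dv_eq H); ring.
  have e0 : xe E s0 k + 0 * E k d - aa = xe E s0 k - aa by rewrite mul0r addr0.
  have d2 := @dv_comp _ (fun c => ln (tilt_Z c)) (fun t => xe E s0 k + t * E k d - aa) 0
    (tilt_mean (xe E s0 k - aa)) (E k d).
  rewrite e0 in d2; have d3 := d2 (ln_tilt_dv _) d1.
  apply: (dv_eq (dvD d3 (dvN (dvM d1 (dv_cst (y 0 k) 0))))); ring.
have := min_dv df; rewrite scale0r addr0 => /(_ (fun t => fmin _)) H.
rewrite !mxE; apply/eqP; rewrite -subr_eq0 -sumrB -[X in _ == X]H; apply/eqP.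
by apply: eq_bigr => k _; rewrite mxE mulrBl.
Qed.

End tilt.

(** * Log-concavity of the fiber integral of a cell *)

Section tilted_site.
Context {R : realType}.
Variables (de de1 de2 : R -> R) (b0 b1 b2 : R).
Hypothesis de_dv : forall t, dv de t (de1 t).
Hypothesis de1_dv : forall t, dv de1 t (de2 t).
Hypothesis de2_cont : continuous de2.
Hypothesis de_le : forall t, `|de t| <= b0.
Hypothesis de1_le : forall t, `|de1 t| <= b1.
Hypothesis de2_le : forall t, `|de2 t| <= b2.
Variable c : R.

Let d0 t : dv (sh de c) t (sh de1 c t). Proof. exact: sh_dv. Qed.
Let d1 t : dv (sh de1 c) t (sh de2 c t). Proof. exact: sh_dv. Qed.
Let l0 t : `|sh de c t| <= b0. Proof. exact: de_le. Qed.
Let l1 t : `|sh de1 c t| <= b1. Proof. exact: de1_le. Qed.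
Let l2 t : `|sh de2 c t| <= b2. Proof. exact: de2_le. Qed.
Let c2 : continuous (sh de2 c).
Proof.
move=> t; apply: (@continuous_comp _ _ _ (fun t => t + c) de2); last exact: de2_cont.
by apply: cvgD; [exact: cvg_id|exact: cvg_cst].
Qed.

Definition tilt_th t := t - c + de1 t.
Definition tilt_var := site_var (sh de c).
Definition tilt_F t := tilt_var * tilt_th t - (t - tilt_mean de c).
Definition tilt_be t := site_be (sh de c) (sh de1 c) (sh de2 c) (t - c).
Definition tilt_ga t := site_ga (sh de c) (sh de1 c) (t - c).
Definition tilt_ga1 t := site_ga1 (sh de c) (sh de1 c) (t - c).

Let FE t : tilt_F t = site_F (sh de c) (sh de1 c) (t - c).
Proof. have e : sh de1 c (t - c) = de1 t by rewrite /sh subrK.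
by rewrite /tilt_F /tilt_var /site_F /tilt_mean /tilt_th /site_th e; ring. Qed.

Let WE t : tilt_var ^+ 2 * (1 + de2 t) - tilt_F t ^+ 2 - tilt_var =
  site_W (sh de c) (sh de1 c) (sh de2 c) (t - c).
Proof. by rewrite FE /site_W /sh subrK. Qed.

Lemma tilt_p_gt0 t : 0 < tilt_p de c t.
Proof. exact: (site_r_gt0 d0 l0). Qed.

Lemma tilt_p_gb1 : gb1 (tilt_p de c).
Proof. exact: (gb1_shift (- c) (site_r_gb1 d0 l0)). Qed.

Lemma tilt_p_int : Int (tilt_p de c) = 1.
Proof. by rewrite (Int_shiftG (- c) (site_r_gb1 d0 l0)) (site_r_int d0 l0). Qed.

Lemma tilt_p_dv t : dv (tilt_p de c) t (- (tilt_th t * tilt_p de c t)).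
Proof.
apply: (dv_eq (dv_shift (b := - c) (site_r_dv d0 (t - c)))).
by rewrite /tilt_th /site_th /sh subrK.
Qed.

Lemma tilt_th_dv t : dv tilt_th t (1 + de2 t).
Proof.
apply: (dv_eq (dvD (dvD (dv_id t) (dv_cst (- c) t)) (de1_dv t))); by rewrite addr0.
Qed.

Lemma tilt_var_bounds : expR (- (2 * b0)) <= tilt_var <= var_max b0.
Proof. by rewrite (site_var_ge d0 l0) (site_var_le d0 l0). Qed.

Lemma tilt_be_gb1 : gb1 tilt_be.
Proof. exact: (gb1_shift (- c) (site_be_gb1 d0 d1 c2 l0 l1 l2)). Qed.

Lemma tilt_W_gb1 : gb1 (fun t => (tilt_var ^+ 2 * (1 + de2 t) - tilt_F t ^+ 2 - tilt_var) * tilt_p de c t).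
Proof.
by under eq_fun do rewrite WE; exact: (gb1_shift (- c) (site_W_gb1 d0 d1 c2 l0 l1 l2)).
Qed.

Lemma tilt_be_dv t :
  dv tilt_be t ((tilt_var ^+ 2 * (1 + de2 t) - tilt_F t ^+ 2 - tilt_var) * tilt_p de c t).
Proof.
by rewrite WE; exact: (dv_shift (b := - c) (site_be_dv d0 d1 c2 l0 l1 l2 (t - c))).
Qed.

Lemma tilt_be_Int : Int (fun t => `|tilt_be t|) <= site_const b0 b1 b2.
Proof.
rewrite (Int_shiftG (- c) (gb1_norm (site_be_gb1 d0 d1 c2 l0 l1 l2))).
exact: (site_be_Int d0 d1 c2 l0 l1 l2).
Qed.

Lemma tilt_F_gb1 : gb1 (fun t => tilt_F t * tilt_p de c t).
Proof.
by under eq_fun do rewrite FE; exact: (gb1_shift (- c) (site_F_gb1 d0 d1 l0 l1)).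
Qed.

Lemma tilt_ga1_gb1 : gb1 tilt_ga1.
Proof. exact: (gb1_shift (- c) (site_ga1_gb1 d0 d1 l0 l1)). Qed.

Lemma tilt_ga1_dv t : dv tilt_ga1 t (tilt_F t * tilt_p de c t).
Proof. by rewrite FE; exact: (dv_shift (b := - c) (site_ga1_dv d0 d1 l0 l1 (t - c))). Qed.

Lemma tilt_ga_gb1 : gb1 tilt_ga.
Proof. exact: (gb1_shift (- c) (site_ga_gb1 d0 d1 l0 l1)). Qed.

Lemma tilt_ga_dv t : dv tilt_ga t (tilt_ga1 t).
Proof. exact: (dv_shift (b := - c) (site_ga_dv d0 d1 l0 l1 (t - c))). Qed.

Lemma tilt_ga_Int : Int (fun t => `|tilt_ga t|) <= site_const b0 b1 b2.
Proof.
rewrite (Int_shiftG (- c) (gb1_norm (site_ga_gb1 d0 d1 l0 l1))).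
exact: (site_ga_Int d0 d1 l0 l1 l2).
Qed.

Let id_p : gb1 (fun t => t * tilt_p de c t).
Proof.
apply: gb_gb1; apply: gb_mul_sg; first exact: gb1_gb tilt_p_gb1.
exact: sg_coord.
Qed.

Lemma tilt_centered_gb1 : gb1 (fun t => (t - tilt_mean de c) * tilt_p de c t).
Proof.
have -> : (fun t => (t - tilt_mean de c) * tilt_p de c t) =
  (fun t => (- tilt_mean de c) * tilt_p de c t + t * tilt_p de c t).
  by apply/funext => t; ring.
exact: gb1_lin tilt_p_gb1 id_p.
Qed.

Lemma tilt_centered_int : Int (fun t => (t - tilt_mean de c) * tilt_p de c t) = 0.
Proof.
have -> : (fun t => (t - tilt_mean de c) * tilt_p de c t) =
  (fun t => (- tilt_mean de c) * tilt_p de c t + t * tilt_p de c t).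
  by apply/funext => t; ring.
by rewrite Int_linG//; [rewrite (tilt_mean_eq de_dv de_le) tilt_p_int; ring|exact: tilt_p_gb1].
Qed.

Lemma tilt_sqr_gb1 : gb1 (fun t => (t - tilt_mean de c) ^+ 2 * tilt_p de c t).
Proof.
have := gb1_shift (- c) (site_sqr_gb1 d0 l0 (site_mean (sh de c))).
congr gb1; apply/funext => t; congr (_ ^+ 2 * _); rewrite /tilt_mean; ring.
Qed.

Lemma tilt_varE : Int (fun t => (t - tilt_mean de c) ^+ 2 * tilt_p de c t) = tilt_var.
Proof.
rewrite -[RHS](Int_shiftG (- c) (site_sqr_gb1 d0 l0 (site_mean (sh de c)))).
by congr Int; apply/funext => t; congr (_ ^+ 2 * _); rewrite /tilt_mean; ring.
Qed.

End tilted_site.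

(** The second derivative of [ln G] is at most [- k]; integrated twice, this makes
    [ln (G s) + ln (G (- s)) + k * s ^+ 2] nonincreasing for [s >= 0]. *)
Lemma log_concave_midpoint {R : realType} (G G1 G2 : R -> R) (k : R) :
  (forall t, 0 < G t) -> (forall t, dv G t (G1 t)) -> (forall t, dv G1 t (G2 t)) ->
  (forall t, G2 t * G t - G1 t ^+ 2 <= - k * G t ^+ 2) ->
  forall t, G t * G (- t) * expR (k * t ^+ 2) <= G 0 ^+ 2.
Proof.
move=> G0 dG dG1 H t.
wlog t0 : t / 0 <= t => [W|].
  have [|t0] := leP 0 t; first exact: W.
  have := W (- t); rewrite opprK sqrrN [G (- t) * _]mulrC; apply; by rewrite oppr_ge0 ltW.
pose q t := G1 t / G t.
have dq s : dv q s ((G2 s * G s - G1 s ^+ 2) / G s ^+ 2).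
  have Gs : G s != 0 by rewrite gt_eqF.
  apply: (dv_eq (dvM (dG1 s) (dvV Gs (dG s)))); by field.
have dl s : dv (fun s => ln (G s)) s (q s) by apply: dv_ln.
pose phi s := ln (G s) + ln (G (- s)) + k * s ^+ 2.
pose phi1 s := q s - q (- s) + 2 * k * s.
have dm s : dv (fun s : R => - s) s (- 1) by exact: dvN (dv_id s).
have dphi s : dv phi s (phi1 s).
  apply: (dv_eq (dvD (dvD (dl s) (dv_comp (dl (- s)) (dm s))) (dvZ k (dvM (dv_id s) (dv_id s))))).
  by rewrite /phi1; ring.
have phi1_le s : 0 <= s -> phi1 s <= 0.
  move=> s0; have := @dv_le _ q _ (- s) s (- k) _ (fun u _ => dq u).
  have ss : - s <= s by lra.
  have qk u : - s <= u <= s -> (G2 u * G u - G1 u ^+ 2) / G u ^+ 2 <= - k.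
    by move=> _; rewrite ler_pdivrMr ?exprn_gt0.
  by move=> /(_ ss qk); rewrite /phi1; lra.
have := @dv_le _ phi phi1 0 t 0 t0 (fun u _ => dphi u).
have h u : 0 <= u <= t -> phi1 u <= 0 by move=> /andP[u0 _]; exact: phi1_le.
move=> /(_ h); rewrite mul0r subr_le0 /phi oppr0 expr0n mulr0 addr0 => L.
rewrite -ler_ln ?posrE ?mulr_gt0 ?expR_gt0 ?exprn_gt0//.
by rewrite !lnM ?posrE ?mulr_gt0 ?expR_gt0// expRK.
Qed.

Section cell.
Context {R : realType}.
Variables (de de1 de2 : R -> R) (b0 b1 b2 aa : R).
Hypothesis de_dv : forall t, dv de t (de1 t).
Hypothesis de1_dv : forall t, dv de1 t (de2 t).
Hypothesis de2_cont : continuous de2.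
Hypothesis de_le : forall t, `|de t| <= b0.
Hypothesis de1_le : forall t, `|de1 t| <= b1.
Hypothesis de2_le : forall t, `|de2 t| <= b2.
Variables (n D q : nat).
Variables (E : 'M[R]_(n, D)) (B : 'M[R]_(q, n)) (B' : 'M[R]_(n, q)).
Hypothesis BE : B *m E = 0.
Hypothesis BB' : B *m B' = 1%:M.
Hypothesis kerE : forall u : 'rV[R]_n, u *m E = 0 -> u *m B' *m B = u.
Variables (cls : 'I_n -> nat) (A : nat -> 'M[R]_(D, n)) (C1 : R).
Hypothesis AE : forall r, (r < D + 6)%N -> A r *m E = 1%:M.
Hypothesis A_cls : forall r i k, A r i k != 0 -> cls k = r.
Hypothesis A_frob : forall r, (r < D + 6)%N -> frob (A r) <= C1.
Hypothesis C1_ge0 : 0 <= C1.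
Variables (kap cG CE : R).
Hypothesis kap_gt0 : 0 < kap.
Hypothesis E_row : forall j, sqn (row j E) <= kap ^+ 2.
Hypothesis kapE : n%:R * kap ^+ 2 <= CE.
Hypothesis cG_gt0 : 0 < cG.
Hypothesis gram : forall xi : 'rV[R]_D, cG * sqn xi <= \sum_k xe E xi k ^+ 2.

Definition site_dens (t : R) : R := expR (- (t ^+ 2 / 2 + aa * t + de t)).

Let Ch := 1 + b2.
Let Cv := @var_max R b0.
Let CS := CE * Cv.
Let cv := expR (- (2 * b0)).
Let Cb := site_const b0 b1 b2.

(* Bounds the relative error in the Hessian of [ln cell_g]; [kap] is of order
   [K^(-1/2)]. *)
Definition cell_err : R := kap * (Ufac D Ch C1 1 / low_const D Ch C1 CS * Cb)
  + kap ^+ 2 * CE * (Ufac D Ch C1 4 / low_const D Ch C1 CS * (Cb * Cb)).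

Hypothesis small : cell_err <= cv / 2.

Let b2_ge0 : 0 <= b2. Proof. exact: le_trans (de2_le 0). Qed.
Let Ch0 : 0 <= Ch. Proof. by rewrite addr_ge0. Qed.
Let CE0 : 0 <= CE. Proof. by apply: le_trans kapE; rewrite mulr_ge0 ?sqr_ge0. Qed.
Let cv0 : 0 < cv. Proof. exact: expR_gt0. Qed.
Let Cv0 : 0 < Cv.
Proof. by have /andP[] := tilt_var_bounds de_dv de_le 0; move=> h1 /(le_trans h1); exact: lt_le_trans. Qed.

Let Jq := isInt_J (R := R) q.
Let Jn := isInt_J (R := R) n.

Definition cell_th (t : R) : R := t + aa + de1 t.

Let P0 := Pi (fun (_ : 'I_n) => site_dens).
Let th0 := fun (_ : 'I_n) => cell_th.

Lemma frobE_le : frob E <= CE.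
Proof.
apply: le_trans kapE; rewrite frobE mulr_natl -[X in _ *+ X]card_ord -sumr_const.
by apply: ler_sum => k _; exact: E_row.
Qed.

Lemma fib_ker (y y' : 'rV[R]_n) f : gb f -> y *m E = y' *m E -> fib B y f = fib B y' f.
Proof.
move=> gf yE; have e : (y' - y) *m E = 0 by rewrite mulmxBl yE subrr.
rewrite /fib -(int_tr Jq ((y' - y) *m B')); last exact: (fib_gbw BB').
congr J; apply/funext => w; congr f; rewrite mulmxDl (kerE e).
by rewrite addrCA [y + _]addrC subrK addrC.
Qed.

Lemma dens_gb1 : gb1 site_dens.
Proof.
have := tilt_gb1 de_dv de_le (- aa); congr gb1; apply/funext => t.
by rewrite /site_dens /weight /gauss1 -!expRD; congr expR; field.
Qed.

Lemma site_dens_dv t : dv site_dens t (- (cell_th t * site_dens t)).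
Proof.
have H := dv_expR (dvN (dvD (dvD (dvM (dvM (dv_id t) (dv_id t)) (dv_cst 2^-1 t)) (dvZ aa (dv_id t))) (de_dv t))).
have -> : site_dens = (fun t => expR (- (t * t / 2 + aa * t + de t))).
  by apply/funext => s; rewrite /site_dens expr2.
by apply: (dv_eq H); rewrite /cell_th; field.
Qed.

Lemma cell_th_dv t : dv cell_th t (1 + de2 t).
Proof. apply: (dv_eq (dvD (dvD (dv_id t) (dv_cst aa t)) (de1_dv t))); by rewrite addr0. Qed.

Let h_le (t : R) : `|1 + de2 t| <= Ch.
Proof. by apply: le_trans (ler_normD _ _) _; rewrite normr1 lerD2l. Qed.

Let h_cont : continuous (fun t => 1 + de2 t).
Proof. by move=> t; apply: cvgD; [exact: cvg_cst|exact: de2_cont]. Qed.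

Let P0_gb : gb P0. Proof. by apply: gb_Pi => _; exact: dens_gb1. Qed.

Definition cell_g y := fib B y P0.

Let P0_gt0 x : 0 < P0 x.
Proof. by apply: prodr_gt0 => k _; exact: expR_gt0. Qed.

Lemma cell_g_gt0 y : 0 < cell_g y.
Proof. by apply: J_gt0 => [|w]; [exact: (fib_gbw BB')|exact: P0_gt0]. Qed.

Let hq (a x : 'rV[R]_n) := \sum_k a 0 k ^+ 2 * (1 + de2 (x 0 k)).
Let r0 (a : 'rV[R]_n) := rho th0 a.

Let r0_sg a : sg (r0 a).
Proof. by apply: (@sg_rho _ n th0 (fun _ t => 1 + de2 t) Ch) => // k t; exact: cell_th_dv. Qed.

Let hq_sg a : sg (hq a).
Proof.
apply: sg_sum => k _; apply: sgM; first exact: sg_cst.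
exact: (@sg_h _ n (fun _ t => 1 + de2 t) Ch).
Qed.

Let gb_r a : gb (fun x => r0 a x * P0 x). Proof. exact: gb_mul_sg. Qed.

Let gb_2 a : gb (fun x => (r0 a x ^+ 2 - hq a x) * P0 x).
Proof.
apply: gb_mul_sg => //; under eq_fun do rewrite -mulN1r expr2.
by apply: sgD; apply: sgM => //; exact: sg_cst.
Qed.

Let dP0 a x : dv (fun s => P0 (x + s *: a)) 0 (r0 a x * P0 x).
Proof.
have H0 b : b \in [::] -> disj b a by [].
have := @dv_Phi R n (fun _ => site_dens) th0 (fun _ t => site_dens_dv t)
  (fun _ => site_dens) [::] a x (fun _ _ => erefl) H0.
rewrite /Phi big_cons big_nil mulr1 mulrC; under eq_fun do rewrite big_nil mulr1.
by [].
Qed.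

Let dr0 a x : dv (fun s => r0 a (x + s *: a) * P0 (x + s *: a)) 0 ((r0 a x ^+ 2 - hq a x) * P0 x).
Proof.
have h1 := @dv_rho R n th0 (fun _ t => 1 + de2 t) (fun _ t => cell_th_dv t) a x.
apply: (dv_eq (dvM h1 (dP0 a x))); rewrite scale0r addr0 -/(r0 a) -/(hq a x); ring.
Qed.

Lemma cell_dv1 y u t : dv (fun s => cell_g (y + s *: u)) t (fib B (y + t *: u) (fun x => r0 u x * P0 x)).
Proof. exact: (@fib_dv R n q _ P0 (fun x => r0 u x * P0 x) u y B B' t Jq BB' P0_gb (gb_r u) (dP0 u)). Qed.

Lemma cell_dv2 y u t : dv (fun s => fib B (y + s *: u) (fun x => r0 u x * P0 x)) t
  (fib B (y + t *: u) (fun x => (r0 u x ^+ 2 - hq u x) * P0 x)).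
Proof. exact: (@fib_dv R n q _ (fun x => r0 u x * P0 x) (fun x => (r0 u x ^+ 2 - hq u x) * P0 x) u y B B' t Jq BB' (gb_r u) (gb_2 u) (dr0 u)). Qed.

(** Two directions with the same moments give the same function of [s], hence the same derivatives;
    this frees the choice of the lift in [cell_log_concave]. *)
Let fib_uniq1 y u a : u *m E = a *m E ->
  fib B y (fun x => r0 u x * P0 x) = fib B y (fun x => r0 a x * P0 x).
Proof.
move=> uE; have h1 := cell_dv1 y u 0; have h2 := cell_dv1 y a 0.
have e : (fun s => cell_g (y + s *: u)) = (fun s => cell_g (y + s *: a)).
  apply/funext => s; apply: fib_ker => //.
  by rewrite !mulmxDl -!scalemxAl uE.
rewrite e in h1; have := dv_uniq h1 h2; by rewrite !scale0r !addr0.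
Qed.

Let fib_uniq2 y u a : u *m E = a *m E ->
  fib B y (fun x => (r0 u x ^+ 2 - hq u x) * P0 x) = fib B y (fun x => (r0 a x ^+ 2 - hq a x) * P0 x).
Proof.
move=> uE; have h1 := cell_dv2 y u 0; have h2 := cell_dv2 y a 0.
have e : (fun s => fib B (y + s *: u) (fun x => r0 u x * P0 x)) =
   (fun s => fib B (y + s *: a) (fun x => r0 a x * P0 x)).
  apply/funext => s; rewrite (fib_uniq1 _ uE); apply: fib_ker => //.
  by rewrite !mulmxDl -!scalemxAl uE.
rewrite e in h1; have := dv_uniq h1 h2; by rewrite !scale0r !addr0.
Qed.

Section at_point.
Variables (y : 'rV[R]_n) (s : 'rV[R]_D).
Hypothesis sE : \row_k tilt_mean de (xe E s k - aa) *m E = y *m E.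

Let c (k : 'I_n) := xe E s k - aa.
Let m : 'rV[R]_n := \row_k tilt_mean de (c k).
Let p (k : 'I_n) := tilt_p de (c k).
Let th (k : 'I_n) := tilt_th de1 (c k).
Let v (k : 'I_n) := tilt_var de (c k).

Let mE k : m 0 k = tilt_mean de (c k). Proof. by rewrite mxE. Qed.

(** The Chebyshev input of [fib_lower]. Under the tilted product measure the sites are independent
    and centered at [m], so only the diagonal terms survive. *)
Lemma tilt_moment : J (fun x => sqn ((x - m) *m E) * Pi p x) <= CS.
Proof.
have gp k : gb1 (p k) by exact: (tilt_p_gb1 de_dv de_le).
pose X k t := (t - m 0 k) * p k t; pose X2 k t := (t - m 0 k) ^+ 2 * p k t.
have gX k : gb1 (X k) by rewrite /X mE; exact: (tilt_centered_gb1 de_dv de_le).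
have gX2 k : gb1 (X2 k) by rewrite /X2 mE; exact: (tilt_sqr_gb1 de_dv de_le).
pose T i j := if i == j then Pi (upd p i (X2 i)) else Pi (upd (upd p i (X i)) j (X j)).
have gT i j : gb (T i j).
  rewrite /T; case: eqP => _; apply: gb_Pi; first exact: upd_gb1.
  by do 2 apply: upd_gb1 => //.
have Te x : sqn ((x - m) *m E) * Pi p x = \sum_d \sum_i \sum_j E i d * E j d * T i j x.
  rewrite /sqn mulr_suml; apply: eq_bigr => d _.
  rewrite mxE expr2 !mulr_suml; apply: eq_bigr => i _.
  rewrite mulr_sumr mulr_suml; apply: eq_bigr => j _.
  rewrite /T; case: eqP => [->|/eqP ij].
    rewrite (@Pi_updM _ _ _ _ _ (fun t => (t - m 0 j) ^+ 2))//.
    by rewrite [(x - m) _ _]mxE [(- m) _ _]mxE; ring.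
  rewrite (@Pi_updM _ _ _ _ _ (fun t => (t - m 0 j))); last first.
    by move=> t; rewrite /upd eq_sym (negbTE ij).
  rewrite (@Pi_updM _ _ _ _ _ (fun t => (t - m 0 i)))//.
  by rewrite ![(x - m) _ _]mxE ![(- m) _ _]mxE; ring.
under eq_fun do rewrite Te.
rewrite (int_sum Jn); last by move=> d _; do 2 (apply: gb_sum => ? _); exact: gbZ.
apply: (@le_trans _ _ (\sum_d \sum_i E i d ^+ 2 * Cv)); last first.
  rewrite exchange_big /=; under eq_bigr do rewrite -mulr_suml.
  by rewrite -mulr_suml; apply: ler_wpM2r; [exact: ltW|exact: frobE_le].
apply: ler_sum => d _; rewrite (int_sum Jn); last by move=> i _; apply: gb_sum => ? _; exact: gbZ.
apply: ler_sum => i _; rewrite (int_sum Jn); last by move=> j _; exact: gbZ.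
rewrite (bigD1 i)//= big1 ?addr0 => [|j ji].
  rewrite (intZ Jn)// -expr2 ler_wpM2l ?sqr_ge0// /T eqxx J_prod; last exact: upd_gb1.
  rewrite (bigD1 i)//= /upd eqxx big1 ?mulr1 => [|k ki].
    by rewrite /X2 mE (tilt_varE de_dv de_le); have /andP[] := tilt_var_bounds de_dv de_le (c i).
  by rewrite (negbTE ki) (tilt_p_int de_dv de_le).
rewrite (intZ Jn)// /T eq_sym (negbTE ji) J_prod; last by do 2 apply: upd_gb1 => //.
rewrite (bigD1 j)//= /upd eqxx (_ : Int (X j) = 0) ?mul0r ?mulr0//.
by rewrite /X mE (tilt_centered_int de_dv de_le).
Qed.

Let Zc := \prod_k tilt_Z de (c k).

Let Zc_gt0 : 0 < Zc.
Proof. by apply: prodr_gt0 => k _; exact: (tilt_Z_gt0 de_dv de_le). Qed.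

Let ly := expR (\sum_k xe E s k * m 0 k) / Zc.

Let ly_gt0 : 0 < ly. Proof. by rewrite divr_gt0 ?expR_gt0. Qed.

(** The exponent of the tilt is a combination of moments, hence constant on the fiber: tilting only
    rescales the fiber integral. *)
Let pP0 w : Pi p (m + w *m B) = ly * P0 (m + w *m B).
Proof.
rewrite /ly; have -> : \sum_k xe E s k * m 0 k = \sum_k xe E s k * (m + w *m B) 0 k.
  have Z := fiber_sum0 BE s w; rewrite -[LHS]addr0 -[X in _ + X]Z -big_split /=.
  by apply: eq_bigr => k _; rewrite [(m + _) _ _]mxE; ring.
rewrite expR_sum mulrAC -big_split /= /Zc -prodf_div; apply: eq_bigr => k _.
rewrite /p (tilt_pE de_dv de_le); congr (_ / _).
rewrite /weight /site_dens /gauss1 -!expRD; congr expR; by rewrite /c; field.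
Qed.

Let rr a x : r0 a x = rho th a x - \sum_k a 0 k * xe E s k.
Proof.
rewrite /r0 /rho -opprD -big_split; congr (- _); apply: eq_bigr => k _ /=.
by rewrite /th0 /cell_th /th /tilt_th /c; ring.
Qed.

(** Tilting changes the score only by the constant [b], which cancels on the right side; [fib_hess]
    bounds the tilted expression. *)
Lemma cell_hess_at xi (a := \row_k (v k * xe E xi k)) :
  cv / 2 * (\sum_k xe E xi k ^+ 2) * cell_g y ^+ 2 <=
  fib B y (fun x => r0 a x * P0 x) ^+ 2 -
  fib B y (fun x => (r0 a x ^+ 2 - hq a x) * P0 x) * cell_g y.
Proof.
have H : (cv - kap * (Ufac D Ch C1 1 / low_const D Ch C1 CS * Cb)
      - kap ^+ 2 * CE * (Ufac D Ch C1 4 / low_const D Ch C1 CS * (Cb * Cb))) *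
   (\sum_k xe E xi k ^+ 2) * fib B m (Pi p) <=
  fib B m (fun x => (hq a x - rho th a x ^+ 2) * Pi p x).
  apply: (@fib_hess R n D q p th (fun _ t => 1 + de2 t) Ch _ _ _ _ _ _ E B B' BE BB' kerE cls A
    (D + 6) C1 AE A_cls A_frob C1_ge0 Ch0 kap kap_gt0 E_row erefl _ m CS _ tilt_moment
    v (fun k => tilt_F de de1 (c k)) (fun k => tilt_be de de1 de2 (c k)) _
    (fun k => tilt_ga de de1 (c k)) (fun k => tilt_ga1 de de1 (c k)) _ cv Cb CE) => //.
  - by move=> k t; exact: (tilt_p_gt0 de_dv de_le).
  - by move=> k; exact: (tilt_p_gb1 de_dv de_le).
  - by move=> k t; exact: (tilt_p_dv de_dv).
  - by move=> k t; exact: tilt_th_dv.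
  - by move=> k; exact: (tilt_p_int de_dv de_le).
  - by rewrite mulr_ge0// ltW.
  - by move=> k; have /andP[] := tilt_var_bounds de_dv de_le (c k).
  - by move=> k t; rewrite mE.
  - by move=> k; exact: (tilt_be_gb1 de_dv de1_dv de2_cont de_le de1_le de2_le).
  - by move=> k; exact: (tilt_W_gb1 de_dv de1_dv de2_cont de_le de1_le de2_le).
  - by move=> k; exact: (tilt_ga_gb1 de_dv de1_dv de_le de1_le).
  - by move=> k; exact: (tilt_ga1_gb1 de_dv de1_dv de_le de1_le).
  - by move=> k; exact: (tilt_F_gb1 de_dv de1_dv de_le de1_le).
  - by move=> k t; exact: (tilt_be_dv de_dv de1_dv de2_cont de_le de1_le de2_le).
  - by move=> k t; exact: (tilt_ga_dv de_dv de1_dv de_le de1_le).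
  - by move=> k t; exact: (tilt_ga1_dv de_dv de1_dv de_le de1_le).
  - by move=> k; exact: (tilt_be_Int de_dv de1_dv de2_cont de_le de1_le de2_le).
  - by move=> k; exact: (tilt_ga_Int de_dv de1_dv de_le de1_le de2_le).
set S := \sum_k _ in H *.
have S0 : 0 <= S by apply: sumr_ge0 => k _; exact: sqr_ge0.
rewrite /cell_g !(@fib_ker y m) ?sE//.
set b := \sum_k a 0 k * xe E s k.
have sgr : sg (rho th a).
  by apply: (@sg_rho _ n th (fun _ t => 1 + de2 t) Ch) => // k t; exact: tilt_th_dv.
have g1 : gb (fun x => rho th a x * P0 x) := gb_mul_sg P0_gb sgr.
have g2 : gb (fun x => (hq a x - rho th a x ^+ 2) * P0 x).
  apply: gb_mul_sg => //; under eq_fun do rewrite -mulN1r expr2.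
  by apply: sgD => //; apply: sgM; [exact: sg_cst|exact: sgM].
set A1 := fib B m (fun x => rho th a x * P0 x).
set A2 := fib B m (fun x => (hq a x - rho th a x ^+ 2) * P0 x).
set G := fib B m P0.
have gw f : gb f -> gb (fun w : 'rV_q => f (m + w *m B)) by exact: (fib_gbw BB').
have e1 : fib B m (fun x => r0 a x * P0 x) = A1 - b * G.
  have -> : (fun x => r0 a x * P0 x) = (fun x => (- b) * P0 x + rho th a x * P0 x).
    by apply/funext => x; rewrite rr -/b; ring.
  transitivity (- b * G + A1); last ring.
  by rewrite /fib (int_lin Jq _ (gw _ P0_gb) (gw _ g1)).
have e2 : fib B m (fun x => (r0 a x ^+ 2 - hq a x) * P0 x) = - A2 - 2 * b * A1 + b ^+ 2 * G.
  have -> : (fun x => (r0 a x ^+ 2 - hq a x) * P0 x) = (fun x => (-1) * ((hq a x - rho th a x ^+ 2) * P0 x) +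
      ((- (2 * b)) * (rho th a x * P0 x) + b ^+ 2 * P0 x)).
    by apply/funext => x; rewrite rr -/b; ring.
  have g3 : gb (fun x => b ^+ 2 * P0 x) by exact: gbZ.
  have g4 : gb (fun x => (- (2 * b)) * (rho th a x * P0 x) + b ^+ 2 * P0 x) by exact: gb_lin.
  transitivity ((-1) * A2 + (- (2 * b) * A1 + b ^+ 2 * G)); last ring.
  rewrite /fib (int_lin Jq (-1) (gw _ g2) (gw _ g4)) (int_lin Jq _ (gw _ g1) (gw _ g3)).
  by rewrite (intZ Jq _ (gw _ P0_gb)).
have G0 : 0 < G.
  by apply: J_gt0 => [|w]; [exact: gw|exact: P0_gt0].
have h1 : fib B m (Pi p) = ly * G.
  by rewrite /G /fib -(intZ Jq _ (gw _ P0_gb)); congr J; apply/funext => w; exact: pP0.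
have h2 : fib B m (fun x => (hq a x - rho th a x ^+ 2) * Pi p x) = ly * A2.
  rewrite /A2 /fib -(intZ Jq _ (gw _ g2)); congr J; apply/funext => w; rewrite pP0; ring.
rewrite h1 h2 mulrCA ler_pM2l// in H.
rewrite e1 e2; have -> : (A1 - b * G) ^+ 2 - (- A2 - 2 * b * A1 + b ^+ 2 * G) * G = A1 ^+ 2 + A2 * G by ring.
(* The square of the integrated score has the favourable sign and is dropped. *)
apply: (@le_trans _ _ (A2 * G)); last by rewrite lerDr sqr_ge0.
rewrite expr2 mulrA ler_pM2r//; apply: le_trans H; rewrite ler_pM2r// ler_wpM2r//.
by have := small; rewrite /cell_err; lra.
Qed.

End at_point.

(** [cv / 2] is what the error leaves of the lower variance bound. The denominator converts the sum
    of the [xe E xi k ^+ 2] into [sqn (u *m E)]; see [HS] in [cell_log_concave]. *)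
Definition cell_rate : R := cv / 2 / ((CE + 1) * Cv ^+ 2).

Lemma cell_rate_gt0 : 0 < cell_rate.
Proof. by rewrite /cell_rate divr_gt0 ?divr_gt0// mulr_gt0 ?exprn_gt0// ltr_pwDr. Qed.

(** [E^T *m V *m E], with [V] the diagonal of the [v k], is positive definite, so every moment
    vector has a lift of the weighted form required by [cell_hess_at]. *)
Lemma weighted_gram (v : 'I_n -> R) (z : 'rV[R]_D) : (forall k, cv <= v k) ->
  exists xi : 'rV[R]_D, (\row_k (v k * xe E xi k)) *m E = z.
Proof.
move=> vc; pose V : 'M[R]_n := diag_mx (\row_k v k); pose W := E^T *m V *m E.
have We (xi : 'rV[R]_D) : xi *m W = (\row_k (v k * xe E xi k)) *m E.
  rewrite /W !mulmxA; congr (_ *m E); apply/rowP => k.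
  rewrite mul_mx_diag !mxE mulrC; congr (_ * _); apply: eq_bigr => d _.
  by rewrite mxE mulrC.
have Wpos (xi : 'rV[R]_D) : xi *m W = 0 -> xi = 0.
  move=> W0; have : (xi *m W *m xi^T) 0 0 = 0 by rewrite W0 mul0mx mxE.
  have -> : (xi *m W *m xi^T) 0 0 = \sum_k v k * xe E xi k ^+ 2.
    rewrite We mxE; under eq_bigr => d _ do rewrite mxE [xi^T _ _]mxE mulr_suml.
    rewrite exchange_big; apply: eq_bigr => k _ /=.
    transitivity (\sum_d v k * xe E xi k * (E k d * xi 0 d)).
      by apply: eq_bigr => d _; rewrite mxE mulrA.
    by rewrite -mulr_sumr -/(xe E xi k) expr2 mulrA.
  move=> S0; have h : cv * (cG * sqn xi) <= 0.
    rewrite -S0; apply: (@le_trans _ _ (cv * \sum_k xe E xi k ^+ 2)).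
      by rewrite ler_wpM2l ?(ltW cv0)// gram.
    by rewrite mulr_sumr; apply: ler_sum => k _; rewrite ler_wpM2r ?sqr_ge0.
  have h0 : sqn xi <= 0 by move: h; rewrite !pmulr_rle0.
  apply/rowP => d; rewrite mxE; apply/eqP; rewrite -sqrf_eq0; apply/eqP/le_anti.
  by rewrite sqr_ge0 andbT (le_trans (coord_sqn _ _)).
have Wu : W \in unitmx.
  by rewrite -row_free_unit -kermx_eq0; apply/rowV0P => u /sub_kermxP; exact: Wpos.
by exists (z *m invmx W); rewrite -We mulmxKV.
Qed.

Theorem cell_log_concave y u :
  cell_g (y + u) * cell_g (y - u) * expR (cell_rate * sqn (u *m E)) <= cell_g y ^+ 2.
Proof.
pose G t := cell_g (y + t *: u).
have := @log_concave_midpoint R G _ _ (cell_rate * sqn (u *m E)) _ (cell_dv1 y u) (cell_dv2 y u) _ 1.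
rewrite /G scale0r addr0 scale1r scaleN1r expr1n mulr1; apply; first by move=> t; exact: cell_g_gt0.
move=> t; set Y := y + t *: u.
have [s sE] := tilt_exists de_dv de_le aa Y cG_gt0 gram.
pose v k := tilt_var de (xe E s k - aa).
have vb k : cv <= v k <= Cv by exact: (tilt_var_bounds de_dv de_le).
have [xi aE] := @weighted_gram v (u *m E) (fun k => proj1 (andP (vb k))).
have H := cell_hess_at sE xi; cbv zeta in H; rewrite -/v in H.
set a := \row_k _ in aE H; set S := \sum_k _ in H; rewrite (fib_uniq1 Y aE) (fib_uniq2 Y aE) in H.
have HS : sqn (u *m E) <= (CE + 1) * Cv ^+ 2 * S.
  rewrite -aE; apply: le_trans (sqn_mulmx _ _) _; rewrite -mulrA.
  apply: ler_pM; rewrite ?frob_ge0 ?sqn_ge0//; first by apply: le_trans frobE_le _; rewrite lerDl.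
  rewrite /sqn /S mulr_sumr; apply: ler_sum => k _; rewrite mxE exprMn ler_wpM2r ?sqr_ge0//.
  have /andP[v1 v2] := vb k; have v0 : 0 <= v k by exact: le_trans (ltW cv0) v1.
  by rewrite lerXn2r ?nnegrE// ltW.
have HS2 : cell_rate * sqn (u *m E) <= cv / 2 * S.
  rewrite /cell_rate mulrAC ler_pdivrMr; last by rewrite mulr_gt0 ?exprn_gt0// ltr_pwDr.
  rewrite -[leRHS]mulrA ler_wpM2l ?divr_ge0 ?(ltW cv0)//; by rewrite mulrC.
have : cell_rate * sqn (u *m E) * cell_g Y ^+ 2 <= cv / 2 * S * cell_g Y ^+ 2.
  by rewrite ler_wpM2r ?sqr_ge0.
move: H; rewrite /S; lra.
Qed.

End cell.

(** * Moments of a cell *)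

Section moment_matrix.
Context {R : realType}.

(* Integrals of [t ^ d] over the unit intervals [[rD + i, rD + i + 1]]. *)
Definition vmat D r : 'M[R]_D :=
  \matrix_(i, d) (((r * D + i).+1%:R ^+ d.+1 - (r * D + i)%:R ^+ d.+1) / d.+1%:R).

(** A vector orthogonal to all rows gives a polynomial [p] of degree at most [D] with equal values
    at [D + 1] consecutive integers. Such a [p] is constant, so its coefficients of positive degree
    vanish. *)
Lemma vmat_unit D r : vmat D r \in unitmx.
Proof.
rewrite -unitmx_tr -row_free_unit -kermx_eq0; apply/rowV0P => u /sub_kermxP uV.
pose p : {poly R} := \sum_(d < D) (u 0 d / d.+1%:R) *: 'X^(d.+1).
have pE x : p.[x] = \sum_(d < D) u 0 d / d.+1%:R * x ^+ d.+1.
  by rewrite horner_sum; apply: eq_bigr => d _; rewrite hornerZ hornerXn.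
have step i : (i < D)%N -> p.[(r * D + i).+1%:R] = p.[(r * D + i)%:R].
  move=> iD; apply/eqP; rewrite -subr_eq0 !pE -sumrB; apply/eqP.
  have := congr1 (fun A : 'rV_D => A 0 (Ordinal iD)) uV; rewrite mxE [in RHS]mxE => E0.
  by rewrite -[RHS]E0; apply: eq_bigr => d _; rewrite !mxE /=; ring.
have cst i : (i <= D)%N -> p.[(r * D + i)%:R] = p.[(r * D)%:R].
  elim: i => [|i IH] iD; first by rewrite addn0.
  by rewrite addnS step// IH// ltnW.
pose rs : seq R := [seq (r * D + i)%:R | i <- iota 0 D.+1].
have q0 : p - p.[(r * D)%:R]%:P = 0.
  apply: (@roots_geq_poly_eq0 _ _ rs).
  - apply/allP => x /mapP[i]; rewrite mem_iota add0n ltnS => /andP[_ iD] xE.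
    by rewrite xE rootE !hornerE cst// subrr.
  - rewrite map_inj_uniq ?iota_uniq// => i j /eqP; rewrite eqr_nat eqn_add2l.
    by move/eqP.
  - rewrite size_map size_iota; apply: leq_trans (size_polyD _ _) _.
    rewrite geq_max size_polyN (leq_trans (size_polyC_leq1 _))// andbT.
    apply: leq_trans (size_sum _ _ _) _; apply/bigmax_leqP => d _.
    by apply: leq_trans (size_scale_leq _ _) _; rewrite size_polyXn !ltnS.
apply/rowP => d; rewrite mxE.
have := congr1 (fun q : {poly R} => q`_d.+1) q0; rewrite coefB coefC coef0 subr0 coef_sum.
rewrite (bigD1 d)//= big1 => [|j jd].
  rewrite addr0 coefZ coefXn eqxx mulr1 => /eqP; rewrite mulf_eq0 invr_eq0 pnatr_eq0 orbF.
  by move/eqP.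
by rewrite coefZ coefXn eqSS eq_sym (_ : (j == d :> nat) = false) ?mulr0//; apply/negbTE.
Qed.

(* [sqrt K] times the integral of [t ^ d] over [[k/K, (k+1)/K]]. *)
Definition cellE D K : 'M[R]_(K, D) := \matrix_(k, d)
  ((Num.sqrt K%:R)^-1 * ((k.+1%:R ^+ d.+1 - k%:R ^+ d.+1) / (d.+1%:R * K%:R ^+ d))).

Definition wid D K := (K %/ ((D + 6) * D))%N.

Definition cellcls D K (k : 'I_K) := (k %/ (D * wid D K))%N.

Definition cellh D K : R := (wid D K)%:R / K%:R.

Definition subsum D K r : 'M[R]_(D, K) :=
  \matrix_(i, k) (k %/ wid D K == r * D + i)%N%:R.

(* [A r] lives on the [r]-th of [D + 6] blocks of consecutive sites; summing the
   telescoping rows of [cellE] over [D] subblocks gives the invertible [vmat D r]. *)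
Definition cellA D K r : 'M[R]_(D, K) :=
  (Num.sqrt K%:R)^-1 *: (diag_mx (\row_d (cellh D K ^- d.+1)) *m invmx (vmat D r) *m subsum D K r).

Lemma sum_block K w u (f : nat -> R) : (0 < w)%N -> (u.+1 * w <= K)%N ->
  \sum_(k < K) (k %/ w == u)%N%:R * f k = \sum_(u * w <= k < u.+1 * w) f k.
Proof.
move=> w0 uK; rewrite -(big_mkord xpredT (fun k => (k %/ w == u)%N%:R * f k)).
have uu : (u * w <= u.+1 * w)%N by rewrite leq_mul2r leqnSn orbT.
have big0 a b : (forall k, (a <= k < b)%N -> (k %/ w != u)%N) ->
    \sum_(a <= k < b) (k %/ w == u)%N%:R * f k = 0.
  by move=> H; rewrite big_nat big1// => k /H/negbTE ->; rewrite mul0r.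
rewrite (@big_cat_nat _ _ _ (u.+1 * w))//= (@big_cat_nat _ _ _ (u * w))//=.
rewrite big0 ?add0r => [|k /andP[_ ku]]; last first.
  by rewrite neq_ltn ltn_divLR// ku.
rewrite [X in _ + X]big0 ?addr0 => [|k /andP[ku _]]; last first.
  by rewrite neq_ltn leq_divRL// ku orbT.
rewrite big_nat [RHS]big_nat; apply: eq_bigr => k /andP[k1 k2].
rewrite (_ : (k %/ w == u)%N) ?mul1r// eqn_leq.
by rewrite -ltnS ltn_divLR// k2 leq_divRL.
Qed.

Section fixed_size.
Variables (D K : nat).
Hypothesis D_gt0 : (0 < D)%N.
Hypothesis K_ge : ((D + 6) * D <= K)%N.

Let w := wid D K.
Let sK : R := Num.sqrt K%:R.

Let K_gt0 : (0 < K)%N.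
Proof. by apply: leq_trans K_ge; rewrite muln_gt0 D_gt0 addn_gt0 D_gt0. Qed.

Let KR : (0 : R) < K%:R. Proof. by rewrite ltr0n. Qed.

Let sK_gt0 : 0 < sK. Proof. by rewrite sqrtr_gt0. Qed.

Let sKK : sK * sK = K%:R. Proof. by rewrite -expr2 sqr_sqrtr// ler0n. Qed.

Let DD : (0 < (D + 6) * D)%N. Proof. by rewrite muln_gt0 D_gt0 addn_gt0 D_gt0. Qed.

Lemma wid_gt0 : (0 < wid D K)%N. Proof. by rewrite divn_gt0. Qed.

Lemma wid_le : ((D + 6) * D * wid D K <= K)%N.
Proof. by rewrite mulnC leq_divM. Qed.

Lemma cellh_gt0 : 0 < cellh D K.
Proof. by rewrite divr_gt0// ltr0n wid_gt0. Qed.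

Lemma cellh_le1 : cellh D K <= 1.
Proof.
rewrite ler_pdivrMr// mul1r ler_nat; apply: leq_trans wid_le; exact: leq_pmull.
Qed.

(** As the quotient is at least 1, rounding down loses at most a factor 2. *)
Lemma cellh_ge : (2 * ((D + 6) * D)%:R)^-1 <= cellh D K.
Proof.
rewrite /cellh ler_pdivlMr// mulrC ler_pdivrMr ?mulr_gt0 ?ltr0n//.
rewrite mulrC -natrM -natrM ler_nat /wid.
have := divn_eq K ((D + 6) * D); have := ltn_pmod K DD; have := wid_gt0; rewrite /wid.
set x := (K %/ _)%N; set y := (K %% _)%N; set z := ((D + 6) * D)%N; nia.
Qed.

Lemma subsumE r : (r < D + 6)%N ->
  subsum D K r *m cellE D K = sK *: (vmat D r *m diag_mx (\row_d cellh D K ^+ d.+1)).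
Proof.
move=> rD; apply/matrixP => i d; rewrite mul_mx_diag mxE [RHS]mxE [X in sK * X]mxE.
rewrite [vmat _ _ _ _]mxE [(\row_d0 _) _ _]mxE.
pose f k : R := sK^-1 * ((k.+1%:R ^+ d.+1 - k%:R ^+ d.+1) / (d.+1%:R * K%:R ^+ d)).
transitivity (\sum_(k < K) (k %/ w == r * D + i)%N%:R * f k).
  by apply: eq_bigr => k _; rewrite !mxE.
have ub : ((r * D + i).+1 * w <= K)%N.
  apply: leq_trans wid_le; rewrite leq_mul2r; apply/orP; right.
  by have := ltn_ord i; nia.
rewrite sum_block ?wid_gt0// -mulr_sumr -mulr_suml telescope_sumr; last by rewrite leq_mul2r leqnSn orbT.
rewrite /cellh !natrM !exprMn -/w exprVn.
have sk0 : sK != 0 by rewrite gt_eqF.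
have k0 : K%:R != 0 :> R by rewrite gt_eqF.
have -> : sK^-1 = sK / K%:R by rewrite -sKK; field.
rewrite [K%:R ^+ d.+1]exprS; have : d.+1%:R != 0 :> R by rewrite pnatr_eq0.
have : K%:R ^+ d != 0 :> R by rewrite expf_neq0.
move: (K%:R ^+ d) (d.+1%:R : R) => x y x0 y0.
by field; rewrite x0 y0 k0.
Qed.

Lemma cellAE r : (r < D + 6)%N -> cellA D K r *m cellE D K = 1%:M.
Proof.
move=> rD; rewrite -scalemxAl -(mulmxA (diag_mx _ *m invmx _)) subsumE// -scalemxAr scalerA.
rewrite mulVf ?gt_eqF// scale1r !mulmxA mulmxKV ?vmat_unit// mulmx_diag.
apply/matrixP => i j; rewrite !mxE; congr (_ *+ _).
by rewrite mulVf// expf_neq0// gt_eqF// cellh_gt0.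
Qed.

Lemma cellA_cls r i (k : 'I_K) : cellA D K r i k != 0 -> cellcls D k = r.
Proof.
rewrite mxE mulf_eq0 negb_or => /andP[_]; rewrite mxE => H.
have [j] : exists j, subsum D K r j k != 0.
  apply: contrapT => Hn; move/negP: H; apply; apply/eqP; rewrite big1// => j _.
  by rewrite (_ : subsum D K r j k = 0) ?mulr0//; apply: contrapT => /eqP s0; apply: Hn; exists j.
rewrite mxE pnatr_eq0 eqb0 negbK => /eqP kj.
by rewrite /cellcls mulnC divnMA kj divnMDl// divn_small ?addn0.
Qed.

(** The entries are of order K^(-1/2) and there are [D * K] of them, so the bound is free of [K]. *)
Lemma cellA_frob r : frob (cellA D K r) <=
  D%:R * (2 * ((D + 6) * D)%:R) ^+ (2 * D) * frob (invmx (vmat D r)).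
Proof.
set h0 := (2 * _); have h00 : 0 < h0 by rewrite mulr_gt0 ?ltr0n.
have hh (d : 'I_D) : cellh D K ^- d.+1 ^+ 2 <= h0 ^+ (2 * D).
  rewrite mulnC exprM -exprVn; apply: lerXn2r; rewrite ?nnegrE.
  - by rewrite exprn_ge0// invr_ge0 ltW// cellh_gt0.
  - by rewrite exprn_ge0// ltW.
  apply: (@le_trans _ _ ((cellh D K)^-1 ^+ D)).
    by rewrite ler_weXn2l// invf_ge1 ?cellh_gt0 ?cellh_le1.
  apply: lerXn2r; rewrite ?nnegrE ?invr_ge0 ?(ltW cellh_gt0) ?(ltW h00)//.
  by rewrite -[h0]invrK lef_pV2 ?posrE ?invr_gt0 ?cellh_gt0// cellh_ge.
have ent d k : cellA D K r d k ^+ 2 <=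
    K%:R^-1 * (D%:R * h0 ^+ (2 * D) * \sum_i invmx (vmat D r) d i ^+ 2).
  rewrite mxE exprMn exprVn sqr_sqrtr ?ler0n// ler_wpM2l ?invr_ge0 ?ler0n//.
  rewrite mxE; under eq_bigr => i _ do rewrite mul_diag_mx mxE [(\row_d0 _) _ _]mxE -mulrA.
  rewrite -mulr_sumr exprMn (_ : D%:R * _ * _ = h0 ^+ (2 * D) *
    (D%:R * \sum_i invmx (vmat D r) d i ^+ 2)); last ring.
  apply: ler_pM; [exact: sqr_ge0|exact: sqr_ge0|exact: hh|].
  apply: le_trans (sum_CauchySchwarz _ _) _.
  rewrite mulrC ler_wpM2r ?sumr_ge0//; first by move=> i _; exact: sqr_ge0.
  rewrite -[X in _ <= X%:R]card_ord -sumr_const; apply: ler_sum => i _.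
  by rewrite mxE; case: (_ == _); rewrite ?expr1n ?expr0n.
apply: (@le_trans _ _ (\sum_d \sum_(k < K) K%:R^-1 * (D%:R * h0 ^+ (2 * D) * \sum_i invmx (vmat D r) d i ^+ 2))).
  by apply: ler_sum => d _; apply: ler_sum => k _; exact: ent.
rewrite /frob mulr_sumr; apply: ler_sum => d _.
by rewrite sumr_const card_ord -[X in X <= _]mulr_natl mulrA mulfV ?mul1r// gt_eqF.
Qed.

Lemma cellE_row (j : 'I_K) : sqn (row j (cellE D K)) <= D%:R / K%:R.
Proof.
rewrite /sqn mulr_natl -[X in _ *+ X]card_ord -sumr_const; apply: ler_sum => d _.
rewrite !mxE exprMn exprVn sqr_sqrtr ?ler0n// ler_piMr ?invr_ge0 ?ler0n//.
have a0 : 0 <= (j.+1%:R ^+ d.+1 - j%:R ^+ d.+1) / (d.+1%:R * K%:R ^+ d) :> R.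
  by rewrite divr_ge0 ?mulr_ge0 ?exprn_ge0 ?ler0n// subr_ge0 lerXn2r ?nnegrE ?ler0n// ler_nat.
rewrite expr_le1// ler_pdivrMr ?mulr_gt0 ?exprn_gt0 ?ltr0n// mul1r subrXX.
have -> : j.+1%:R - j%:R = 1 :> R by rewrite -natr1 addrC addKr.
have -> : d.+1%:R * K%:R ^+ d = \sum_(i < d.+1) K%:R ^+ d :> R.
  by rewrite sumr_const card_ord mulr_natl.
rewrite mul1r; apply: ler_sum => i _.
apply: (@le_trans _ _ (j.+1%:R ^+ (d.+1.-1 - i) * j.+1%:R ^+ i)).
  by rewrite ler_wpM2l ?exprn_ge0 ?ler0n// lerXn2r ?nnegrE ?ler0n// ler_nat.
rewrite -exprD subnK -1?ltnS//= lerXn2r ?nnegrE ?ler0n// ler_nat; exact: ltn_ord.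
Qed.

End fixed_size.

(** Common to all classes: the sum over [r] replaces a maximum, and the [1 +] keeps it positive. *)
Definition frob_max D : R := D%:R * (2 * ((D + 6) * D)%:R) ^+ (2 * D) *
  (1 + \sum_(r < D + 6) frob (invmx (vmat D r))).

Lemma cellA_frob_max D K r : (0 < D)%N -> ((D + 6) * D <= K)%N -> (r < D + 6)%N ->
  frob (cellA D K r) <= frob_max D.
Proof.
move=> D0 DK rD; apply: le_trans (cellA_frob D0 DK r) _; rewrite ler_wpM2l//.
rewrite (bigD1 (Ordinal rD))//= addrCA lerDl addr_ge0//.
by apply: sumr_ge0 => i _; exact: frob_ge0.
Qed.

Lemma frob_max_gt0 D : (0 < D)%N -> 0 < frob_max D.
Proof.
move=> D0; rewrite /frob_max !mulr_gt0 ?exprn_gt0 ?mulr_gt0 ?ltr0n ?muln_gt0 ?addn_gt0 ?D0//.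
by rewrite ltr_pwDl//; apply: sumr_ge0 => i _; exact: frob_ge0.
Qed.

(** The transpose of [cellA D K 0] is a right inverse of the transpose of [cellE], which bounds the
    Gram matrix from below with a constant free of [K]. *)
Lemma cellE_gram D K (xi : 'rV[R]_D) : (0 < D)%N -> ((D + 6) * D <= K)%N ->
  (frob_max D)^-1 * sqn xi <= \sum_k xe (cellE D K) xi k ^+ 2.
Proof.
move=> D0 DK; have r0 : (0 < D + 6)%N by rewrite addn_gt0 D0.
rewrite mulrC ler_pdivrMr ?frob_max_gt0// mulrC.
have e : xi *m (cellE D K)^T *m (cellA D K 0)^T = xi.
  by rewrite -mulmxA -trmx_mul (cellAE D0 DK r0) trmx1 mulmx1.
rewrite -{1}e; apply: le_trans (sqn_mulmx _ _) _.
have -> : frob (cellA D K 0)^T = frob (cellA D K 0).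
  by rewrite /frob exchange_big; apply: eq_bigr => i _; apply: eq_bigr => j _; rewrite mxE.
apply: ler_pM; rewrite ?frob_ge0 ?sqn_ge0 ?cellA_frob_max//.
rewrite le_eqVlt; apply/orP; left; apply/eqP; apply: eq_bigr => k _.
by congr (_ ^+ 2); rewrite mxE; apply: eq_bigr => d _; rewrite mxE mulrC.
Qed.

Definition kerB n D (E : 'M[R]_(n, D)) : 'M[R]_(\rank (kermx E), n) := row_base (kermx E).

Lemma kerBE n D (E : 'M[R]_(n, D)) : kerB E *m E = 0.
Proof. by apply/sub_kermxP; rewrite eq_row_base. Qed.

Lemma kerBV n D (E : 'M[R]_(n, D)) : kerB E *m pinvmx (kerB E) = 1%:M.
Proof. by apply: mulmxVp; exact: row_base_free. Qed.

Lemma kerB_ker n D (E : 'M[R]_(n, D)) (u : 'rV[R]_n) : u *m E = 0 ->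
  u *m pinvmx (kerB E) *m kerB E = u.
Proof. by move=> uE; apply: mulmxKpV; rewrite eq_row_base; apply/sub_kermxP. Qed.

End moment_matrix.

(** * Uniformity in the number of sites per cell *)

Section cell_uniform.
Context {R : realType}.
Variables (de de1 de2 : R -> R) (b0 b1 b2 aa : R).
Hypothesis de_dv : forall t, dv de t (de1 t).
Hypothesis de1_dv : forall t, dv de1 t (de2 t).
Hypothesis de2_cont : continuous de2.
Hypothesis de_le : forall t, `|de t| <= b0.
Hypothesis de1_le : forall t, `|de1 t| <= b1.
Hypothesis de2_le : forall t, `|de2 t| <= b2.

Theorem cell_uniform D : (0 < D)%N -> exists K0 : nat, ((D + 6) * D <= K0)%N /\
  exists2 r : R, 0 < r & forall K, (K0 <= K)%N -> forall y u : 'rV[R]_K,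
    cell_g de aa (kerB (cellE D K)) (y + u) * cell_g de aa (kerB (cellE D K)) (y - u) *
      expR (r * sqn (u *m cellE D K)) <= cell_g de aa (kerB (cellE D K)) y ^+ 2.
Proof.
move=> D0; pose C1 := @frob_max R D; have C10 := @frob_max_gt0 R D D0.
pose CE : R := D%:R; pose cv := expR (- (2 * b0)); have cv0 : 0 < cv by exact: expR_gt0.
pose CS := CE * var_max b0.
pose a1 := Ufac D (1 + b2) C1 1 / low_const D (1 + b2) C1 CS * site_const b0 b1 b2.
pose a2 := CE * (Ufac D (1 + b2) C1 4 / low_const D (1 + b2) C1 CS *
  (site_const b0 b1 b2 * site_const b0 b1 b2)).
pose eps := cv / 2 / (`|a1| + `|a2| + 1); have a0 : 0 < `|a1| + `|a2| + 1 by rewrite ltr_wpDl.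
have eps0 : 0 < eps by rewrite divr_gt0// divr_gt0.
(* Beyond [K1], [kap ^+ 2 = D / K] is at most [eps ^+ 2] and at most 1, which makes
   [cell_err <= cv / 2]. *)
pose K1 := Num.truncn (D%:R / eps ^+ 2 + D%:R).
exists (((D + 6) * D) + K1.+1)%N; split; first exact: leq_addr.
exists (cell_rate b0 CE).
  (* Positivity of the rate uses [n] and [kap] only through [n * kap ^+ 2 <= CE], so trivial values
     suffice. *)
  by apply: (cell_rate_gt0 de_dv de_le (n := 1) (kap := 0)); rewrite expr0n mulr0.
move=> K HK y u.
have DK : ((D + 6) * D <= K)%N by apply: leq_trans HK; exact: leq_addr.
have K0 : (0 < K)%N by apply: leq_trans HK; rewrite addnS.
have KR : (0 : R) < K%:R by rewrite ltr0n.
pose kap := Num.sqrt (D%:R / K%:R : R).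
have kap0 : 0 < kap by rewrite sqrtr_gt0 divr_gt0// ltr0n.
have kapK : kap ^+ 2 = D%:R / K%:R by rewrite sqr_sqrtr// divr_ge0// ler0n.
have KK1 : D%:R / eps ^+ 2 + D%:R <= K%:R.
  apply: ltW; apply: (@lt_le_trans _ _ K1.+1%:R).
    have q0 : 0 <= D%:R / eps ^+ 2 + D%:R :> R by rewrite addr_ge0// divr_ge0// exprn_ge0// ltW.
    by have /andP[] := truncn_itv q0.
  by rewrite ler_nat; apply: leq_trans HK; exact: leq_addl.
have kap_eps : kap <= eps.
  rewrite -(@ler_pXn2r _ 2)// ?nnegrE ?(ltW kap0) ?(ltW eps0)// kapK ler_pdivrMr// mulrC -ler_pdivrMr ?exprn_gt0//.
  by apply: le_trans KK1; rewrite lerDl.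
have kap1 : kap <= 1.
  rewrite -(@ler_pXn2r _ 2)// ?nnegrE ?(ltW kap0)// kapK expr1n ler_pdivrMr// mul1r.
  by apply: le_trans KK1; rewrite lerDr divr_ge0// exprn_ge0// ltW.
have H := @cell_log_concave R de de1 de2 b0 b1 b2 aa de_dv de1_dv de2_cont de_le de1_le de2_le K D _
  (cellE D K) (kerB (cellE D K)) (pinvmx (kerB (cellE D K))) (kerBE _) (kerBV _) (@kerB_ker _ _ _ _)
  (@cellcls D K) (cellA D K) C1 (cellAE D0 DK) (fun r i k => @cellA_cls R D K D0 r i k)
  (fun r => @cellA_frob_max R D K r D0 DK) (ltW C10) kap C1^-1 CE kap0.
apply: H.
- by move=> j; rewrite kapK; exact: cellE_row.
- by rewrite kapK mulrCA mulfV ?mulr1// gt_eqF.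
- by rewrite invr_gt0.
- by move=> xi; exact: cellE_gram.
rewrite /cell_err -/CE -/CS -/a1 -mulrA -/a2.
apply: (@le_trans _ _ (kap * `|a1| + kap * `|a2|)).
  apply: lerD; first by rewrite ler_wpM2l ?(ltW kap0)// ler_norm.
  apply: (@le_trans _ _ (kap ^+ 2 * `|a2|)); first by rewrite ler_wpM2l ?sqr_ge0// ler_norm.
  by rewrite ler_wpM2r// expr2 ler_piMr// ltW.
rewrite -mulrDr; apply: (@le_trans _ _ (eps * (`|a1| + `|a2| + 1))).
  by apply: ler_pM => //; [exact: ltW|rewrite lerDl].
by rewrite /eps divfK// gt_eqF.
Qed.

End cell_uniform.

(** * The Prekopa-Leindler inequality *)

Section prekopa_leindler.
Context {R : realType}.

(* [T] transports the normalised [f] to the normalised [g]; along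
   [M x = (x + T x) / 2] the primitive of [h] grows at least as fast as a
   multiple of the primitive of [f]. *)
Lemma prekopa_leindler1 (f g h : R -> R) : gb1 f -> gb1 g -> gb1 h -> (forall t, 0 < f t) ->
  (forall t, 0 < g t) -> (forall t, 0 <= h t) ->
  (forall s t, f s * g t <= h ((s + t) / 2) ^+ 2) -> Int f * Int g <= Int h ^+ 2.
Proof.
move=> gf gg gh f0 g0 h0 H.
have If0 := Int_pos gf f0; have Ig0 := Int_pos gg g0; have Ih0 := Int_nneg gh h0.
have [cf [Cf [ef [ef0 Cf0 bf]]]] := gf; have [cg [Cg [eg [eg0 Cg0 bg]]]] := gg.
have [ch [Chh [eh [eh0 Ch0 bh]]]] := gh.
pose G := prim g; pose F := prim f.
have dG t : dv G t (g t) by exact: prim_dv bg.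
have dF t : dv F t (f t) by exact: prim_dv bf.
have dH t : dv (prim h) t (h t) by exact: prim_dv bh.
have inc (u u' : R -> R) x y : (forall t, dv u t (u' t)) -> (forall t, 0 < u' t) ->
    x < y -> u x < u y.
  move=> du u0 xy; have [c _ e] := dv_MVT xy (fun t _ => du t).
  by rewrite -subr_gt0 e mulr_gt0// subr_gt0.
have Ginj : injective G.
  move=> x y e; have [xy|xy|//] := ltgtP x y.
    by have := inc _ _ _ _ dG g0 xy; rewrite e ltxx.
  by have := inc _ _ _ _ dG g0 xy; rewrite e ltxx.
have Fpos x : 0 < F x.
  have a : F (x - 1) < F x by apply: (inc _ _ _ _ dF f0); lra.
  apply: le_lt_trans a.
  apply: (@seq_lim_le _ _ _ _ (@prim_ninfty _ f (x - 1) Cf ef ef0 cf bf)) => k.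
  by apply: (prim_le ef0 cf bf) => [t|]; [exact: ltW|rewrite gerDr oppr_le0].
have Flt x : F x < Int f.
  have a : F x < F (x + 1) by apply: (inc _ _ _ _ dF f0); lra.
  apply: (lt_le_trans a).
  apply: (@seq_lim_ge _ _ _ _ (@prim_pinfty _ f (x + 1) Cf ef ef0 cf bf)) => k.
  by apply: (prim_le ef0 cf bf) => [t|]; [exact: ltW|rewrite lerDr].
have Gsurj v : 0 < v -> v < Int g -> exists x, G x = v.
  move=> v0 vI.
  have h1 := @prim_ninfty _ g 0 Cg eg eg0 cg bg; have h2 := @prim_pinfty _ g 0 Cg eg eg0 cg bg.
  have [k1 k1v] : exists k : nat, G (- k%:R + 0) < v.
    apply: contrapT => Hn; have : v <= 0.
      apply: (@seq_lim_ge _ _ _ _ h1) => k; rewrite leNgt; apply/negP => kv; apply: Hn; by exists k.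
    by rewrite leNgt v0.
  have [k2 k2v] : exists k : nat, v < G (k%:R + 0).
    apply: contrapT => Hn; have : Int g <= v.
      apply: (@seq_lim_le _ _ _ _ h2) => k; rewrite leNgt; apply/negP => kv; apply: Hn; by exists k.
    by rewrite leNgt vI.
  have ab : - k1%:R + 0 <= k2%:R + 0 :> R by rewrite !addr0 (@le_trans _ _ 0)// oppr_le0.
  have [] := @IVT R G (- k1%:R + 0) (k2%:R + 0) v ab.
  - by apply: continuous_subspaceT => t; exact: dv_continuous (dG t).
  - by rewrite ge_min le_max (ltW k1v) (ltW k2v) orbT.
  - by move=> x _ e; exists x.
(* Inverse of [G], with value 0 outside its range; [T] evaluates it inside the range only. *)
pose Gi v := xget 0 [set x | G x = v].
have GiK x : Gi (G x) = x.
  rewrite /Gi; case: xgetP => [y _ /= e|/(_ x)]; first exact: Ginj.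
  by move=> /(_ erefl).
have dGi x : dv Gi (G x) (g x)^-1.
  apply: is_derive_inverse; last by rewrite gt_eqF.
  - by near=> y; exact: GiK.
  - by near=> y; exact: dv_continuous (dG y).
  - exact: dG.
pose c := Int g / Int f; have c0 : 0 < c by rewrite divr_gt0.
pose T x := Gi (c * F x).
have GT x : G (T x) = c * F x.
  have [y e] : exists y, G y = c * F x.
    apply: Gsurj; first by rewrite mulr_gt0.
    by rewrite -[ltRHS](@divfK _ (Int f)) ?gt_eqF// ltr_pM2l.
  by rewrite /T -e GiK.
have dT x : dv T x ((g (T x))^-1 * (c * f x)).
  apply: dv_comp; last exact: dvZ.
  by rewrite -GT; exact: dGi.
pose M x := (x + T x) / 2.
(* [k * Int f] is the geometric mean of the two integrals. *)
pose k := Num.sqrt c; have k0 : 0 < k by rewrite sqrtr_gt0.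
have kk : k ^+ 2 = c by rewrite sqr_sqrtr// ltW.
pose M1 x := (1 + (g (T x))^-1 * (c * f x)) / 2.
have dM x : dv M x (M1 x).
  by apply: (dv_eq (dvM (dvD (dv_id x) (dT x)) (dv_cst 2^-1 x))); rewrite mulr0 addr0.
pose A x := - prim h (M x) + k * F x.
have dA x : dv A x (- (h (M x) * M1 x) + k * f x).
  by apply: dvD; [apply: dvN; apply: dv_comp; [exact: dH|exact: dM]|exact: dvZ].
have A1 x : - (h (M x) * M1 x) + k * f x <= 0.
  have gx := g0 (T x); have fx := f0 x; have hx := h0 (M x); have Hx := H x (T x).
  rewrite -/(M x) in Hx; set r := (g (T x))^-1 * (c * f x).
  have r0 : 0 < r by rewrite !mulr_gt0// invr_gt0.
  have M10 : 0 <= M1 x by rewrite /M1 -/r divr_ge0// addr_ge0// ltW.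
  suff : k * f x <= h (M x) * M1 x by lra.
  rewrite -(@ler_pXn2r _ 2)// ?nnegrE ?(mulr_ge0 hx M10)//; last by rewrite mulr_ge0// ltW.
  (* With [r] the derivative of [T], this is the hypothesis on [h] combined with
     [r <= ((1 + r) / 2) ^+ 2]. *)
  rewrite !exprMn kk; apply: (@le_trans _ _ (f x * g (T x) * r)).
    by rewrite /r le_eqVlt; apply/orP; left; apply/eqP; field; rewrite gt_eqF.
  apply: ler_pM; rewrite ?(ltW r0) ?mulr_ge0 ?(ltW fx) ?(ltW gx)//.
  by rewrite /M1 -/r; have := sqr_ge0 (r - 1); lra.
have prim_h0 x : 0 <= prim h x.
  apply: (@seq_lim_le _ _ _ _ (@prim_ninfty _ h x Chh eh eh0 ch bh)) => j.
  by apply: (prim_le eh0 ch bh) => //; rewrite gerDr oppr_le0.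
have prim_hI x : prim h x <= Int h.
  apply: (@seq_lim_ge _ _ _ _ (@prim_pinfty _ h x Chh eh eh0 ch bh)) => j.
  by apply: (prim_le eh0 ch bh) => //; rewrite lerDr.
(* [A] is nonincreasing, and far to the left it is at most [k * F], which tends to 0. *)
have A0 x : A x <= 0.
  have hl : (fun j : nat => k * F (- j%:R + x)) @ \oo --> k * 0.
    by apply: cvgMr; exact: prim_ninfty bf.
  rewrite mulr0 in hl; apply: (@seq_lim_ge _ _ _ _ hl) => j.
  have xy : - j%:R + x <= x by rewrite gerDr oppr_le0.
  have L : A x - A (- j%:R + x) <= 0.
    by apply: le_trans (dv_le xy (fun t _ => dA t) (fun t _ => A1 t)) _; rewrite mul0r.
  apply: (@le_trans _ _ (A (- j%:R + x))); first by rewrite -subr_le0.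
  by rewrite {1}/A gerDr oppr_le0.
have kI : k * Int f <= Int h.
  have hl : (fun j : nat => k * F (j%:R + 0)) @ \oo --> k * Int f.
    by apply: cvgMr; exact: prim_pinfty bf.
  apply: (@seq_lim_le _ _ _ _ hl) => j.
  apply: le_trans (prim_hI (M (j%:R + 0))); rewrite -subr_le0 addrC.
  exact: A0.
have -> : Int f * Int g = (k * Int f) ^+ 2.
  by rewrite exprMn kk /c; field; rewrite gt_eqF.
by rewrite lerXn2r ?nnegrE// mulr_ge0// ltW.
Unshelve. all: by end_near.
Qed.

Lemma gb1_J n (f : 'rV[R]_(1 + n) -> R) : gb f ->
  gb1 (fun t => J (fun x : 'rV[R]_n => f (row_mx (t%:M : 'rV_1) x))).
Proof.
move=> gf; have [h1 h2] := gb_scalar (gb_int2 (isInt_J n) (gb_gb2 gf)).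
by split.
Qed.

(** Tensorisation: for fixed first coordinates the sections satisfy the hypothesis in dimension [n],
    so the partial integrals satisfy that of [prekopa_leindler1]. *)
Theorem prekopa_leindler n (f g h : 'rV[R]_n -> R) : gb f -> gb g -> gb h ->
  (forall x, 0 < f x) -> (forall x, 0 < g x) -> (forall x, 0 < h x) ->
  (forall x y, f x * g y <= h (2^-1 *: (x + y)) ^+ 2) -> J f * J g <= J h ^+ 2.
Proof.
elim: n f g h => [|n IH] f g h gf gg gh f0 g0 h0 H /=.
  by have := H 0 0; rewrite addr0 scaler0.
apply: prekopa_leindler1 => [|||t|t|t|s t]; try exact: gb1_J.
- by apply: J_gt0 => // ; exact: (@gb_slice _ 1 n).
- by apply: J_gt0 => // ; exact: (@gb_slice _ 1 n).
- by apply/ltW; apply: J_gt0 => // ; exact: (@gb_slice _ 1 n).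
apply: IH => [|||x|x|x|x y]; rewrite ?f0 ?g0 ?h0//; try exact: (@gb_slice _ 1 n).
have := H (row_mx (s%:M : 'rV_1) x : 'rV_(1 + n)) (row_mx (t%:M : 'rV_1) y).
rewrite (@add_row_mx _ 1 1 n) (@scale_row_mx _ 1 1 n) -[s%:M + t%:M]raddfD scale_scalar_mx.
rewrite (_ : 2^-1 * (s + t) = (s + t) / 2); last exact: mulrC.
exact: id.
Qed.

End prekopa_leindler.

(** * Products of cells *)

Section block_diagonal.
Context {R : realType}.

Fixpoint bd p n M (A : 'M[R]_(p, n)) : 'M[R]_(M * p, M * n) :=
  match M with
  | 0%N => 0
  | S m => block_mx A 0 0 (bd m A) : 'M[R]_(p + m * p, n + m * n)
  end.

Lemma bd_mul p n m M (A : 'M[R]_(p, n)) (B : 'M[R]_(n, m)) : bd M A *m bd M B = bd M (A *m B).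
Proof.
elim: M => [|M IH]; first by rewrite mul0mx.
transitivity ((block_mx A 0 0 (bd M A) : 'M[R]_(p + M * p, n + M * n)) *m
  (block_mx B 0 0 (bd M B) : 'M[R]_(n + M * n, m + M * m))) => //.
by rewrite mulmx_block !mul0mx !mulmx0 !addr0 add0r IH.
Qed.

Lemma bd1 p M : bd M (1%:M : 'M[R]_p) = 1%:M.
Proof.
elim: M => [|M IH]; first by apply/matrixP => -[].
by rewrite /= IH -scalar_mx_block.
Qed.

Lemma bd0 p n M : bd M (0 : 'M[R]_(p, n)) = 0.
Proof. by elim: M => [|M IH]//=; rewrite IH block_mx0. Qed.

Lemma bd_ker n D q M (E : 'M[R]_(n, D)) (B : 'M[R]_(q, n)) (B' : 'M[R]_(n, q)) :
  (forall u : 'rV[R]_n, u *m E = 0 -> u *m B' *m B = u) ->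
  forall u : 'rV[R]_(M * n), u *m bd M E = 0 -> u *m bd M B' *m bd M B = u.
Proof.
move=> kerE; elim: M => [|M IH] u uE; first by apply/rowP => -[].
move: uE; rewrite -[u](@hsubmxK _ 1 n (M * n)); set a := lsubmx _; set b := rsubmx _.
have mb (m : nat) (X : 'M[R]_(n, m)) : (row_mx a b : 'rV_(n + M * n)) *m
    (block_mx X 0 0 (bd M X) : 'M[R]_(n + M * n, m + M * m)) = row_mx (a *m X) (b *m bd M X).
  by rewrite mul_row_block !mulmx0 addr0 add0r.
rewrite [X in X = 0 -> _]mb -[0 in X in X -> _](@row_mx0 _ 1 D (M * D)) => /eq_row_mx[a0 b0].
have mb' : (row_mx (a *m B') (b *m bd M B') : 'rV_(q + M * q)) *m
    (block_mx B 0 0 (bd M B) : 'M[R]_(q + M * q, n + M * n)) =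
    row_mx (a *m B' *m B) (b *m bd M B' *m bd M B).
  by rewrite mul_row_block !mulmx0 addr0 add0r.
rewrite [X in X *m _ = _]mb [LHS]mb' kerE// IH//.
Qed.

End block_diagonal.

Section stacked_kernel.
Context {R : realType}.
Variables (N P d q p : nat) (E : 'M[R]_(N, P)) (C : 'M[R]_(P, N)).
Variables (B : 'M[R]_(q, N)) (B' : 'M[R]_(N, q)).
Variables (be : 'M[R]_(P, d)) (Q : 'M[R]_(p, P)) (Q' : 'M[R]_(P, p)).
Hypothesis CE : C *m E = 1%:M.
Hypothesis BE : B *m E = 0.
Hypothesis BB' : B *m B' = 1%:M.
Hypothesis kerE : forall u : 'rV[R]_N, u *m E = 0 -> u *m B' *m B = u.
Hypothesis Qbe : Q *m be = 0.
Hypothesis QQ' : Q *m Q' = 1%:M.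
Hypothesis kerQ : forall u : 'rV[R]_P, u *m be = 0 -> u *m Q' *m Q = u.

(* A basis of the kernel of [E *m be] from bases of the kernels of [be] and [E]. *)
Definition stackB : 'M[R]_(p + q, N) := col_mx (Q *m C) B.
Definition stackB' : 'M[R]_(N, p + q) := row_mx (E *m Q') (B' - E *m C *m B').

Lemma stackBV : stackB *m stackB' = 1%:M.
Proof.
rewrite mul_col_row !mulmxBr -!mulmxA (mulmxA C E) CE mul1mx QQ' (mulmxA B E) BE mul0mx.
by rewrite (mulmxA C E) CE mul1mx (mulmxA B E) BE mul0mx subrr subr0 BB' -scalar_mx_block.
Qed.

Lemma stackBE : stackB *m (E *m be) = 0.
Proof.
by rewrite mul_col_mx (mulmxA B) BE mul0mx -mulmxA (mulmxA C) CE mul1mx Qbe col_mx0.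
Qed.

Lemma stackB_ker (u : 'rV[R]_N) : u *m (E *m be) = 0 -> u *m stackB' *m stackB = u.
Proof.
rewrite mulmxA => /kerQ uQ; rewrite -mulmxA mul_row_col mulmxDr.
rewrite (_ : u *m (E *m Q' *m (Q *m C)) = u *m E *m C); last first.
  by rewrite -[in RHS]uQ !mulmxA.
have e : (u - u *m E *m C) *m E = 0 by rewrite mulmxBl -!mulmxA CE mulmx1 subrr.
rewrite (_ : u *m ((B' - E *m C *m B') *m B) = (u - u *m E *m C) *m B' *m B); last first.
  by rewrite !(mulmxBl, mulmxBr) !mulmxA.
by rewrite (kerE e) addrC subrK.
Qed.

End stacked_kernel.

(** A matrix and its transpose have the same norm: [sqn (k *m be)] is the pairing of [k] with
    [k *m be *m be^T]. *)
Lemma sqn_adjoint {R : realType} P d (be : 'M[R]_(P, d)) (c : R) : 0 < c ->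
  (forall v : 'rV[R]_d, sqn (v *m be^T) <= c * sqn v) ->
  forall k : 'rV[R]_P, sqn (k *m be) <= c * sqn k.
Proof.
move=> c0 H k; set h := k *m be; have [->|h0] := eqVneq (sqn h) 0.
  by rewrite mulr_ge0 ?sqn_ge0// ltW.
have hp : 0 < sqn h by rewrite lt_neqAle eq_sym h0 sqn_ge0.
have e : sqn h = \sum_i k 0 i * (h *m be^T) 0 i.
  rewrite /sqn; transitivity (\sum_j \sum_i k 0 i * be i j * h 0 j).
    by apply: eq_bigr => j _; rewrite expr2 {1}/h mxE mulr_suml.
  rewrite exchange_big; apply: eq_bigr => i _ /=; rewrite mxE mulr_sumr.
  by apply: eq_bigr => j _; rewrite [be^T _ _]mxE; ring.
have : sqn h ^+ 2 <= sqn k * (c * sqn h).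
  rewrite {1}e; apply: le_trans (sum_CauchySchwarz _ _) _; rewrite ler_wpM2l ?sqn_ge0//.
  exact: H.
by rewrite expr2 mulrA ler_pM2r// mulrC.
Qed.

(** The pseudo-inverse [invmx (E^T *m E) *m E^T] lifts each [h] with least norm. The lower bound on
    [E^T] makes the Gram matrix invertible and controls that norm. *)
Lemma mx_right_inverse {R : realType} N d (E : 'M[R]_(N, d)) (c : R) : 0 < c ->
  (forall v : 'rV[R]_d, c * sqn v <= sqn (v *m E^T)) ->
  exists T : 'M[R]_(d, N), T *m E = 1%:M /\ forall h : 'rV[R]_d, sqn (h *m T) <= c^-1 * sqn h.
Proof.
move=> c0 H; pose W := E^T *m E.
have We (v : 'rV[R]_d) : \sum_j (v *m W) 0 j * v 0 j = sqn (v *m E^T).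
  have -> : \sum_j (v *m W) 0 j * v 0 j = (v *m W *m v^T) 0 0.
    by rewrite mxE; apply: eq_bigr => j _; rewrite [v^T _ _]mxE.
  have -> : v *m W *m v^T = (v *m E^T) *m (v *m E^T)^T.
    by rewrite trmx_mul trmxK !mulmxA.
  by rewrite mxE; apply: eq_bigr => j _; rewrite [_^T _ _]mxE expr2.
have Wu : W \in unitmx.
  rewrite -row_free_unit -kermx_eq0; apply/rowV0P => u /sub_kermxP uW.
  have h0 : c * sqn u <= 0.
    apply: le_trans (H u) _; rewrite -We uW big1// => j _; by rewrite mxE mul0r.
  have {}h0 : sqn u <= 0 by move: h0; rewrite pmulr_rle0.
  apply/rowP => j; rewrite mxE; apply/eqP; rewrite -sqrf_eq0; apply/eqP/le_anti.
  by rewrite sqr_ge0 andbT (le_trans (coord_sqn _ _)).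
exists (invmx W *m E^T); split; first by rewrite -mulmxA mulVmx.
move=> h; set v := h *m invmx W; have vW : v *m W = h by rewrite /v mulmxKV.
rewrite mulmxA -/v -We vW.
have Hv : c * sqn v <= \sum_j h 0 j * v 0 j by rewrite -vW We.
set S := \sum_j _ in Hv *; have S2 := sum_CauchySchwarz (fun j => h 0 j) (fun j => v 0 j).
rewrite -/S -/(sqn h) -/(sqn v) in S2.
have hs := sqn_ge0 h; have vs := sqn_ge0 v.
have S0 : 0 <= S by apply: le_trans Hv; rewrite mulr_ge0// ltW.
have [S00|Sn] := eqVneq S 0; first by rewrite S00 mulr_ge0// invr_ge0 ltW.
have Sp : 0 < S by rewrite lt_neqAle eq_sym Sn.
have : S ^+ 2 <= sqn h * (c^-1 * S).
  apply: le_trans S2 _; rewrite ler_wpM2l// mulrC ler_pdivlMr// mulrC//.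
by rewrite expr2 mulrA ler_pM2r// mulrC.
Qed.

(** * From one cell to all cells and to the spline fiber *)

Section product_cells.
Context {R : realType}.
Variables (de de1 de2 : R -> R) (b0 b2 aa r : R).
Hypothesis de_dv : forall t, dv de t (de1 t).
Hypothesis de1_dv : forall t, dv de1 t (de2 t).
Hypothesis de_le : forall t, `|de t| <= b0.
Hypothesis de2_le : forall t, `|de2 t| <= b2.
Variables (K D q : nat) (E : 'M[R]_(K, D)) (C : 'M[R]_(D, K)).
Variables (B : 'M[R]_(q, K)) (B' : 'M[R]_(K, q)).
Hypothesis CE : C *m E = 1%:M.
Hypothesis BE : B *m E = 0.
Hypothesis BB' : B *m B' = 1%:M.
Hypothesis kerE : forall u : 'rV[R]_K, u *m E = 0 -> u *m B' *m B = u.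
Hypothesis r_gt0 : 0 < r.
Hypothesis cell_lc : forall y u : 'rV[R]_K,
  cell_g de aa B (y + u) * cell_g de aa B (y - u) * expR (r * sqn (u *m E)) <= cell_g de aa B y ^+ 2.

Let dens := site_dens de aa.
Definition Fdens n : 'rV[R]_n -> R := Pi (fun _ => dens).

Lemma Fdens_gb n : gb (@Fdens n).
Proof. by apply: gb_Pi => _; exact: (dens_gb1 aa de_dv de_le). Qed.

Lemma Fdens_gt0 n (x : 'rV[R]_n) : 0 < Fdens x.
Proof. by apply: prodr_gt0 => i _; exact: expR_gt0. Qed.

(** Up to a constant, the product of the cell integrals as a function of the moments [z] of all
    cells; [z *m bd M C] is a point with these moments. *)
Definition Gam M (z : 'rV[R]_(M * D)) : R := fib (bd M B) (z *m bd M C) (@Fdens (M * K)).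

Let bdV M : bd M B *m bd M B' = 1%:M. Proof. by rewrite bd_mul BB' bd1. Qed.
Let bdCE M : bd M C *m bd M E = 1%:M. Proof. by rewrite bd_mul CE bd1. Qed.
Let bdBE M : bd M B *m bd M E = 0. Proof. by rewrite bd_mul BE bd0. Qed.

Lemma Gam_gt0 M (z : 'rV[R]_(M * D)) : 0 < Gam z.
Proof.
by apply: J_gt0 => [|w]; [apply: (fib_gbw (bdV M)); exact: Fdens_gb|exact: Fdens_gt0].
Qed.

Lemma Fdens_row_mx n m (x : 'rV[R]_n) (y : 'rV[R]_m) : Fdens (row_mx x y) = Fdens x * Fdens y.
Proof.
rewrite /Fdens /Pi big_split_ord /=; congr (_ * _); apply: eq_bigr => i _.
  by rewrite row_mxEl.
by rewrite row_mxEr.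
Qed.

(** Splitting off a cell regroups the iterated integral. The constant is that of [isInt_uniq] and
    cancels in estimates of log-concavity. *)
Lemma Gam_rec M : exists2 c : R, 0 < c & forall (a : 'rV[R]_D) (z : 'rV[R]_(M * D)),
  Gam (row_mx a z : 'rV_(M.+1 * D)) = c * (cell_g de aa B (a *m C) * Gam z).
Proof.
pose I (f : 'rV[R]_(q + M * q) -> R) := J (fun u : 'rV_q => J (fun v : 'rV_(M * q) => f (row_mx u v))).
have II : isInt I by exact: isInt_comp (isInt_J q) (isInt_J (M * q)).
pose k := I (gauss 1) / J (gauss 1 : 'rV[R]_(q + M * q) -> R).
have k0 : 0 < k by rewrite divr_gt0 ?(int_gauss II) ?(int_gauss (isInt_J _)).
exists k^-1; first by rewrite invr_gt0.
move=> a z; set y := (row_mx a z : 'rV_(M.+1 * D)) *m bd M.+1 C.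
have gf : gb (fun w : 'rV[R]_(q + M * q) => Fdens (y + w *m bd M.+1 B)).
  by apply: (fib_gbw (bdV M.+1)); exact: Fdens_gb.
have := isInt_uniq II gf; rewrite -/k => e.
have -> : Gam (row_mx a z : 'rV_(M.+1 * D)) = J (fun w : 'rV[R]_(q + M * q) => Fdens (y + w *m bd M.+1 B)) by [].
apply: (mulfI (lt0r_neq0 k0)); rewrite [RHS]mulrA mulfV ?gt_eqF// mul1r -e /I.
have yE : y = row_mx (a *m C) (z *m bd M C) :> 'rV_(K + M * K).
  by rewrite /y; etransitivity; [exact: (@mul_row_block _ 1 D (M * D) K (M * K))|rewrite !mulmx0 addr0 add0r].
have wE (u : 'rV[R]_q) (v : 'rV[R]_(M * q)) : (row_mx u v : 'rV_(q + M * q)) *m bd M.+1 B =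
    row_mx (u *m B) (v *m bd M B) :> 'rV_(K + M * K).
  by etransitivity; [exact: (@mul_row_block _ 1 q (M * q) K (M * K))|rewrite !mulmx0 addr0 add0r].
have FE u v : Fdens (y + (row_mx u v : 'rV_(q + M * q)) *m bd M.+1 B) =
    Fdens (a *m C + u *m B) * Fdens (z *m bd M C + v *m bd M B).
  rewrite wE yE; transitivity (Fdens (row_mx (a *m C + u *m B) (z *m bd M C + v *m bd M B) : 'rV_(K + M * K))).
    by congr Fdens; exact: (@add_row_mx _ 1 K (M * K)).
  exact: Fdens_row_mx.
under eq_fun do under eq_fun do rewrite FE.
have gv : gb (fun v : 'rV[R]_(M * q) => Fdens (z *m bd M C + v *m bd M B)).
  by apply: (fib_gbw (bdV M)); exact: Fdens_gb.
have gu : gb (fun u : 'rV[R]_q => Fdens (a *m C + u *m B)) by apply: (fib_gbw BB'); exact: Fdens_gb.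
under eq_fun do rewrite (intZ (isInt_J _) _ gv) mulrC.
by rewrite (intZ (isInt_J _) _ gu) mulrC.
Qed.

Theorem Gam_log_concave M (z k : 'rV[R]_(M * D)) :
  Gam (z + k) * Gam (z - k) * expR (r * sqn k) <= Gam z ^+ 2.
Proof.
elim: M z k => [|M IH] z k.
  have e (u v : 'rV[R]_(0 * D)) : u = v by apply/rowP => -[].
  rewrite (e (z + k) z) (e (z - k) z) /sqn big_ord0 mulr0 expR0 mulr1; exact: lexx.
have [c c0 H] := Gam_rec M.
rewrite -[z](@hsubmxK _ 1 D (M * D)) -[k](@hsubmxK _ 1 D (M * D)).
set a := lsubmx z; set b := rsubmx z; set a' := lsubmx k; set b' := rsubmx k.
rewrite (_ : row_mx a b + row_mx a' b' = row_mx (a + a') (b + b')); last exact: (@add_row_mx _ 1).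
rewrite (_ : row_mx a b - row_mx a' b' = row_mx (a - a') (b - b')); last first.
  by rewrite (@opp_row_mx _ 1 D (M * D)); exact: (@add_row_mx _ 1).
rewrite !H (_ : sqn (row_mx a' b' : 'rV_(D + M * D)) = sqn a' + sqn b'); last exact: sqn_row_mx.
rewrite mulrDr expRD !mulmxDl mulNmx.
have h1 := cell_lc (a *m C) (a' *m C); rewrite -(mulmxA a') CE mulmx1 in h1.
have h2 := IH b b'.
set g1 := cell_g _ _ _ (_ + _); set g2 := cell_g _ _ _ (_ - _) in h1 *.
rewrite -/g1 in h1; set G1 := Gam (b + b') in h2 *; set G2 := Gam (b - b') in h2 *.
have p (x y : R) : 0 < x -> 0 < y -> 0 <= x * y by move=> *; exact/ltW/mulr_gt0.
have g10 : 0 < g1 by exact: (cell_g_gt0 aa de_dv de_le BB').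
have g20 : 0 < g2 by exact: (cell_g_gt0 aa de_dv de_le BB').
have := ler_pM _ _ h1 h2.
rewrite !mulr_ge0 ?expR_ge0 ?(ltW g10) ?(ltW g20) ?(ltW (Gam_gt0 _))// => /(_ isT isT) HH.
rewrite !exprMn (_ : _ * _ * _ = c ^+ 2 * (g1 * g2 * expR (r * sqn a') * (G1 * G2 * expR (r * sqn b')))); last ring.
by rewrite ler_wpM2l ?sqr_ge0.
Qed.

Section global.
Variables (M d : nat) (be : 'M[R]_(M * D, d)) (c2 : R).
Hypothesis c2_gt0 : 0 < c2.
Hypothesis be_le : forall v : 'rV[R]_d, sqn (v *m be^T) <= c2 * sqn v.

Let Q := kerB be.
Let Q' := pinvmx Q.
(** Coordinates of the fiber over a spline: first the changes of the cell moments that leave the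
    spline fixed, then the fibers of the cells. *)
Definition glB := stackB (bd M C) (bd M B) Q.
Definition glB' := stackB' (bd M E) (bd M C) (bd M B') Q'.
Definition glE : 'M[R]_(M * K, d) := bd M E *m be.

Lemma glBE : glB *m glE = 0.
Proof. by apply: stackBE; rewrite ?bdCE ?bdBE ?kerBE. Qed.

Lemma glBV : glB *m glB' = 1%:M.
Proof. by apply: stackBV; rewrite ?bdCE ?bdBE ?bdV ?kerBV. Qed.

Lemma glB_ker (u : 'rV[R]_(M * K)) : u *m glE = 0 -> u *m glB' *m glB = u.
Proof.
apply: stackB_ker; rewrite ?bdCE//; first exact: bd_ker.
exact: kerB_ker.
Qed.

Definition glZ (y : 'rV[R]_(M * K)) : R := fib glB y (@Fdens (M * K)).

Lemma glZ_gt0 y : 0 < glZ y.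
Proof.
by apply: J_gt0 => [|w]; [apply: (fib_gbw glBV); exact: Fdens_gb|exact: Fdens_gt0].
Qed.

Let fibGam (y : 'rV[R]_(M * K)) : fib (bd M B) y (@Fdens (M * K)) = Gam (y *m bd M E).
Proof.
apply: (fib_ker (bdV M) (bd_ker kerE)); first exact: Fdens_gb.
by rewrite -!mulmxA bdCE mulmx1.
Qed.

Let gamma (y : 'rV[R]_(M * K)) t := Gam (y *m bd M E + t *m Q).

Let JE y t : J (fun v => Fdens (y + row_mx t v *m glB)) = gamma y t.
Proof.
have -> : gamma y t = fib (bd M B) (y + t *m Q *m bd M C) (@Fdens (M * K)).
  by rewrite fibGam mulmxDl -!(mulmxA _ _ (bd M E)) bdCE mulmx1.
by congr J; apply/funext => v; rewrite mul_row_col addrA mulmxA.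
Qed.

Let gbG y : gb (gamma y).
Proof.
have := gb_int2 (isInt_J _) (gb_gb2 (fib_gbw glBV y (Fdens_gb (M * K)))).
by under eq_fun do rewrite JE.
Qed.

Let glZE : exists2 c : R, 0 < c & forall y, glZ y = c * J (gamma y).
Proof.
pose I (f : 'rV[R]_(\rank (kermx be) + M * q) -> R) :=
  J (fun u : 'rV_(\rank (kermx be)) => J (fun v : 'rV_(M * q) => f (row_mx u v))).
have II : isInt I by exact: isInt_comp (isInt_J _) (isInt_J _).
pose k := I (gauss 1) / J (gauss 1 : 'rV[R]_(\rank (kermx be) + M * q) -> R).
have k0 : 0 < k by rewrite divr_gt0 ?(int_gauss II) ?(int_gauss (isInt_J _)).
exists k^-1 => [|y]; first by rewrite invr_gt0.
have := isInt_uniq II (fib_gbw glBV y (Fdens_gb (M * K))).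
rewrite -/k /I; under eq_fun do rewrite JE.
by move=> ->; rewrite mulrA mulVf ?mul1r ?gt_eqF.
Qed.

(** Up to a constant the fiber integral is that of [Gam] over a translate of the kernel of [be].
    Strong log-concavity survives this marginalisation because the half-difference [w] of two points
    over [y + u] and [y - u] satisfies [w *m be = u *m glE], whatever the points: a constant
    Gaussian factor can be taken out before Prekopa-Leindler applies. *)
Theorem glZ_lower y u : glZ (y + u) * glZ (y - u) * expR (r / c2 * sqn (u *m glE)) <= glZ y ^+ 2.
Proof.
have [c c0 H] := glZE; rewrite !H.
have alg (a b k : R) : c * a * (c * b) * k = c ^+ 2 * (k * a * b) by ring.
set k := expR _; have k0 : 0 < k by exact: expR_gt0.
have := @prekopa_leindler R _ (fun t => k * gamma (y + u) t) (gamma (y - u)) (gamma y)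
  (gbZ k (gbG _)) (gbG _) (gbG _).
rewrite (intZ (isInt_J _) k (gbG _)) => HH.
rewrite alg.
rewrite exprMn ler_wpM2l ?sqr_ge0//; apply: HH => [x|x|x|x x'].
- by rewrite mulr_gt0// Gam_gt0.
- exact: Gam_gt0.
- exact: Gam_gt0.
set z := y *m bd M E + (2^-1 *: (x + x')) *m Q.
pose w := u *m bd M E + (2^-1 *: (x - x')) *m Q.
have half (a : 'rV[R]_(M * D)) : a = 2^-1 *: a + 2^-1 *: a.
  by rewrite -scalerDl (_ : 2^-1 + 2^-1 = 1 :> R) ?scale1r//; field.
have e1 : (y + u) *m bd M E + x *m Q = z + w.
  rewrite /z /w mulmxDl -!scalemxAl mulmxDl mulmxBl scalerDr scalerBr {1}[x *m Q]half.
  by apply/rowP => i; rewrite !mxE; ring.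
have e2 : (y - u) *m bd M E + x' *m Q = z - w.
  rewrite /z /w mulmxBl -!scalemxAl mulmxDl mulmxBl scalerDr scalerBr {1}[x' *m Q]half.
  by apply/rowP => i; rewrite !mxE; ring.
rewrite /gamma e1 e2; apply: le_trans (Gam_log_concave z w).
rewrite -mulrA mulrC ler_wpM2l ?mulr_ge0 ?(ltW (Gam_gt0 _))// ler_expR.
have -> : u *m glE = w *m be.
  by rewrite /w mulmxDl -[_ *m Q *m be]mulmxA kerBE mulmx0 addr0 mulmxA.
rewrite mulrAC ler_pdivrMr// -mulrA ler_wpM2l ?(ltW r_gt0)// mulrC.
exact: (sqn_adjoint c2_gt0 be_le).
Qed.

Theorem glZ_upper y u : glZ y ^+ 2 <= expR ((1 + b2) * sqn u) * (glZ (y + u) * glZ (y - u)).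
Proof.
have gf y' : gb (fun w : 'rV_(\rank (kermx be) + M * q) => Fdens (y' + w *m glB)).
  by apply: (fib_gbw glBV); exact: Fdens_gb.
apply: (int_midpoint (isInt_J _)) => //; try (by move=> w; exact: ltW (Fdens_gt0 _)); try exact: expR_gt0; try exact: glZ_gt0.
move=> w; have := @Pi_midpoint R (M * K) (fun _ => dens) (fun _ => cell_th de1 aa) (fun _ t => 1 + de2 t) (1 + b2) _ _ _ _ (y + w *m glB) u.
rewrite ![_ + w *m glB + _]addrAC; apply.
- by move=> _ t; exact: expR_gt0.
- by move=> _ t; exact: site_dens_dv.
- by move=> _ t; exact: cell_th_dv.
- by move=> _ t; apply: le_trans (ler_normD _ _) _; rewrite normr1 lerD2l.
Qed.

End global.

End product_cells.

(** * Hausdorff measure on affine subspaces *)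

Section hausdorff_outer.
Context {R : realType}.
Variables (N d : nat).
Local Open Scope ereal_scope.

Let hd (delta : R) (S : set (all_sets R N)) : \bar R := mu_ext (@hausdorff_cost R N d delta) S.
Let nu := hausdorff_outer_measure R N d.

Lemma dist_coord (x y : 'rV[R]_N) i : (`|x 0 i - y 0 i| <= euclidean_dist x y)%R.
Proof.
rewrite -sqrtr_sqr /euclidean_dist ler_wsqrtr//.
by rewrite (bigD1 i)//= lerDl; apply: sumr_ge0 => j _; exact: sqr_ge0.
Qed.

Lemma ubv_gt0 n : (0 < unit_ball_volume R n)%R.
Proof.
suff: (0 < unit_ball_volume R n)%R /\ (0 < unit_ball_volume R n.+1)%R by case.
elim: n => [|n [IH0 IH1]]; first by [].
by split=> //=; rewrite mulr_gt0// divr_gt0// mulr_gt0// pi_gt0.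
Qed.

Definition haus_k : R := unit_ball_volume R d / 2 ^+ d.

Lemma haus_k_gt0 : (0 < haus_k)%R.
Proof. by rewrite divr_gt0 ?ubv_gt0// exprn_gt0. Qed.

Lemma diam_ge0 (U : set 'rV[R]_N) x : U x -> 0 <= euclidean_diam U.
Proof.
move=> Ux; apply: ereal_sup_ubound; exists x, x; split=> //.
by rewrite /euclidean_dist big1 ?sqrtr0// => i _; rewrite subrr expr0n.
Qed.

Lemma cost0 delta : @hausdorff_cost R N d delta set0 = 0.
Proof. by rewrite /hausdorff_cost eqxx. Qed.

Lemma cost_ge0 delta U : 0 <= @hausdorff_cost R N d delta U.
Proof.
rewrite /hausdorff_cost; case: eqP => // /eqP/set0P[x Ux].
case: ifP => _; last exact: leey.
by rewrite mule_ge0 ?lee_fin ?(ltW haus_k_gt0)// expe_ge0// (diam_ge0 Ux).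
Qed.

Lemma cost_le delta delta' U : (delta <= delta')%R ->
  @hausdorff_cost R N d delta' U <= @hausdorff_cost R N d delta U.
Proof.
move=> dd; rewrite /hausdorff_cost; case: eqP => // _.
have [h|h] := boolP (euclidean_diam U <= delta%:E); last exact: leey.
by rewrite ifT// (le_trans h)// lee_fin.
Qed.

Lemma cost_ub delta (r : R) U : (0 <= r)%R -> (r <= delta)%R -> euclidean_diam U <= r%:E ->
  @hausdorff_cost R N d delta U <= (haus_k * r ^+ d)%:E.
Proof.
move=> r0 rd Ur; rewrite /hausdorff_cost; case: eqP => [_|/eqP/set0P[x Ux]].
  by rewrite lee_fin mulr_ge0 ?(ltW haus_k_gt0)// exprn_ge0.
rewrite ifT ?(le_trans Ur) ?lee_fin// -/haus_k [leRHS]EFinM lee_pmul2l ?lte_fin ?haus_k_gt0//.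
have := diam_ge0 Ux; case: (euclidean_diam U) Ur => [v| |]//; rewrite !lee_fin => vr v0.
by rewrite -EFin_expe lee_fin lerXn2r ?nnegrE.
Qed.

Lemma hd_le delta delta' S : (delta <= delta')%R -> hd delta' S <= hd delta S.
Proof.
move=> dd; apply: le_ereal_inf_tmp => _ [F SF <-].
apply: (@le_trans _ _ (\sum_(k <oo) @hausdorff_cost R N d delta' (F k))).
  by apply: ereal_inf_lbound; exists F.
by apply: lee_nneseries => [k _ _|k _]; [exact: cost_ge0|exact: cost_le].
Qed.

Lemma hd_nu delta S : (0 < delta)%R -> hd delta S <= nu S.
Proof. by move=> d0; apply: ereal_sup_ubound; exists delta. Qed.

Lemma hd_ge0 delta S : 0 <= hd delta S.
Proof. by apply: mu_ext_ge0 => U; exact: cost_ge0. Qed.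

Lemma nu_le M S : (forall delta, (0 < delta)%R -> hd delta S <= M) -> nu S <= M.
Proof. by move=> H; apply: ge_ereal_sup => _ [e e0 <-]; exact: H. Qed.

(** A set of diameter at most [delta < t - s] cannot meet both [S] and [T], and larger ones cost
    [+oo]: a cover of finite cost splits into one of [S] and one of [T]. *)
Lemma hd_sep (i : 'I_N) (s t delta : R) (S T : set 'rV[R]_N) : (s < t)%R -> (delta < t - s)%R ->
  (forall x, S x -> (x 0 i <= s)%R) -> (forall x, T x -> (t <= x 0 i)%R) ->
  hd delta S + hd delta T <= hd delta (S `|` T).
Proof.
move=> st dst Ss Tt; apply: le_ereal_inf_tmp => _ [F [_ STF] <-].
pose P (Y : set 'rV[R]_N) k : set (all_sets R N) := if `[< exists x, F k x /\ Y x >] then F k else set0.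
have cov Y : Y `<=` S `|` T -> hd delta Y <= \sum_(k <oo) @hausdorff_cost R N d delta (P Y k).
  move=> YS; apply: ereal_inf_lbound; exists (P Y) => //; split=> // x Yx.
  have [k _ Fx] := STF x (YS x Yx); exists k => //.
  by rewrite /P ifT//; apply/asboolP; exists x.
apply: (@le_trans _ _ (\sum_(k <oo) (@hausdorff_cost R N d delta (P S k) + @hausdorff_cost R N d delta (P T k)))).
  rewrite nneseriesD; [|by move=> *; exact: cost_ge0|by move=> *; exact: cost_ge0].
  by apply: leeD; apply: cov; [exact: subsetUl|exact: subsetUr].
apply: lee_nneseries => [k _ _|k _]; first by rewrite adde_ge0 ?cost_ge0.
rewrite /P; case: asboolP => [[x [Fx Sx]]|_]; case: asboolP => [[y [Fy Ty]]|_];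
  rewrite ?cost0 ?adde0 ?add0e ?cost_ge0//.
rewrite {3}/hausdorff_cost; case: eqP => [F0|_]; first by rewrite F0 in Fx.
rewrite ifF ?leey//; apply/negbTE; rewrite -ltNge.
apply: (@lt_le_trans _ _ (euclidean_dist x y)%:E).
  rewrite lte_fin; apply: lt_le_trans (dist_coord x y i).
  by have := Ss x Sx; have := Tt y Ty; rewrite distrC => h1 h2; apply: lt_le_trans (ler_norm _); lra.
by apply: ereal_sup_ubound; exists x, y.
Qed.

Lemma nu_sep (i : 'I_N) (s t : R) (S T : set 'rV[R]_N) : (s < t)%R ->
  (forall x, S x -> (x 0 i <= s)%R) -> (forall x, T x -> (t <= x 0 i)%R) ->
  nu S + nu T <= nu (S `|` T).
Proof.
move=> st Ss Tt; have [->|fin] := eqVneq (nu (S `|` T)) +oo; first exact: leey.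
have finU : nu (S `|` T) \is a fin_num by rewrite ge0_fin_numE ?ltey// outer_measure_ge0.
have sub (Y : set 'rV[R]_N) : Y `<=` S `|` T -> nu Y \is a fin_num.
  move=> YS; rewrite ge0_fin_numE ?outer_measure_ge0//.
  apply: le_lt_trans (le_outer_measure nu _ _ YS) _; by rewrite ltey.
(* The suprema over the mesh are taken separately for [S] and [T]; a mesh below both and below
   [t - s] serves them together. *)
have H (d1 d2 : R) : (0 < d1)%R -> (0 < d2)%R -> hd d1 S + hd d2 T <= nu (S `|` T).
  move=> d10 d20; pose m : R := Num.min (Num.min d1 d2) ((t - s) / 2)%R.
  have m0 : (0 < m)%R by rewrite !lt_min d10 d20 divr_gt0// subr_gt0.
  apply: (@le_trans _ _ (hd m S + hd m T)).
    by apply: leeD; apply: hd_le; rewrite !ge_min lexx ?orbT.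
  apply: le_trans (hd_sep st _ Ss Tt) (hd_nu _ m0).
  rewrite gt_min; apply/orP; right; lra.
have fT (d2 : R) : (0 < d2)%R -> hd d2 T \is a fin_num.
  move=> d20; rewrite ge0_fin_numE ?hd_ge0//; apply: le_lt_trans (hd_nu _ d20) _.
  have := sub T (@subsetUr _ _ _); by rewrite ge0_fin_numE// outer_measure_ge0.
have fS := sub S (@subsetUl _ _ _).
rewrite addeC -leeBrDr//; apply: nu_le => d2 d20.
rewrite leeBrDr// addeC -leeBrDr ?fT//; apply: nu_le => d1 d10.
by rewrite leeBrDr ?fT//; exact: H.
Qed.

(* Hausdorff measure is additive on sets at positive distance; slabs accumulating
   at the hyperplane separate the two sides up to a summable tail. *)
Lemma halfspace_measurable (i : 'I_N) (a : R) : nu.-caratheodory [set x | (x 0 i <= a)%R].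
Proof.
apply: le_caratheodory_measurable => X; set A := [set x | _].
have [->|fin] := eqVneq (nu X) +oo; first exact: leey.
have finX : nu X \is a fin_num by rewrite ge0_fin_numE ?ltey// outer_measure_ge0.
pose tau (k : nat) : R := (a + k.+1%:R^-1)%R.
have tauS k l : (k < l)%N -> (tau l < tau k)%R.
  by move=> kl; rewrite ltrD2l ltf_pV2 ?posrE// ltr_nat ltnS.
pose Rg k := X `&` [set x : 'rV[R]_N | (tau k.+1 <= x 0 i < tau k)%R].
pose T n := X `&` [set x : 'rV[R]_N | (tau n <= x 0 i)%R].
(* Adjacent slabs touch, slabs of equal parity do not: the even ([e = 0]) and the odd ([e = 1]) ones
   are summed separately, each sum staying below [nu X]. *)
have parts e n : \sum_(k < n.+1) nu (Rg (k.*2 + e)%N) <= nu (T (n.*2 + e).+1).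
  elim: n => [|n IH].
    by rewrite big_ord1; apply: le_outer_measure => x [Xx /= /andP[h1 _]]; split.
  rewrite big_ord_recr /=; apply: (@le_trans _ _ (nu (T (n.*2 + e).+1) + nu (Rg (n.+1.*2 + e)%N))).
    by rewrite leeD2r.
  rewrite addeC; apply: (@le_trans _ _ (nu (Rg (n.+1.*2 + e)%N `|` T (n.*2 + e).+1))).
    apply: (@nu_sep i (tau (n.+1.*2 + e)%N) (tau (n.*2 + e).+1)).
    - by apply: tauS; rewrite doubleS !addSn.
    - by move=> x [_ /= /andP[_ /ltW]].
    - by move=> x [_ /=].
  apply: le_outer_measure => x [[Xx /= /andP[h1 _]]|[Xx /= h]]; split=> //=.
  by apply: le_trans h; rewrite ltW// tauS// doubleS !addSn ltnS.
have Tn n : nu (T n) <= nu X by apply: le_outer_measure => x [].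
have R0 k : 0 <= nu (Rg k) by exact: outer_measure_ge0.
have sumR : \sum_(0 <= k <oo) nu (Rg k) <= nu X + nu X.
  apply: lime_le; first by apply: is_cvg_nneseries.
  near=> n; apply: (@le_trans _ _ (\sum_(0 <= k < (n.+1).*2) nu (Rg k))).
    apply: lee_sum_nneg_natr => //; by rewrite -addnn; exact: leq_trans (leqnSn n) (leq_addr _ _).
  have -> : \sum_(0 <= k < (n.+1).*2) nu (Rg k) =
      \sum_(k < n.+1) nu (Rg (k.*2 + 0)%N) + \sum_(k < n.+1) nu (Rg (k.*2 + 1)%N).
    elim: (n.+1) => [|m IH]; first by rewrite big_nil !big_ord0 adde0.
    rewrite doubleS !big_nat_recr//= IH !big_ord_recr /= addn0 addn1.
    by rewrite -!addeA; congr (_ + _); rewrite addeCA.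
  by apply: leeD; apply: le_trans (parts _ _) (Tn _).
have fsum : \sum_(0 <= k <oo) nu (Rg k) < +oo.
  by apply: le_lt_trans sumR _; rewrite ltey_eq fin_numD finX.
have tail := nneseries_tail_cvg fsum (fun k _ => R0 k).
have key n : nu (X `&` A) + nu (X `&` ~` A) <= nu X + \sum_(n <= k <oo) nu (Rg k).
  apply: (@le_trans _ _ (nu (X `&` A) + (nu (T n) + \sum_(n <= k <oo) nu (Rg k)))).
    rewrite leeD2l//; apply: (@le_trans _ _ (nu (T n `|` \bigcup_(k in ~` `I_n) Rg k))).
      apply: le_outer_measure => x [Xx /= /negP]; rewrite -ltNge => ax.
      have [h|h] := leP (tau n) (x 0%R i); [by left|right].
      pose Pk k := (tau k <= x 0 i)%R.
      have exk : exists k, Pk k.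
        exists (Num.truncn (x 0 i - a)^-1)%R; rewrite /Pk /tau -lerBrDl.
        rewrite -[leRHS]invrK lef_pV2 ?posrE ?invr_gt0 ?subr_gt0//.
        have q0 : (0 <= (x 0 i - a)^-1)%R by rewrite invr_ge0 subr_ge0 ltW.
        by have /andP[_ /ltW] := truncn_itv q0.
      have nk : (n < ex_minn exk)%N.
        case: ex_minnP => k Pk_ _; rewrite ltnNge; apply/negP => kn.
        move: h; rewrite ltNge => /negP; apply; apply: le_trans Pk_.
        by move: kn; rewrite leq_eqVlt => /predU1P[->//|/tauS/ltW].
      case: ex_minnP nk => k Pk_ mk nk; case: k Pk_ mk nk => // k Pk_ mk nk.
      exists k; first by move=> /= kn; move: nk; rewrite ltnS leqNgt => /negP; apply.
      split=> //=; apply/andP; split=> //; rewrite ltNge; apply/negP => /mk.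
      by rewrite ltnn.
    apply: le_trans (outer_measureU2 nu _ _) _; rewrite leeD2l//.
    exact: outer_measure_sigma_subadditive_tail.
  rewrite addeA leeD2r//; apply: (@le_trans _ _ (nu ((X `&` A) `|` T n))).
    apply: (@nu_sep i a (tau n)) => [||x [_]//]; first by rewrite ltrDl invr_gt0.
    by move=> x [_].
  by apply: le_outer_measure => x [[]|[]].
apply/lee_addgt0Pr => e e0.
have [n _ Hn] : \forall n \near \oo, \sum_(n <= k <oo) nu (Rg k) < e%:E.
  have fin_tail : \forall n \near \oo, \sum_(n <= k <oo) nu (Rg k) \is a fin_num.
    near=> n; rewrite ge0_fin_numE; last by apply: nneseries_ge0.
    apply: le_lt_trans fsum; rewrite (@nneseries_split _ _ 0%N n)// leeDr//.
    by rewrite big_nat sume_ge0.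
  have /fine_cvgP[_ /cvgrPdist_lt/(_ e e0) H] := tail.
  near=> n; have ft : \sum_(n <= k <oo) nu (Rg k) \is a fin_num by near: n.
  rewrite -(fineK ft) lte_fin; apply: le_lt_trans (ler_norm _) _.
  rewrite -normrN -sub0r; near: n; exact: H.
by apply: le_trans (key n) _; rewrite leeD2l// ltW// Hn//=.
Unshelve. all: by end_near.
Qed.

Lemma nu_translate (a : 'rV[R]_N) (S : set 'rV[R]_N) : nu [set x | S (x + a)%R] = nu S.
Proof.
suff H b (T : set 'rV[R]_N) : nu [set x | T (x + b)%R] <= nu T.
  apply/eqP; rewrite eq_le H/=; have := H (- a)%R [set x | S (x + a)%R].
  by congr (nu _ <= _); apply/seteqP; split=> x /=; rewrite subrK.
apply: nu_le => delta d0; apply: le_trans (hd_nu T d0).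
apply: le_ereal_inf_tmp => _ [F [_ TF] <-].
pose F' k : set (all_sets R N) := [set x | F k (x + b)%R].
apply: (@le_trans _ _ (\sum_(k <oo) @hausdorff_cost R N d delta (F' k))).
  apply: ereal_inf_lbound; exists F' => //; split=> // x /= Tx.
  by have [k _ Fk] := TF _ Tx; exists k.
apply: lee_nneseries => [k _ _|k _]; first exact: cost_ge0.
have diamE : euclidean_diam (F' k) <= euclidean_diam (F k).
  apply: ge_ereal_sup => _ [x [y [Fx Fy ->]]]; apply: ereal_sup_ubound.
  exists (x + b)%R, (y + b)%R; split=> //; congr EFin; rewrite /euclidean_dist.
  by congr Num.sqrt; apply: eq_bigr => i _; rewrite !mxE; congr (_ ^+ 2)%R; ring.
rewrite {1}/hausdorff_cost; case: eqP => [_|/eqP/set0P[x Fx]]; first exact: cost_ge0.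
rewrite /hausdorff_cost; case: eqP => [F0|_].
  by move: Fx; rewrite /F' F0.
case: ifPn => h; last by rewrite ifN// -ltNge (lt_le_trans _ diamE)// ltNge.
have h0 := @diam_ge0 (F' k) x Fx.
have [hk|hk] := boolP (euclidean_diam (F k) <= delta%:E); last exact: leey.
rewrite lee_wpmul2l ?lee_fin ?(ltW haus_k_gt0)//.
move: h0 diamE h hk; case: (euclidean_diam (F' k)) => [u| |]//; case: (euclidean_diam (F k)) => [v| |]//.
rewrite !lee_fin => u0 uv _ _; rewrite -!EFin_expe lee_fin lerXn2r ?nnegrE//.
exact: le_trans uv.
Qed.

Lemma hd_seq delta (s : seq (set 'rV[R]_N)) (S : set 'rV[R]_N) :
  (forall x, S x -> exists2 U, U \in s & U x) ->
  hd delta S <= \sum_(U <- s) @hausdorff_cost R N d delta U.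
Proof.
move=> Ss; pose F k : set (all_sets R N) := nth set0 s k.
apply: (@le_trans _ _ (\sum_(k <oo) @hausdorff_cost R N d delta (F k))).
  apply: ereal_inf_lbound; exists F => //; split=> // x /Ss[U Us Ux].
  by exists (index U s) => //; rewrite /F nth_index.
rewrite (@nneseries_split _ _ 0%N (size s)); last by move=> *; exact: cost_ge0.
rewrite [X in _ + X]eseries0 ?adde0; last first.
  by move=> k sk _; rewrite /F nth_default ?cost0.
by rewrite add0n (big_nth set0).
Qed.

End hausdorff_outer.

Lemma dist_sqn {R : realType} n (x y : 'rV[R]_n) : euclidean_dist x y = Num.sqrt (sqn (x - y)).
Proof. by congr Num.sqrt; apply: eq_bigr => i _; rewrite !mxE. Qed.

Section hausdorff_affine.
Context {R : realType}.
Variables (N d : nat) (B : 'M[R]_(d, N)) (B' : 'M[R]_(N, d)) (x0 : 'rV[R]_N).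
Hypothesis BB' : B *m B' = 1%:M.
Local Open Scope ereal_scope.

Let nu := hausdorff_outer_measure R N d.

Definition cube (s : R) : set 'rV[R]_N :=
  [set x | exists2 w : 'rV[R]_d, forall i, (`|w 0 i| <= s)%R & x = (x0 + w *m B)%R].

Definition cube_const : R := @haus_k R d * (2 * Num.sqrt (frob B * d%:R)) ^+ d.

(** Cutting the parameter cube into [n ^ d] subcubes divides the bound on the diameter by [n], so
    the total cost does not depend on [n], which is then taken large enough for the mesh [delta]. *)
Lemma cube_le (s : R) : (0 <= s)%R -> nu (cube s) <= (cube_const * s ^+ d)%:E.
Proof.
move=> s0; apply: nu_le => delta d0.
pose c := (2 * Num.sqrt (frob B * d%:R))%R.
have c0 : (0 <= c)%R by rewrite mulr_ge0// sqrtr_ge0.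
pose n := (Num.truncn (c * s / delta)).+1.
have n0 : (0 < n%:R :> R)%R by rewrite ltr0n.
have nd : (c * s / n%:R <= delta)%R.
  rewrite ler_pdivrMr// [(delta * _)%R]mulrC -ler_pdivrMr//.
  have q0 : (0 <= c * s / delta)%R by rewrite divr_ge0 ?mulr_ge0// ltW.
  by have /andP[_ /ltW] := truncn_itv q0.
pose U (k : {ffun 'I_d -> 'I_n}) : set 'rV[R]_N := [set x | exists2 w : 'rV[R]_d,
  forall i, (- s + 2 * s * (k i)%:R / n%:R <= w 0 i <= - s + 2 * s * (k i).+1%:R / n%:R)%R &
  x = (x0 + w *m B)%R].
have := @hd_seq R N d delta [seq U k | k <- enum {ffun 'I_d -> 'I_n}] (cube s).
rewrite big_map => H; apply: le_trans (H _) _.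
  move=> x [w ws ->].
  have idx i : exists k : 'I_n,
      (- s + 2 * s * k%:R / n%:R <= w 0 i <= - s + 2 * s * k.+1%:R / n%:R)%R.
    have := ws i; rewrite ler_norml => /andP[w1 w2].
    have [sz|sn] := eqVneq s 0%R.
      have z (y u : R) : (2 * s * y / u = 0)%R by rewrite sz mulr0 !mul0r.
      by exists ord0; rewrite !z !addr0; apply/andP; split; lra.
    have sp : (0 < s)%R by rewrite lt_neqAle eq_sym sn.
    pose q := ((w 0 i + s) / (2 * s) * n%:R)%R.
    have q0 : (0 <= q)%R by rewrite mulr_ge0// divr_ge0 ?mulr_ge0//; lra.
    have qn : (q <= n%:R)%R.
      by rewrite ler_piMl ?ler0n// ler_pdivrMr ?mulr_gt0// mul1r; lra.
    have [k kq qk] : exists2 k : 'I_n, (k%:R <= q)%R & (q <= k.+1%:R)%R.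
      have /andP[t1 t2] := truncn_itv q0.
      have [tn|nt] := ltnP (Num.truncn q) n.
        by exists (Ordinal tn) => //=; exact: ltW.
      exists ord_max => //=; apply: le_trans t1; rewrite ler_nat.
      by apply: leq_trans nt; exact: leqnSn.
    have wE : (w 0 i = - s + 2 * s * q / n%:R)%R.
      rewrite /q; field; by rewrite sn gt_eqF.
    exists k; rewrite wE !lerD2l !ler_pM2r ?invr_gt0// !ler_pM2l ?mulr_gt0//.
    by rewrite kq qk.
  have /choice[k Hk] := idx.
  exists (U [ffun i => k i]); first by apply: map_f; rewrite mem_enum.
  by exists w => // i; rewrite ffunE.
apply: (@le_trans _ _ (\sum_(k <- enum {ffun 'I_d -> 'I_n}) (@haus_k R d * (c * s / n%:R) ^+ d)%:E)).
  apply: lee_sum => k _; apply: cost_ub => //.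
    by rewrite divr_ge0 ?mulr_ge0// ltW.
  apply: ge_ereal_sup => _ [_ [_ [[w ws ->] [w' ws' ->] ->]]].
  rewrite lee_fin dist_sqn (_ : x0 + w *m B - (x0 + w' *m B) = (w - w') *m B)%R; last first.
    by rewrite mulmxBl opprD addrACA subrr add0r.
  have L i : ((w - w') 0 i ^+ 2 <= (2 * s / n%:R) ^+ 2)%R.
    rewrite -real_normK ?num_real// lerXn2r ?nnegrE ?divr_ge0 ?mulr_ge0//.
    have e : (2 * s * (k i).+1%:R / n%:R = 2 * s * (k i)%:R / n%:R + 2 * s / n%:R)%R.
      by rewrite -[(k i).+1%:R]natr1; ring.
    rewrite !mxE ler_norml; have := ws i; have := ws' i.
    rewrite e => /andP[h1 h2] /andP[h3 h4]; apply/andP; split; lra.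
  have -> : (c * s / n%:R = Num.sqrt (frob B * (d%:R * (2 * s / n%:R) ^+ 2)))%R.
    rewrite mulrA sqrtrM ?mulr_ge0 ?frob_ge0// sqrtr_sqr ger0_norm; last by rewrite divr_ge0 ?mulr_ge0.
    by rewrite /c; ring.
  apply: ler_wsqrtr; apply: le_trans (sqn_mulmx _ _) _; rewrite ler_wpM2l ?frob_ge0//.
  apply: (@le_trans _ _ (\sum_(i < d) (2 * s / n%:R) ^+ 2)%R); first by apply: ler_sum.
  by rewrite sumr_const card_ord -[leLHS]mulr_natl.
rewrite sumEFin lee_fin big_const_seq count_predT -cardE card_ffun !card_ord iter_addr_0.
rewrite -[leLHS]mulr_natl natrX le_eqVlt; apply/orP; left; apply/eqP; rewrite /cube_const -/c.
rewrite !exprMn exprVn; have : (n%:R ^+ d != 0 :> R)%R by rewrite expf_neq0// gt_eqF.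
move: (n%:R ^+ d)%R => X X0; by field.
Qed.

Hypothesis d_gt0 : (0 < d)%N.

Let gauss1_scale (k rho : R) : (0 < k)%R -> (0 < rho)%R ->
  Int (gauss1 (k / rho ^+ 2)%R) = (rho * Num.sqrt (pi / k))%R.
Proof.
move=> k0 r0; pose sg := (rho / Num.sqrt (2 * k))%R.
have sg0 : (0 < sg)%R by rewrite divr_gt0// sqrtr_gt0 mulr_gt0.
have sg2 : (sg ^+ 2 = rho ^+ 2 / (2 * k))%R.
  by rewrite /sg exprMn exprVn sqr_sqrtr// mulr_ge0// ltW.
have gE : normal_pdf 0%R sg = (fun x => normal_peak sg * gauss1 (k / rho ^+ 2) x)%R.
  rewrite normal_pdfE ?gt_eqF//; apply/funext => x; congr (_ * _)%R.
  rewrite /normal_fun /gauss1 subr0 sg2; congr expR; field.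
  by rewrite !gt_eqF.
have c0 : (0 < k / rho ^+ 2)%R by rewrite divr_gt0// exprn_gt0.
have e : Int (fun x => normal_peak sg * gauss1 (k / rho ^+ 2) x)%R = 1%R.
  by rewrite -gE /Int /Rintegral integral_normal_pdf.
move: e; rewrite Int_Z; last exact: gauss1_gb1.
rewrite /= /normal_peak sg2 => e.
have p0 : (0 < Num.sqrt (rho ^+ 2 / (2 * k) * pi *+ 2))%R.
  by rewrite sqrtr_gt0 pmulrn_lgt0// mulr_gt0 ?pi_gt0// divr_gt0 ?exprn_gt0// mulr_gt0.
apply: (mulfI (invr_neq0 (lt0r_neq0 p0))); rewrite e.
have -> : (rho ^+ 2 / (2 * k) * pi *+ 2 = rho ^+ 2 * (pi / k))%R.
  by rewrite -mulr_natr; field; rewrite gt_eqF.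
by rewrite sqrtrM ?sqr_ge0// sqrtr_sqr ger0_norm ?(ltW r0)// mulVf// gt_eqF// mulr_gt0// sqrtr_gt0 divr_gt0// pi_gt0.
Qed.

Let J_gauss (c : R) : (0 < c)%R -> J (gauss c : 'rV[R]_d -> R) = (Int (gauss1 c) ^+ d)%R.
Proof.
move=> c0; have -> : gauss c = Pi (fun _ : 'I_d => gauss1 c).
  apply/funext => w; rewrite /gauss /Pi /gauss1 -expR_sum; congr expR.
  by rewrite sumrN /sqn mulr_sumr.
rewrite J_prod; last by move=> _; exact: gauss1_gb1.
by rewrite prodr_const card_ord.
Qed.

(* A cover is turned into a sum of Gaussian bumps dominating the unit Gaussian. *)
Lemma cover_bound (k : R) : (0 < k)%R -> (forall w : 'rV[R]_d, k * sqn w <= sqn (w *m B))%R ->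
  exists2 K : R, (0 < K)%R & forall (F : nat -> set 'rV[R]_N) (r : nat -> R),
    (forall i, 0 <= r i)%R -> (forall i x y, F i x -> F i y -> euclidean_dist x y <= r i)%R ->
    (forall w : 'rV[R]_d, exists i, F i (x0 + w *m B)%R) ->
    (K%:E <= \sum_(0 <= i <oo) (r i ^+ d)%:E).
Proof.
move=> k0 kB; pose C := Num.sqrt (pi / k); have C0 : (0 < C)%R by rewrite sqrtr_gt0 divr_gt0// pi_gt0.
pose Jg := J (gauss 1 : 'rV[R]_d -> R).
have Jg0 : (0 < Jg)%R by exact: (int_gauss (isInt_J d) ltr01).
pose Q := (expR 1 * C ^+ d * 2 ^+ d)%R.
have Q0 : (0 < Q)%R by rewrite !mulr_gt0 ?expR_gt0 ?exprn_gt0.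
exists (Jg / Q / 2)%R; first by rewrite !divr_gt0.
move=> F r r0 Fr Fcov.
have rd0 i : 0 <= (r i ^+ d)%:E by rewrite lee_fin exprn_ge0.
have [->|Sfin] := eqVneq (\sum_(0 <= i <oo) (r i ^+ d)%:E) +oo; first exact: leey.
have Sf : \sum_(0 <= i <oo) (r i ^+ d)%:E \is a fin_num.
  by rewrite ge0_fin_numE ?ltey// nneseries_ge0.
set S := \sum_(0 <= i <oo) _ in Sfin Sf *.
pose e0 := (Jg / Q / 2)%R; have e00 : (0 < e0)%R by rewrite !divr_gt0.
(* The [ep i] are positive with total at most [e0]: they keep the enlarged radii [r' i] positive
   when a set of the cover is a point or empty. *)
pose eta := Num.min 1%R e0; have eta0 : (0 < eta)%R by rewrite lt_min ltr01.
pose ep (i : nat) : R := (eta / 2 ^+ i.+1)%R.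
have ep0 i : (0 < ep i)%R by rewrite divr_gt0// exprn_gt0.
have ep1 i : (ep i <= 1)%R.
  rewrite ler_pdivrMr ?exprn_gt0// mul1r (@le_trans _ _ 1%R)//; first by rewrite ge_min lexx.
  by rewrite exprn_ege1// ler1n.
have epS n : (\sum_(i < n) ep i <= e0)%R.
  apply: (@le_trans _ _ (eta * (1 - 2^-1 ^+ n))%R).
    elim: n => [|n IH]; first by rewrite big_ord0 expr0 subrr mulr0.
    rewrite big_ord_recr /=; apply: le_trans (lerD IH (lexx _)) _.
    rewrite /ep -exprVn exprS le_eqVlt; apply/orP; left; apply/eqP; by field.
  apply: (@le_trans _ _ eta); last by rewrite ge_min lexx orbT.
  by rewrite ler_piMr ?(ltW eta0)// gerBl exprn_ge0.
pose r' i := (r i + ep i)%R; have r'0 i : (0 < r' i)%R by rewrite ltr_wpDl.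
(* Center of the bump of [F i]; the default 0 serves when [F i] misses the subspace. *)
pose wi i : 'rV[R]_d := xget 0%R [set w | F i (x0 + w *m B)%R].
pose bump i (w : 'rV[R]_d) : R := (expR 1 * gauss (k / r' i ^+ 2) (w - wi i))%R.
have kr0 i : (0 < k / r' i ^+ 2)%R by rewrite divr_gt0// exprn_gt0.
have gbump i : gb (bump i) by apply: gbZ; apply: gb_shift; exact: gauss_gb.
have bump0 i w : (0 <= bump i w)%R by rewrite mulr_ge0 ?expR_ge0// gauss_ge0.
have Jbump i : J (bump i) = (expR 1 * (C * r' i) ^+ d)%R.
  rewrite /bump (intZ (isInt_J d)); last by apply: gb_shift; exact: gauss_gb.
  rewrite (int_tr (isInt_J d) (- wi i)%R); last exact: gauss_gb.
  by rewrite J_gauss// gauss1_scale// [(_ * C)%R]mulrC.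
have bump1 i w : F i (x0 + w *m B)%R -> (1 <= bump i w)%R.
  move=> Fw; have Fwi : F i (x0 + wi i *m B)%R by exact: (@xgetI _ 0%R [set w | F i (x0 + w *m B)%R] w).
  have := Fr i _ _ Fw Fwi; rewrite dist_sqn.
  rewrite (_ : x0 + w *m B - (x0 + wi i *m B) = (w - wi i) *m B)%R; last first.
    by rewrite mulmxBl opprD addrACA subrr add0r.
  move=> D; rewrite /bump /gauss -expRD -[leLHS]expR0 ler_expR subr_ge0 mulrAC ler_pdivrMr ?exprn_gt0// mul1r.
  apply: le_trans (kB _) _; rewrite -[leLHS]sqr_sqrtr ?sqn_ge0// lerXn2r ?nnegrE ?sqrtr_ge0 ?(ltW (r'0 i))//.
  by apply: le_trans D _; rewrite lerDl ltW.
(* Truncation at the Gaussian makes the sequence dominated; at [w] it equals the Gaussian as soon as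
   a set covering [w] has been counted. *)
pose fn n (w : 'rV[R]_d) : R := Num.min (gauss 1 w) (\sum_(i < n) bump i w)%R.
have g1 := @gauss_gb R d 1 ltr01.
have gs n : gb (fun w => \sum_(i < n) bump i w)%R by apply: gb_sum.
have sfn n : scont (fn n).
  have -> : fn n = (fun w => 2^-1 * (gauss 1 w + \sum_(i < n) bump i w - `|gauss 1 w - \sum_(i < n) bump i w|))%R.
    by apply/funext => w; rewrite /fn minr_absE mulrC.
  have [cg _] := g1; have [cs _] := gs n.
  apply: scontM; first exact: scont_cst.
  apply: scontD; first exact: scontD.
  by apply: scontN; apply: scont_norm; apply: scontD => //; exact: scontN.
have fn0 n w : (0 <= fn n w)%R.
  by rewrite le_min gauss_ge0/=; apply: sumr_ge0 => i _; exact: bump0.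
have fn1 n : gbd (fn n) 1 1.
  by move=> w; rewrite ger0_norm// mul1r ge_min lexx.
have lim : (fun n => J (fn n)) @ \oo --> Jg.
  apply: (int_dc (isInt_J d) ltr01 ler01 sfn) => //; first by case: g1.
  move=> w; have [j Fj] := Fcov w.
  apply: cvg_near_cst; exists j.+1 => //= n jn; rewrite /fn; apply/min_idPl.
  apply: (@le_trans _ _ 1%R); first exact: gauss_le1.
  rewrite (bigD1 (Ordinal jn))//=; apply: le_trans (bump1 j w Fj) _; rewrite lerDl.
  by apply: sumr_ge0 => i _; exact: bump0.
have pow (a b : R) : (0 <= a)%R -> (0 <= b)%R -> ((a + b) ^+ d <= 2 ^+ d * (a ^+ d + b ^+ d))%R.
  move=> a0 b0; wlog ab : a b a0 b0 / (a <= b)%R => [W|].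
    have [|/ltW ba] := leP a b; first exact: W.
    by rewrite [(a + b)%R]addrC [(a ^+ d + _)%R]addrC; exact: W.
  apply: (@le_trans _ _ ((2 * b) ^+ d)%R); first by rewrite lerXn2r ?nnegrE ?addr_ge0 ?mulr_ge0//; lra.
  by rewrite exprMn ler_wpM2l ?exprn_ge0// lerDr exprn_ge0.
have Jle : (Jg <= Q * (fine S + e0))%R.
  apply: (@seq_lim_le _ _ _ _ lim) => n.
  apply: (@le_trans _ _ (\sum_(i < n) J (bump i))%R).
    rewrite -(int_sum (isInt_J d)); last by move=> i _.
    apply: (int_mono (isInt_J d)) => //; last by move=> w; rewrite ge_min lexx orbT.
    by split=> //; exists 1%R, 1%R.
  apply: (@le_trans _ _ (\sum_(i < n) Q * (r i ^+ d + ep i))%R).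
    apply: ler_sum => i _; rewrite Jbump exprMn /Q -!mulrA.
    rewrite ler_wpM2l ?expR_ge0// ler_wpM2l ?exprn_ge0 ?(ltW C0)//.
    apply: le_trans (pow _ _ (r0 i) (ltW (ep0 i))) _.
    rewrite ler_wpM2l ?exprn_ge0// lerD2l -[leRHS]expr1 ler_wiXn2l//; exact: ltW.
  rewrite -mulr_sumr big_split /= ler_wpM2l ?(ltW Q0)//; apply: lerD; last exact: epS.
  rewrite -lee_fin fineK// -sumEFin -(big_mkord xpredT (fun i => (r i ^+ d)%:E)).
  exact: nneseries_lim_ge.
rewrite -(fineK Sf) lee_fin -/e0; move: Jle; rewrite mulrC -ler_pdivrMr//.
rewrite (_ : Jg / Q = e0 + e0)%R; first by rewrite lerD2r.
by rewrite /e0; field; rewrite gt_eqF.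
Qed.

(** Needed for [int_gauss]: it excludes that the functional given by the Hausdorff measure
    vanishes. *)
Lemma affine_pos : 0 < nu [set x | exists w : 'rV[R]_d, x = (x0 + w *m B)%R].
Proof.
have [k k0 kB] := sqn_row_free BB'; have [K K0 HK] := cover_bound k0 kB.
set A : set 'rV[R]_N := [set x | _].
apply: (@lt_le_trans _ _ (@haus_k R d * K)%:E); first by rewrite lte_fin mulr_gt0 ?haus_k_gt0.
apply: le_trans (@hd_nu R N d 1%R A ltr01); apply: le_ereal_inf_tmp => _ [F [_ AF] <-].
have [allfin|] := pselect (forall i, @hausdorff_cost R N d 1 (F i) < +oo); last first.
  move=> /existsNP[i /negP]; rewrite -leNgt leye_eq => /eqP ci.
  rewrite (@nneseriesD1 _ _ i)// ?ci; last by move=> *; exact: cost_ge0.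
  by rewrite addye ?leey// gt_eqF// (lt_le_trans (ltNyr 0%R))// nneseries_ge0// => *; exact: cost_ge0.
(* An empty set gets radius 0, whose [d]-th power is 0 because [d > 0]. *)
pose r i := if pselect (F i !=set0) then fine (euclidean_diam (F i)) else 0%R.
have dfin i : F i !=set0 -> euclidean_diam (F i) \is a fin_num.
  move=> [x Fx]; rewrite ge0_fin_numE ?(diam_ge0 Fx)//.
  have := allfin i; rewrite /hausdorff_cost; case: eqP => [F0|_]; first by rewrite F0 in Fx.
  by case: ifP => // h _; exact: le_lt_trans h (ltry _).
have r0 i : (0 <= r i)%R.
  by rewrite /r; case: pselect => // -[x Fx]; rewrite fine_ge0// (diam_ge0 Fx).
have Fr i x y : F i x -> F i y -> (euclidean_dist x y <= r i)%R.
  move=> Fx Fy; rewrite /r; case: pselect => [h|[]]; last by exists x.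
  by rewrite -lee_fin fineK ?dfin//; apply: ereal_sup_ubound; exists x, y.
have Fc w : exists i, F i (x0 + w *m B)%R.
  by have [i _ Fi] := AF (x0 + w *m B)%R (ex_intro _ w erefl); exists i.
apply: (@le_trans _ _ ((@haus_k R d)%:E * \sum_(0 <= i <oo) (r i ^+ d)%:E)).
  rewrite EFinM; apply: lee_wpmul2l; first by rewrite lee_fin ltW ?haus_k_gt0.
  exact: (HK F r r0 Fr Fc).
rewrite -nneseriesZl; last by move=> *; rewrite lee_fin exprn_ge0.
apply: lee_nneseries => [i _ _|i _].
  by rewrite -EFinM lee_fin; apply: mulr_ge0; [apply/ltW; exact: haus_k_gt0|exact: exprn_ge0].
have := allfin i; rewrite /r; case: pselect => [h|h].
  rewrite /hausdorff_cost; case: eqP => [F0|_]; first by case: h => x; rewrite F0.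
  case: ifP => // _ _; rewrite -/haus_k EFin_expe fineK//; exact: dfin.
by rewrite expr0n eqn0Ngt d_gt0 mule0 => _; exact: cost_ge0.
Qed.

End hausdorff_affine.

Section hausdorff_measurable.
Context {R : realType}.
Variables (N d : nat).

Let nu := hausdorff_outer_measure R N d.
Let T : measurableType _ := caratheodory_type nu.
Lemma coord_measurable (i : 'I_N) : measurable_fun setT (fun x : T => (x : 'rV[R]_N) 0 i).
Proof.
move=> mT; apply: (measurability _ (RGenOInfty.measurableE R)) => //.
move=> /= _ [_ [a ->] <-]; rewrite setTI.
have -> : (fun x : T => (x : 'rV[R]_N) 0 i) @^-1` `]a, +oo[%classic =
    ~` [set x : T | (x : 'rV[R]_N) 0 i <= a].
  by apply/seteqP; split=> x /=; rewrite in_itv /= andbT ltNge => /negP.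
by apply: measurableC; exact: halfspace_measurable.
Qed.

(** Rounding the coordinates down to multiples of [1 / (n + 1)] gives functions with countably many
    constant pieces, each an intersection of slabs; they converge pointwise by sequential
    continuity. *)
Lemma scont_measurable (f : 'rV[R]_N -> R) : scont f -> measurable_fun setT (f : T -> R).
Proof.
move=> cf; pose fl (n : nat) (x : 'rV[R]_N) : 'rV[int]_N := \row_i Num.floor (n.+1%:R * x 0 i).
pose rd (n : nat) (k : 'rV[int]_N) : 'rV[R]_N := \row_i ((k 0 i)%:~R / n.+1%:R).
apply: (@measurable_fun_cvg _ T R setT (fun n x => f (rd n (fl n x)))) => [n|x _]; last first.
  apply: cf => i; under eq_fun do rewrite !mxE.
  apply/cvgrPdist_le => e e0; exists (Num.truncn e^-1) => // n /= ne.
  have n0 : 0 < n.+1%:R :> R by rewrite ltr0n.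
  have /andP[f1 f2] := floor_itv (n.+1%:R * x 0 i).
  set F := Num.floor _ in f1 f2 *.
  have -> : x 0 i - F%:~R / n.+1%:R = (n.+1%:R * x 0 i - F%:~R) / n.+1%:R.
    by rewrite mulrBl mulrAC divff ?mul1r// gt_eqF.
  rewrite normrM normfV (ger0_norm (ltW n0)) ler_pdivrMr// ger0_norm ?subr_ge0//.
  apply: (@le_trans _ _ 1).
    by rewrite lerBlDl; move: f2; rewrite intrD => /ltW.
  rewrite -ler_pdivrMl// mulr1; apply: ltW; apply: lt_le_trans (truncnS_gt _) _.
  by rewrite ler_nat ltnS.
move=> _ Y _; rewrite setTI.
have -> : (fun x => f (rd n (fl n x))) @^-1` Y =
    \bigcup_(k : 'rV[int]_N) ([set x : T | fl n x = k] `&` [set _ | Y (f (rd n k))]).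
  apply/seteqP; split=> [x Yx|x [k _ [/= <-]]//].
  by exists (fl n x).
apply: countable_bigcupT_measurable => // k.
have [h|h] := pselect (Y (f (rd n k))); last first.
  by rewrite (_ : _ `&` _ = set0)//; apply/seteqP; split=> x // [].
rewrite (_ : _ `&` _ = \bigcap_(i : 'I_N) [set x : T | Num.floor (n.+1%:R * (x : 'rV[R]_N) 0 i) = k 0 i]); last first.
  apply/seteqP; split=> [x [/= <- _] i _|x Hx]; first by rewrite /= mxE.
  by split=> //=; apply/rowP => i; rewrite mxE; exact: Hx.
apply: fin_bigcap_measurable; first exact: finite_finset.
move=> i _; have := measurable_funM (measurable_cst (n.+1%:R : R)) (coord_measurable i).
move=> /(_ measurableT [set t | Num.floor t = k 0 i]); rewrite setTI; apply.
rewrite (_ : [set t | _] = `[(k 0 i)%:~R, (k 0 i + 1)%:~R[%classic)//.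
apply/seteqP; split=> t /=; rewrite in_itv /=; first by move=> <-; exact: floor_itv.
by move=> tk; apply: floor_def.
Qed.

Lemma scont_le_measurable (f : 'rV[R]_N -> R) (s : R) : scont f ->
  measurable ([set x | f x <= s] : set T).
Proof.
move=> cf; have := scont_measurable cf => /(_ measurableT [set t | t <= s]).
rewrite setTI; apply; rewrite (_ : [set t | _] = `]-oo, s]%classic)//.
Qed.

End hausdorff_measurable.

(** * Hausdorff integrals over affine subspaces *)

Section affine_integral.
Context {R : realType}.
Variables (N d : nat) (B : 'M[R]_(d, N)) (B' : 'M[R]_(N, d)).
Hypothesis BB' : B *m B' = 1%:M.
Hypothesis d_gt0 : (0 < d)%N.

Let nu := hausdorff_outer_measure R N d.
Let T : measurableType _ := caratheodory_type nu.
Let mu : {measure set T -> \bar R} := (nu : set T -> \bar R).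

Definition aff (x0 : 'rV[R]_N) : set 'rV[R]_N := [set x | exists w : 'rV[R]_d, x = x0 + w *m B].

Let co (x0 x : 'rV[R]_N) : 'rV[R]_d := (x - x0) *m B'.

Let coK x0 w : co x0 (x0 + w *m B) = w.
Proof. by rewrite /co addrC addKr -mulmxA BB' mulmx1. Qed.

Let affE x0 x : aff x0 x -> x = x0 + co x0 x *m B.
Proof. by move=> [w ->]; rewrite coK. Qed.

Let scont_co x0 (f : 'rV[R]_d -> R) : scont f -> scont (fun x => f (co x0 x)).
Proof.
move=> cf u x ux; apply: cf; apply: vcvg_mulmx; apply: vcvgD => //; exact: vcvg_cst.
Qed.

Let aff_measurable x0 : measurable (aff x0 : set T).
Proof.
have c : scont (fun x : 'rV[R]_N => sqn (x - (x0 + co x0 x *m B))).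
  move=> u x ux; apply: scont_sqn; apply: vcvgD => //.
  under eq_fun do rewrite -scaleN1r; rewrite -scaleN1r.
  apply: vcvgZ; first exact: cvg_cst.
  apply: vcvgD; first exact: vcvg_cst.
  apply: vcvg_mulmx; apply: vcvg_mulmx; apply: vcvgD => //; exact: vcvg_cst.
have := @scont_le_measurable R N d _ 0 c; congr measurable; apply/seteqP; split=> x /= h.
  exists (co x0 x); apply/eqP; rewrite -subr_eq0; apply/eqP.
  move: (x - _) h => z h; apply/rowP => i; rewrite [RHS]mxE; apply/eqP; rewrite -sqrf_eq0 eq_le sqr_ge0 andbT; apply: le_trans h; exact: coord_sqn.
by rewrite -(affE h) subrr sqn0.
Qed.

Let shift_measurable (a : 'rV[R]_N) : measurable_fun setT ((fun x : 'rV[R]_N => x + a) : T -> T).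
Proof.
move=> _ S; rewrite setTI => mS.
suff: nu.-caratheodory [set x : 'rV[R]_N | S (x + a)] by [].
have {}mS : nu.-caratheodory S by [].
move=> X; have tr Y : nu [set x | Y (x + a)] = nu Y by exact: nu_translate.
have e : X = [set x | [set y | X (y - a)] (x + a)].
  by apply/seteqP; split=> x /=; rewrite addrK.
rewrite {1}e tr (mS [set y | X (y - a)]); congr (_ + _)%E.
  by rewrite -tr; congr (nu _); apply/seteqP; split=> x /=; rewrite addrK.
by rewrite -tr; congr (nu _); apply/seteqP; split=> x /=; rewrite addrK.
Qed.

Let integral_shift (D : set T) (f : T -> R) a : measurable D -> measurable_fun setT f ->
  mu.-integrable [set x : T | D (x + a : 'rV[R]_N)] (fun x : T => (f (x + a : 'rV[R]_N))%:E) ->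
  \int[mu]_(x in [set x : T | D (x + a : 'rV[R]_N)]) f (x + a : 'rV[R]_N) = \int[mu]_(x in D) f x.
Proof.
move=> mD mf fi; have mf' : measurable_fun setT (EFin \o f) by exact/measurable_EFinP.
congr fine; apply: etrans (esym (@integral_pushforward _ _ T T R _ (shift_measurable a) mu D _ mf' fi mD)) _.
by apply: eq_measure_integral => A _ _; exact: nu_translate.
Qed.

Let cube_measurable x0 (s : R) : measurable (cube B x0 s : set T).
Proof.
have -> : (cube B x0 s : set T) =
    aff x0 `&` \bigcap_(i : 'I_d) [set x | `|co x0 x 0 i| <= s].
  apply/seteqP; split=> [x [w ws ->]|x [[w ->] h]].
    by split=> [|i _]; [exists w|rewrite /= coK].
  by exists w => // i; have := h i I; rewrite /= coK.
apply: measurableI; first exact: aff_measurable.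
apply: fin_bigcap_measurable; first exact: finite_finset.
move=> i _; have c : scont (fun x => `|co x0 x 0 i|).
  by apply: (@scont_co x0 (fun w => `|w 0 i|)); apply: scont_norm; exact: scont_coord.
exact: (@scont_le_measurable R N d _ s c).
Qed.

Let cube_term_measurable x0 (c s : R) :
  measurable_fun (aff x0 : set T) (fun x : T => (c * \1_(cube B x0 s) x)%:E).
Proof.
apply/measurable_EFinP; apply: measurable_funM; first exact: measurable_cst.
apply: (@measurable_indic _ T R _ (cube B x0 s)); exact: cube_measurable.
Qed.

(** The Gaussian is dominated by a series of indicators of growing cubes. By [cube_le] their
    measures grow polynomially, and completing the square in the exponent leaves a geometric
    series. *)
Let gauss_integrable x0 (c : R) : 0 < c -> mu.-integrable (aff x0) (fun x => (gauss c (co x0 x))%:E).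
Proof.
move=> c0; apply/integrableP; split.
  apply/measurable_EFinP; apply: measurable_funTS; apply: scont_measurable.
  by apply: scont_co; case: (@gauss_gb R d c c0).
under eq_integral do rewrite gee0_abs ?lee_fin ?(ltW (gauss_gt0 _ _))//.
pose a k := gauss1 c k%:R.
have cc0 : 0 <= cube_const B.
  by rewrite /cube_const mulr_ge0 ?(ltW (haus_k_gt0 d))// exprn_ge0// mulr_ge0// sqrtr_ge0.
pose C := cube_const B * expR ((d%:R + 1) ^+ 2 / (4 * c)).
pose q := expR (- 1) : R.
have q0 : 0 < q by exact: expR_gt0.
have q1 : q < 1 by rewrite expR_lt1; lra.
have C0 : 0 <= C by rewrite mulr_ge0// expR_ge0.
apply: (@le_lt_trans _ _ (\int[mu]_(x in aff x0) \sum_(0 <= k <oo)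
    (a k * \1_(cube B x0 k.+1%:R) x)%:E)%E).
  apply: ge0_le_integral; first exact: aff_measurable.
  - by move=> x _; rewrite lee_fin ltW// gauss_gt0.
  - apply/measurable_EFinP; apply: measurable_funTS; apply: scont_measurable.
    by apply: scont_co; case: (@gauss_gb R d c c0).
  - apply: ge0_emeasurable_sum => [k x _ _|k _]; first by rewrite lee_fin mulr_ge0 ?expR_ge0.
    exact: cube_term_measurable.
  move=> x Ax; pose s := Num.sqrt (sqn (co x0 x)).
  have s0 : 0 <= s by exact: sqrtr_ge0.
  have /andP[k1 k2] := truncn_itv s0; set k := Num.truncn s in k1 k2.
  rewrite (@nneseriesD1 _ _ k)//; last by move=> *; rewrite lee_fin mulr_ge0 ?expR_ge0.
  apply: (@le_trans _ _ (a k * \1_(cube B x0 k.+1%:R) x)%:E); last first.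
    by rewrite leeDl// nneseries_ge0// => *; rewrite lee_fin mulr_ge0 ?expR_ge0.
  rewrite lee_fin indicE mem_set ?mulr1.
    rewrite /gauss /a /gauss1 ler_expR lerN2 ler_wpM2l ?(ltW c0)//.
    by rewrite -[leRHS]sqr_sqrtr ?sqn_ge0// lerXn2r ?nnegrE.
  exists (co x0 x); last exact: affE.
  by move=> i; apply: le_trans (coord_sqrt_sqn _ _) _; exact: ltW.
rewrite integral_nneseries//; last by move=> k x _; rewrite lee_fin mulr_ge0 ?expR_ge0.
apply: (@le_lt_trans _ _ (C * (1 - q)^-1)%:E); last exact: ltry.
apply: (@le_trans _ _ (\sum_(0 <= k <oo) (C * q ^+ k)%:E)%E).
  apply: lee_nneseries => [k _ _|k _].
    by apply: integral_ge0 => x _; rewrite lee_fin mulr_ge0 ?expR_ge0.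
  have mc : measurable_fun (aff x0 : set T) (fun x : T => (\1_(cube B x0 k.+1%:R) x : R)%:E).
    apply/measurable_EFinP; apply: (@measurable_indic _ T R _ (cube B x0 k.+1%:R)).
    exact: cube_measurable.
  have -> : (\int[mu]_(x in aff x0) (a k * \1_(cube B x0 k.+1%:R) x)%:E =
      (a k)%:E * mu (cube B x0 k.+1%:R `&` aff x0))%E.
    transitivity (\int[mu]_(x in aff x0) ((a k)%:E * (\1_(cube B x0 k.+1%:R) x : R)%:E))%E.
      by apply: eq_integral => x _; rewrite EFinM.
    rewrite (@ge0_integralZl _ T R mu (aff x0) (aff_measurable x0) _ mc (a k)%:E) ?lee_fin ?expR_ge0//.
    by rewrite (@integral_indic _ T R mu (aff x0) (aff_measurable x0) (cube B x0 k.+1%:R)).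
  apply: (@le_trans _ _ ((a k)%:E * (cube_const B * k.+1%:R ^+ d)%:E)%E).
    rewrite lee_wpmul2l ?lee_fin ?expR_ge0//; apply: le_trans (le_outer_measure nu _ _ (@subIsetl _ _ _)) _.
    exact: cube_le.
  rewrite -EFinM lee_fin mulrCA /C -mulrA ler_wpM2l// /a /gauss1 /q.
  have kd : k.+1%:R ^+ d <= expR (d%:R * k%:R) :> R.
    rewrite mulrC expRM_natr lerXn2r ?nnegrE ?expR_ge0//.
    by rewrite -natr1 addrC expR_ge1Dx.
  apply: le_trans (ler_wpM2l (expR_ge0 _) kd) _.
  rewrite -expRM_natr -!expRD ler_expR.
  have e : (d%:R + 1) ^+ 2 / (4 * c) + -1 * k%:R - (- (c * k%:R ^+ 2) + d%:R * k%:R) =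
      c * (k%:R - (d%:R + 1) / (2 * c)) ^+ 2 by field; rewrite gt_eqF.
  by rewrite -subr_ge0 e mulr_ge0 ?sqr_ge0// ltW.
apply: lime_le; first by apply: is_cvg_nneseries => *; rewrite lee_fin mulr_ge0// exprn_ge0// ltW.
apply: nearW => n; rewrite sumEFin lee_fin.
by apply: geometric_le_lim => //; rewrite ger0_norm ?(ltW q0).
Qed.

Let gb_integrable x0 (f : 'rV[R]_d -> R) : gb f -> mu.-integrable (aff x0) (fun x => (f (co x0 x))%:E).
Proof.
move=> [cf [C [c [c0 C0 fC]]]].
apply: (@le_integrable _ T R mu (aff x0) (aff_measurable x0) _
  (fun x => (C%:E * (gauss c (co x0 x))%:E)%E)); last first.
- exact: (integrableZl (aff_measurable x0) _ (gauss_integrable x0 c0)).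
- by move=> x _; rewrite -EFinM lee_fin; apply: le_trans (fC _) _; exact: ler_norm.
- by apply/measurable_EFinP; apply: measurable_funTS; apply: scont_measurable; exact: scont_co.
Qed.

Let I (x0 : 'rV[R]_N) (f : 'rV[R]_d -> R) : R := \int[mu]_(x in aff x0) f (co x0 x).

Let scont_meas x0 (f : 'rV[R]_d -> R) : scont f ->
  measurable_fun (setT : set T) (fun x : T => f (co x0 x)).
Proof. by move=> cf; apply: scont_measurable; exact: scont_co. Qed.

(** In the coordinates of the subspace the Hausdorff integral satisfies [isInt], so [isInt_uniq]
    identifies it with [J] up to a factor. *)
Let I_isInt x0 : isInt (I x0).
Proof.
split=> [a f g gf gg|f g gf gg fg|f_ f C c c0 C0 cf_ cf fC ff|f a gf|c c0]; rewrite /I.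
- have gaf : gb (fun w => a * f w) by exact: gbZ.
  rewrite (RintegralD (aff_measurable x0) (gb_integrable x0 gaf) (gb_integrable x0 gg)).
  by rewrite (RintegralZl a (aff_measurable x0) (gb_integrable x0 gf)).
- by apply: (le_Rintegral (aff_measurable x0) (gb_integrable x0 gf) (gb_integrable x0 gg)) => x _.
- apply: (@Rintegral_dct _ T R mu _ _ _ (fun x => C * gauss c (co x0 x)) (aff_measurable x0)).
  + by move=> k; apply: measurable_funTS; exact: scont_meas.
  + by move=> x _; exact: ff.
  + by apply: (@gb_integrable x0 (fun w => C * gauss c w)); apply: gbZ; exact: gauss_gb.
  + by move=> k x _; exact: fC.
- pose s := a *m B.
  have DE : [set x : T | aff x0 (x + s : 'rV[R]_N)] = aff x0.
    apply/seteqP; split=> x /= [w e]; last by exists (w + a); rewrite e mulmxDl addrA.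
    by exists (w - a); rewrite mulmxBl addrA -e addrK.
  have coE x : co x0 x + a = co x0 (x + s).
    by rewrite /co [in RHS]addrAC [in RHS]mulmxDl /s -mulmxA BB' mulmx1.
  have [cf _] := gf; rewrite -(@integral_shift (aff x0) (fun x => f (co x0 x)) s (aff_measurable x0) (scont_meas x0 cf)).
    by rewrite DE; under [in RHS]eq_fun do rewrite -coE.
  rewrite DE; under eq_fun do rewrite -coE.
  by apply: (@gb_integrable x0 (fun w => f (w + a))); exact: gb_shift.
- rewrite lt_neqAle Rintegral_ge0 ?andbT; last by move=> x _; rewrite ltW// gauss_gt0.
  apply/eqP => /esym I0; have gi := @gauss_integrable x0 c c0.
  have I0' : (\int[mu]_(x in aff x0) `|(gauss c (co x0 x))%:E| = 0)%E.
    under eq_integral do rewrite gee0_abs ?lee_fin ?(ltW (gauss_gt0 _ _))//.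
    by rewrite -[LHS]fineK ?[fine _]I0//; exact: integrable_fin_num.
  have [|A [mA A0 sA]] := (ae_eq_integral_abs mu (aff_measurable x0) _).1 I0'.
    by case/integrableP: gi.
  have := affine_pos x0 BB' d_gt0; rewrite ltNge => /negP; apply.
  rewrite -[leRHS]A0; apply: le_outer_measure => x Ax; apply: sA => /= /(_ Ax) /eqP.
  by rewrite eqe gt_eqF// gauss_gt0.
Qed.

(** Makes the factor in [hausdorff_integral_affine] the same for all parallel subspaces, so that it
    adds a constant to the coarse-grained Hamiltonian. *)
Let I_base x0 f : gb f -> I x0 f = I 0 f.
Proof.
move=> gf; have DE : [set x : T | aff 0 (x + - x0 : 'rV[R]_N)] = aff x0.
  apply/seteqP; split=> x /= [w e]; exists w.
    by rewrite -[x](subrK x0) e add0r addrC.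
  by rewrite e addrAC subrr.
have coE x : co x0 x = co 0 (x + - x0) by rewrite /co subr0.
have [cf _] := gf.
rewrite /I -(@integral_shift (aff 0) (fun x => f (co 0 x)) (- x0) (aff_measurable 0) (scont_meas 0 cf)).
  by rewrite DE; under [in RHS]eq_fun do rewrite -coE.
by rewrite DE; under eq_fun do rewrite -coE; exact: gb_integrable.
Qed.

Lemma hausdorff_integral_affine : exists2 cB : R, 0 < cB & forall x0 (f : 'rV[R]_N -> R), gb f ->
  hausdorff_integral d (aff x0) f = cB * J (fun w : 'rV[R]_d => f (x0 + w *m B)).
Proof.
exists (I 0 (gauss 1) / J (gauss 1 : 'rV[R]_d -> R)).
  by rewrite divr_gt0// (int_gauss (I_isInt 0), int_gauss (isInt_J d)).
move=> x0 f gf; pose g (w : 'rV[R]_d) := f (x0 + w *m B).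
have gg : gb g by exact: (gb_affine x0 BB').
rewrite -(isInt_uniq (I_isInt 0) gg) -(I_base x0 gg) /I.
by apply: eq_Rintegral => x; rewrite inE => Ax; rewrite /g -(affE Ax).
Qed.

End affine_integral.

Lemma affine_dim_aff {R : realType} (N d : nat) (B : 'M[R]_(d, N)) x0 : row_free B ->
  affine_dim (aff B x0) = d.
Proof.
move=> Bf; have dN : (d < N.+1)%N by rewrite ltnS -(eqP Bf) rank_leq_col.
apply/eqP; rewrite eqn_leq; apply/andP; split.
  apply/bigmax_leqP => k /asboolP[x [C [[w0 ->] Cf CA]]].
  rewrite -(eqP Cf) -(eqP Bf); apply: mxrankS; apply/row_subP => i.
  have [w e] := CA i; apply/submxP; exists (w - w0).
  rewrite mulmxBl; apply: (@addrI _ (x0 + w0 *m B)).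
  by rewrite e [w *m B - _]addrC addrA addrK.
apply: (@leq_bigmax_cond _ (fun k : 'I_N.+1 => _) (fun k : 'I_N.+1 => k : nat) (Ordinal dN)) => /=.
apply/asboolP; exists x0, B; split=> //; first by exists 0; rewrite mul0mx addr0.
by move=> i; exists (delta_mx 0 i); rewrite -rowE.
Qed.

(** * Hessians in coordinates *)

(** If [f2 0 < k], then [f t - k / 2 * t ^+ 2] has negative second derivative near 0, and three
    applications of the mean value theorem make its second difference negative. *)
Lemma second_diff_ge {R : realType} (f f1 f2 : R -> R) (k : R) :
  (forall t, dv f t (f1 t)) -> (forall t, dv f1 t (f2 t)) -> {for 0, continuous f2} ->
  (forall t, k * t ^+ 2 <= f t + f (- t) - 2 * f 0) -> k <= f2 0.
Proof.
move=> df df1 cf2 H; rewrite leNgt; apply/negP => lt0.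
have [d d0 Hd] : exists2 d : R, 0 < d & forall t, `|t| <= d -> f2 t < k.
  have /cvgrPdist_lt/(_ (k - f2 0)) := cf2; rewrite subr_gt0 => /(_ lt0)[e /= e0 He].
  exists (e / 2); first by rewrite divr_gt0.
  move=> t td; have : ball (0 : R) e t by rewrite -ball_normE /= sub0r normrN; lra.
  by move=> /He; rewrite ltr_norml => /andP[+ _]; lra.
pose g t := f t - k / 2 * t ^+ 2; pose g1 t := f1 t - k * t.
have dg t : dv g t (g1 t).
  rewrite /g /g1; under eq_fun do rewrite expr2.
  apply: (dv_eq (dvD (df t) (dvN (dvZ (k / 2) (dvM (dv_id t) (dv_id t)))))); by field.
have dg1 t : dv g1 t (f2 t - k).
  by apply: (dv_eq (dvD (df1 t) (dvN (dvZ k (dv_id t))))); ring.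
have [c /andP[c0 cd] e1] := dv_MVT d0 (fun t _ => dg t).
have nd : - d < 0 by rewrite oppr_lt0.
have [c' /andP[c'd c'0] e2] := dv_MVT nd (fun t _ => dg t).
have cc : c' < c by exact: lt_trans c'0 c0.
have [c'' /andP[x1 x2] e3] := dv_MVT cc (fun t _ => dg1 t).
have h2 : f2 c'' < k by apply: Hd; rewrite ler_norml; apply/andP; split; lra.
have h3 : g1 c - g1 c' < 0 by rewrite e3 nmulr_rlt0 ?subr_gt0// subr_lt0.
have e4 : g d + g (- d) - 2 * g 0 = (g1 c - g1 c') * d.
  have -> : g d + g (- d) - 2 * g 0 = (g d - g 0) - (g 0 - g (- d)) by ring.
  by rewrite e1 e2; ring.
have : g d + g (- d) - 2 * g 0 < 0 by rewrite e4 nmulr_rlt0.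
have e5 : g d + g (- d) - 2 * g 0 = f d + f (- d) - 2 * f 0 - k * d ^+ 2.
  by rewrite /g; field.
by rewrite e5; have := H d; lra.
Qed.

Lemma second_diff_le {R : realType} (f f1 f2 : R -> R) (k : R) :
  (forall t, dv f t (f1 t)) -> (forall t, dv f1 t (f2 t)) -> {for 0, continuous f2} ->
  (forall t, f t + f (- t) - 2 * f 0 <= k * t ^+ 2) -> f2 0 <= k.
Proof.
move=> df df1 cf2 H; rewrite -lerN2.
apply: (@second_diff_ge _ (fun t => - f t) (fun t => - f1 t) (fun t => - f2 t)).
- by move=> t; exact: dvN.
- by move=> t; exact: dvN.
- exact: cvgN.
- by move=> t; have := H t; lra.
Qed.

Lemma scont_near {R : realType} n (f : 'rV[R]_n -> R) q (e : R) : scont f -> 0 < e ->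
  exists2 r : R, 0 < r & forall k, Num.sqrt (sqn k) < r -> `|f (q + k) - f q| <= e.
Proof.
move=> cf e0; apply: contrapT => H.
have Hn (m : nat) : exists k : 'rV[R]_n, Num.sqrt (sqn k) < m.+1%:R^-1 /\ e < `|f (q + k) - f q|.
  apply: contrapT => Hm; apply: H; exists m.+1%:R^-1; first by rewrite invr_gt0.
  move=> k kr; rewrite leNgt; apply/negP => ke; apply: Hm; by exists k.
have /choice[k Hk] := Hn.
have ck : vcvg (fun m => q + k m) q.
  move=> i; suff H' : (fun m => q 0 i + k m 0 i) @ \oo --> q 0 i + 0.
    by rewrite addr0 in H'; under eq_fun do rewrite mxE.
  apply: cvgD; first exact: cvg_cst.
  apply/cvgrPdist_le => d d0; exists (Num.truncn d^-1) => // m /= md.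
  rewrite sub0r normrN; apply: le_trans (coord_sqrt_sqn _ _) _.
  apply: (le_trans (ltW (Hk m).1)); rewrite -[leRHS]invrK lef_pV2 ?posrE ?invr_gt0//.
  by apply: ltW; apply: lt_le_trans (truncnS_gt _) _; rewrite ler_nat ltnS.
have /cvgrPdist_lt/(_ e e0)[m _ Hm] := cf _ _ ck.
have := Hm m (leqnn m); rewrite /= distrC => h.
by have := lt_trans (Hk m).2 h; rewrite ltxx.
Qed.

Lemma scont_line {R : realType} n (f : 'rV[R]_n -> R) q h : scont f ->
  continuous (fun t : R => f (q + t *: h)).
Proof.
move=> cf t0; apply/cvgrPdist_le => e e0.
have [r r0 Hr] := scont_near (q + t0 *: h) cf e0.
pose c := Num.sqrt (sqn h) + 1; have c0 : 0 < c by rewrite ltr_wpDl ?sqrtr_ge0.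
exists (r / c) => /=; first by rewrite divr_gt0.
move=> t; rewrite /= => tt; rewrite distrC.
have -> : q + t *: h = q + t0 *: h + (t - t0) *: h by rewrite -addrA -scalerDl [t0 + _]addrC subrK.
apply: Hr; rewrite sqnZ sqrtrM ?sqr_ge0// sqrtr_sqr distrC.
apply: (@le_lt_trans _ _ (`|t0 - t| * c)); first by rewrite ler_wpM2l// lerDl.
by rewrite -ltr_pdivlMr.
Qed.

(** * Smoothness of the free energy in the moments *)

Section free_energy.
Context {R : realType}.
Variables (de de1 de2 : R -> R) (b0 b2 aa : R).
Hypothesis de_dv : forall t, dv de t (de1 t).
Hypothesis de1_dv : forall t, dv de1 t (de2 t).
Hypothesis de2_cont : continuous de2.
Hypothesis de_le : forall t, `|de t| <= b0.
Hypothesis de2_le : forall t, `|de2 t| <= b2.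
Variables (n D q : nat).
Variables (E : 'M[R]_(n, D)) (T : 'M[R]_(D, n)) (B : 'M[R]_(q, n)) (B' : 'M[R]_(n, q)).
Hypothesis TE : T *m E = 1%:M.
Hypothesis BE : B *m E = 0.
Hypothesis BB' : B *m B' = 1%:M.

Let Jq := isInt_J (R := R) q.
Let th (_ : 'I_n) := cell_th de1 aa.
Let h (_ : 'I_n) t := 1 + de2 t.
Let F : 'rV[R]_n -> R := Pi (fun _ => site_dens de aa).

Let th_dv (k : 'I_n) t : dv (th k) t (h k t). Proof. exact: cell_th_dv. Qed.

Let h_le (k : 'I_n) t : `|h k t| <= 1 + b2.
Proof. by rewrite /h; apply: le_trans (ler_normD _ _) _; rewrite normr1 lerD2l. Qed.

Let F_gb : gb F. Proof. by apply: gb_Pi => _; exact: (dens_gb1 aa de_dv de_le). Qed.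

Let r_sg a : sg (rho th a). Proof. exact: (sg_rho th_dv h_le). Qed.

Let hq (a b x : 'rV[R]_n) := \sum_k a 0 k * b 0 k * (1 + de2 (x 0 k)).

Let hq_sg a b : sg (hq a b).
Proof.
apply: sg_sum => k _; apply: sgM; first exact: sg_cst.
have hc (i : 'I_n) : continuous (h i).
  by move=> t; apply: cvgD; [exact: cvg_cst|exact: de2_cont].
exact: (sg_h hc h_le).
Qed.

Let F1 a x := rho th a x * F x.
Let F2 a b x := (rho th a x * rho th b x - hq a b x) * F x.

Let F1_gb a : gb (F1 a). Proof. exact: gb_mul_sg. Qed.

Let F2_gb a b : gb (F2 a b).
Proof.
apply: gb_mul_sg => //; under eq_fun do rewrite -mulN1r.
by apply: sgD; apply: sgM => //; exact: sg_cst.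
Qed.

Let dF a x : dv (fun s => F (x + s *: a)) 0 (F1 a x).
Proof.
have H0 b : b \in [::] -> disj b a by [].
have := @dv_Phi R n (fun _ => site_dens de aa) th (fun _ t => site_dens_dv aa de_dv t)
  (fun _ => site_dens de aa) [::] a x (fun _ _ => erefl) H0.
rewrite /Phi big_cons big_nil mulr1 mulrC; under eq_fun do rewrite big_nil mulr1.
by [].
Qed.

Let dF1 a b x : dv (fun s => F1 b (x + s *: a)) 0 (F2 a b x).
Proof.
have h1 : dv (fun s => rho th b (x + s *: a)) 0 (- hq a b x).
  apply: dvN; apply: dv_sum => k _.
  have := dvZ (b 0 k) (dv_comp (th_dv k _) (dv_coord x a k 0)).
  by rewrite scale0r addr0 => H; apply: (dv_eq H); rewrite /h; ring.
by apply: (dv_eq (dvM h1 (dF a x))); rewrite scale0r addr0 /F1 /F2; ring.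
Qed.

Let fq f (z : 'rV[R]_D) : R := fib B (z *m T) f.

Let fq_scont f : gb f -> scont (fq f).
Proof.
move=> gf; have V : col_mx T B *m row_mx E (B' - E *m T *m B') = 1%:M.
  rewrite mul_col_row TE BE !mulmxBr BB' !mulmxA TE BE mul1mx !mul0mx subrr subr0.
  by rewrite -scalar_mx_block.
have := gb_int2 Jq (gb_gb2 (gb_affine 0 V gf)).
by under eq_fun do under eq_fun do rewrite mul_row_col add0r; case.
Qed.

Let fq_dv f f' z u t : gb f -> gb f' -> (forall x, dv (fun s => f (x + s *: (u *m T))) 0 (f' x)) ->
  dv (fun s => fq f (z + s *: u)) t (fq f' (z + t *: u)).
Proof.
move=> gf gf' df; have := @fib_dv R n q _ f f' (u *m T) (z *m T) B B' t Jq BB' gf gf' df.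
by rewrite /fq /fib mulmxDl scalemxAl; under [X in dv X _ _ -> _]eq_fun do rewrite scalemxAl -mulmxDl.
Qed.

Definition fib_log (N lnc : R) (z : 'rV[R]_D) : R := - (N^-1 * (lnc + ln (fq F z))).

Let Z_gt0 z : 0 < fq F z.
Proof. by apply: J_gt0 => [|w]; [exact: (fib_gbw BB')|apply: prodr_gt0 => k _; exact: expR_gt0]. Qed.

Let G1 i z := fq (F1 (row i T)) z.
Let G2 i j z := fq (F2 (row i T) (row j T)) z.

Let rowT (u : 'rV[R]_D) k : (u *m T) 0 k = \sum_i u 0 i * (row i T) 0 k.
Proof. by rewrite mxE; apply: eq_bigr => i _; rewrite [row _ _ _ _]mxE. Qed.

Let rhoT u x : rho th (u *m T) x = \sum_i u 0 i * rho th (row i T) x.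
Proof.
rewrite /rho; under [in RHS]eq_bigr do rewrite mulrN mulr_sumr.
rewrite sumrN exchange_big /=; congr (- _); apply: eq_bigr => k _.
by rewrite rowT mulr_suml; apply: eq_bigr => i _; rewrite mulrA.
Qed.

Let fq_sum (f : 'I_D -> 'rV[R]_n -> R) (c : 'I_D -> R) z : (forall i, gb (f i)) ->
  fq (fun x => \sum_i c i * f i x) z = \sum_i c i * fq (f i) z.
Proof.
move=> gf; rewrite /fq /fib (int_sum Jq); last first.
  by move=> i _; apply: (@gbZ R q (c i) (fun w => f i (z *m T + w *m B))); exact: (fib_gbw BB').
by apply: eq_bigr => i _; rewrite (intZ Jq)//; exact: (fib_gbw BB').
Qed.

Let dZ z u t : dv (fun s => fq F (z + s *: u)) t (\sum_i u 0 i * G1 i (z + t *: u)).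
Proof.
apply: (dv_eq (fq_dv z t F_gb (F1_gb (u *m T)) (dF (u *m T)))).
rewrite -fq_sum//; congr (fq _ _); apply/funext => x.
by rewrite /F1 rhoT mulr_suml; apply: eq_bigr => i _; rewrite mulrA.
Qed.

Let dG1 j z u t : dv (fun s => G1 j (z + s *: u)) t (\sum_i u 0 i * G2 i j (z + t *: u)).
Proof.
apply: (dv_eq (fq_dv z t (F1_gb (row j T)) (F2_gb (u *m T) (row j T)) (dF1 (u *m T) (row j T)))).
rewrite -fq_sum//; congr (fq _ _); apply/funext => x.
rewrite /F2 rhoT (_ : hq _ _ _ = \sum_i u 0 i * hq (row i T) (row j T) x).
  rewrite mulr_suml -sumrB mulr_suml; apply: eq_bigr => i _; ring.
rewrite /hq; under [in RHS]eq_bigr do rewrite mulr_sumr.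
rewrite exchange_big /=; apply: eq_bigr => k _.
by rewrite rowT !mulr_suml; apply: eq_bigr => i _; ring.
Qed.

(** Derivatives along lines with sequentially continuous coefficients: the form of C2 regularity
    from which [hessian_lcomb] builds Frechet derivatives. In [H i j] the index [i] belongs to the
    second differentiation. *)
Lemma fib_log_C2 (N lnc : R) (phi := fib_log N lnc) :
  exists (G : 'I_D -> 'rV[R]_D -> R) (H : 'I_D -> 'I_D -> 'rV[R]_D -> R),
  [/\ forall i, scont (G i), forall i j, scont (H i j),
      forall z u t, dv (fun s => phi (z + s *: u)) t (\sum_i u 0 i * G i (z + t *: u))
    & forall j z u t, dv (fun s => G j (z + s *: u)) t (\sum_i u 0 i * H i j (z + t *: u))].
Proof.
have cinv f : (forall z, 0 < f z) -> scont f -> scont (fun z : 'rV[R]_D => (f z)^-1).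
  by move=> f0 cf u z uz; apply: cvgV; [rewrite gt_eqF|exact: cf].
have cZ : scont (fun z => (fq F z)^-1) by apply: cinv => //; exact: fq_scont.
exists (fun i z => - N^-1 * (G1 i z * (fq F z)^-1)).
exists (fun i j z => - N^-1 * (G2 i j z * (fq F z)^-1 + - (G1 i z * G1 j z * ((fq F z)^-1 * (fq F z)^-1)))).
split=> [i|i j|z u t|j z u t].
- by apply: scontM; [exact: scont_cst|apply: scontM => //; exact: fq_scont].
- apply: scontM; first exact: scont_cst.
  apply: scontD; first by apply: scontM => //; exact: fq_scont.
  by apply: scontN; apply: scontM; apply: scontM => //; exact: fq_scont.
- have := dvN (dvZ N^-1 (dvD (dv_cst lnc t) (dv_ln (Z_gt0 _) (dZ z u t)))).
  move=> H; apply: (dv_eq H); rewrite add0r -mulNr mulr_suml mulr_sumr.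
  by apply: eq_bigr => i _; ring.
- have := dvZ (- N^-1) (dvM (dG1 j z u t) (dvV (lt0r_neq0 (Z_gt0 _)) (dZ z u t))).
  move=> H; apply: (dv_eq H); set Z := fq F _.
  set S1 := \sum_i u 0 i * G1 i _; set S2 := \sum_i u 0 i * G2 i j _.
  transitivity (- N^-1 * (S2 * Z^-1 - S1 * (G1 j (z + t *: u) * (Z^-1 * Z^-1)))).
    by rewrite expr2 invfM; ring.
  by rewrite /S1 /S2 !mulr_suml -sumrB mulr_sumr; apply: eq_bigr => i _; ring.
Qed.

End free_energy.

(** * Frechet Hessians from coordinates *)

Section hessian_coordinates.
Context {R : realType}.
Variables (Y : set (R -> R)) (D : nat) (b : 'I_D -> R -> R).

Definition lcomb (z : 'rV[R]_D) : R -> R := fun t => \sum_i z 0 i * b i t.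

Hypothesis lcomb_Y : forall z, Y (lcomb z).
Hypothesis Y_lcomb : forall y, Y y -> exists z, y = lcomb z.
Hypothesis lcomb_ip : forall z w, l2ip (lcomb z) (lcomb w) = \sum_i z 0 i * w 0 i.
Variables (F : (R -> R) -> R) (phi : 'rV[R]_D -> R).
Hypothesis F_phi : forall z, F (lcomb z) = phi z.
Variables (G : 'I_D -> 'rV[R]_D -> R) (H : 'I_D -> 'I_D -> 'rV[R]_D -> R).
Hypothesis G_cont : forall i, scont (G i).
Hypothesis H_cont : forall i j, scont (H i j).
Hypothesis phi_dv : forall z u t,
  dv (fun s => phi (z + s *: u)) t (\sum_i u 0 i * G i (z + t *: u)).
Hypothesis G_dv : forall j z u t,
  dv (fun s => G j (z + s *: u)) t (\sum_i u 0 i * H i j (z + t *: u)).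

Let lcombD z w : lcomb z \+ lcomb w = lcomb (z + w).
Proof.
apply/funext => t; rewrite /lcomb /= -big_split; apply: eq_bigr => i _.
by rewrite mxE mulrDl.
Qed.

Let lcombB z w : lcomb z \- lcomb w = lcomb (z - w).
Proof.
apply/funext => t; rewrite /lcomb /= -sumrB; apply: eq_bigr => i _.
by rewrite !mxE mulrBl.
Qed.

Let lcombN z : l2norm (lcomb z) = Num.sqrt (sqn z).
Proof. by rewrite /l2norm lcomb_ip; congr Num.sqrt; apply: eq_bigr => i _; rewrite expr2. Qed.

Let coef (y : R -> R) : 'rV[R]_D := xget 0 [set z | y = lcomb z].

Let lcomb_inj z w : lcomb z = lcomb w -> z = w.
Proof.
move=> e; apply/eqP; rewrite -subr_eq0; apply/eqP.
have : l2norm (lcomb (z - w)) = 0.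
  rewrite -lcombB e; have -> : lcomb w \- lcomb w = lcomb 0.
    by apply/funext => t; rewrite /lcomb /= subrr big1// => i _; rewrite mxE mul0r.
  by rewrite lcombN// sqn0 sqrtr0.
rewrite lcombN// => /eqP; rewrite sqrtr_eq0 => s0; apply/rowP => i; rewrite [RHS]mxE.
by apply/eqP; rewrite -sqrf_eq0 eq_le sqr_ge0 andbT; apply: le_trans s0; exact: coord_sqn.
Qed.

Let coefK z : coef (lcomb z) = z.
Proof. by apply: lcomb_inj; rewrite -[RHS]/(lcomb z); exact/esym/(@xgetI _ 0 [set w | lcomb z = lcomb w] z). Qed.

(** The mean value theorem along the segment reduces Frechet differentiability to continuity of the
    partial derivatives; the sum over coordinates costs the factor [D]. *)
Let mean_value (f : 'rV[R]_D -> R) (f' : 'I_D -> 'rV[R]_D -> R) z k (e : R) :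
  (forall u t, dv (fun s => f (z + s *: u)) t (\sum_i u 0 i * f' i (z + t *: u))) ->
  (forall t i, 0 <= t <= 1 -> `|f' i (z + t *: k) - f' i z| <= e) ->
  `|f (z + k) - f z - \sum_i k 0 i * f' i z| <= D%:R * (e * Num.sqrt (sqn k)).
Proof.
move=> df He; have [c /andP[c0 c1]] := dv_MVT ltr01 (fun t _ => df k t).
rewrite scale1r scale0r addr0 subr0 mulr1 => ->; rewrite -sumrB.
apply: le_trans (ler_norm_sum _ _ _) _.
rewrite mulr_natl -[X in _ *+ X]card_ord -sumr_const; apply: ler_sum => i _.
rewrite -mulrBr normrM mulrC; apply: ler_pM => //; last exact: coord_sqrt_sqn.
by apply: He; rewrite !ltW.
Qed.

Let near_all (f : 'I_D -> 'rV[R]_D -> R) z (e : R) : (forall i, scont (f i)) -> 0 < e ->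
  exists2 r : R, 0 < r & forall k, Num.sqrt (sqn k) < r -> forall t i, 0 <= t <= 1 ->
    `|f i (z + t *: k) - f i z| <= e.
Proof.
move=> cf e0; pose g w := \sum_i `|f i w - f i z|.
have cg : scont g.
  apply: scont_sum => i _; apply: scont_norm; apply: scontD => //; exact: scont_cst.
have [r r0 Hr] := scont_near z cg e0; exists r => // k kr t i /andP[t0 t1].
have tk : Num.sqrt (sqn (t *: k)) < r.
  rewrite sqnZ sqrtrM ?sqr_ge0// sqrtr_sqr ger0_norm//.
  by apply: le_lt_trans kr; rewrite ler_piMl// sqrtr_ge0.
have := Hr _ tk; have -> : g z = 0 by rewrite /g big1// => j _; rewrite subrr normr0.
rewrite subr0 => h; apply: le_trans (le_trans (ler_norm _) h).
by rewrite /g (bigD1 i)//= lerDl; exact: sumr_ge0.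
Qed.

(** Dividing by [D + 1] rather than [D] covers [D = 0]. *)
Let Dle (e x : R) : 0 <= e -> 0 <= x -> D%:R * (e / (D%:R + 1) * x) <= e * x.
Proof.
move=> e0 x0; rewrite mulrA ler_wpM2r// mulrCA ler_piMr// ler_pdivrMr// mul1r.
by rewrite lerDl.
Qed.

Let gradient z : is_gradient Y F (lcomb z) (lcomb (\row_i G i z)).
Proof.
split=> // e e0; have e'0 : 0 < e / (D%:R + 1) by rewrite divr_gt0.
have [r r0 Hr] := near_all z G_cont e'0; exists r => // y /Y_lcomb[k ->].
rewrite lcombN// => kr; rewrite lcombD !F_phi lcomb_ip.
have -> : \sum_i (\row_i G i z) 0 i * k 0 i = \sum_i k 0 i * G i z.
  by apply: eq_bigr => i _; rewrite mxE mulrC.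
apply: le_trans (mean_value (phi_dv z) (Hr k kr)) _.
by apply: Dle; [exact: ltW|exact: sqrtr_ge0].
Qed.

Definition hess_op z (y : R -> R) : R -> R := lcomb (coef y *m \matrix_(i, j) H i j z).

Lemma hess_opE z u : hess_op z (lcomb u) = lcomb (\row_j \sum_i u 0 i * H i j z).
Proof.
rewrite /hess_op coefK; congr lcomb; apply/rowP => j; rewrite !mxE.
by apply: eq_bigr => i _; rewrite mxE.
Qed.

Lemma hess_op_ip z u :
  l2ip (hess_op z (lcomb u)) (lcomb u) = \sum_j u 0 j * \sum_i u 0 i * H i j z.
Proof. by rewrite hess_opE lcomb_ip; apply: eq_bigr => j _; rewrite mxE mulrC. Qed.

Let sqrt_sum_le (v : 'rV[R]_D) (e : R) : 0 <= e -> (forall j, `|v 0 j| <= e) ->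
  Num.sqrt (sqn v) <= D%:R * e.
Proof.
move=> e0 ve; have s0 : 0 <= D%:R * e by rewrite mulr_ge0.
rewrite -[leRHS]ger0_norm// -sqrtr_sqr ler_wsqrtr// exprMn.
apply: (@le_trans _ _ (D%:R * e ^+ 2)).
  rewrite mulr_natl -[X in _ *+ X]card_ord -sumr_const; apply: ler_sum => j _.
  by rewrite -real_normK ?num_real// lerXn2r ?nnegrE.
rewrite ler_wpM2r ?sqr_ge0// -natrX ler_nat; case: (D) => // m.
by rewrite expnS expn1 leq_pmulr.
Qed.

Theorem hessian_lcomb z : is_hessian Y F (lcomb z) (hess_op z).
Proof.
split=> [h _|c _ _ /Y_lcomb[u ->] /Y_lcomb[w ->]|]; first exact: lcomb_Y.
  have -> : (fun t => c * lcomb u t + lcomb w t) = lcomb (c *: u + w).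
    apply/funext => t; rewrite /lcomb mulr_sumr -big_split; apply: eq_bigr => i _ /=.
    by rewrite !mxE mulrDl mulrA.
  rewrite /hess_op !coefK mulmxDl -scalemxAl; apply/funext => t.
  move: (u *m _) (w *m _) => p p'; rewrite /lcomb mulr_sumr -big_split.
  by apply: eq_bigr => i _ /=; rewrite !mxE mulrDl mulrA.
exists (fun y => lcomb (\row_i G i (coef y))), 1; split=> // [y /Y_lcomb[w ->] _|e e0].
  by rewrite coefK; exact: gradient.
(* One factor pays for the sum over [i] in [mean_value], the other for the components [j] in
   [sqrt_sum_le]. *)
pose e' := e / (D%:R + 1) / (D%:R + 1).
have e'0 : 0 < e' by rewrite !divr_gt0.
have [r r0 Hr] : exists2 r : R, 0 < r & forall k, Num.sqrt (sqn k) < r -> forall j t i, 0 <= t <= 1 ->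
    `|H i j (z + t *: k) - H i j z| <= e'.
  have /choice[r Hr] : forall j, exists r : R, 0 < r /\ forall k, Num.sqrt (sqn k) < r ->
      forall t i, 0 <= t <= 1 -> `|H i j (z + t *: k) - H i j z| <= e'.
    by move=> j; have [r r0 Hr] := @near_all (fun i => H i j) z e' (fun i => @H_cont i j) e'0; exists r.
  exists (\big[Num.min/1]_j r j).
    by apply: lt_bigmin => // j _; case: (Hr j).
  move=> k kr j; apply: (Hr j).2; apply: lt_le_trans kr _; exact: bigmin_le.
exists r => // y /Y_lcomb[k ->]; rewrite lcombN// => kr; rewrite lcombD !coefK hess_opE.
rewrite (_ : (fun t => _) = lcomb (\row_j (G j (z + k) - G j z - \sum_i k 0 i * H i j z))); last first.
  apply/funext => t; rewrite /lcomb -!sumrB; apply: eq_bigr => i _.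
  by rewrite !mxE !mulrBl.
rewrite lcombN//; have s0 := sqrtr_ge0 (sqn k).
apply: (@le_trans _ _ (D%:R * (e / (D%:R + 1) * Num.sqrt (sqn k)))); last by apply: Dle => //; exact: ltW.
apply: sqrt_sum_le; first by rewrite mulr_ge0// divr_ge0// ltW.
move=> j; rewrite mxE; apply: le_trans (@mean_value (G j) (fun i => H i j) z k e' (G_dv j z) (Hr k kr j)) _.
by apply: Dle => //; rewrite divr_ge0// ltW.
Qed.

Lemma hess_op_bounds z u (lo hi : R) :
  (forall t, lo * sqn u * t ^+ 2 <= phi (z + t *: u) + phi (z - t *: u) - 2 * phi z) ->
  (forall t, phi (z + t *: u) + phi (z - t *: u) - 2 * phi z <= hi * sqn u * t ^+ 2) ->
  lo * l2ip (lcomb u) (lcomb u) <= l2ip (hess_op z (lcomb u)) (lcomb u) <= hi * l2ip (lcomb u) (lcomb u).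
Proof.
move=> Hlo Hhi.
pose f t := phi (z + t *: u); pose f1 t := \sum_i u 0 i * G i (z + t *: u).
pose f2 t := \sum_j u 0 j * \sum_i u 0 i * H i j (z + t *: u).
have df t : dv f t (f1 t) by exact: phi_dv.
have df1 t : dv f1 t (f2 t) by apply: dv_sum => j _; apply: dvZ; exact: G_dv.
have cf2 : {for 0, continuous f2}.
  apply: (@scont_line _ _ (fun w => \sum_j u 0 j * \sum_i u 0 i * H i j w) z u).
  apply: scont_sum => j _; apply: scontM; first exact: scont_cst.
  by apply: scont_sum => i _; apply: scontM => //; exact: scont_cst.
have ipE : l2ip (lcomb u) (lcomb u) = sqn u.
  by rewrite lcomb_ip; apply: eq_bigr => i _; rewrite expr2.
have HE : l2ip (hess_op z (lcomb u)) (lcomb u) = f2 0.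
  by rewrite hess_op_ip /f2 scale0r addr0.
have f0 : f 0 = phi z by rewrite /f scale0r addr0.
have fN t : f (- t) = phi (z - t *: u) by rewrite /f scaleNr.
rewrite HE ipE; apply/andP; split.
  by apply: (second_diff_ge df df1 cf2) => t; rewrite f0 fN.
by apply: (second_diff_le df df1 cf2) => t; rewrite f0 fN; exact: Hhi.
Qed.

End hessian_coordinates.

(** * Splines *)

Section piecewise_continuous.
Context {R : realType}.
Let mu := @lebesgue_measure R.
Implicit Types (f g : R -> R) (a b c : R).

Let itv_cat_integrable f a b c : a <= b -> b <= c ->
  mu.-integrable `[a, b[ (EFin \o f) -> mu.-integrable `[b, c[ (EFin \o f) ->
  mu.-integrable `[a, c[ (EFin \o f).
Proof.
move=> ab bc i1 i2; apply/integrable_mkcond => //.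
have -> : (EFin \o f) \_ `[a, c[ = (EFin \o f) \_ `[a, b[ \+ (EFin \o f) \_ `[b, c[.
  apply/funext => t; rewrite /= !patchE.
  case: (boolP (t \in `[a, b[%classic)) => [|h1]; rewrite ?inE /=.
    rewrite in_itv /= => /andP[h1 h2].
    rewrite mem_set /= ?in_itv /= ?h1 ?(lt_le_trans h2)// memNset ?adde0//=.
    by rewrite in_itv /= leNgt h2.
  case: (boolP (t \in `[b, c[%classic)) => [|h2]; rewrite ?inE /=.
    rewrite in_itv /= => /andP[h2 h3].
    by rewrite mem_set /= ?in_itv /= ?h3 ?(le_trans ab)// add0e.
  rewrite memNset ?adde0//= in_itv /= => /andP[h3 h4].
  have [tb|bt] := ltP t b.
    by move: h1; rewrite notin_setE /= in_itv /= h3 tb.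
  by move: h2; rewrite notin_setE /= in_itv /= h4 bt.
by apply: integrableD => //; [move: i1|move: i2] => /integrable_mkcond; apply.
Qed.

Let itv_cat f a b c : a <= b -> b <= c ->
  mu.-integrable `[a, b[ (EFin \o f) -> mu.-integrable `[b, c[ (EFin \o f) ->
  \int[mu]_(t in `[a, c[) f t = \int[mu]_(t in `[a, b[) f t + \int[mu]_(t in `[b, c[) f t.
Proof.
move=> ab bc i1 i2; have u : `[a, c[%classic = `[a, b[%classic `|` `[b, c[%classic.
  apply/seteqP; split=> t /=; rewrite !in_itv /=.
    by move=> /andP[h1 h2]; have [tb|bt] := ltP t b; [left; rewrite h1|right; rewrite h2].
  by case=> /andP[h1 h2]; apply/andP; split=> //; [exact: lt_le_trans bc|exact: le_trans h1].
rewrite u Rintegral_setU//; first by rewrite -u; exact: itv_cat_integrable i1 i2.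
apply/disj_setPS => t /= []; rewrite !in_itv /= => /andP[_ h1] /andP[h2 _].
by move: h1; rewrite ltNge h2.
Qed.

Let grid_split f (a : nat -> R) n : (forall j, a j <= a j.+1) ->
  (forall j, (j < n)%N -> mu.-integrable `[a j, a j.+1[ (EFin \o f)) ->
  mu.-integrable `[a 0%N, a n[ (EFin \o f) /\
  \int[mu]_(t in `[a 0%N, a n[) f t = \sum_(j < n) \int[mu]_(t in `[a j, a j.+1[) f t.
Proof.
move=> aS; have a0 k : a 0%N <= a k by elim: k => // k IH; exact: le_trans (aS k).
elim: n => [_|n IH H].
  rewrite (_ : `[a 0%N, a 0%N[%classic = set0); last first.
    by apply/seteqP; split=> t //=; rewrite in_itv /= => /andP[h1]; rewrite ltNge h1.
  by rewrite big_ord0 Rintegral_set0; split=> //; exact: integrable_set0.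
have [i1 e1] := IH (fun j jn => H j (ltnW jn)).
split; first exact: (itv_cat_integrable (a0 n) (aS n) i1 (H n (ltnSn n))).
by rewrite big_ord_recr /= -e1; apply: itv_cat => //; exact: H.
Qed.

(** Agreement on the open interval only: the polynomial pieces of a spline are given inside the
    cells, and the nodes are null sets. *)
Definition oo_eq a b f g := forall t, a < t < b -> f t = g t.

Let piece f g a b : a <= b -> continuous g -> oo_eq a b f g ->
  mu.-integrable `[a, b[ (EFin \o f) /\
  \int[mu]_(t in `[a, b[) f t = \int[mu]_(t in `[a, b]) g t.
Proof.
move=> ab cg fg.
have ig : mu.-integrable `[a, b] (EFin \o g).
  apply: continuous_compact_integrable; first exact: segment_compact.
  exact: continuous_subspaceT.
have ig1 : mu.-integrable `]a, b[ (EFin \o g).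
  by apply: integrableS ig => //; apply: subset_itvW.
have if1 : mu.-integrable `]a, b[ (EFin \o f).
  apply/(eq_integrable _ _ _ _ ig1) => // t; rewrite inE /= in_itv /= => tab.
  by rewrite /= fg.
have if2 : mu.-integrable `[a, b[ (EFin \o f).
  have /integrableP[m1 l1] := if1; apply/integrableP.
  have m2 : measurable_fun `[a, b[ (EFin \o f).
    by apply/measurable_EFinP/measurable_fun_itv_obnd_cbndP/measurable_EFinP.
  split=> //; rewrite -integral_itv_obnd_cbnd//.
  exact: measurableT_comp.
split=> //; rewrite -Rintegral_itv_obnd_cbnd// (@eq_Rintegral _ _ _ mu `]a, b[ g f); last first.
  by move=> t; rewrite inE /= in_itv /= => /fg.
rewrite Rintegral_itv_obnd_cbnd//.
rewrite Rintegral_itv_bndo_bndc//; apply: integrableS ig => // t /=.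
by rewrite !in_itv /= => /andP[-> /ltW].
Qed.

Let cint_ftc (g G : R -> R) a b : a < b -> continuous g -> (forall t, dv G t (g t)) ->
  \int[mu]_(t in `[a, b]) g t = G b - G a.
Proof.
move=> ab cg dG; rewrite /Rintegral (@continuous_FTC2 R g G a b ab)//.
- exact: continuous_subspaceT.
- have cG x : {for x, continuous G} by exact: dv_continuous (dG x).
  split=> [t _||].
  + by have [] := dG t.
  + by apply: cvg_at_right_filter; exact: cG.
  + by apply: cvg_at_left_filter; exact: cG.
- by move=> t _; rewrite derive1E; have [_ ->] := dG t.
Qed.

Variable N : nat.
Hypothesis N_gt0 : (0 < N)%N.

Definition gpt (j : nat) : R := j%:R / N%:R.

Lemma gptS j : gpt j < gpt j.+1.
Proof. by rewrite ltr_pM2r ?invr_gt0 ?ltr0n// ltr_nat. Qed.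

Lemma gptB j : gpt j.+1 - gpt j = N%:R^-1.
Proof. by rewrite /gpt -mulrBl -natr1 addrC addKr mul1r. Qed.

Definition pcont f := forall j, (j < N)%N ->
  exists2 g, continuous g & oo_eq (gpt j) (gpt j.+1) f g.

Lemma pcont_lin (c : R) f g : pcont f -> pcont g -> pcont (fun t => c * f t + g t).
Proof.
move=> pf pg j jN; have [f1 c1 e1] := pf j jN; have [g1 c2 e2] := pg j jN.
exists (fun t => c * f1 t + g1 t); last by move=> t tj; rewrite e1// e2.
by move=> t; apply: cvgD; [apply: cvgM; [exact: cvg_cst|exact: c1]|exact: c2].
Qed.

Lemma pcontM f g : pcont f -> pcont g -> pcont (fun t => f t * g t).
Proof.
move=> pf pg j jN; have [f1 c1 e1] := pf j jN; have [g1 c2 e2] := pg j jN.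
exists (fun t => f1 t * g1 t); last by move=> t tj; rewrite e1// e2.
by move=> t; apply: cvgM; [exact: c1|exact: c2].
Qed.

Lemma pcont_cst (c : R) : pcont (fun=> c).
Proof. by move=> j _; exists (fun=> c) => // t; exact: cvg_cst. Qed.

Definition sint j f : R := \int[mu]_(t in `[gpt j, gpt j.+1[) f t.

Let sint_integrable j f : (j < N)%N -> pcont f ->
  mu.-integrable `[gpt j, gpt j.+1[ (EFin \o f).
Proof. by move=> jN pf; have [g cg e] := pf j jN; have [] := piece (ltW (gptS j)) cg e. Qed.

Lemma sint_lin j (c : R) f g : (j < N)%N -> pcont f -> pcont g ->
  sint j (fun t => c * f t + g t) = c * sint j f + sint j g.
Proof.
move=> jN pf pg; have if1 := sint_integrable jN pf.
rewrite /sint RintegralD//; last exact: sint_integrable.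
  by rewrite RintegralZl.
have pz : pcont (fun=> 0) by exact: pcont_cst.
have := sint_integrable jN (pcont_lin c pf pz).
by rewrite (_ : (fun t => c * f t + 0) = (fun t => c * f t))//; apply/funext => t; rewrite addr0.
Qed.

Lemma sint_eq j f g : (j < N)%N -> pcont g -> oo_eq (gpt j) (gpt j.+1) f g -> sint j f = sint j g.
Proof.
move=> jN pg fg; have [g1 c1 e1] := pg j jN; have gj := ltW (gptS j).
rewrite /sint; have [_ ->] := piece gj c1 e1; apply: (piece gj c1 _).2 => t tj.
by rewrite fg// e1.
Qed.

Lemma sint_ftc j f g G : (j < N)%N -> continuous g -> oo_eq (gpt j) (gpt j.+1) f g ->
  (forall t, dv G t (g t)) -> sint j f = G (gpt j.+1) - G (gpt j).
Proof.
move=> jN cg fg dG; rewrite /sint (piece (ltW (gptS j)) cg fg).2.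
exact: cint_ftc (gptS j) cg dG.
Qed.

Lemma sint_cst j (c : R) : (j < N)%N -> sint j (fun=> c) = c / N%:R.
Proof.
move=> jN; rewrite (@sint_ftc j _ (fun=> c) (fun t => c * t))//.
- by rewrite -mulrBr gptB.
- by move=> t; exact: cvg_cst.
- by move=> t; apply: (dv_eq (dvZ c (dv_id t))); rewrite mulr1.
Qed.

Lemma sint_ge0 j f : (forall t, 0 <= f t) -> 0 <= sint j f.
Proof. by move=> f0; apply: Rintegral_ge0. Qed.

Lemma sint_le j f g : (j < N)%N -> pcont f -> pcont g ->
  (forall t, gpt j < t < gpt j.+1 -> f t <= g t) -> sint j f <= sint j g.
Proof.
move=> jN pf pg fg; have [f1 c1 e1] := pf j jN; have [g1 c2 e2] := pg j jN.
(* [f1 <= g1] is known on the open interval only; the maximum gives an inequality on the closed one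
   without changing the integral. *)
pose h t := Num.max (f1 t) (g1 t).
have ch : continuous h by move=> t; apply: continuous_max; [exact: c1|exact: c2].
have gj := ltW (gptS j).
have eh : oo_eq (gpt j) (gpt j.+1) g h.
  by move=> t tj; rewrite /h -e1// -e2//; apply/esym/max_idPr; exact: fg.
rewrite /sint (piece gj c1 e1).2 (piece gj ch eh).2.
have ic k : continuous k -> mu.-integrable `[gpt j, gpt j.+1] (EFin \o k).
  move=> ck; apply: continuous_compact_integrable; first exact: segment_compact.
  exact: continuous_subspaceT.
by apply: le_Rintegral; [exact: measurable_itv|exact: ic|exact: ic|move=> t _; rewrite le_max lexx].
Qed.

(** Jensen: with [c] the mean of [f] on the cell, the integral of [(f t - c) ^+ 2] is
    nonnegative. *)
Lemma sint_sqr_ge j f : (j < N)%N -> pcont f ->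
  N%:R * sint j f ^+ 2 <= sint j (fun t => f t * f t).
Proof.
move=> jN pf; have N0 : 0 < N%:R :> R by rewrite ltr0n.
pose c := N%:R * sint j f.
have := @sint_ge0 j (fun t => (- (2 * c)) * f t + (1 * (f t * f t) + c ^+ 2)).
rewrite sint_lin//; last by apply: pcont_lin; [exact: pcontM|exact: pcont_cst].
rewrite sint_lin//; [|exact: pcontM|exact: pcont_cst].
rewrite sint_cst// => H; rewrite -subr_ge0.
have -> : sint j (fun t => f t * f t) - N%:R * sint j f ^+ 2 =
  - (2 * c) * sint j f + (1 * sint j (fun t => f t * f t) + c ^+ 2 / N%:R).
  by rewrite /c; field; rewrite gt_eqF.
by apply: H => t; have := sqr_ge0 (f t - c); rewrite sqrrB; lra.
Qed.

Lemma l2ipE f g : pcont f -> pcont g -> l2ip f g = \sum_(j < N) sint j (fun t => f t * g t).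
Proof.
move=> pf pg; have pfg := pcontM pf pg.
have [|i e] := @grid_split (fun t => f t * g t) gpt N (fun j => ltW (gptS j)).
  by move=> j jN; exact: sint_integrable.
have g0 : gpt 0%N = 0 by rewrite /gpt mul0r.
have g1 : gpt N = 1 by rewrite /gpt divff// gt_eqF// ltr0n.
by rewrite /l2ip -e g0 g1 Rintegral_itv_bndo_bndc//; rewrite g0 g1 in i.
Qed.

Lemma l2ip_lin (c : R) f g h : pcont f -> pcont g -> pcont h ->
  l2ip (fun t => c * f t + g t) h = c * l2ip f h + l2ip g h.
Proof.
move=> pf pg ph; rewrite !l2ipE//; last exact: pcont_lin.
rewrite mulr_sumr -big_split; apply: eq_bigr => j _ /=.
rewrite -sint_lin//; [|exact: pcontM|exact: pcontM].
by congr sint; apply/funext => t; ring.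
Qed.

Lemma l2ipC f g : l2ip f g = l2ip g f.
Proof. by rewrite /l2ip; congr Rintegral; apply/funext => t; rewrite mulrC. Qed.

Lemma l2ip_ge0 f : 0 <= l2ip f f.
Proof. by apply: Rintegral_ge0 => t _; rewrite -expr2 sqr_ge0. Qed.

End piecewise_continuous.

Lemma sum_divmod {R : nmodType} (M D : nat) (F : nat -> nat -> R) : (0 < D)%N ->
  \sum_(r < M * D) F (r %/ D)%N (r %% D)%N = \sum_(m < M) \sum_(l < D) F m l.
Proof.
move=> D0; elim: M F => [|M IH] F; first by rewrite !big_ord0.
rewrite (@big_split_ord _ _ _ D (M * D)) big_ord_recl /=; congr (_ + _).
  by apply: eq_bigr => l _; rewrite divn_small// modn_small.
rewrite -(IH (fun m l => F m.+1 l)); apply: eq_bigr => r _.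
by rewrite divnDl// divnn D0 modnDl.
Qed.

Lemma bd_entry {R : realType} (p n M : nat) (a : nat -> nat -> R) i j : (0 < p)%N -> (0 < n)%N ->
  bd M (\matrix_(k < p, l < n) a k l) i j =
  if (i %/ p == j %/ n)%N then a (i %% p)%N (j %% n)%N else 0.
Proof.
move=> p0 n0; elim: M i j => [|M IH] i j; first by case: i.
have [i' ei|i' ei] := @splitP p (M * p) i; have [j' ej|j' ej] := @splitP n (M * n) j.
- have -> : i = lshift _ i' by exact: val_inj.
  have -> : j = lshift _ j' by exact: val_inj.
  by rewrite /= block_mxEul mxE !divn_small// !modn_small.
- have -> : i = lshift _ i' by exact: val_inj.
  have -> : j = rshift _ j' by exact: val_inj.
  by rewrite /= block_mxEur mxE divn_small// divnDl// divnn n0.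
- have -> : i = rshift _ i' by exact: val_inj.
  have -> : j = lshift _ j' by exact: val_inj.
  by rewrite /= block_mxEdl mxE divnDl// divnn p0 [(j' %/ n)%N]divn_small.
- have -> : i = rshift _ i' by exact: val_inj.
  have -> : j = rshift _ j' by exact: val_inj.
  by rewrite /= block_mxEdr IH !divnDl// !divnn p0 n0 !modnDl eqSS.
Qed.

(** * Piecewise polynomials in local coordinates *)

Section piecewise_polynomial.
Context {R : realType}.
Variables (M K D : nat).
Hypothesis M_gt0 : (0 < M)%N.
Hypothesis K_gt0 : (0 < K)%N.
Hypothesis D_gt0 : (0 < D)%N.
Implicit Types (f g : R -> R) (c : nat -> nat -> R).

Definition cpoly c m (t : R) : R := \sum_(l < D) c m l * (M%:R * t - m%:R) ^+ l.

(* On the [m]-th cell [f] is a polynomial in the local variable [M t - m]. *)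
Definition pwc f c := forall m, (m < M)%N -> oo_eq (gpt M m) (gpt M m.+1) f (cpoly c m).

Let N := (M * K)%N.
Let N_gt0 : (0 < N)%N. Proof. by rewrite muln_gt0 M_gt0. Qed.
Let M0 : 0 < M%:R :> R. Proof. by rewrite ltr0n. Qed.
Let K0 : 0 < K%:R :> R. Proof. by rewrite ltr0n. Qed.

Definition cellc k l : R :=
  (Num.sqrt K%:R)^-1 * ((k.+1%:R ^+ l.+1 - k%:R ^+ l.+1) / (l.+1%:R * K%:R ^+ l)).

Lemma cellE_cellc : cellE D K = \matrix_(k < K, l < D) cellc k l.
Proof. by apply/matrixP => k l; rewrite !mxE. Qed.

Let dv_pow (m n : nat) (t : R) :
  dv (fun t : R => (M%:R * t - m%:R) ^+ n.+1) t (n.+1%:R * M%:R * (M%:R * t - m%:R) ^+ n).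
Proof.
have da : dv (fun t : R => M%:R * t - m%:R) t M%:R.
  by apply: (dv_eq (dvD (dvZ M%:R (dv_id t)) (dv_cst (- m%:R) t))); rewrite addr0 mulr1.
elim: n => [|n IH]; first by rewrite expr0 mul1r mulr1.
under eq_fun do rewrite exprS; apply: (dv_eq (dvM da IH)).
by rewrite -[n.+2%:R]natr1 !exprS; ring.
Qed.

Lemma cpoly_continuous c m : continuous (cpoly c m).
Proof.
move=> t; pose d l : R := if l is n.+1 then n.+1%:R * M%:R * (M%:R * t - m%:R) ^+ n else 0.
apply: (@dv_continuous _ _ _ (\sum_(l < D) c m l * d l)); apply: dv_sum => l _; apply: dvZ.
by case: (l : nat) => [|n] /=; [exact: dv_cst|exact: dv_pow].
Qed.

Let cell_lt j : (j < N)%N -> (j %/ K < M)%N.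
Proof. by move=> jN; rewrite ltn_divLR. Qed.

Let subcell j (t : R) : (j < N)%N -> gpt N j < t < gpt N j.+1 ->
  gpt M (j %/ K)%N < t < gpt M (j %/ K).+1.
Proof.
move=> jN /andP[t1 t2]; apply/andP; split.
  apply: le_lt_trans t1; rewrite /gpt ler_pdivrMr ?ltr0n// mulrAC ler_pdivlMr ?ltr0n//.
  by rewrite -!natrM ler_nat /N mulnCA mulnC leq_mul2r leq_divM orbT.
apply: lt_le_trans t2 _; rewrite /gpt ler_pdivrMr ?ltr0n// mulrAC ler_pdivlMr ?ltr0n//.
by rewrite -!natrM ler_nat /N mulnCA [leqLHS]mulnC leq_mul2l ltn_ceil// orbT.
Qed.

Lemma pwc_oo f c j : pwc f c -> (j < N)%N -> oo_eq (gpt N j) (gpt N j.+1) f (cpoly c (j %/ K)).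
Proof. by move=> fc jN t tj; apply: (fc _ (cell_lt jN)); exact: subcell. Qed.

Lemma pwc_pcont f c : pwc f c -> pcont N f.
Proof.
by move=> fc j jN; exists (cpoly c (j %/ K)); [exact: cpoly_continuous|exact: pwc_oo].
Qed.

(** In the local variable [M * t - m] the site is [[k / K, (k + 1) / K]], so the integrals of
    monomials over it are, up to normalisation, the entries of [cellE]. *)
Lemma pwc_sint f c j : pwc f c -> (j < N)%N ->
  sint N j f = Num.sqrt K%:R / N%:R * \sum_(l < D) cellc (j %% K) l * c (j %/ K)%N l.
Proof.
move=> fc jN; set m := (j %/ K)%N; set k := (j %% K)%N.
pose G (t : R) := \sum_(l < D) c m l / (l.+1%:R * M%:R) * (M%:R * t - m%:R) ^+ l.+1.
have dG t : dv G t (cpoly c m t).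
  apply: dv_sum => l _; apply: (dv_eq (dvZ _ (dv_pow m l t))).
  by rewrite mulrA; congr (_ * _); field; rewrite nat1r !gt_eqF// ltr0n.
rewrite (sint_ftc N_gt0 jN (@cpoly_continuous c m) (pwc_oo fc jN) dG).
have E (i : nat) : M%:R * gpt N (m * K + i) - m%:R = i%:R / K%:R :> R.
  rewrite /gpt /N natrD !natrM; field; by rewrite !gt_eqF.
have ej : j = (m * K + k)%N by exact: divn_eq.
rewrite /G {1 2}ej -addnS !E -sumrB mulr_sumr; apply: eq_bigr => l _.
rewrite /cellc /N natrM !expr_div_n !exprS.
have s0 : Num.sqrt K%:R != 0 :> R by rewrite gt_eqF// sqrtr_gt0.
have s1 : Num.sqrt K%:R * (Num.sqrt K%:R)^-1 = 1 :> R by rewrite divff.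
have kl : K%:R ^+ l != 0 :> R by rewrite expf_neq0// gt_eqF.
move: (Num.sqrt K%:R) (K%:R ^+ l) (k%:R ^+ l) (k.+1%:R ^+ l) s0 kl => s Kl kl k1l s0 Kl0.
field; by rewrite s0 Kl0 nat1r !gt_eqF// ltr0n.
Qed.

(** By Jensen on each site the squared norm dominates that of the site averages, and these control
    the coefficients through [cellE_gram]. The constant depends on [D] only. *)
Lemma pwc_l2_ge f c : ((D + 6) * D <= K)%N -> pwc f c ->
  (frob_max D)^-1 * \sum_(m < M) \sum_(l < D) c m l ^+ 2 <= M%:R * l2ip f f.
Proof.
move=> DK fc; have pf := pwc_pcont fc; rewrite (l2ipE N_gt0 pf pf).
pose xi m : 'rV[R]_D := \row_l c m l.
pose S j := \sum_(l < D) cellc (j %% K)%N l * c (j %/ K)%N l.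
apply: (@le_trans _ _ (\sum_(j < N) S j ^+ 2)).
  rewrite (@sum_divmod R M K (fun m k => (\sum_(l < D) cellc k l * c m l) ^+ 2) K_gt0) mulr_sumr.
  apply: ler_sum => m _; have := cellE_gram (xi m) D_gt0 DK.
  have -> : sqn (xi m) = \sum_(l < D) c m l ^+ 2 by apply: eq_bigr => l _; rewrite mxE.
  move=> H; apply: le_trans H _; rewrite le_eqVlt; apply/orP; left; apply/eqP.
  apply: eq_bigr => k _; congr (_ ^+ 2); apply: eq_bigr => l _.
  by rewrite cellE_cellc !mxE.
rewrite mulr_sumr; apply: ler_sum => j _.
apply: le_trans (ler_wpM2l (ltW M0) (sint_sqr_ge N_gt0 (ltn_ord j) pf)).
rewrite (pwc_sint fc (ltn_ord j)) -/(S j) exprMn expr_div_n sqr_sqrtr ?ler0n// /N natrM.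
rewrite le_eqVlt; apply/orP; left; apply/eqP; field; by rewrite !gt_eqF.
Qed.

(** The local variable lies in [[0, 1]], so Cauchy-Schwarz bounds the square of each polynomial
    piece pointwise by [D] times the sum of its squared coefficients. *)
Lemma pwc_l2_le f c : pwc f c ->
  M%:R * l2ip f f <= D%:R * \sum_(m < M) \sum_(l < D) c m l ^+ 2.
Proof.
move=> fc; have pf := pwc_pcont fc; rewrite (l2ipE N_gt0 pf pf).
have N0 : 0 < N%:R :> R by rewrite ltr0n.
pose S m := \sum_(l < D) c m l ^+ 2.
apply: (@le_trans _ _ (M%:R * \sum_(j < N) D%:R * S (j %/ K)%N / N%:R)).
  rewrite ler_wpM2l ?ler0n//; apply: ler_sum => j _; rewrite -(sint_cst N_gt0 _ (ltn_ord j)).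
  apply: (sint_le N_gt0 (ltn_ord j)); [exact: pcontM|exact: pcont_cst|move=> t tj].
  rewrite (pwc_oo fc (ltn_ord j) tj) -expr2 /cpoly.
  have /andP[s1 s2] := subcell (ltn_ord j) tj; set m := (j %/ K)%N in s1 s2 *.
  have s01 : 0 <= M%:R * t - m%:R <= 1.
    move: s1 s2; rewrite /gpt ltr_pdivrMr// ltr_pdivlMr// [t * _]mulrC => /ltW s1 /ltW s2.
    by rewrite subr_ge0 s1/= lerBlDl -[1]/(1%:R) -natrD addn1.
  apply: le_trans (sum_CauchySchwarz (fun l : 'I_D => c m l) (fun l : 'I_D => (M%:R * t - m%:R) ^+ l)) _.
  rewrite mulrC ler_wpM2r ?sumr_ge0//; first by move=> l _; exact: sqr_ge0.
  apply: (@le_trans _ _ (\sum_(l < D) (1 : R))); last by rewrite sumr_const card_ord.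
  apply: ler_sum => l _.
  by move/andP: s01 => [a0 a1]; rewrite -exprM exprn_ile1.
rewrite (@sum_divmod R M K (fun m _ => D%:R * S m / N%:R) K_gt0) !mulr_sumr.
apply: ler_sum => m _; rewrite sumr_const card_ord -[X in _ * X <= _]mulr_natl /N natrM.
rewrite le_eqVlt; apply/orP; left; apply/eqP; rewrite -/(S m); field; by rewrite !gt_eqF.
Qed.

End piecewise_polynomial.

(** * The spline space and its orthonormal bases *)

Section spline_space.
Context {R : realType}.
Variables (L M : nat).
Hypothesis M_gt0 : (0 < M)%N.
Let D := L.+1.
Let Y := @spline R L M.
Implicit Types f g h : R -> R.

Let M0 : 0 < M%:R :> R. Proof. by rewrite ltr0n. Qed.

Lemma derive1n_lin k f g (c : R) : continuously_differentiable k f ->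
  continuously_differentiable k g -> forall i, (i <= k)%N ->
  ((fun t => c * f t + g t)^`(i))%classic = (fun t => c * (f^`(i))%classic t + (g^`(i))%classic t).
Proof.
move=> [df _] [dg _]; elim=> [|i IH] ik //.
rewrite !derive1nS IH; last exact: ltnW.
apply/funext => t; rewrite !derive1E.
have h1 : dv (f^`(i))%classic t ('D_1 (f^`(i))%classic t) by apply: DeriveDef => //; exact: df.
have h2 : dv (g^`(i))%classic t ('D_1 (g^`(i))%classic t) by apply: DeriveDef => //; exact: dg.
by have [_ ->] := dvD (dvZ c h1) h2.
Qed.

Lemma continuously_differentiable_lin k f g (c : R) : continuously_differentiable k f ->
  continuously_differentiable k g -> continuously_differentiable k (fun t => c * f t + g t).
Proof.
move=> cf cg; have E := derive1n_lin c cf cg; have [df cf'] := cf; have [dg cg'] := cg.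
split=> [i ik t|]; last first.
  by rewrite E// => t; apply: cvgD; [apply: cvgM; [exact: cvg_cst|exact: cf']|exact: cg'].
rewrite E; last exact: ltnW.
have h1 : dv (f^`(i))%classic t ('D_1 (f^`(i))%classic t) by apply: DeriveDef => //; exact: df.
have h2 : dv (g^`(i))%classic t ('D_1 (g^`(i))%classic t) by apply: DeriveDef => //; exact: dg.
by have [] := dvD (dvZ c h1) h2.
Qed.

Lemma spline_lin f g (c : R) : Y f -> Y g -> Y (fun t => c * f t + g t).
Proof.
rewrite /Y /spline /=; case: L => [|L'] [pf Hf] [pg Hg]; (split; first by move=> t; rewrite pf pg).
  move=> m mM; have [a Ha] := Hf m mM; have [b Hb] := Hg m mM.
  by exists (c * a + b) => t tm; rewrite Ha// Hb.
split; first exact: continuously_differentiable_lin Hf.1 Hg.1.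
move=> m mM; have [p sp Hp] := Hf.2 m mM; have [q sq Hq] := Hg.2 m mM.
exists (c *: p + q); last by move=> t tm; rewrite Hp// Hq// hornerD hornerZ.
apply: leq_trans (size_polyD _ _) _; rewrite geq_max sq andbT.
exact: leq_trans (size_scale_leq _ _) sp.
Qed.

Lemma spline0 : Y (fun=> 0).
Proof.
have dn n : ((fun=> 0 : R)^`(n))%classic = (fun=> 0) :> (R -> R).
  by elim: n => // n IH; rewrite derive1nS IH; apply/funext => t; rewrite derive1_cst.
rewrite /Y /spline /=; case: L => [|L']; split=> //; first by move=> m _; exists 0.
split; first by split=> [i _ t|]; rewrite dn//; move=> t; exact: cvg_cst.
by move=> m _; exists 0 => [|t _]; rewrite ?size_poly0 ?horner0.
Qed.

Lemma spline_pwc f : Y f -> exists c, pwc M D f c.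
Proof.
have gE m (t : R) : gpt M m < t < gpt M m.+1 -> m%:R / M%:R < t < m.+1%:R / M%:R by [].
rewrite /Y /spline /pwc /cpoly /D /=; case: L => [|L'] [pf Hf].
  have /choice[a Ha] : forall m, exists a : R, (m < M)%N -> forall t : R,
      m%:R / M%:R <= t < m.+1%:R / M%:R -> f t = a.
    move=> m; have [mM|_] := boolP (m < M)%N; last by exists 0.
    by have [a Ha] := Hf m mM; exists a.
  exists (fun m _ => a m) => m mM t /gE/andP[t1 t2].
  by rewrite big_ord1 expr0 mulr1; apply: Ha => //; rewrite ltW.
have /choice[p Hp] : forall m, exists p : {poly R}, (m < M)%N -> (size p <= L'.+2)%N /\
    forall t : R, m%:R / M%:R < t < m.+1%:R / M%:R -> f t = p.[t].
  move=> m; have [mM|_] := boolP (m < M)%N; last by exists 0.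
  by have [a sa Ha] := Hf.2 m mM; exists a.
pose q m : {poly R} := p m \Po (M%:R^-1 *: ('X + (m%:R)%:P)).
exists (fun m l => (q m)`_l) => m mM t tm; have [sp ->] := Hp m mM; last exact: gE.
have sq : (size (q m) <= L'.+2)%N.
  apply: leq_trans (size_comp_poly_leq _ _) _.
  rewrite size_scale ?size_XaddC ?muln1; last by rewrite invr_eq0 gt_eqF.
  by case: (size (p m)) sp.
rewrite -horner_coef_wide// /q horner_comp hornerZ hornerD hornerX hornerC subrK.
by rewrite mulrA mulVf ?mul1r// gt_eqF.
Qed.

Lemma spline_continuous f : (0 < L)%N -> Y f -> continuous f.
Proof.
rewrite /Y /spline /=; case: L => // L' _ [_ [[df cf] _]]; case: L' df cf => [//|L''] df _ t.
have h1 : dv f t ('D_1 f t) by apply: DeriveDef => //; exact: (df 0%N).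
exact: dv_continuous h1.
Qed.

(** Values at the nodes are recovered from the half-open cells for [L = 0] and by continuity
    otherwise; periodicity extends the result from one period. *)
Lemma spline_eq0 f : Y f ->
  (forall m, (m < M)%N -> oo_eq (gpt M m) (gpt M m.+1) f (fun=> 0)) -> f = (fun=> 0).
Proof.
move=> Yf f0.
have H m t : (m < M)%N -> gpt M m <= t < gpt M m.+1 -> f t = 0.
  move=> mM /andP[t1 t2]; have [L0|L0] := posnP L.
    move: Yf; rewrite /Y /spline /= L0 => -[_ Hf]; have [a Ha] := Hf m mM.
    have gS := @gptS R M M_gt0 m; pose s := (gpt M m + gpt M m.+1) / 2 : R.
    rewrite Ha; last by rewrite t1.
    rewrite -(Ha s); last by apply/andP; split; rewrite /s -/(gpt M m) -/(gpt M m.+1); lra.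
    by apply: (f0 m mM); rewrite /s; apply/andP; split; lra.
  have cf := spline_continuous L0 Yf.
  apply: contrapT => /eqP ft; have ftp : 0 < `|f t| by rewrite normr_gt0.
  have /cvgrPdist_lt/(_ _ ftp)[e /= e0 He] := cf t.
  pose s := t + Num.min e (gpt M m.+1 - t) / 2.
  have mp : 0 < Num.min e (gpt M m.+1 - t) by rewrite lt_min e0 subr_gt0.
  have m1 : Num.min e (gpt M m.+1 - t) <= e by rewrite ge_min lexx.
  have m2 : Num.min e (gpt M m.+1 - t) <= gpt M m.+1 - t by rewrite ge_min lexx orbT.
  have fs : f s = 0 by apply: (f0 m mM); rewrite /s; apply/andP; split; lra.
  have : ball t e s.
    rewrite -ball_normE /= /s opprD addNKr normrN ger0_norm; lra.
  by move=> /He; rewrite fs subr0 ltxx.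
have H01 t : 0 <= t < 1 -> f t = 0.
  move=> /andP[t0 t1]; have q0 : 0 <= M%:R * t by rewrite mulr_ge0.
  have /andP[k1 k2] := truncn_itv q0; apply: (H (Num.truncn (M%:R * t))).
    rewrite -(ltr_nat R); apply: le_lt_trans k1 _; by rewrite gtr_pMr.
  by rewrite /gpt ler_pdivrMr// ltr_pdivlMr// [t * _]mulrC k1.
have pf : periodic f 1 by case: Yf.
apply/funext => t; have /andP[t1 t2] := floor_itv t; pose s := t - (Num.floor t)%:~R.
have s01 : 0 <= s < 1.
  by rewrite /s subr_ge0 t1/= ltrBlDl; move: t2; rewrite intrD.
have tE : t = s + (Num.floor t)%:~R by rewrite subrK.
case: (Num.floor t) tE => n tE.
  by rewrite tE -[_%:~R]/(n%:R) (periodicn pf); exact: H01.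
have sE : s = t + 1 *+ n.+1 by rewrite tE NegzE mulrNz addrNK.
by rewrite -(periodicn pf n.+1 t) -sE; exact: H01.
Qed.

(** An auxiliary number of sites per cell, the least that [pwc_l2_ge] admits; the facts about the
    inner product proved with it do not depend on it. *)
Let K1 := ((D + 6) * D)%N.
Let K1_gt0 : (0 < K1)%N. Proof. by []. Qed.
Let N1 := (M * K1)%N.
Let N1_gt0 : (0 < N1)%N. Proof. by rewrite muln_gt0 M_gt0. Qed.

Lemma spline_pcont K f : (0 < K)%N -> Y f -> pcont (M * K) f.
Proof. by move=> K0 /spline_pwc[c fc]; exact: (pwc_pcont M_gt0 K0 fc). Qed.

Lemma spline_ip_lin f g h (c : R) : Y f -> Y g -> Y h ->
  l2ip (fun t => c * f t + g t) h = c * l2ip f h + l2ip g h.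
Proof. by move=> Yf Yg Yh; apply: (l2ip_lin N1_gt0); exact: spline_pcont. Qed.

Lemma spline_ip_eq0 f : Y f -> l2ip f f = 0 -> f = (fun=> 0).
Proof.
move=> Yf f0; have [c fc] := spline_pwc Yf; apply: spline_eq0 => // m mM t tm.
rewrite (fc m mM t tm); have := pwc_l2_ge M_gt0 K1_gt0 (ltn0Sn L) (leqnn K1) fc.
rewrite f0 mulr0 pmulr_rle0 ?invr_gt0 ?frob_max_gt0// => S0.
rewrite /cpoly big1// => l _.
suff -> : c m l = 0 by rewrite mul0r.
apply/eqP; rewrite -sqrf_eq0 eq_le sqr_ge0 andbT; apply: le_trans S0.
rewrite (bigD1 (Ordinal mM))//= (bigD1 l)//= -addrA lerDl addr_ge0 ?sumr_ge0// => i _.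
  exact: sqr_ge0.
by apply: sumr_ge0 => k _; exact: sqr_ge0.
Qed.

Definition lsum n (a : nat -> R) (b : nat -> R -> R) : R -> R := fun t => \sum_(i < n) a i * b i t.

Let lsumS n a b : lsum n.+1 a b = (fun t => a n * b n t + lsum n a b t).
Proof. by apply/funext => t; rewrite /lsum big_ord_recr /= addrC. Qed.

Let lsum0 a b : lsum 0 a b = (fun=> 0).
Proof. by apply/funext => t; rewrite /lsum big_ord0. Qed.

Lemma lsum_spline n a b : (forall i, (i < n)%N -> Y (b i)) -> Y (lsum n a b).
Proof.
elim: n => [|n IH] Yb; first by rewrite lsum0; exact: spline0.
by rewrite lsumS; apply: spline_lin; [exact: Yb|apply: IH => i ni; exact: Yb (ltnW _)].
Qed.

Lemma lsum_ip n a b h : (forall i, (i < n)%N -> Y (b i)) -> Y h ->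
  l2ip (lsum n a b) h = \sum_(i < n) a i * l2ip (b i) h.
Proof.
move=> + Yh; elim: n => [|n IH] Yb.
  rewrite lsum0 big_ord0 /l2ip; under eq_Rintegral do rewrite mul0r.
  by rewrite Rintegral_cst// mul0r.
have Yb' i : (i < n)%N -> Y (b i) by move=> ni; exact: Yb (ltnW _).
by rewrite lsumS spline_ip_lin ?IH ?big_ord_recr 1?addrC//; [exact: Yb|exact: lsum_spline].
Qed.

Lemma pwc_lsum n a b c : (forall i, (i < n)%N -> pwc M D (b i) (c i)) ->
  pwc M D (lsum n a b) (fun m l => \sum_(i < n) a i * c i m l).
Proof.
move=> bc m mM t tm; rewrite /lsum /cpoly.
under [RHS]eq_bigr do rewrite mulr_suml; rewrite exchange_big /=; apply: eq_bigr => i _.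
rewrite (bc i (ltn_ord i) m mM t tm) /cpoly mulr_sumr.
by apply: eq_bigr => l _; rewrite mulrA.
Qed.

Definition ortho_splines n (b : nat -> R -> R) :=
  (forall i, (i < n)%N -> Y (b i)) /\
  forall i j, (i < n)%N -> (j < n)%N -> l2ip (b i) (b j) = (i == j)%:R.

Lemma lsum_ip_ortho n a b j : ortho_splines n b -> (j < n)%N ->
  l2ip (lsum n a b) (b j) = a j.
Proof.
move=> [Yb ob] jn; rewrite lsum_ip//; last exact: Yb.
rewrite (bigD1 (Ordinal jn))//= ob// eqxx mulr1 big1 ?addr0// => i ij.
by rewrite ob// (_ : _ == _ = false) ?mulr0//; apply/negbTE.
Qed.

Let coefs n (b : nat -> R -> R) : (forall i, (i < n)%N -> Y (b i)) ->
  exists c, forall i, (i < n)%N -> pwc M D (b i) (c i).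
Proof.
move=> Yb; suff /choice[c Hc] : forall i, exists c, (i < n)%N -> pwc M D (b i) c by exists c.
move=> i; have [ni|_] := boolP (i < n)%N; last by exists (fun _ _ => 0).
by have [c] := spline_pwc (Yb i ni); exists c.
Qed.

(** The coefficient rows of an orthonormal family are independent, because a vanishing combination
    of them is a spline vanishing inside every cell. *)
Let ortho_le n b : ortho_splines n b -> (n <= M * D)%N.
Proof.
move=> ob; have [c bc] := coefs ob.1.
pose X : 'M[R]_(n, M * D) := \matrix_(i, r) c i (r %/ D)%N (r %% D)%N.
suff <- : \rank X = n by exact: rank_leq_col.
apply/eqP; rewrite -/(row_free X) -kermx_eq0; apply/rowV0P => v /sub_kermxP vX.
pose a i := if insub i is Some j then v 0 j else 0.
have aE (i : 'I_n) : a i = v 0 i by rewrite /a valK.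
have s0 : lsum n a b = (fun=> 0).
  apply: spline_eq0; first exact: lsum_spline ob.1.
  move=> m mM t tm; rewrite (pwc_lsum a bc mM tm) /cpoly big1// => l _.
  suff -> : \sum_(i < n) a i * c i m l = 0 by rewrite mul0r.
  have rM : (m * D + l < M * D)%N.
    by apply: (@leq_trans (m.+1 * D)); [rewrite mulSn addnC ltn_add2r|rewrite leq_mul2r mM orbT].
  have := congr1 (fun Z : 'rV_(M * D) => Z 0 (Ordinal rM)) vX; rewrite /= !mxE => e; rewrite -[RHS]e.
  apply: eq_bigr => i _; rewrite mxE aE /=.
  by rewrite divnMDl// divn_small// addn0 modnMDl modn_small.
apply/rowP => j; rewrite [RHS]mxE -aE -(lsum_ip_ortho a ob (ltn_ord j)) s0.
rewrite /l2ip; under eq_Rintegral do rewrite mul0r.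
by rewrite Rintegral_cst// mul0r.
Qed.

(** A maximal orthonormal family, which exists by [ortho_le], spans: the normalised residual of a
    spline outside its span would extend it. The dimension of the spline space need not be
    computed. *)
Lemma orthonormal_basis : exists d b c, [/\ ortho_splines d b,
  forall i, (i < d)%N -> pwc M D (b i) (c i) &
  forall y, Y y -> y = lsum d (fun i => l2ip y (b i)) b].
Proof.
pose P n := `[< exists b, ortho_splines n b >].
have P0 : exists n, P n by exists 0%N; apply/asboolP; exists (fun _ _ => 0).
have PM n : P n -> (n <= M * D)%N by move=> /asboolP[b /ortho_le].
have [d /asboolP[b ob] dmax] := ex_maxnP P0 PM.
have [c bc] := coefs ob.1; exists d, b, c; split=> // y Yy.
pose y1 := lsum d (fun i => l2ip y (b i)) b.
have Yy1 : Y y1 by exact: lsum_spline ob.1.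
pose z : R -> R := fun t => -1 * y1 t + y t; have Yz : Y z by exact: spline_lin.
have zb i : (i < d)%N -> l2ip z (b i) = 0.
  move=> id; rewrite spline_ip_lin//; last exact: ob.1.
  by rewrite (lsum_ip_ortho _ ob id) mulN1r addNr.
have [z0|zn] := eqVneq (l2ip z z) 0.
  have := spline_ip_eq0 Yz z0 => e; apply/funext => t.
  have := congr1 (fun f : R -> R => f t) e; rewrite /z /= mulN1r addrC => /eqP.
  by rewrite subr_eq0 => /eqP.
have zp : 0 < l2ip z z by rewrite lt_neqAle eq_sym zn l2ip_ge0.
pose s := (Num.sqrt (l2ip z z))^-1.
pose w : R -> R := fun t => s * z t + 0.
have Yw : Y w by apply: spline_lin => //; exact: spline0.
have wh h : Y h -> l2ip w h = s * l2ip z h.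
  move=> Yh; rewrite spline_ip_lin//; last exact: spline0.
  rewrite (_ : l2ip (fun=> 0) h = 0) ?addr0//.
  rewrite /l2ip; under eq_Rintegral do rewrite mul0r.
  by rewrite Rintegral_cst// mul0r.
have ww : l2ip w w = 1.
  rewrite wh// l2ipC wh// mulrA -expr2 exprVn sqr_sqrtr ?(ltW zp)// mulVf//.
pose b' i := if (i < d)%N then b i else w.
have ob' : ortho_splines d.+1 b'.
  split=> [i _|i j]; first by rewrite /b'; case: ifPn => // id; exact: ob.1.
  rewrite !ltnS /b' => id jd; case: ifPn => [id'|id']; case: ifPn => [jd'|jd'].
  - exact: ob.2.
  - rewrite l2ipC wh; last exact: ob.1.
    rewrite zb// mulr0 (_ : (i == j) = false)//; apply/negbTE; rewrite neq_ltn.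
    by rewrite (leq_trans id')// leqNgt.
  - rewrite wh; last exact: ob.1.
    rewrite zb// mulr0 (_ : (i == j) = false)//; apply/negbTE; rewrite neq_ltn.
    by rewrite (leq_trans jd') ?orbT// leqNgt.
  - rewrite ww; have -> : i = d by apply/eqP; rewrite eqn_leq id leqNgt.
    have -> : j = d by apply/eqP; rewrite eqn_leq jd leqNgt.
    by rewrite eqxx.
have /dmax : P d.+1 by apply/asboolP; exists b'.
by rewrite ltnn.
Qed.

End spline_space.

(** * Projection of step functions onto splines *)

Section step_projection.
Context {R : realType}.
Variables (L M K : nat).
Hypothesis M_gt0 : (0 < M)%N.
Hypothesis K_gt0 : (0 < K)%N.
Let D := L.+1.
Let N := (M * K)%N.
Let N_gt0 : (0 < N)%N. Proof. by rewrite muln_gt0 M_gt0. Qed.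
Let Y := @spline R L M.
Variables (d : nat) (b : nat -> R -> R) (c : nat -> nat -> nat -> R).
Hypothesis ob : ortho_splines L M d b.
Hypothesis bc : forall i, (i < d)%N -> pwc M D (b i) (c i).
Hypothesis b_span : forall y, Y y -> y = lsum d (fun i => l2ip y (b i)) b.

Definition spline_basis (i : 'I_d) : R -> R := b i.

Definition spline_coef : 'M[R]_(M * D, d) := \matrix_(r, i) c i (r %/ D)%N (r %% D)%N.

Definition step_moment : 'M[R]_(M * K, d) := \matrix_(j, i) sint N j (b i).

(** The coordinates of the projection factor through the moments of the cells; this allows the fiber
    to be treated cell by cell. *)
Lemma step_momentE :
  step_moment = (Num.sqrt K%:R / N%:R) *: (bd M (cellE D K) *m spline_coef).
Proof.
apply/matrixP => j i; rewrite [LHS]mxE [RHS]mxE (pwc_sint M_gt0 K_gt0 (bc (ltn_ord i)) (ltn_ord j)).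
congr (_ * _); rewrite [RHS]mxE cellE_cellc.
under [RHS]eq_bigr => r _ do rewrite bd_entry// mxE.
have jM : (j %/ K < M)%N by rewrite ltn_divLR.
pose F m l := (if (j %/ K == m)%N then cellc K (j %% K) l else 0) * c i m l.
rewrite (@sum_divmod R M D F)// (bigD1 (Ordinal jM))//= [X in _ = _ + X]big1 ?addr0 /F.
  by apply: eq_bigr => l _; rewrite eqxx.
move=> m mj; rewrite big1// => l _; rewrite ifN ?mul0r//.
by apply: contra mj => /eqP e; apply/eqP/val_inj.
Qed.

Let nsum (z : 'rV[R]_d) : lcomb spline_basis z = lsum d (fun i => if insub i is Some j then z 0 j else 0) b.
Proof. by apply/funext => t; apply: eq_bigr => i _; rewrite valK. Qed.

Lemma lcomb_spline z : Y (lcomb spline_basis z).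
Proof. by rewrite nsum; apply: lsum_spline ob.1. Qed.

Lemma spline_lcomb y : Y y -> exists z, y = lcomb spline_basis z.
Proof.
move=> Yy; exists (\row_i l2ip y (b i)); rewrite {1}(b_span Yy).
by apply/funext => t; apply: eq_bigr => i _; rewrite mxE.
Qed.

Lemma lcomb_basis_ip z (i : 'I_d) : l2ip (lcomb spline_basis z) (b i) = z 0 i.
Proof. by rewrite nsum (lsum_ip_ortho M_gt0 _ ob (ltn_ord i)) valK. Qed.

Lemma lcomb_ip z w : l2ip (lcomb spline_basis z) (lcomb spline_basis w) = \sum_i z 0 i * w 0 i.
Proof.
rewrite nsum (lsum_ip M_gt0 _ ob.1 (lcomb_spline w)); apply: eq_bigr => i _.
by rewrite valK l2ipC lcomb_basis_ip.
Qed.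

Let sqn_coef v : sqn (v *m spline_coef^T) =
  \sum_(m < M) \sum_(l < D) (\sum_(i < d) v 0 i * c i m l) ^+ 2.
Proof.
rewrite -(@sum_divmod R M D (fun m l => (\sum_(i < d) v 0 i * c i m l) ^+ 2))//.
apply: eq_bigr => r _; congr (_ ^+ 2); rewrite mxE; apply: eq_bigr => i _.
by rewrite !mxE.
Qed.

Let sqn_lcomb v : l2ip (lcomb spline_basis v) (lcomb spline_basis v) = sqn v.
Proof. by rewrite lcomb_ip; apply: eq_bigr => i _; rewrite expr2. Qed.

Let lcomb_pwc v : pwc M D (lcomb spline_basis v) (fun m l => \sum_(i < d) v 0 i * c i m l).
Proof.
rewrite nsum; have := pwc_lsum (fun i => if insub i is Some j then v 0 j else 0) bc.
congr pwc; apply/funext => m; apply/funext => l.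
by apply: eq_bigr => i _; rewrite valK.
Qed.

Lemma spline_coef_le v : ((D + 6) * D <= K)%N ->
  sqn (v *m spline_coef^T) <= frob_max D * M%:R * sqn v.
Proof.
move=> DK; have := pwc_l2_ge M_gt0 K_gt0 (ltn0Sn L) DK (lcomb_pwc v).
by rewrite -sqn_coef sqn_lcomb ler_pdivrMl ?frob_max_gt0// mulrA.
Qed.

Lemma spline_coef_ge v : M%:R * sqn v <= D%:R * sqn (v *m spline_coef^T).
Proof. by rewrite sqn_coef -sqn_lcomb; exact: (pwc_l2_le M_gt0 K_gt0 (lcomb_pwc v)). Qed.

Let step_oo (x : 'rV[R]_N) (j : 'I_N) :
  oo_eq (gpt N j) (gpt N j.+1) (step_function x) (fun=> x 0 j).
Proof.
move=> t /andP[t1 t2]; have N0 : 0 < N%:R :> R by rewrite ltr0n.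
have g0 : 0 <= gpt N j :> R by rewrite /gpt divr_ge0.
have g1 : gpt N j.+1 <= 1 :> R by rewrite /gpt ler_pdivrMr// mul1r ler_nat.
have f0 : Num.floor t = 0.
  by apply: floor_def; rewrite (le_trans g0 (ltW t1))/= add0r (lt_le_trans t2).
rewrite /step_function f0 subr0 (bigD1 j)//= big1 ?addr0.
  by rewrite indicE mem_set ?mulr1//= in_itv /= (ltW t1) t2.
move=> i ij; rewrite indicE memNset ?mulr0//= in_itv /= => /andP[h1 h2].
have ltn_of (p q : nat) : gpt N p < gpt N q :> R -> (p < q)%N.
  by rewrite /gpt ltr_pM2r ?invr_gt0// ltr_nat.
have a1 := ltn_of _ _ (le_lt_trans h1 t2); have a2 := ltn_of _ _ (lt_trans t1 h2).
by move/eqP: ij; apply; apply/val_inj/anti_leq/andP; split; rewrite -ltnS.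
Qed.

Let step_pcont (x : 'rV[R]_N) : pcont N (step_function x).
Proof.
move=> j jN; exists (fun=> x 0 (Ordinal jN)); first by move=> t; exact: cvg_cst.
by move=> t; apply: (@step_oo x (Ordinal jN)).
Qed.

Let Y_pcont y : Y y -> pcont N y. Proof. by move=> Yy; apply: spline_pcont Yy. Qed.

Let step_ip (x : 'rV[R]_N) (i : 'I_d) : l2ip (step_function x) (b i) = (x *m step_moment) 0 i.
Proof.
have pb := Y_pcont (ob.1 i (ltn_ord i)).
rewrite (l2ipE N_gt0 (step_pcont x) pb) mxE; apply: eq_bigr => j _; rewrite mxE.
have p0 : pcont N (fun=> 0 : R) by exact: pcont_cst.
transitivity (sint N j (fun t => x 0 j * b i t + 0)).
  apply: (sint_eq N_gt0 (ltn_ord j)); first exact: pcont_lin.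
  by move=> t tj; rewrite (step_oo x tj) addr0.
by rewrite (sint_lin N_gt0 _ (ltn_ord j))// sint_cst// mul0r addr0.
Qed.

Lemma orth_proj_step (x : 'rV[R]_N) :
  orth_proj Y (step_function x) = lcomb spline_basis (x *m step_moment).
Proof.
set y0 := lcomb _ _; have Yy0 : Y y0 by exact: lcomb_spline.
have subE y z : Y y -> Y z -> l2ip (step_function x \- y) z = l2ip (step_function x) z - l2ip y z.
  move=> Yy Yz; have -> : step_function x \- y = (fun t => -1 * y t + step_function x t).
    by apply/funext => t; rewrite mulN1r addrC.
  by rewrite (l2ip_lin N_gt0 _ (Y_pcont Yy) (step_pcont x) (Y_pcont Yz)) mulN1r addrC.
(* [xget] returns the projection once it is unique: the difference of two candidates is a spline
   orthogonal to itself. *)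
apply: xget_subset1; last first.
  move=> y y' [Yy Hy] [Yy' Hy']; pose z : R -> R := fun t => -1 * y' t + y t.
  have Yz : Y z by exact: spline_lin.
  have z0 : l2ip z z = 0.
    rewrite {1}/z (spline_ip_lin M_gt0 _ Yy' Yy Yz).
    by have := Hy z Yz; have := Hy' z Yz; rewrite !subE//; lra.
  apply/funext => t; have := congr1 (fun f : R -> R => f t) (spline_ip_eq0 M_gt0 Yz z0).
  by rewrite /z /= mulN1r addrC => /eqP; rewrite subr_eq0 => /eqP.
split=> // z Yz; rewrite subE// (b_span Yz) ![l2ip _ (lsum _ _ _)]l2ipC.
have zb' f n : pcont N f -> (n <= d)%N ->
    l2ip (lsum n (fun i => l2ip z (b i)) b) f = \sum_(i < n) l2ip z (b i) * l2ip (b i) f.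
  move=> pf; elim: n => [|n IH] nd.
    rewrite big_ord0 /lsum /l2ip; under eq_Rintegral do rewrite big_ord0 mul0r.
    by rewrite Rintegral_cst// mul0r.
  rewrite big_ord_recr /= -IH; last exact: ltnW.
  rewrite addrC -(l2ip_lin N_gt0)//; [|exact: Y_pcont (ob.1 n nd)|].
    by congr l2ip; apply/funext => t; rewrite /lsum big_ord_recr /= addrC.
  by apply/Y_pcont/lsum_spline => i ni; apply: ob.1; exact: ltn_trans ni nd.
have zb f pf := zb' f d pf (leqnn d).
rewrite (zb _ (step_pcont x)) (zb _ (Y_pcont Yy0)).
rewrite -sumrB big1// => i _; rewrite -mulrBr ![l2ip (b i) _]l2ipC step_ip lcomb_basis_ip.
by rewrite subrr mulr0.
Qed.

Lemma lcomb_basis_inj z w : lcomb spline_basis z = lcomb spline_basis w -> z = w.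
Proof. by move=> e; apply/rowP => i; rewrite -lcomb_basis_ip e lcomb_basis_ip. Qed.

End step_projection.

(** * The coarse-grained Hamiltonian *)

Lemma bd_gram {R : realType} (p n M : nat) (A : 'M[R]_(p, n)) (g : R) :
  (forall v : 'rV[R]_n, g * sqn v <= sqn (v *m A^T)) ->
  forall v : 'rV[R]_(M * n), g * sqn v <= sqn (v *m (bd M A)^T).
Proof.
move=> gA; elim: M => [|M IH] v; first by rewrite /sqn !big_ord0 mulr0.
rewrite -[v](@hsubmxK _ 1 n (M * n)); set a := lsubmx _; set b := rsubmx _.
have -> : (row_mx a b : 'rV_(n + M * n)) *m
    (block_mx A 0 0 (bd M A) : 'M[R]_(p + M * p, n + M * n))^T =
    row_mx (a *m A^T) (b *m (bd M A)^T).
  by rewrite tr_block_mx mul_row_block !trmx0 !mulmx0 addr0 add0r.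
by rewrite !sqn_row_mx mulrDr lerD.
Qed.

Lemma ln_second_ge {R : realType} (a b c k : R) : 0 < a -> 0 < b -> 0 < c ->
  a * b * expR k <= c ^+ 2 -> k <= 2 * ln c - ln a - ln b.
Proof.
move=> a0 b0 c0 H; have ab0 : 0 < a * b by exact: mulr_gt0.
have L0 : 0 < a * b * expR k by rewrite mulr_gt0// expR_gt0.
have := H; rewrite -ler_ln ?posrE ?exprn_gt0//.
by rewrite lnXn// lnM ?posrE ?expR_gt0// lnM ?posrE// expRK -mulr_natl; lra.
Qed.

Lemma ln_second_le {R : realType} (a b c k : R) : 0 < a -> 0 < b -> 0 < c ->
  c ^+ 2 <= expR k * (a * b) -> 2 * ln c - ln a - ln b <= k.
Proof.
move=> a0 b0 c0 H; have ab0 : 0 < a * b by exact: mulr_gt0.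
have L0 : 0 < expR k * (a * b) by rewrite mulr_gt0// expR_gt0.
have := H; rewrite -ler_ln ?posrE ?exprn_gt0//.
by rewrite lnXn// lnM ?posrE ?expR_gt0// lnM ?posrE// expRK -mulr_natl; lra.
Qed.

(** With [N] as a parameter, [K * M] can be replaced by [M * K], the shape in which block matrices
    have their sizes. *)
Definition coarse_free_energy {R : realType} (psi : R -> R) (L M N : nat) (y : R -> R) : R :=
  let fiber := [set x : 'rV[R]_N | orth_proj (@spline R L M) (step_function x) = y] in
  - (N%:R^-1 * ln (hausdorff_integral (affine_dim fiber) fiber
                     (fun x => expR (- hamiltonian psi x)))).

Lemma coarse_hamiltonianE {R : realType} (psi : R -> R) (L K M : nat) (y : R -> R) :
  coarse_hamiltonian psi L K M y = coarse_free_energy psi L M (M * K) y.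
Proof. by rewrite mulnC. Qed.

Section coarse_graining.
Context {R : realType}.
Variables (psi de de1 de2 : R -> R) (b0 b2 aa r : R).
Hypothesis de_dv : forall t, dv de t (de1 t).
Hypothesis de1_dv : forall t, dv de1 t (de2 t).
Hypothesis de2_cont : continuous de2.
Hypothesis de_le : forall t, `|de t| <= b0.
Hypothesis de2_le : forall t, `|de2 t| <= b2.
Hypothesis psiE : forall t, psi t = t ^+ 2 / 2 + aa * t + de t.
Variables (L M K : nat).
Let D := L.+1.
Hypothesis M_gt0 : (0 < M)%N.
Hypothesis DK : ((D + 6) * D <= K)%N.
Hypothesis r_gt0 : 0 < r.
Let E := @cellE R D K.
Let B := kerB E.
Let B' := pinvmx B.
Hypothesis cell_lc : forall y u : 'rV[R]_K,
  cell_g de aa B (y + u) * cell_g de aa B (y - u) * expR (r * sqn (u *m E)) <= cell_g de aa B y ^+ 2.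

Let Y := @spline R L M.
Let N := (M * K)%N.
Let D0 : (0 < D)%N. Proof. by []. Qed.
Let K_gt0 : (0 < K)%N. Proof. by apply: leq_trans DK; rewrite muln_gt0 addn_gt0 D0. Qed.
Let N_gt0 : (0 < N)%N. Proof. by rewrite muln_gt0 M_gt0. Qed.
Let Nr : 0 < N%:R :> R. Proof. by rewrite ltr0n. Qed.
Let Kr : 0 < K%:R :> R. Proof. by rewrite ltr0n. Qed.
Let Mr : 0 < M%:R :> R. Proof. by rewrite ltr0n. Qed.
Let Dr : 0 < D%:R :> R. Proof. by rewrite ltr0n. Qed.
Let fm : R := frob_max D.
Let fm0 : 0 < fm. Proof. exact: frob_max_gt0. Qed.
Let C := @cellA R D K 0.
Let CE : C *m E = 1%:M. Proof. by apply: cellAE => //; rewrite addn_gt0 D0. Qed.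

Section basis.
Variables (d : nat) (b : nat -> R -> R) (c : nat -> nat -> nat -> R).
Hypothesis ob : ortho_splines L M d b.
Hypothesis bc : forall i, (i < d)%N -> pwc M D (b i) (c i).
Hypothesis b_span : forall y, Y y -> y = lsum d (fun i => l2ip y (b i)) b.

Let be : 'M[R]_(M * D, d) := spline_coef L M d c.
Let Es : 'M[R]_(M * K, d) := step_moment M K d b.
Let s := Num.sqrt K%:R / N%:R : R.
Let s0 : 0 < s. Proof. by rewrite divr_gt0// sqrtr_gt0. Qed.
Let gE : 'M[R]_(M * K, d) := glE E be.
Let EsE : Es = s *: gE. Proof. exact: step_momentE. Qed.
Let gB := glB C B be.
Let gB' := glB' E C B' be.

(** The cells contribute [fm^-1], the splines [M / D] and the normalisation [s ^+ 2], where
    [s ^+ 2 * M = 1 / N]. *)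
Let Es_gram v : (fm * D%:R * N%:R)^-1 * sqn v <= sqn (v *m Es^T).
Proof.
rewrite EsE linearZ /= -scalemxAr sqnZ /gE /glE trmx_mul mulmxA.
have h1 := spline_coef_ge M_gt0 K_gt0 ob bc v.
have h2 : fm^-1 * sqn (v *m be^T) <= sqn (v *m be^T *m (bd M E)^T).
  apply: bd_gram => w; apply: le_trans (cellE_gram w D0 DK) _.
  rewrite le_eqVlt; apply/orP; left; apply/eqP; apply: eq_bigr => k _; congr (_ ^+ 2).
  by rewrite mxE; apply: eq_bigr => i _; rewrite [E^T _ _]mxE mulrC.
apply: (@le_trans _ _ (s ^+ 2 * (fm^-1 * sqn (v *m be^T)))); last by rewrite ler_wpM2l ?sqr_ge0.
apply: (@le_trans _ _ (s ^+ 2 * (fm^-1 * (D%:R^-1 * (M%:R * sqn v))))); last first.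
  by rewrite !ler_wpM2l ?sqr_ge0 ?invr_ge0 ?(ltW fm0)// ler_pdivrMl.
rewrite /s expr_div_n sqr_sqrtr ?ler0n// /N natrM le_eqVlt; apply/orP; left; apply/eqP.
by field; rewrite !gt_eqF.
Qed.

Let Tex : exists T : 'M[R]_(d, M * K), T *m Es = 1%:M /\
  forall h : 'rV[R]_d, sqn (h *m T) <= fm * D%:R * N%:R * sqn h.
Proof.
have c0 : 0 < (fm * D%:R * N%:R)^-1 by rewrite invr_gt0 (mulr_gt0 (mulr_gt0 fm0 Dr) Nr).
by have [T [TE HT]] := mx_right_inverse c0 Es_gram; exists T; split=> // h; rewrite -[X in X * _]invrK.
Qed.

Let BE := @kerBE R K D E.
Let BV := @kerBV R K D E.
Let Bker := @kerB_ker R K D E.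

Let gBE : gB *m Es = 0.
Proof. by rewrite EsE -scalemxAr (glBE CE BE) scaler0. Qed.

Let gBV : gB *m gB' = 1%:M. Proof. exact: (glBV CE BE BV). Qed.

Let c2_gt0 : 0 < fm * M%:R. Proof. exact: mulr_gt0. Qed.

Let be_le (v : 'rV[R]_d) : sqn (v *m be^T) <= fm * M%:R * sqn v.
Proof. exact: (spline_coef_le M_gt0 K_gt0 ob bc). Qed.

Section lift.
Variable T : 'M[R]_(d, M * K).
Hypothesis TE : T *m Es = 1%:M.
Hypothesis T_le : forall h : 'rV[R]_d, sqn (h *m T) <= fm * D%:R * N%:R * sqn h.

Let fiberE (q : 'rV[R]_d) : [set x : 'rV[R]_N | orth_proj Y (step_function x) = lcomb (spline_basis b) q] =
  aff gB (q *m T).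
Proof.
apply/seteqP; split=> x /=.
  rewrite (orth_proj_step M_gt0 K_gt0 ob b_span) => /(lcomb_basis_inj M_gt0 ob) xq.
  have z0 : (x - q *m T) *m gE = 0.
    apply: (scalerI (lt0r_neq0 s0)); rewrite scaler0 scalemxAr -EsE mulmxBl xq -mulmxA.
    by rewrite TE mulmx1 subrr.
  exists ((x - q *m T) *m gB').
  by rewrite (glB_ker CE Bker z0) addrC subrK.
move=> [w ->]; rewrite (orth_proj_step M_gt0 K_gt0 ob b_span); congr lcomb.
by rewrite mulmxDl -!mulmxA TE gBE mulmx1 mulmx0 addr0.
Qed.

Let F : 'rV[R]_N -> R := Pi (fun _ => site_dens de aa).

Let F_gb : gb F. Proof. by apply: gb_Pi => _; exact: (dens_gb1 aa de_dv de_le). Qed.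

Let F_ham : (fun x : 'rV[R]_N => expR (- hamiltonian psi x)) = F.
Proof.
apply/funext => x; rewrite /F /Pi /site_dens -expR_sum sumrN; congr (expR (- _)).
by apply: eq_bigr => i _; rewrite psiE.
Qed.

(** Each cell contributes at least [K - D > 0] dimensions to the fiber; [hausdorff_integral_affine]
    requires a positive one. *)
Let dim_gt0 : (0 < \rank (kermx be) + M * \rank (kermx E))%N.
Proof.
rewrite addn_gt0; apply/orP; right; rewrite muln_gt0 M_gt0 mxrank_ker subn_gt0.
apply: leq_ltn_trans (rank_leq_col _) _; apply: leq_trans DK.
by rewrite -[X in (X < _)%N]mul1n ltn_mul2r D0 addnC.
Qed.

Let energyE : exists lnc, forall q : 'rV[R]_d,
  coarse_free_energy psi L M N (lcomb (spline_basis b) q) = fib_log de aa T gB N%:R lnc q.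
Proof.
have [cB cB0 HB] := hausdorff_integral_affine gBV dim_gt0.
exists (ln cB) => q; rewrite /coarse_free_energy F_ham fiberE affine_dim_aff; last first.
  by apply/row_freeP; exists gB'.
rewrite HB// lnM ?posrE//.
by apply: J_gt0 => [|w]; [exact: (fib_gbw gBV)|apply: prodr_gt0 => k _; exact: expR_gt0].
Qed.

Let Z q := glZ de aa C B be (q *m T).

Let Z_gt0 q : 0 < Z q. Proof. exact: (glZ_gt0 aa de_dv de_le CE BE BV). Qed.

Let phiE lnc q : fib_log de aa T gB N%:R lnc q = - (N%:R^-1 * (lnc + ln (Z q))).
Proof. by []. Qed.

Let phi_second lnc z w w' (phi := fib_log de aa T gB N%:R lnc) :
  phi w + phi w' - 2 * phi z = (2 * ln (Z z) - ln (Z w) - ln (Z w')) / N%:R.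
Proof. by rewrite /phi !phiE; move: (ln (Z z)) (ln (Z w)) (ln (Z w')) => p q q'; ring. Qed.

(** As [s ^+ 2 = 1 / (M * N)], the [M] in the norm of [be], the [1 / N] of the energy and the
    normalisation of [Es] cancel: the constant is free of [K] and [M]. *)
Let second_lower lnc z u t (phi := fib_log de aa T gB N%:R lnc) :
  r / fm * sqn u * t ^+ 2 <= phi (z + t *: u) + phi (z - t *: u) - 2 * phi z.
Proof.
have := glZ_lower de_dv de_le CE BE BV Bker r_gt0 cell_lc c2_gt0 be_le (z *m T) (t *: u *m T).
rewrite -mulmxDl -mulmxBl -/(Z _) -/(Z _) -/(Z _).
have -> : sqn (t *: u *m T *m glE E be) = t ^+ 2 * sqn u / s ^+ 2.
  have -> : glE E be = s^-1 *: Es by rewrite EsE scalerA mulVf ?scale1r// gt_eqF.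
  by rewrite -scalemxAr -mulmxA TE mulmx1 !sqnZ exprVn mulrC.
move=> /(ln_second_ge (Z_gt0 _) (Z_gt0 _) (Z_gt0 _)) H.
rewrite phi_second ler_pdivlMr//; apply: le_trans H.
rewrite /s expr_div_n sqr_sqrtr ?ler0n// /N natrM le_eqVlt; apply/orP; left; apply/eqP.
by field; rewrite !gt_eqF.
Qed.

(** The factor [N] in the norm of the lift [T] is cancelled by the [1 / N] of the energy. *)
Let second_upper lnc z u t (phi := fib_log de aa T gB N%:R lnc) :
  phi (z + t *: u) + phi (z - t *: u) - 2 * phi z <= (1 + b2) * fm * D%:R * sqn u * t ^+ 2.
Proof.
have b20 : 0 <= b2 by exact: le_trans (de2_le 0).
have := glZ_upper aa de_dv de1_dv de_le de2_le CE BE BV be (z *m T) (t *: u *m T).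
rewrite -mulmxDl -mulmxBl -/(Z _) -/(Z _) -/(Z _).
move=> /(ln_second_le (Z_gt0 _) (Z_gt0 _) (Z_gt0 _)) H.
rewrite phi_second ler_pdivrMr//; apply: le_trans H _.
apply: (@le_trans _ _ ((1 + b2) * (fm * D%:R * N%:R * sqn (t *: u)))).
  by apply: ler_wpM2l; [rewrite addr_ge0|exact: T_le].
rewrite sqnZ le_eqVlt; apply/orP; left; apply/eqP.
by move: fm D%:R N%:R => fm' D' N'; ring.
Qed.

Lemma coarse_hessian_lift y : Y y ->
  exists2 A : (R -> R) -> (R -> R), is_hessian Y (coarse_free_energy psi L M N) y A &
    forall h, Y h -> r / fm * l2ip h h <= l2ip (A h) h <= (1 + b2) * fm * D%:R * l2ip h h.
Proof.
move=> Yy; have [lnc HF] := energyE; have [z ->] := spline_lcomb b_span Yy.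
have [G [H [cG cH dphi dG]]] :=
  fib_log_C2 aa de_dv de1_dv de2_cont de_le de2_le TE gBE gBV N%:R lnc.
have cY (w : 'rV[R]_d) : Y (lcomb (spline_basis b) w) := lcomb_spline ob w.
have sY w : Y w -> exists q : 'rV[R]_d, w = lcomb (spline_basis b) q by exact: (spline_lcomb b_span).
have ipb := lcomb_ip M_gt0 ob.
exists (hess_op (spline_basis b) H z).
  exact: (hessian_lcomb cY sY ipb HF cG cH dphi dG).
move=> h /sY[u ->]; apply: (hess_op_bounds ipb cH dphi dG) => t.
  exact: second_lower.
exact: second_upper.
Qed.

End lift.

Lemma coarse_hessian_basis y : Y y ->
  exists2 A : (R -> R) -> (R -> R), is_hessian Y (coarse_free_energy psi L M N) y A &
    forall h, Y h -> r / fm * l2ip h h <= l2ip (A h) h <= (1 + b2) * fm * D%:R * l2ip h h.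
Proof. by have [T [TE T_le]] := Tex; exact: coarse_hessian_lift TE T_le y. Qed.

End basis.

Lemma coarse_hessian y : Y y ->
  exists2 A : (R -> R) -> (R -> R), is_hessian Y (coarse_free_energy psi L M N) y A &
    forall h, Y h -> r / fm * l2ip h h <= l2ip (A h) h <= (1 + b2) * fm * D%:R * l2ip h h.
Proof. by have [d [b [c [ob bc sp]]]] := @orthonormal_basis R L M M_gt0; exact: (coarse_hessian_basis ob bc sp). Qed.

End coarse_graining.

Theorem theorem1p6 (R : realType) (L : nat) (psi dpsi : R -> R) (a : R)
    (dpsi_C2 : continuously_differentiable 2 dpsi)
    (dpsi_bounded : exists B : R, forall z, `|dpsi z| <= B)
    (dpsi2_bounded : exists B : R, forall z, `|(dpsi^`(2))%classic z| <= B)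
    (psiE : forall z, psi z = z ^+ 2 / 2 + a * z + dpsi z)
    (mean0 : (\int[@lebesgue_measure R]_(z in setT)
                (z * expR (- psi z))%:E = 0)%E) :
  exists lambda Lambda Kstar : R,
    [/\ 0 < lambda, 0 < Lambda, 0 < Kstar &
      forall K M : nat, Kstar <= K%:R -> (1 <= M)%N ->
      forall y : R -> R, spline L M y ->
      exists2 A : (R -> R) -> (R -> R),
        is_hessian (spline L M) (coarse_hamiltonian psi L K M) y A &
        forall h : R -> R, spline L M h ->
          2 * lambda * l2ip h h <= l2ip (A h) h <= 2 * Lambda * l2ip h h].
Proof.
have [[df cf2] [b0 de_le] [b2 de2_le]] := And3 dpsi_C2 dpsi_bounded dpsi2_bounded.
have d0 t : dv dpsi t ((dpsi^`(1))%classic t).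
  by rewrite derive1n1 derive1E; apply: DeriveDef => //; exact: (df 0%N).
have d1 t : dv (dpsi^`(1))%classic t ((dpsi^`(2))%classic t).
  have -> : (dpsi^`(2))%classic t = 'D_1 (dpsi^`(1))%classic t by rewrite -derive1E -derive1nS.
  by apply: DeriveDef => //; exact: (df 1%N).
have b20 : 0 <= b2 by exact: le_trans (de2_le 0).
(* Interpolation: by the mean value theorem the first derivative is at most [2 * b0] in absolute
   value somewhere in []t, t + 1[], and from there to [t] it varies by at most [b2]. *)
pose b1 := 2 * b0 + b2.
have de1_le t : `|(dpsi^`(1))%classic t| <= b1.
  have t1 : t < t + 1 by rewrite ltrDl.
  have [c /andP[c1 c2] e] := dv_MVT t1 (fun x _ => d0 x).
  have [c' _ e'] := dv_MVT c1 (fun x _ => d1 x).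
  have h1 := de_le t; have h2 := de_le (t + 1); have h3 := de2_le c'.
  have h4 : `|(dpsi^`(1))%classic c| <= 2 * b0.
    have -> : (dpsi^`(1))%classic c = dpsi (t + 1) - dpsi t by rewrite e addrC addKr mulr1.
    by apply: le_trans (ler_normB _ _) _; lra.
  have h5 : `|(dpsi^`(1))%classic c - (dpsi^`(1))%classic t| <= b2.
    rewrite e' normrM -[leRHS]mulr1; apply: ler_pM => //.
    by rewrite ger0_norm; lra.
  have -> : (dpsi^`(1))%classic t = (dpsi^`(1))%classic c -
      ((dpsi^`(1))%classic c - (dpsi^`(1))%classic t) by rewrite opprB addrC subrK.
  by apply: le_trans (ler_normB _ _) _; rewrite /b1 lerD.
have [K0 [DK0 [r r0 Hr]]] := cell_uniform a d0 d1 cf2 de_le de1_le de2_le (ltn0Sn L).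
have fm0 : 0 < frob_max L.+1 :> R by exact: frob_max_gt0.
(* The halves match the factors 2 of the claim, and [+ 1] gives positivity of the threshold at
   once. *)
exists (r / frob_max L.+1 / 2), ((1 + b2) * frob_max L.+1 * L.+1%:R / 2), (K0%:R + 1).
have c0 : 0 < 1 + b2 by rewrite ltr_pwDl.
have two0 : 0 < 2 :> R by [].
have L0 : 0 < L.+1%:R :> R by rewrite ltr0n.
split; [exact: divr_gt0 (divr_gt0 r0 fm0) two0|exact: divr_gt0 (mulr_gt0 (mulr_gt0 c0 fm0) L0) two0|by rewrite ltr_wpDl|].
move=> K M KK M0 y Yy; have K0K : (K0 <= K)%N by rewrite -(ler_nat R); lra.
have [A HA bA] := coarse_hessian d0 d1 cf2 de_le de2_le psiE M0 (leq_trans DK0 K0K) r0 (Hr K K0K) Yy.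
have -> : coarse_hamiltonian psi L K M = coarse_free_energy psi L M (M * K).
  by apply/funext => x; exact: coarse_hamiltonianE.
exists A => // h Yh; have := bA h Yh.
have -> : 2 * (r / frob_max L.+1 / 2) = r / frob_max L.+1 by field; rewrite gt_eqF.
by have -> : 2 * ((1 + b2) * frob_max L.+1 * L.+1%:R / 2) = (1 + b2) * frob_max L.+1 * L.+1%:R by field.
Qed.
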